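(* Let $d\in\mathbb{N}$, $d\ge 1$, let $(k,l)\in\mathbb{R}^2$, and let $T>0$. Assume that the Zakharov system $$i\partial_t u+\Delta u=nu,\qquad \partial_t^2 n-\Delta n=\Delta|u|^2,\qquad (u,n,\partial_t n)|_{t=0}\in H^{k,l},$$ with $u:\mathbb{R}\times\mathbb{R}^d\to\mathbb{C}$ and $n:\mathbb{R}\times\mathbb{R}^d\to\mathbb{R}$, is locally well-posed in $H^{k,l}$ in the time interval $[0,T]$. If $$l<k-2\qquad\text{or}\qquad l>k+1,$$ then the solution mapping $S:B_r\to\mathcal{C}([0,T];H^{k,l})$ of the system fails to be $C^2$ at the origin of $H^{k,l}$.
   Context: Spaces. $H^{k,l}:=H^k(\mathbb{R}^d;\mathbb{C})\times H^l(\mathbb{R}^d;\mathbb{R})\times H^{l-1}(\mathbb{R}^d;\mathbb{R})$ (inhomogeneous $L^2$-based Sobolev spaces), with norm $\|(\varphi,\psi,\phi)\|_{H^{k,l}}^2=\|\varphi\|_{H^k}^2+\|\psi\|_{H^l}^2+\|\phi\|_{H^{l-1}}^2$, regarded as a real Banach space. $\mathcal{C}([0,T];H^{k,l})$ denotes $C([0,T];H^k(\mathbb{R}^d))\times C([0,T];H^l(\mathbb{R}^d))\times C([0,T];H^{l-1}(\mathbb{R}^d))$, with the supremum-in-time norm. For $r>0$, $B_r=\{(\varphi,\psi,\phi)\in H^{k,l}:\|(\varphi,\psi,\phi)\|_{H^{k,l}}<r\}$. $\Delta$ is the Laplacian in the space variable. Solutions. A local solution on $[0,T]$ with initial data $(u,n,\partial_t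 n)|_{t=0}=(\varphi,\psi,\phi)$ is a triple $(u,n,\partial_t n)\in\mathcal{C}([0,T];H^{k,l})$ satisfying, for all $t\in[0,T]$, the integral equations $$u(t)=e^{it\Delta}\varphi-i\int_0^t e^{i(t-s)\Delta}u(s)n(s)\,ds,$$ $$n(t)=W_0(t)\psi+W_1(t)\phi+\int_0^t W_1(t-s)\Delta|u|^2(s)\,ds,$$ $$\partial_t n(t)=W_0(t)\phi+W_1(t)\Delta\psi+\int_0^t W_0(t-s)\Delta|u|^2(s)\,ds,$$ where $e^{it\Delta}$, $W_0(t)$, $W_1(t)$ are the Fourier multiplier operators in $x$ with symbols $e^{-it|\xi|^2}$, $\cos(t|\xi|)$, $\sin(t|\xi|)/|\xi|$, respectively. Local well-posedness in $[0,T]$ is understood in the usual sense (existence, uniqueness and continuous dependence on the data): for some $r>0$, every $(\varphi,\psi,\phi)\in B_r$ gives rise to a unique local solution $(u_{(\varphi,\psi,\phi)},n_{(\varphi,\psi,\phi)},\partial_t n_{(\varphi,\psi,\phi)})\in\mathcal{C}([0,T];H^{k,l})$ on $[0,T]$, depending continuously on the data (in particular the zero data gives the zero solution). Solution mapping. $$S:B_r\to\mathcal{C}([0,T];H^{k,l}),\qquad S(\varphi,\psi,\phi)=\big(u_{(\varphi,\psi,\phi)},\,n_{(\varphi,\psi,\phi)},\,\partial_t n_{(\varphi,\psi,\phi)}\big).$$ ''Fails to be $C^2$ at the origin'' means: is not two times Fréchet differentiable at the origin $(0,0,0)$ of $H^{k,l}$. *)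

(* Defs.v *)
From HB Require Import structures.
From mathcomp Require Import all_boot all_order all_algebra.
From mathcomp Require Import all_classical all_reals all_analysis.
From mathcomp Require Import complex.

Set Implicit Arguments.
Unset Strict Implicit.
Unset Printing Implicit Defensive.

Import Order.TTheory GRing.Theory Num.Theory.
Import numFieldNormedType.Exports.
Local Open Scope classical_set_scope.
Local Open Scope ring_scope.
Local Open Scope complex_scope.

(** * Lebesgue measure on R^d, as a measure on ['rV[R]_d] *)

Section measurable_rV.
Context (R : realType) (n : nat).

Let coord : 'I_n -> 'rV[R]_n -> measurableTypeR R := fun i x => x ord0 i.

Let rV_set0 : g_sigma_preimage coord set0.
Proof. exact: sigma_algebra0. Qed.

Let rV_setC A : g_sigma_preimage coord A -> g_sigma_preimage coord (~` A).
Proof. exact: sigma_algebraC. Qed.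

Let rV_bigcup (F : (set 'rV[R]_n)^nat) :
  (forall i, g_sigma_preimage coord (F i)) ->
  g_sigma_preimage coord (\bigcup_i (F i)).
Proof. exact: sigma_algebra_bigcup. Qed.

HB.instance Definition _ := @isMeasurable.Build
  (measure_tuple_display default_measure_display) 'rV[R]_n (g_sigma_preimage coord) rV_set0 rV_setC rV_bigcup.

End measurable_rV.

Section lebesgue_rV.
Context (R : realType).

Definition cons_rV n (p : measurableTypeR R * 'rV[R]_n) : 'rV[R]_n.+1 :=
  \row_i oapp (fun j => p.2 ord0 j) p.1 (unlift ord0 i).

Definition uncons_rV n (x : 'rV[R]_n.+1) : measurableTypeR R * 'rV[R]_n :=
  (x ord0 ord0, \row_j x ord0 (lift ord0 j)).

Lemma cons_rVK n : cancel (@cons_rV n) (@uncons_rV n).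
Proof.
move=> [a x]; rewrite /uncons_rV /cons_rV mxE unlift_none /=; congr pair.
by apply/rowP => j; rewrite !mxE liftK.
Qed.

Lemma measurable_coord_rV n (i : 'I_n) :
  measurable_fun [set: 'rV[R]_n] (fun x => x ord0 i : measurableTypeR R).
Proof.
move=> _ Y mY; rewrite setTI; apply: sub_sigma_algebra => /=.
rewrite -bigcup_seq/=; exists i => /=; first by rewrite mem_index_enum.
by exists Y => //; rewrite setTI.
Qed.

Lemma measurable_rVP d (T : measurableType d) n (f : T -> 'rV[R]_n) :
  (forall i, measurable_fun [set: T]
    (fun x => f x ord0 i : measurableTypeR R)) ->
  measurable_fun [set: T] f.
Proof.
move=> mf _ A mA; rewrite setTI.
suff : @measurable _ 'rV[R]_n `<=` [set B | measurable (f @^-1` B)] by exact.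
apply: smallest_sub.
  split => /=.
  - by rewrite preimage_set0.
  - by move=> B mB; rewrite setTD preimage_setC; exact: measurableC.
  - by move=> F mF; rewrite preimage_bigcup; exact: bigcup_measurable.
move=> B; rewrite -bigcup_seq => -[i _ [C mC <-]] /=.
by rewrite setTI -comp_preimage -[X in measurable X]setTI; exact: mf.
Qed.

Lemma measurable_cons_rV n : measurable_fun setT (@cons_rV n).
Proof.
apply: measurable_rVP => i; rewrite /cons_rV.
under eq_fun do rewrite mxE.
case: unliftP => [j _|_] /=; last exact: measurable_fst.
apply: (@measurableT_comp _ _ _ _ _ _ (fun x : 'rV[R]_n => x ord0 j)).
  exact: measurable_coord_rV.
exact: measurable_snd.
Qed.

Lemma measurable_uncons_rV n : measurable_fun setT (@uncons_rV n).
Proof.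
apply/measurable_fun_pairP; split => /=; first exact: measurable_coord_rV.
apply: measurable_rVP => i /=.
by under eq_fun do rewrite mxE; exact: measurable_coord_rV.
Qed.

Section image_measure.
Context n (mu : {sigma_finite_measure set 'rV[R]_n -> \bar R}).

Definition cons_measure : set 'rV[R]_n.+1 -> \bar R :=
  pushforward (@lebesgue_measure R \x mu)%E (@cons_rV n).

Let cons_measure0 : cons_measure set0 = 0%E.
Proof. by rewrite /cons_measure /pushforward preimage_set0 measure0. Qed.

Let cons_measure_ge0 A : (0 <= cons_measure A)%E.
Proof. by rewrite /cons_measure /pushforward; exact: measure_ge0. Qed.

Let cons_measure_sigma_additive : semi_sigma_additive cons_measure.
Proof.
move=> F mF tF mUF; rewrite /cons_measure /pushforward preimage_bigcup.
apply: measure_semi_sigma_additive.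
- by move=> i; rewrite -[X in measurable X]setTI; exact: measurable_cons_rV.
- apply/trivIsetP => /= i j _ _ ij; rewrite -preimage_setI.
  by move/trivIsetP : tF => /(_ _ _ _ _ ij) ->//; rewrite preimage_set0.
- rewrite -preimage_bigcup -[X in measurable X]setTI.
  exact: measurable_cons_rV.
Qed.

HB.instance Definition _ := isMeasure.Build _ _ _ cons_measure
  cons_measure0 cons_measure_ge0 cons_measure_sigma_additive.

Let cons_measure_sigma_finite : sigma_finite setT cons_measure.
Proof.
have /sigma_finiteP[F [TF ndF Foo]] := sigma_finiteT (@lebesgue_measure R).
have /sigma_finiteP[G [TG ndG Goo]] := sigma_finiteT mu.
have TFG : \bigcup_i (F i `*` G i) = setT.
  rewrite -setXTT TF TG predeqE => -[x y]; split.
    by move=> [i _ []/= ? ?]; split; exists i.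
  move=> [/= [i _ Fix] [j _ Gjy]]; exists (maxn i j) => //; split.
  - by move: x Fix; exact/subsetPset/ndF/leq_maxl.
  - by move: y Gjy; exact/subsetPset/ndG/leq_maxr.
exists (fun i => @uncons_rV n @^-1` (F i `*` G i)).
  by rewrite -preimage_bigcup TFG preimage_setT.
move=> i; have [mF Fi] := Foo i; have [mG Gi] := Goo i; split.
  rewrite -[X in measurable X]setTI; apply: measurable_uncons_rV => //.
  exact: measurableX.
rewrite /cons_measure /pushforward -comp_preimage.
rewrite (_ : _ \o _ = id); last by apply/funext => x; exact: cons_rVK.
by rewrite preimage_id product_measure1E// lte_mul_pinfty// ge0_fin_numE.
Qed.

HB.instance Definition _ := Measure_isSigmaFinite.Build _ _ _ cons_measure
  cons_measure_sigma_finite.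

End image_measure.

Section point_measure.

Let point_measure_sigma_finite :
  sigma_finite setT (@dirac _ 'rV[R]_0 0 R).
Proof.
by apply: fin_num_fun_sigma_finite; [rewrite measure0|exact: fin_num_measure].
Qed.

HB.instance Definition _ := Measure_isSigmaFinite.Build _ _ _
  (@dirac _ 'rV[R]_0 0 R) point_measure_sigma_finite.

End point_measure.

Fixpoint lebesgue_rV n : {sigma_finite_measure set 'rV[R]_n -> \bar R} :=
  if n is m.+1 then cons_measure (lebesgue_rV m) else \d_(0 : 'rV[R]_0).

End lebesgue_rV.

Section complex_integral.
Context dT (T : measurableType dT) (R : realType).

Definition Cintegral (mu : {measure set T -> \bar R}) (D : set T)
    (f : T -> R[i]) : R[i] :=
  (\int[mu]_(x in D) complex.Re (f x)) +i* (\int[mu]_(x in D) complex.Im (f x)).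

Definition Cmeasurable (f : T -> R[i]) : Prop :=
  measurable_fun [set: T] (fun x => complex.Re (f x)) /\
  measurable_fun [set: T] (fun x => complex.Im (f x)).

End complex_integral.

(** * Tempered distributions, Fourier transform and Sobolev spaces *)

Section sobolev.
Context (R : realType) (d : nat).
Local Notation E := 'rV[R]_d.

Definition dotp (x y : E) : R := \sum_i x ord0 i * y ord0 i.

(* The library norm of ['rV[R]_d] is the sup norm. *)
Definition enorm (x : E) : R := Num.sqrt (dotp x x).

Definition expi (a : R) : R[i] := cos a +i* sin a.

Definition sqmod (z : R[i]) : R := complex.Re z ^+ 2 + complex.Im z ^+ 2.

Fixpoint partial (s : seq 'I_d) (f : E -> R) : E -> R :=
  if s is i :: s' then fun x => 'D_(delta_mx ord0 i) (partial s' f) x else f.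

Definition real_schwartz (f : E -> R) : Prop :=
  forall s : seq 'I_d,
    (forall x, differentiable (partial s f) x) /\
    forall m : nat, exists M : R,
      forall x, enorm x ^+ m * `|partial s f x| <= M.

Definition schwartz : Type :=
  {f : E -> R[i] | real_schwartz (fun x => complex.Re (f x)) /\
                   real_schwartz (fun x => complex.Im (f x))}.

(* Functionals on the Schwartz space.  No continuity is required here: the
   members of the Sobolev spaces below are continuous by construction.  The
   codomain is the alias [Rcomplex R] of [R[i]] so that distributions form a
   vector space over [R]. *)
Definition dist : Type := schwartz -> Rcomplex R.

Definition ifourier (f : E -> R[i]) (x : E) : R[i] :=
  ((Num.sqrt (2 * pi) ^+ d)^-1)%:C *
  Cintegral (lebesgue_rV R d) setT (fun y => expi (dotp x y) * f y).

(* The inverse Fourier transform of the function [g], as a distribution. *)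
Definition dist_ifourier (g : E -> R[i]) : dist :=
  fun f => Cintegral (lebesgue_rV R d) setT
    (fun xi => g xi * ifourier (sval f) xi).

Definition dist_of_fun (g : E -> R[i]) : dist :=
  fun f => Cintegral (lebesgue_rV R d) setT (fun x => g x * sval f x).

Definition bracket2 (s : R) (xi : E) : R := (1 + dotp xi xi) `^ s.

Definition weighted_L2 (s : R) (g : E -> R[i]) : Prop :=
  Cmeasurable g /\
  (\int[lebesgue_rV R d]_xi (bracket2 s xi * sqmod (g xi))%:E < +oo)%E.

(* The Fourier transform of a distribution of class H^s for some s: a
   function, determined up to a null set. *)
Definition fourier (u : dist) : E -> R[i] :=
  xget (fun=> 0)
    [set g | (exists s, weighted_L2 s g) /\ u = dist_ifourier g].

Definition sobolev (s : R) : set dist :=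
  [set u | exists2 g, weighted_L2 s g & u = dist_ifourier g].

Definition sobolev_norm (s : R) (u : dist) : R :=
  Num.sqrt (\int[lebesgue_rV R d]_xi (bracket2 s xi * sqmod (fourier u xi))).

Definition real_dist (u : dist) : Prop :=
  forall f : schwartz, (forall x, complex.Im (sval f x) = 0) ->
    complex.Im (u f) = 0.

Definition multiplier (m : E -> R[i]) (u : dist) : dist :=
  dist_ifourier (fun xi => m xi * fourier u xi).

Definition laplacian : dist -> dist :=
  multiplier (fun xi => (- enorm xi ^+ 2)%:C).

Definition schrodinger (t : R) : dist -> dist :=
  multiplier (fun xi => expi (- (t * enorm xi ^+ 2))).

Definition W0 (t : R) : dist -> dist :=
  multiplier (fun xi => (cos (t * enorm xi))%:C).

(* At xi = 0 the quotient takes the value 0 instead of its limit t; this is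
   immaterial for d >= 1, where {0} is a null set. *)
Definition W1 (t : R) : dist -> dist :=
  multiplier (fun xi => (sin (t * enorm xi) / enorm xi)%:C).

(* The part of [u] of frequency at most [N]; it is a smooth function for
   every [u] in a Sobolev space. *)
Definition low_freq (N : R) (u : dist) : E -> R[i] :=
  ifourier (fun xi => if enorm xi <= N then fourier u xi else 0).

End sobolev.

(** * The Zakharov system *)

Section zakharov.
Context (R : realType) (d : nat).
Local Notation dist := (dist R d).

Definition triple : Type := (dist * dist * dist)%type.

Definition Hkl (k l : R) : set triple :=
  [set x | [/\ sobolev k x.1.1,
               sobolev l x.1.2 /\ real_dist x.1.2
             & sobolev (l - 1) x.2 /\ real_dist x.2]].

Definition Hkl_norm (k l : R) (x : triple) : R :=
  Num.sqrt (sobolev_norm k x.1.1 ^+ 2 + sobolev_norm l x.1.2 ^+ 2 +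
            sobolev_norm (l - 1) x.2 ^+ 2).

Definition Hkl_ball (k l r : R) : set triple :=
  [set x | Hkl k l x /\ Hkl_norm k l x < r].

(* Trajectories are functions on R, of which only the restriction to [0, T] is
   meaningful. *)
Definition CHkl (k l T : R) : set (R -> triple) :=
  [set U | forall t : R, 0 <= t <= T -> Hkl k l (U t) /\
     forall e, 0 < e -> exists2 delta, 0 < delta &
       forall s, 0 <= s <= T -> `|s - t| < delta ->
         Hkl_norm k l (U s - U t) < e].

Definition CHkl_norm (k l T : R) (U : R -> triple) : \bar R :=
  ereal_sup [set (Hkl_norm k l (U t))%:E | t in `[0, T]].

(* A pointwise product of distributions of arbitrary regularity has no meaning in
   general.  The Duhamel integral of a product v w is read here as the limit, as
   N -> +oo and in the sense of distributions, of the integrals for the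
   (genuine) products of the parts of v and w of frequency at most N; whenever
   the product is a bounded bilinear map into some Sobolev space (for instance
   on H^a x H^b with a + b >= 0) this is the usual integral.
   [duhamel A F t z] means z = \lim_N \int_0^t A(t - s) F_N(s) ds. *)
Definition duhamel (A : R -> dist -> dist) (F : R -> R -> 'rV[R]_d -> R[i])
    (t : R) (z : dist) : Prop :=
  forall f : schwartz R d,
    let I N := Cintegral (@lebesgue_measure R) `[0, t]
                 (fun s => A (t - s) (dist_of_fun (F N s)) f) in
    (complex.Re (I N) @[N --> +oo] --> complex.Re (z f)) /\
    (complex.Im (I N) @[N --> +oo] --> complex.Im (z f)).

Definition prod_trunc (u n : R -> dist) (N s : R) (x : 'rV[R]_d) : R[i] :=
  low_freq N (u s) x * low_freq N (n s) x.

Definition sqmod_trunc (u : R -> dist) (N s : R) (x : 'rV[R]_d) : R[i] :=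
  (sqmod (low_freq N (u s) x))%:C.

(* The three components of [U t] are u(t), n(t) and \partial_t n(t). *)
Definition local_solution (k l T : R) (x : triple) (U : R -> triple) : Prop :=
  let: (phi, psi, phi1) := x in
  let u t := (U t).1.1 in let n t := (U t).1.2 in let nt t := (U t).2 in
  CHkl k l T U /\
  exists Iu In Int : R -> dist, forall t : R, 0 <= t <= T ->
    [/\ duhamel (@schrodinger R d) (prod_trunc u n) t (Iu t),
        duhamel (fun a w => W1 a (laplacian w)) (sqmod_trunc u) t (In t)
      & duhamel (fun a w => W0 a (laplacian w)) (sqmod_trunc u) t (Int t)] /\
    [/\ forall f, u t f = schrodinger t phi f - (0 +i* 1) * (Iu t f : R[i]),
        n t = W0 t psi + W1 t phi1 + In t
      & nt t = W0 t phi1 + W1 t (laplacian psi) + Int t].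

(* Local well-posedness in [0, T], with solution mapping [S] on B_r; the values
   of [S] outside B_r, and of [S x] outside [0, T], are irrelevant. *)
Definition well_posed (k l T r : R) (S : triple -> R -> triple) : Prop :=
  [/\ 0 < r,
      forall x, Hkl_ball k l r x -> local_solution k l T x (S x),
      forall x U, Hkl_ball k l r x -> local_solution k l T x U ->
        forall t : R, 0 <= t <= T -> U t = S x t
    & forall x, Hkl_ball k l r x -> forall e, 0 < e ->
        exists2 delta, 0 < delta & forall y, Hkl_ball k l r y ->
          Hkl_norm k l (y - x) < delta ->
          (CHkl_norm k l T (S y - S x)%R < e%:E)%E].

(** * Fréchet differentiability of maps from H^{k,l} to C([0,T]; H^{k,l}) *)

Definition linear_map (k l T : R) (L : triple -> R -> triple) : Prop :=
  forall (a : R) x y, Hkl k l x -> Hkl k l y ->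
    forall t : R, 0 <= t <= T -> L (a *: x + y) t = a *: L x t + L y t.

Definition op_bound (k l T M : R) (L : triple -> R -> triple) : Prop :=
  forall x, Hkl k l x -> (CHkl_norm k l T (L x) <= (M * Hkl_norm k l x)%:E)%E.

Definition bounded_linear (k l T : R) (L : triple -> R -> triple) : Prop :=
  [/\ forall x, Hkl k l x -> CHkl k l T (L x),
      linear_map k l T L
    & exists M, op_bound k l T M L].

Definition is_frechet_derivative (k l T : R) (S : triple -> R -> triple)
    (x : triple) (L : triple -> R -> triple) : Prop :=
  bounded_linear k l T L /\
  forall e, 0 < e -> exists2 delta, 0 < delta &
    forall h, Hkl k l h -> Hkl_norm k l h < delta ->
      (CHkl_norm k l T (S (x + h) - S x - L h)%R <= (e * Hkl_norm k l h)%:E)%E.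

(* [S] is differentiable in a neighbourhood of 0 and its derivative, with values
   in the bounded linear maps normed by the operator norm, is differentiable at
   0, with derivative [B]. *)
Definition twice_frechet_differentiable_at0 (k l T : R)
    (S : triple -> R -> triple) : Prop :=
  exists DS B : triple -> triple -> R -> triple,
  [/\ exists2 rho, 0 < rho & forall x, Hkl_ball k l rho x ->
        is_frechet_derivative k l T S x (DS x),
      forall x, Hkl k l x -> bounded_linear k l T (B x),
      forall h, Hkl k l h -> linear_map k l T (B^~ h),
      exists M, forall x, Hkl k l x ->
        op_bound k l T (M * Hkl_norm k l x) (B x)
    & forall e, 0 < e -> exists2 delta, 0 < delta &
        forall x, Hkl k l x -> Hkl_norm k l x < delta ->
          op_bound k l T (e * Hkl_norm k l x)
            (fun h => DS x h - DS 0 h - B x h)].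

End zakharov.

(* Main.v *)
(** For data [h] with bounded, compactly supported Fourier transform, Picard iteration on
    the Fourier side, with pointwise bounds by exponentially decreasing weights, gives an
    explicit local solution with data [z *: h], z small, of the form
    [z u1 + z^2 u2 + O(z^3)].  By the uniqueness part of well-posedness it is [S (z *: h)],
    so a second derivative [B] at 0 satisfies [B h h = 2 u2], and is bounded as a quadratic
    map.  Take h to be the sum of a bump at frequency 0 and a bump at frequency N, the
    latter for n when l < k - 2 and for u when l > k + 1, and test u2 at time c / N^2 on the
    box of side 2 around the frequency N: all oscillating factors are then at least 1/2, and
    letting N tend to infinity contradicts the boundedness of [B].

    A distribution determines its Fourier transform almost everywhere because Gaussians
    separate functions: products of powers [1 - (1 - t^(n^2))^(2^(n^2 - n))] of Gaussians
    tend to indicators of boxes. *)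

Require Import Defs.
From mathcomp Require Import all_boot all_order all_algebra.
From mathcomp Require Import all_classical all_reals all_analysis.
From mathcomp Require Import measurable_realfun complex ring lra.

Set Implicit Arguments.
Unset Strict Implicit.
Unset Printing Implicit Defensive.

Import Order.TTheory GRing.Theory Num.Theory.
Import numFieldNormedType.Exports.
Local Open Scope classical_set_scope.
Local Open Scope ring_scope.
Local Open Scope complex_scope.

(** * Integrals and Fubini for real functions *)

(** What shapes the proof is a loss of one derivative: the kernel of the wave equation for [n] grows
    like the frequency, so a bound by a fixed weight is not reproduced by the Duhamel integral. As
    in the Cauchy-Kovalevskaya theorem, the exponential rate of the weight is therefore allowed to
    decrease in time, and integrating in time recovers the lost factor. Compactly supported
    transforms afford any initial rate, and a positive final rate puts the solution in every Sobolev
    space, which is why the construction does not depend on [k] and [l]. The map [S] is known only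
    through well-posedness, so its second derivative is reached along rays [z *: h] and after
    testing with a bounded linear functional, the integral of a Fourier transform over a box; this
    leaves a Taylor expansion of a real function. When l > k + 1 the component tested is the time
    derivative of [n]: its kernel contains the full Laplacian, whose factor N^2 offsets the time
    N^-2. *)

Section real_integrals.
Context d (T : measurableType d) (R : realType).
Variable mu : {measure set T -> \bar R}.
Implicit Types f g : T -> R.

Definition intble f := mu.-integrable setT (EFin \o f).

Lemma intble_meas f : intble f -> measurable_fun setT f.
Proof. by move=> /integrableP[/measurable_EFinP]. Qed.

Lemma intble_dom g f : measurable_fun setT f -> intble g ->
  (forall x, `|f x| <= g x) -> intble f.
Proof.
move=> mf ig fg; apply: le_integrable ig => //; first exact/measurable_EFinP.
by move=> x _ /=; rewrite lee_fin (le_trans (fg x))// ler_norm.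
Qed.

Lemma intbleD f g : intble f -> intble g -> intble (fun x => f x + g x).
Proof. by move=> hf hg; have := integrableD measurableT hf hg. Qed.

Lemma intbleB f g : intble f -> intble g -> intble (fun x => f x - g x).
Proof. by move=> hf hg; have := integrableB measurableT hf hg. Qed.

Lemma intbleZ (c : R) f : intble f -> intble (fun x => c * f x).
Proof. by move=> hf; have := integrableZl measurableT c hf. Qed.

Lemma intbleN f : intble f -> intble (fun x => - f x).
Proof.
by move=> /(intbleZ (-1)); congr intble; apply/funext => x; rewrite mulN1r.
Qed.

Lemma intble0 : intble (fun=> 0).
Proof. exact: integrable0. Qed.

Lemma intble_norm f : intble f -> intble (fun x => `|f x|).
Proof. by move=> /(integrable_norm (D := setT)). Qed.

Lemma intble_abs_dom g f : measurable_fun setT f -> intble g ->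
  (forall x, `|f x| <= `|g x|) -> intble f.
Proof. by move=> mf /intble_norm ig fg; exact: intble_dom ig fg. Qed.

Lemma integral_intble f : intble f ->
  (\int[mu]_x (f x)%:E)%E = (\int[mu]_x f x)%:E.
Proof. by move=> hf; rewrite fineK//; exact: integrable_fin_num. Qed.

Lemma intble_ge0P f : measurable_fun setT f -> (forall x, 0 <= f x) ->
  (\int[mu]_x (f x)%:E < +oo)%E -> intble f.
Proof.
move=> mf f0 foo; apply/integrableP; split; first exact/measurable_EFinP.
by under eq_integral do rewrite /= ger0_norm//.
Qed.

Lemma ler_Rintegral f g : intble f -> intble g -> (forall x, f x <= g x) ->
  \int[mu]_x f x <= \int[mu]_x g x.
Proof. by move=> hf hg fg; apply: le_Rintegral. Qed.

Lemma ler_norm_Rintegral f g : measurable_fun setT f -> intble g ->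
  (forall x, `|f x| <= g x) -> `|\int[mu]_x f x| <= \int[mu]_x g x.
Proof.
move=> mf ig fg; have iff := intble_dom mf ig fg.
apply: le_trans (le_normr_Rintegral measurableT iff) _.
by apply: ler_Rintegral => //; exact: intble_norm.
Qed.

Lemma Rintegral_add f g : intble f -> intble g ->
  \int[mu]_x (f x + g x) = \int[mu]_x f x + \int[mu]_x g x.
Proof. by move=> hf hg; rewrite RintegralD. Qed.

Lemma Rintegral_sub f g : intble f -> intble g ->
  \int[mu]_x (f x - g x) = \int[mu]_x f x - \int[mu]_x g x.
Proof. by move=> hf hg; rewrite RintegralB. Qed.

Lemma Rintegral_scale (c : R) f : intble f ->
  \int[mu]_x (c * f x) = c * \int[mu]_x f x.
Proof. by move=> hf; rewrite RintegralZl. Qed.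

Lemma Rintegral_opp f : intble f -> \int[mu]_x (- f x) = - \int[mu]_x f x.
Proof.
move=> hf; rewrite -mulN1r -Rintegral_scale//.
by apply: eq_Rintegral => x _; rewrite mulN1r.
Qed.

Lemma ae_eq_Rintegral f g : measurable_fun setT f -> measurable_fun setT g ->
  {ae mu, forall x, f x = g x} -> \int[mu]_x f x = \int[mu]_x g x.
Proof.
move=> mf mg fg; rewrite /Rintegral; congr fine.
apply: ae_eq_integral => //; [exact/measurable_EFinP|exact/measurable_EFinP|].
by apply: filterS fg => x -> _.
Qed.

End real_integrals.

(** * Tonelli and Fubini for real-valued integrals *)

Section real_fubini.
Context d1 d2 (T1 : measurableType d1) (T2 : measurableType d2) (R : realType).
Variables (m1 : {sigma_finite_measure set T1 -> \bar R})
          (m2 : {sigma_finite_measure set T2 -> \bar R}).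

(** As [f] may fail to be integrable in [y], Tonelli is applied to its positive and negative parts
    separately. *)
Lemma measurable_Rintegral (f : T1 * T2 -> R) : measurable_fun setT f ->
  measurable_fun setT (fun x => \int[m2]_y f (x, y)).
Proof.
move=> mf; apply: measurableT_comp => //.
under eq_fun do rewrite integralE.
apply: emeasurable_funB.
- have mF : measurable_fun setT (EFin \o f)^\+%E.
    by apply: measurable_funepos; exact/measurable_EFinP.
  have := measurable_fun_fubini_tonelli_F (m2 := m2) _ mF (fun=> funepos_ge0 _ _).
  apply: eq_measurable_fun => x _; apply: eq_integral => y _.
  by rewrite [LHS]funeposE [RHS]funeposE.
- have mF : measurable_fun setT (EFin \o f)^\-%E.
    by apply: measurable_funeneg; exact/measurable_EFinP.
  have := measurable_fun_fubini_tonelli_F (m2 := m2) _ mF (fun=> funeneg_ge0 _ _).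
  apply: eq_measurable_fun => x _; apply: eq_integral => y _.
  by rewrite [LHS]funenegE [RHS]funenegE.
Qed.

Lemma intble_prod (f : T1 * T2 -> R) (g : T1 -> R) : measurable_fun setT f ->
  intble m1 g ->
  (forall x, (\int[m2]_y `|f (x, y)|%:E <= (g x)%:E)%E) ->
  intble (m1 \x m2)%E f.
Proof.
move=> mf ig fg; apply/(@integrable12ltyP _ _ _ _ _ m1 m2).
  exact/measurable_EFinP.
apply: (@le_lt_trans _ _ (\int[m1]_x (g x)%:E)%E).
  apply: ge0_le_integral => //=.
  - by move=> x _; apply: integral_ge0.
  - apply: (measurable_fun_fubini_tonelli_F (m2 := m2) (fun z => `|f z|%:E)) => //.
    by apply/measurable_EFinP; exact: measurableT_comp.
  - by apply/measurable_EFinP; exact: intble_meas ig.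
rewrite integral_intble// ltry//.
Qed.

Lemma intble_section (f : T1 * T2 -> R) : intble (m1 \x m2)%E f ->
  {ae m1, forall x, intble m2 (fun y => f (x, y))}.
Proof. by move=> hf; have := ae_integrable1 hf. Qed.

Lemma intble_Rintegral (f : T1 * T2 -> R) : intble (m1 \x m2)%E f ->
  intble m1 (fun x => \int[m2]_y f (x, y)).
Proof.
move=> hf; have h1 := integrable_fubini_F hf.
apply/integrableP; split.
  by apply/measurable_EFinP/measurable_Rintegral; exact: intble_meas hf.
move/integrableP : (h1) => [mF]; apply: le_lt_trans.
apply: ge0_le_integral => //=.
- apply/measurable_EFinP; apply: measurableT_comp => //.
  by apply: measurable_Rintegral; exact: intble_meas hf.
- exact: measurableT_comp.
(* [fine] sends infinite values to 0, so passing to the real inner integral can only decrease the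
   modulus. *)
- move=> x _; rewrite /Rintegral.
  rewrite -[fubini_F _ _ _]/(\int[m2]_y (f (x, y))%:E)%E.
  by case: (\int[m2]_y (f (x, y))%:E)%E => [r| |] /=; rewrite ?normr0 ?leey.
Qed.

(** The real inner integral agrees with the extended one wherever the section is integrable, that is
    almost everywhere. *)
Lemma Rintegral_prod (f : T1 * T2 -> R) : intble (m1 \x m2)%E f ->
  \int[m1]_x \int[m2]_y f (x, y) = \int[(m1 \x m2)%E]_z f z.
Proof.
move=> hf; rewrite /Rintegral -(integral12_prod_meas1 hf); congr fine.
apply: ae_eq_integral => //.
- by apply/measurable_EFinP/measurable_Rintegral; exact: intble_meas hf.
- exact: measurable_fubini_F hf.
- apply: filterS (intble_section hf) => x hx _ /=.
  by rewrite -[RHS]/(\int[m2]_y (f (x, y))%:E)%E (integral_intble hx).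
Qed.

End real_fubini.

Section real_fubini_swap.
Context d1 d2 (T1 : measurableType d1) (T2 : measurableType d2) (R : realType).
Variables (m1 : {sigma_finite_measure set T1 -> \bar R})
          (m2 : {sigma_finite_measure set T2 -> \bar R}).

Lemma intble_prod_swap (f : T1 * T2 -> R) : intble (m1 \x m2)%E f ->
  intble (m2 \x m1)%E (fun z => f (z.2, z.1)).
Proof.
move=> hf; have mf := intble_meas hf.
have mf' : measurable_fun setT (EFin \o (fun z : T2 * T1 => f (z.2, z.1))).
  apply/measurable_EFinP; by apply: measurableT_comp => //; exact/measurable_fun_pair.
apply/(@integrable12ltyP _ _ _ _ _ m2 m1) => //.
by have /(@integrable21ltyP _ _ _ _ _ m1 m2) := hf; apply; exact/measurable_EFinP.
Qed.

Lemma Rfubini (f : T1 * T2 -> R) : intble (m1 \x m2)%E f ->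
  \int[m1]_x \int[m2]_y f (x, y) = \int[m2]_y \int[m1]_x f (x, y).
Proof.
move=> hf; rewrite Rintegral_prod//.
rewrite -[RHS]/(\int[m2]_y \int[m1]_x (fun z : T2 * T1 => f (z.2, z.1)) (y, x)).
rewrite Rintegral_prod; last exact: intble_prod_swap.
rewrite /Rintegral -(integral12_prod_meas1 hf) (Fubini hf).
by rewrite -(integral12_prod_meas1 (intble_prod_swap hf)).
Qed.

End real_fubini_swap.

(** Packs the pushforward as a measure, so that the uniqueness theorems for product measures and for
    Lebesgue measure apply to it. *)
Lemma image_measure d1 d2 (T1 : measurableType d1) (T2 : measurableType d2)
    (R : realType) (mu : {measure set T1 -> \bar R}) (f : T1 -> T2) :
  measurable_fun setT f ->
  exists m : {measure set T2 -> \bar R}, forall A, m A = mu (f @^-1` A).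
Proof.
move=> mf.
by unshelve (exists (pushforward mu f)).
Qed.

(** * Invariance of Lebesgue measure on R^d under translation and reflection *)

Section rV_measure.
Context (R : realType).
Implicit Types n : nat.

Lemma measurable_rV_coord n d (T : measurableType d) (f : T -> 'rV[R]_n) i :
  measurable_fun setT f -> measurable_fun setT (fun x => f x ord0 i).
Proof.
move=> mf; apply: (@measurableT_comp _ _ _ _ _ _ (fun x : 'rV[R]_n => x ord0 i)).
  exact: measurable_coord_rV.
exact: mf.
Qed.

Lemma measurable_rVD n d (T : measurableType d) (f g : T -> 'rV[R]_n) :
  measurable_fun setT f -> measurable_fun setT g ->
  measurable_fun setT (fun x => f x + g x).
Proof.
move=> mf mg; apply: measurable_rVP => i; under eq_fun do rewrite mxE.
by apply: measurable_funD; exact: measurable_rV_coord.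
Qed.

Lemma measurable_rVN n d (T : measurableType d) (f : T -> 'rV[R]_n) :
  measurable_fun setT f -> measurable_fun setT (fun x => - f x).
Proof.
move=> mf; apply: measurable_rVP => i; under eq_fun do rewrite mxE.
by apply: measurableT_comp => //; exact: measurable_rV_coord.
Qed.

Lemma measurable_rVB n d (T : measurableType d) (f g : T -> 'rV[R]_n) :
  measurable_fun setT f -> measurable_fun setT g ->
  measurable_fun setT (fun x => f x - g x).
Proof. by move=> mf mg; apply: measurable_rVD => //; exact: measurable_rVN. Qed.

Lemma lebesgue_rVS n A : lebesgue_rV R n.+1 A =
  (@lebesgue_measure R \x lebesgue_rV R n)%E (@cons_rV R n @^-1` A).
Proof. by []. Qed.

Definition map_rV n (phi : 'I_n -> R -> R) (x : 'rV[R]_n) : 'rV[R]_n :=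
  \row_i phi i (x ord0 i).

Lemma measurable_map_rV n (phi : 'I_n -> R -> R) :
  (forall i, measurable_fun setT (phi i)) -> measurable_fun setT (map_rV phi).
Proof.
move=> mphi; apply: measurable_rVP => i; under eq_fun do rewrite mxE.
apply: (@measurableT_comp _ _ _ _ _ _ (phi i)) => //.
exact: measurable_coord_rV.
Qed.

Lemma map_rV_cons n (phi : 'I_n.+1 -> R -> R) (p : measurableTypeR R * 'rV[R]_n) :
  map_rV phi (cons_rV p) =
  cons_rV (phi ord0 p.1 : measurableTypeR R,
           map_rV (fun i => phi (lift ord0 i)) p.2).
Proof.
by apply/rowP => i; rewrite !mxE; case: unliftP => [j ->|->] //=; rewrite mxE.
Qed.

(** Serves translations and the reflection alike, since both act coordinatewise. By induction on the
    dimension, the image of the product measure agrees with it on rectangles, hence everywhere. *)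
Lemma lebesgue_rV_map n (phi : 'I_n -> R -> R) :
  (forall i, measurable_fun setT (phi i : R -> measurableTypeR R)) ->
  (forall i (A : set (measurableTypeR R)), measurable A ->
    @lebesgue_measure R (phi i @^-1` A) = lebesgue_measure A) ->
  forall A : set 'rV[R]_n, measurable A ->
    lebesgue_rV R n (map_rV phi @^-1` A) = lebesgue_rV R n A.
Proof.
elim: n phi => [|n IH] phi mphi iphi A mA.
  rewrite (_ : map_rV phi = id) ?preimage_id//; apply/funext => x.
  by apply/rowP; case.
pose psi (i : 'I_n) := phi (lift ord0 i).
pose F (p : measurableTypeR R * 'rV[R]_n) :=
  (phi ord0 p.1 : measurableTypeR R, map_rV psi p.2).
have mpsi : measurable_fun setT (map_rV psi).
  by apply: measurable_map_rV => i; exact: mphi.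
have mF : measurable_fun setT F.
  apply/measurable_fun_pairP; split.
    by apply: (@measurableT_comp _ _ _ _ _ _ (phi ord0)) => //; exact: mphi.
  by apply: (@measurableT_comp _ _ _ _ _ _ (map_rV psi)).
have [m2 m2E] := image_measure (@lebesgue_measure R \x lebesgue_rV R n)%E mF.
rewrite !lebesgue_rVS.
have -> : cons_rV (n:=n) @^-1` (map_rV phi @^-1` A) =
          F @^-1` (cons_rV (n:=n) @^-1` A).
  by apply/funext => p; exact: (congr1 A (map_rV_cons phi p)).
have mX : measurable (cons_rV (n:=n) @^-1` A : set (measurableTypeR R * 'rV[R]_n)).
  by rewrite -[X in measurable X]setTI; exact: measurable_cons_rV.
rewrite -m2E; apply/esym/product_measure_unique => // B C mB mC; rewrite m2E.
rewrite (_ : F @^-1` (B `*` C) = (phi ord0 @^-1` B) `*` (map_rV psi @^-1` C))//.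
have mB' : measurable (phi ord0 @^-1` B : set (measurableTypeR R)).
  by rewrite -[X in measurable X]setTI; exact: mphi.
have mC' : measurable (map_rV psi @^-1` C).
  by rewrite -[X in measurable X]setTI; exact: mpsi.
transitivity (@lebesgue_measure R (phi ord0 @^-1` B) *
              lebesgue_rV R n (map_rV psi @^-1` C))%E.
  exact: (product_measure1E (@lebesgue_measure R) (lebesgue_rV R n) mB' mC').
rewrite iphi// IH//.
- by move=> i; exact: mphi.
- by move=> i; exact: iphi.
Qed.

Lemma lebesgue_measure_shift (a : R) (A : set (measurableTypeR R)) :
  measurable A ->
  @lebesgue_measure R ((fun x => x + a) @^-1` A) = lebesgue_measure A.
Proof.
move=> mA.
have mphi : measurable_fun setT (fun x : measurableTypeR R => x + a : measurableTypeR R).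
  exact: measurable_funD.
have [m2 m2E] := image_measure (@lebesgue_measure R) mphi.
rewrite -m2E; apply/esym/lebesgue_measure_unique => // X.
move=> /ocitvP[->|[[x y] /= xy ->]]; first by rewrite !measure0.
rewrite m2E.
rewrite (_ : _ @^-1` _ = `]x - a, y - a]%classic); last first.
  by apply/seteqP; split => z /=; rewrite !in_itv /= ltrBlDr lerBrDr.
rewrite [LHS]lebesgue_measure_itv [RHS]lebesgue_measure_itv /= !lte_fin xy.
by rewrite ifT ?ltrD2r//; congr EFin; ring.
Qed.

Lemma lebesgue_rV_shift n (a : 'rV[R]_n) (A : set 'rV[R]_n) : measurable A ->
  lebesgue_rV R n ((fun x => x + a) @^-1` A) = lebesgue_rV R n A.
Proof.
move=> mA; rewrite -[RHS](@lebesgue_rV_map n (fun i x => x + a ord0 i))//.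
- by congr (_ (_ @^-1` A)); apply/funext => x; apply/rowP => i; rewrite !mxE.
- by move=> i; exact: measurable_funD.
- by move=> i B mB; exact: lebesgue_measure_shift.
Qed.

Lemma lebesgue_rV_opp n (A : set 'rV[R]_n) : measurable A ->
  lebesgue_rV R n ((fun x => - x) @^-1` A) = lebesgue_rV R n A.
Proof.
move=> mA; rewrite -[RHS](@lebesgue_rV_map n (fun i x => - x))//.
- by congr (_ (_ @^-1` A)); apply/funext => x; apply/rowP => i; rewrite !mxE.
- by move=> i; exact: oppr_measurable.
- by move=> i B mB; exact: (lebesgue_measureN mB).
Qed.

Lemma ge0_integral_rV_shift n (a : 'rV[R]_n) (f : 'rV[R]_n -> R) :
  measurable_fun setT f -> (forall x, 0 <= f x) ->
  (\int[lebesgue_rV R n]_x (f (x + a))%:E = \int[lebesgue_rV R n]_x (f x)%:E)%E.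
Proof.
move=> mf f0.
have mphi : measurable_fun setT (fun x : 'rV[R]_n => x + a).
  by apply: measurable_rVD => //; exact: measurable_cst.
have /= := @ge0_integral_pushforward _ _ _ _ R _ mphi (lebesgue_rV R n) setT
  (EFin \o f) measurableT.
rewrite preimage_setT => <-; last 2 first.
- exact/measurable_EFinP.
- by move=> x _ /=; rewrite lee_fin.
apply: eq_measure_integral => B mB _; exact: lebesgue_rV_shift.
Qed.

Lemma ge0_integral_rV_opp n (f : 'rV[R]_n -> R) :
  measurable_fun setT f -> (forall x, 0 <= f x) ->
  (\int[lebesgue_rV R n]_x (f (- x))%:E = \int[lebesgue_rV R n]_x (f x)%:E)%E.
Proof.
move=> mf f0.
have mphi : measurable_fun setT (fun x : 'rV[R]_n => - x) by exact: measurable_rVN.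
have /= := @ge0_integral_pushforward _ _ _ _ R _ mphi (lebesgue_rV R n) setT
  (EFin \o f) measurableT.
rewrite preimage_setT => <-; last 2 first.
- exact/measurable_EFinP.
- by move=> x _ /=; rewrite lee_fin.
apply: eq_measure_integral => B mB _; exact: lebesgue_rV_opp.
Qed.

Lemma integral_rV_shift n (a : 'rV[R]_n) (f : 'rV[R]_n -> R) :
  measurable_fun setT f ->
  (\int[lebesgue_rV R n]_x (f (x + a))%:E = \int[lebesgue_rV R n]_x (f x)%:E)%E.
Proof.
move=> mf; rewrite integralE [RHS]integralE.
rewrite [in RHS](funerpos f) [in RHS](funerneg f).
rewrite -(ge0_integral_rV_shift a (measurable_funrpos mf))//.
rewrite -(ge0_integral_rV_shift a (measurable_funrneg mf))//.
by rewrite (funerpos (fun x => f (x + a))) (funerneg (fun x => f (x + a))).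
Qed.

Lemma integral_rV_opp n (f : 'rV[R]_n -> R) :
  measurable_fun setT f ->
  (\int[lebesgue_rV R n]_x (f (- x))%:E = \int[lebesgue_rV R n]_x (f x)%:E)%E.
Proof.
move=> mf; rewrite integralE [RHS]integralE.
rewrite [in RHS](funerpos f) [in RHS](funerneg f).
rewrite -(ge0_integral_rV_opp (measurable_funrpos mf))//.
rewrite -(ge0_integral_rV_opp (measurable_funrneg mf))//.
by rewrite (funerpos (fun x => f (- x))) (funerneg (fun x => f (- x))).
Qed.

Lemma intble_rV_shift n (a : 'rV[R]_n) (f : 'rV[R]_n -> R) :
  intble (lebesgue_rV R n) f -> intble (lebesgue_rV R n) (fun x => f (x + a)).
Proof.
move=> hf; have mf := intble_meas hf.
have mfa : measurable_fun setT (fun x : 'rV[R]_n => f (x + a)).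
  apply: (@measurableT_comp _ _ _ _ _ _ f) => //.
  by apply: measurable_rVD => //; exact: measurable_cst.
apply/integrableP; split; first exact/measurable_EFinP.
have /integrableP[_] := hf; congr (_ < _)%E; apply/esym.
rewrite -(ge0_integral_rV_shift a (f := fun x => `|f x|))//.
exact: measurableT_comp.
Qed.

Lemma intble_rV_opp n (f : 'rV[R]_n -> R) :
  intble (lebesgue_rV R n) f -> intble (lebesgue_rV R n) (fun x => f (- x)).
Proof.
move=> hf; have mf := intble_meas hf.
have mfa : measurable_fun setT (fun x : 'rV[R]_n => f (- x)).
  apply: (@measurableT_comp _ _ _ _ _ _ f) => //.
  exact: measurable_rVN.
apply/integrableP; split; first exact/measurable_EFinP.
have /integrableP[_] := hf; congr (_ < _)%E; apply/esym.
rewrite -(ge0_integral_rV_opp (f := fun x => `|f x|))//.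
exact: measurableT_comp.
Qed.

Lemma ge0_integral_rVS n (f : 'rV[R]_n.+1 -> R) :
  measurable_fun setT f -> (forall x, 0 <= f x) ->
  (\int[lebesgue_rV R n.+1]_x (f x)%:E =
   \int[@lebesgue_measure R]_a \int[lebesgue_rV R n]_x (f (cons_rV (a, x)))%:E)%E.
Proof.
move=> mf f0.
have mfc : measurable_fun setT (fun p => (f (cons_rV p))%:E).
  apply/measurable_EFinP; apply: (@measurableT_comp _ _ _ _ _ _ f) => //.
  exact: measurable_cons_rV.
rewrite -(fubini_tonelli1 (m1 := @lebesgue_measure R) (m2 := lebesgue_rV R n)
  (fun p => (f (cons_rV p))%:E))//; last by move=> x; rewrite lee_fin.
have /= := @ge0_integral_pushforward _ _ _ _ R _ (@measurable_cons_rV R n)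
  (@lebesgue_measure R \x lebesgue_rV R n)%E setT (EFin \o f) measurableT.
rewrite preimage_setT => <-//; first exact/measurable_EFinP.
by move=> x _ /=; rewrite lee_fin.
Qed.

End rV_measure.

(** * Weights on R^d and complex integrals *)

Section rV_weights.
Context (R : realType).
Implicit Types n : nat.

Lemma cons_rV_ord0 n (a : measurableTypeR R) (x : 'rV[R]_n) :
  cons_rV (a, x) ord0 ord0 = a.
Proof. by rewrite mxE unlift_none. Qed.

Lemma cons_rV_lift n (a : measurableTypeR R) (x : 'rV[R]_n) i :
  cons_rV (a, x) ord0 (lift ord0 i) = x ord0 i.
Proof. by rewrite mxE liftK. Qed.

Lemma measurable_prod_rV n (f : 'I_n -> R -> R) :
  (forall i, measurable_fun setT (f i : measurableTypeR R -> R)) ->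
  measurable_fun setT (fun x : 'rV[R]_n => \prod_i f i (x ord0 i)).
Proof.
move=> mf; apply: measurable_prod => i _.
apply: (@measurableT_comp _ _ _ _ _ _ (f i : measurableTypeR R -> R)) => //.
exact: measurable_coord_rV.
Qed.

Lemma ge0_integral_prod_rV n (f : 'I_n -> R -> R) (c : 'I_n -> R) :
  (forall i, measurable_fun setT (f i : measurableTypeR R -> R)) ->
  (forall i x, 0 <= f i x) ->
  (forall i, \int[@lebesgue_measure R]_x (f i x)%:E = (c i)%:E)%E ->
  (\int[lebesgue_rV R n]_x (\prod_i f i (x ord0 i))%:E = (\prod_i c i)%:E)%E.
Proof.
elim: n f c => [|n IH] f c mf f0 fc.
  rewrite integral_dirac//; last first.
    by apply/measurable_EFinP; exact: measurable_prod_rV.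
  by rewrite diracE mem_set// mul1e !big_ord0.
have mp := measurable_prod_rV (fun i => mf (lift ord0 i)).
rewrite ge0_integral_rVS; [|exact: measurable_prod_rV|by move=> x; exact: prodr_ge0].
rewrite (_ : (fun a => _) = fun a => ((\prod_(i < n) c (lift ord0 i)) * f ord0 a)%:E); last first.
  apply/funext => a.
  under eq_integral => x _.
    rewrite big_ord_recl cons_rV_ord0.
    under eq_bigr do rewrite cons_rV_lift.
    rewrite EFinM; over.
  rewrite ge0_integralZl//=; last 3 first.
  - exact/measurable_EFinP.
  - by move=> x _; rewrite lee_fin prodr_ge0.
  - by rewrite lee_fin.
  by rewrite (IH (fun i => f (lift ord0 i)) (fun i => c (lift ord0 i)))// -EFinM mulrC.
under eq_integral do rewrite EFinM.
rewrite ge0_integralZl//=; last 3 first.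
- by apply/measurable_EFinP; exact: mf.
- by move=> x _; rewrite lee_fin.
- rewrite lee_fin prodr_ge0// => i _; rewrite -lee_fin -fc.
  by apply: integral_ge0 => x _; rewrite lee_fin.
by rewrite fc -EFinM big_ord_recl mulrC.
Qed.

(** The l^1 norm is chosen because multiplication by [1 + n1] is then a sum of multiplications by
    coordinates, which integration by parts controls one at a time. *)
Definition n1 n (x : 'rV[R]_n) : R := \sum_i `|x ord0 i|.

Lemma n1_ge0 n (x : 'rV[R]_n) : 0 <= n1 x.
Proof. exact: sumr_ge0. Qed.

Lemma n1D n (x y : 'rV[R]_n) : n1 (x + y) <= n1 x + n1 y.
Proof. by rewrite -big_split; apply: ler_sum => i _; rewrite mxE ler_normD. Qed.

Lemma n1N n (x : 'rV[R]_n) : n1 (- x) = n1 x.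
Proof. by apply: eq_bigr => i _; rewrite mxE normrN. Qed.

Lemma ler_coord_n1 n (x : 'rV[R]_n) i : `|x ord0 i| <= n1 x.
Proof. by rewrite /n1 (bigD1 i)//= lerDl sumr_ge0. Qed.

Lemma measurable_n1 n d (T : measurableType d) (f : T -> 'rV[R]_n) :
  measurable_fun setT f -> measurable_fun setT (fun x => n1 (f x)).
Proof.
move=> mf; apply: measurable_sum => i; apply: measurableT_comp => //.
exact: measurable_rV_coord.
Qed.

Lemma measurable_dotp n d (T : measurableType d) (f g : T -> 'rV[R]_n) :
  measurable_fun setT f -> measurable_fun setT g ->
  measurable_fun setT (fun x => dotp (f x) (g x)).
Proof.
move=> mf mg; apply: measurable_sum => i.
by apply: measurable_funM; exact: measurable_rV_coord.
Qed.

Lemma measurable_sqrt : measurable_fun setT (@Num.sqrt R).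
Proof.
by apply: continuous_measurable_fun; exact: sqrt_continuous.
Qed.

Lemma measurable_enorm n d (T : measurableType d) (f : T -> 'rV[R]_n) :
  measurable_fun setT f -> measurable_fun setT (fun x => enorm (f x)).
Proof.
move=> mf; apply: (measurableT_comp measurable_sqrt).
exact: measurable_dotp.
Qed.

Lemma dotpxx_ge0 n (x : 'rV[R]_n) : 0 <= dotp x x.
Proof. by apply: sumr_ge0 => i _; rewrite -expr2 sqr_ge0. Qed.

Lemma sqr_enorm n (x : 'rV[R]_n) : enorm x ^+ 2 = dotp x x.
Proof. by rewrite sqr_sqrtr// dotpxx_ge0. Qed.

Lemma enorm_ge0 n (x : 'rV[R]_n) : 0 <= enorm x.
Proof. exact: sqrtr_ge0. Qed.

Lemma dotp_le_n1 n (x : 'rV[R]_n) : dotp x x <= n1 x ^+ 2.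
Proof.
rewrite expr2 {1}/n1 mulr_suml; apply: ler_sum => i _.
rewrite -[x ord0 i * _]ger0_norm; last by rewrite -expr2 sqr_ge0.
by rewrite normrM ler_wpM2l// ler_coord_n1.
Qed.

Lemma enorm_le_n1 n (x : 'rV[R]_n) : enorm x <= n1 x.
Proof.
rewrite -[n1 x]ger0_norm ?n1_ge0// -sqrtr_sqr ler_wsqrtr//; exact: dotp_le_n1.
Qed.

Lemma ler_coord_enorm n (x : 'rV[R]_n) i : `|x ord0 i| <= enorm x.
Proof.
rewrite -sqrtr_sqr ler_wsqrtr// /dotp (bigD1 i)//= -expr2 lerDl sumr_ge0// => j _.
by rewrite -expr2 sqr_ge0.
Qed.

Lemma n1_le_enorm n (x : 'rV[R]_n) : n1 x <= n%:R * enorm x.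
Proof.
rewrite /n1 (le_trans (ler_sum _ (fun i _ => ler_coord_enorm x i)))//.
by rewrite sumr_const card_ord mulr_natl.
Qed.

Lemma enormN n (x : 'rV[R]_n) : enorm (- x) = enorm x.
Proof.
by rewrite /enorm /dotp; congr Num.sqrt; apply: eq_bigr => i _; rewrite mxE mulrNN.
Qed.

Definition jw n (m : nat) (x : 'rV[R]_n) : R := ((1 + n1 x) ^+ m)^-1.

Lemma jw_gt0 n m (x : 'rV[R]_n) : 0 < jw m x.
Proof. by rewrite invr_gt0 exprn_gt0// ltr_wpDr// n1_ge0. Qed.

Lemma jw_le1 n m (x : 'rV[R]_n) : jw m x <= 1.
Proof. by rewrite invf_le1 ?exprn_ege1 ?exprn_gt0// ?ltr_wpDr ?lerDl ?n1_ge0. Qed.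

Lemma jwN n m (x : 'rV[R]_n) : jw m (- x) = jw m x.
Proof. by rewrite /jw n1N. Qed.

Lemma measurable_jw n m d (T : measurableType d) (f : T -> 'rV[R]_n) :
  measurable_fun setT f -> measurable_fun setT (fun x => jw m (f x)).
Proof.
move=> mf.
rewrite (_ : (fun x => _) = fun x => (1 + n1 (f x)) `^ (- m%:R)); last first.
  by apply/funext => x; rewrite powRN powR_mulrn// addr_ge0 ?n1_ge0.
apply: (measurableT_comp (measurable_powR _)).
by apply: measurable_funD => //; exact: measurable_n1.
Qed.

(** The weight is dominated by the product of the functions [1 / (1 + x_i^2)], each of integral
    pi. *)
Lemma intble_jw n : intble (lebesgue_rV R n) (jw (2 * n)).
Proof.
have moneD : measurable_fun setT (fun x : measurableTypeR R => (oneDsqr x)^-1).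
  by apply: continuous_measurable_fun; exact: continuous_oneDsqrV.
have ioneD : (\int[@lebesgue_measure R]_x ((oneDsqr x)^-1)%:E = pi%:E)%E.
  rewrite (ge0_symfun_integralT (f := fun x => (oneDsqr x)^-1)).
  - rewrite (_ : [set x : R | 0 <= x] = `[0, +oo[%classic); last first.
      by apply/seteqP; split => x /=; rewrite in_itv/= andbT.
    by rewrite integral0y_oneDsqr -EFinM; congr EFin; field.
  - by move=> x; rewrite invr_ge0 (le_trans _ (oneDsqr_ge1 x)).
  - exact: continuous_oneDsqrV.
  - by move=> x /=; rewrite /oneDsqr sqrrN.
have h0 (i : 'I_n) (x : R) : 0 <= (oneDsqr x)^-1.
  by rewrite invr_ge0 (le_trans _ (oneDsqr_ge1 x)).
have mp := measurable_prod_rV (n := n) (fun _ => moneD).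
have h := @intble_dom _ _ _ (lebesgue_rV R n)
  (fun x => \prod_(i < n) (oneDsqr (x ord0 i))^-1) (jw (2 * n)).
apply: h.
- by apply: measurable_jw; exact: measurable_id.
- apply: intble_ge0P => //; first by move=> x; exact: prodr_ge0.
  by rewrite (ge0_integral_prod_rV (f := fun _ x => (oneDsqr x)^-1) (c := fun=> pi))// ltry.
move=> x; rewrite ger0_norm ?(ltW (jw_gt0 _ _))// /jw prodfV lef_pV2 ?posrE.
- rewrite exprM -[X in _ <= _ ^+ X]card_ord -prodr_const.
  apply: ler_prod => i _; rewrite (le_trans _ (oneDsqr_ge1 _))//=.
  rewrite /oneDsqr sqrrD expr1n mul1r -addrA lerD2l -real_normK ?num_real//.
  rewrite (@le_trans _ _ (n1 x ^+ 2))//.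
    by rewrite lerXn2r ?nnegrE ?n1_ge0 ?ler_coord_n1.
  by rewrite lerDr mulrn_wge0 ?n1_ge0.
- by rewrite exprn_gt0// ltr_wpDr ?n1_ge0.
- by rewrite prodr_gt0// => i _; rewrite (lt_le_trans _ (oneDsqr_ge1 _)).
Qed.

(** By the triangle inequality [1 + n1 x] is at most twice the larger of [1 + n1 (x - y)] and
    [1 + n1 y]. The weight at [x] thus comes out of a convolution, and what remains is integrable in
    [y]. *)
Lemma jw_conv n m (x y : 'rV[R]_n) :
  jw m (x - y) * jw m y <= 2 ^+ m * jw m x * (jw m (x - y) + jw m y).
Proof.
rewrite /jw; set a := 1 + n1 (x - y); set b := 1 + n1 y; set c := 1 + n1 x.
have a1 : 1 <= a by rewrite lerDl n1_ge0.
have b1 : 1 <= b by rewrite lerDl n1_ge0.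
have c1 : 1 <= c by rewrite lerDl n1_ge0.
have cab : c <= a + b.
  by have := n1D (x - y) y; rewrite subrK /a /b /c; lra.
have am : 0 < a ^+ m by rewrite exprn_gt0//; lra.
have bm : 0 < b ^+ m by rewrite exprn_gt0//; lra.
have cm : 0 < c ^+ m by rewrite exprn_gt0//; lra.
have H : c ^+ m <= 2 ^+ m * (a ^+ m + b ^+ m).
  wlog ab : a b a1 b1 cab am bm / a <= b => [hw|].
    by case/orP: (le_total a b) => ?; [exact: hw|rewrite addrC; apply: hw => //; lra].
  rewrite (@le_trans _ _ ((2 * b) ^+ m))//.
    by rewrite lerXn2r ?nnegrE; lra.
  by rewrite exprMn ler_wpM2l ?exprn_ge0// lerDr ltW.
move: (a ^+ m) (b ^+ m) (c ^+ m) (2 ^+ m) am bm cm H => A B C D am bm cm H.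
rewrite -(@ler_pM2r _ (C * A * B)) ?mulr_gt0//.
rewrite [leLHS](_ : _ = C); last by field; rewrite !gt_eqF.
rewrite [leRHS](_ : _ = D * (A + B))//.
by field; rewrite !gt_eqF.
Qed.

End rV_weights.

(** * Conjugation and the l^1 norm on complex numbers *)

Section complex_l1norm.
Context (R : realType).
Implicit Types z w : R[i].

Definition cj z : R[i] := complex.Re z -i* complex.Im z.

Lemma cjK z : cj (cj z) = z.
Proof. by case: z => a b; rewrite /cj /= opprK. Qed.

(* The l^1 norm suits the componentwise definition of [Cintegral] better than the modulus. *)
Definition cn z : R := `|complex.Re z| + `|complex.Im z|.

Lemma cReD z w : complex.Re (z + w) = complex.Re z + complex.Re w.
Proof. by case: z w => [a b] [c e]. Qed.
Lemma cImD z w : complex.Im (z + w) = complex.Im z + complex.Im w.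
Proof. by case: z w => [a b] [c e]. Qed.
Lemma cReN z : complex.Re (- z) = - complex.Re z.
Proof. by case: z. Qed.
Lemma cImN z : complex.Im (- z) = - complex.Im z.
Proof. by case: z. Qed.
Lemma cReM z w : complex.Re (z * w) =
  complex.Re z * complex.Re w - complex.Im z * complex.Im w.
Proof. by case: z w => [a b] [c e]. Qed.
Lemma cImM z w : complex.Im (z * w) =
  complex.Re z * complex.Im w + complex.Im z * complex.Re w.
Proof. by case: z w => [a b] [c e]. Qed.

Definition RI := (cReD, cImD, cReN, cImN, cReM, cImM).

Lemma complex_ext z w : complex.Re z = complex.Re w ->
  complex.Im z = complex.Im w -> z = w.
Proof. by case: z w => [a b] [c e] /= -> ->. Qed.

Lemma cn_ge0 z : 0 <= cn z. Proof. exact: addr_ge0. Qed.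

Lemma cn0 : cn 0 = 0. Proof. by rewrite /cn /= normr0 addr0. Qed.

Lemma cn_eq0 z : cn z <= 0 -> z = 0.
Proof.
rewrite /cn => h; have h1 := normr_ge0 (complex.Re z).
have h2 := normr_ge0 (complex.Im z).
by apply: complex_ext; apply/eqP; rewrite /= -normr_le0; lra.
Qed.

Lemma cnD z w : cn (z + w) <= cn z + cn w.
Proof.
by rewrite /cn cReD cImD addrACA lerD// ler_normD.
Qed.

Lemma cnN z : cn (- z) = cn z.
Proof. by rewrite /cn cReN cImN !normrN. Qed.

Lemma cnB z w : cn (z - w) <= cn z + cn w.
Proof. by rewrite -(cnN w) cnD. Qed.

Lemma cnM z w : cn (z * w) <= cn z * cn w.
Proof.
rewrite /cn cReM cImM.
apply: le_trans (lerD (ler_normB _ _) (ler_normD _ _)) _.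
by rewrite !normrM; lra.
Qed.

Lemma cn_cj z : cn (cj z) = cn z.
Proof. by rewrite /cn; case: z => a b /=; rewrite normrN. Qed.

Lemma cn_real (x : R) : cn x%:C = `|x|.
Proof. by rewrite /cn /= normr0 addr0. Qed.

Lemma ler_Re_cn z : `|complex.Re z| <= cn z.
Proof. by rewrite lerDl. Qed.

Lemma ler_Im_cn z : `|complex.Im z| <= cn z.
Proof. by rewrite lerDr. Qed.

Lemma sqmod_le_cn z : sqmod z <= cn z ^+ 2.
Proof.
rewrite /sqmod /cn -(real_normK (num_real (complex.Re z))).
rewrite -(real_normK (num_real (complex.Im z))).
have := normr_ge0 (complex.Re z); have := normr_ge0 (complex.Im z).
move: `|_| `|_| => a b; nra.
Qed.

Lemma sqmod_ge0 z : 0 <= sqmod z.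
Proof. by rewrite addr_ge0// sqr_ge0. Qed.

Lemma cn_expi (a : R) : cn (expi a) <= 2.
Proof.
rewrite /cn /=; have := cos_geN1 a; have := cos_le1 a.
have := sin_geN1 a; have := sin_le1 a.
by rewrite -[2]/(1 + 1) => *; rewrite lerD// ler_norml; apply/andP; split; lra.
Qed.

Lemma expiD (a b : R) : expi (a + b) = expi a * expi b.
Proof. by rewrite /expi cosD sinD; apply: complex_ext; rewrite RI /=; ring. Qed.

Lemma expiN (a : R) : expi (- a) = cj (expi a).
Proof. by rewrite /expi cosN sinN. Qed.

Lemma cjM z w : cj (z * w) = cj z * cj w.
Proof. by case: z w => [a b] [c e]; apply: complex_ext; rewrite /=; ring. Qed.

Lemma cjD z w : cj (z + w) = cj z + cj w.
Proof. by case: z w => [a b] [c e]; apply: complex_ext; rewrite /=; ring. Qed.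

End complex_l1norm.

Section Cmeasurable_theory.
Context d (T : measurableType d) (R : realType).
Implicit Types f g : T -> R[i].

Lemma CmeasurableD f g : Cmeasurable f -> Cmeasurable g ->
  Cmeasurable (fun x => f x + g x).
Proof.
move=> [f1 f2] [g1 g2]; split.
  by under eq_fun do rewrite cReD; exact: measurable_funD.
by under eq_fun do rewrite cImD; exact: measurable_funD.
Qed.

Lemma CmeasurableN f : Cmeasurable f -> Cmeasurable (fun x => - f x).
Proof.
move=> [f1 f2]; split.
  by under eq_fun do rewrite cReN; exact: measurable_funN.
by under eq_fun do rewrite cImN; exact: measurable_funN.
Qed.

Lemma CmeasurableB f g : Cmeasurable f -> Cmeasurable g ->
  Cmeasurable (fun x => f x - g x).
Proof. by move=> mf mg; apply: CmeasurableD => //; exact: CmeasurableN. Qed.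

Lemma CmeasurableM f g : Cmeasurable f -> Cmeasurable g ->
  Cmeasurable (fun x => f x * g x).
Proof.
move=> [f1 f2] [g1 g2]; split.
  by under eq_fun do rewrite cReM; apply: measurable_funB; exact: measurable_funM.
by under eq_fun do rewrite cImM; apply: measurable_funD; exact: measurable_funM.
Qed.

Lemma Cmeasurable_cj f : Cmeasurable f -> Cmeasurable (fun x => cj (f x)).
Proof.
move=> [f1 f2]; split; first by move: f1; congr measurable_fun; apply/funext => x;
  case: (f x).
apply: eq_measurable_fun (measurable_funN f2) => x _ /=.
by case: (f x).
Qed.

Lemma Cmeasurable_real (f : T -> R) : measurable_fun setT f ->
  Cmeasurable (fun x => (f x)%:C).
Proof. by move=> mf; split => //=; exact: measurable_cst. Qed.

Lemma Cmeasurable_cst (c : R[i]) : Cmeasurable (fun _ : T => c).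
Proof. by split; exact: measurable_cst. Qed.

Lemma measurable_cos : measurable_fun setT (@cos R).
Proof. by apply: continuous_measurable_fun => x; exact: continuous_cos. Qed.

Lemma measurable_sin : measurable_fun setT (@sin R).
Proof. by apply: continuous_measurable_fun => x; exact: continuous_sin. Qed.

Lemma Cmeasurable_expi (f : T -> R) : measurable_fun setT f ->
  Cmeasurable (fun x => expi (f x)).
Proof.
move=> mf; split => /=; first exact: (measurableT_comp measurable_cos).
exact: (measurableT_comp measurable_sin).
Qed.

Lemma Cmeasurable_comp d2 (T2 : measurableType d2) (h : T2 -> T) f :
  measurable_fun setT h -> Cmeasurable f -> Cmeasurable (fun x => f (h x)).
Proof.
move=> mh [f1 f2]; split.
  exact: (measurableT_comp f1).
exact: (measurableT_comp f2).
Qed.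

Lemma measurable_cn f : Cmeasurable f -> measurable_fun setT (fun x => cn (f x)).
Proof.
by move=> [f1 f2]; apply: measurable_funD; exact: measurableT_comp.
Qed.

Lemma measurable_sqmod f : Cmeasurable f ->
  measurable_fun setT (fun x => sqmod (f x)).
Proof. by move=> [f1 f2]; apply: measurable_funD; exact: measurable_funX. Qed.

Lemma Cmeasurable_if (P : T -> bool) f g : measurable_fun setT P ->
  Cmeasurable f -> Cmeasurable g ->
  Cmeasurable (fun x => if P x then f x else g x).
Proof.
move=> mP [f1 f2] [g1 g2]; split.
  apply: eq_measurable_fun (measurable_fun_ifT mP f1 g1) => x _ /=.
  by case: (P x).
apply: eq_measurable_fun (measurable_fun_ifT mP f2 g2) => x _ /=.
by case: (P x).
Qed.

End Cmeasurable_theory.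

(** * Integrals of complex-valued functions *)

Section complex_integral_theory.
Context d (T : measurableType d) (R : realType).
Variable mu : {measure set T -> \bar R}.
Implicit Types f g : T -> R[i].

Definition Cintble f := intble mu (fun x => complex.Re (f x)) /\
                        intble mu (fun x => complex.Im (f x)).

Definition Cint f : R[i] := Cintegral mu setT f.

Lemma Cintble_meas f : Cintble f -> Cmeasurable f.
Proof. by move=> [/intble_meas f1 /intble_meas f2]. Qed.

Lemma Cintble_dom (g : T -> R) f : Cmeasurable f -> intble mu g ->
  (forall x, cn (f x) <= g x) -> Cintble f.
Proof.
move=> [f1 f2] ig fg; split; apply: intble_dom ig _ => // x.
  exact: le_trans (ler_Re_cn _) (fg x).
exact: le_trans (ler_Im_cn _) (fg x).
Qed.

Lemma intble_cn f : Cintble f -> intble mu (fun x => cn (f x)).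
Proof. by move=> [f1 f2]; apply: intbleD; exact: intble_norm. Qed.

Lemma CintbleN f : Cintble f -> Cintble (fun x => - f x).
Proof.
move=> [f1 f2]; split.
  by under eq_fun do rewrite cReN; exact: intbleN.
by under eq_fun do rewrite cImN; exact: intbleN.
Qed.

Lemma CintbleZ (c : R[i]) f : Cintble f -> Cintble (fun x => c * f x).
Proof.
move=> [f1 f2]; split.
  by under eq_fun do rewrite cReM; apply: intbleB; exact: intbleZ.
by under eq_fun do rewrite cImM; apply: intbleD; exact: intbleZ.
Qed.

Lemma Cintble_cj f : Cintble f -> Cintble (fun x => cj (f x)).
Proof.
move=> hf; apply: Cintble_dom (intble_cn hf) _.
  exact/Cmeasurable_cj/Cintble_meas.
by move=> x; rewrite cn_cj.
Qed.

Lemma CintD f g : Cintble f -> Cintble g ->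
  Cint (fun x => f x + g x) = Cint f + Cint g.
Proof.
move=> [f1 f2] [g1 g2]; rewrite /Cint /Cintegral.
under eq_Rintegral do rewrite cReD.
under [X in _ +i* X]eq_Rintegral do rewrite cImD.
by rewrite !Rintegral_add.
Qed.

Lemma CintN f : Cintble f -> Cint (fun x => - f x) = - Cint f.
Proof.
move=> [f1 f2]; rewrite /Cint /Cintegral.
under eq_Rintegral do rewrite cReN.
under [X in _ +i* X]eq_Rintegral do rewrite cImN.
by rewrite !Rintegral_opp.
Qed.

Lemma CintB f g : Cintble f -> Cintble g ->
  Cint (fun x => f x - g x) = Cint f - Cint g.
Proof. by move=> hf hg; rewrite CintD ?CintN//; exact: CintbleN. Qed.

Lemma CintZ (c : R[i]) f : Cintble f -> Cint (fun x => c * f x) = c * Cint f.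
Proof.
move=> [f1 f2]; rewrite /Cint /Cintegral.
under eq_Rintegral do rewrite cReM.
under [X in _ +i* X]eq_Rintegral do rewrite cImM.
rewrite Rintegral_sub; [|exact: intbleZ|exact: intbleZ].
rewrite Rintegral_add; [|exact: intbleZ|exact: intbleZ].
rewrite !Rintegral_scale//.
by apply: complex_ext; rewrite RI.
Qed.

Lemma CintZr (c : R[i]) f : Cintble f -> Cint (fun x => f x * c) = Cint f * c.
Proof.
by move=> hf; rewrite mulrC -CintZ//; congr Cint; apply/funext => x; rewrite mulrC.
Qed.

Lemma Cint_cj f : Cintble f -> Cint (fun x => cj (f x)) = cj (Cint f).
Proof.
move=> [f1 f2]; apply: complex_ext => //=; exact: Rintegral_opp.
Qed.

Lemma cn_Cint (g : T -> R) f : Cmeasurable f -> intble mu g ->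
  (forall x, cn (f x) <= g x) -> cn (Cint f) <= \int[mu]_x g x.
Proof.
move=> mf ig fg; have hf := Cintble_dom mf ig fg.
apply: (@le_trans _ _ (\int[mu]_x (cn (f x)))); last first.
  by apply: ler_Rintegral => //; exact: intble_cn.
case: (hf) => f1 f2.
rewrite /cn Rintegral_add; [|exact: intble_norm|exact: intble_norm].
by apply: lerD; exact: le_normr_Rintegral.
Qed.

Lemma eq_Cint f g : (forall x, f x = g x) -> Cint f = Cint g.
Proof. by move=> /funext ->. Qed.

Lemma Cint0 : Cint (fun=> 0) = 0.
Proof. by rewrite /Cint /Cintegral /= Rintegral_cst// mul0r. Qed.

Lemma ae_eq_Cint f g : Cmeasurable f -> Cmeasurable g ->
  {ae mu, forall x, f x = g x} -> Cint f = Cint g.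
Proof.
move=> [f1 f2] [g1 g2] fg; rewrite /Cint /Cintegral; congr (_ +i* _).
  by apply: ae_eq_Rintegral => //; apply: filterS fg => x ->.
by apply: ae_eq_Rintegral => //; apply: filterS fg => x ->.
Qed.

End complex_integral_theory.

Section Cfubini.
Context d1 d2 (T1 : measurableType d1) (T2 : measurableType d2) (R : realType).
Variables (m1 : {sigma_finite_measure set T1 -> \bar R})
          (m2 : {sigma_finite_measure set T2 -> \bar R}).

Lemma Cmeasurable_Cint (f : T1 * T2 -> R[i]) : Cmeasurable f ->
  Cmeasurable (fun x => Cint m2 (fun y => f (x, y))).
Proof.
move=> [f1 f2]; split => /=.
  exact: (measurable_Rintegral m2 f1).
exact: (measurable_Rintegral m2 f2).
Qed.

Lemma Cintble_prod (f : T1 * T2 -> R[i]) (F : T1 * T2 -> R) (g : T1 -> R) :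
  Cmeasurable f -> measurable_fun setT F -> intble m1 g ->
  (forall z, cn (f z) <= F z) ->
  (forall x, (\int[m2]_y (F (x, y))%:E <= (g x)%:E)%E) ->
  Cintble (m1 \x m2)%E f.
Proof.
move=> mf mF ig fF Fg; apply: (Cintble_dom (g := F)) => //.
apply: intble_prod ig _ => // x; apply: le_trans (Fg x).
rewrite le_eqVlt; apply/orP; left; apply/eqP; apply: eq_integral => y _.
by rewrite ger0_norm// (le_trans (cn_ge0 _) (fF _)).
Qed.

Lemma Cfubini (f : T1 * T2 -> R[i]) : Cintble (m1 \x m2)%E f ->
  Cint m1 (fun x => Cint m2 (fun y => f (x, y))) =
  Cint m2 (fun y => Cint m1 (fun x => f (x, y))).
Proof.
move=> [f1 f2]; rewrite /Cint /Cintegral /=; congr (_ +i* _).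
  exact: (Rfubini f1).
exact: (Rfubini f2).
Qed.

Lemma Cintble_Cint (f : T1 * T2 -> R[i]) : Cintble (m1 \x m2)%E f ->
  Cintble m1 (fun x => Cint m2 (fun y => f (x, y))).
Proof.
by move=> [f1 f2]; split => /=; [exact: (intble_Rintegral f1)|exact: (intble_Rintegral f2)].
Qed.

End Cfubini.

Section Cint_rV.
Context (R : realType) (n : nat).
Local Notation mu := (lebesgue_rV R n).

Lemma Cint_shift (a : 'rV[R]_n) (f : 'rV[R]_n -> R[i]) : Cmeasurable f ->
  Cint mu (fun x => f (x + a)) = Cint mu f.
Proof.
move=> [f1 f2]; rewrite /Cint /Cintegral; congr (fine _ +i* fine _).
  exact: (integral_rV_shift a f1).
exact: (integral_rV_shift a f2).
Qed.

Lemma Cint_opp (f : 'rV[R]_n -> R[i]) : Cmeasurable f ->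
  Cint mu (fun x => f (- x)) = Cint mu f.
Proof.
move=> [f1 f2]; rewrite /Cint /Cintegral; congr (fine _ +i* fine _).
  exact: (integral_rV_opp f1).
exact: (integral_rV_opp f2).
Qed.

Lemma Cintble_shift (a : 'rV[R]_n) (f : 'rV[R]_n -> R[i]) : Cintble mu f ->
  Cintble mu (fun x => f (x + a)).
Proof.
move=> [f1 f2]; split; first exact: (intble_rV_shift a f1).
exact: (intble_rV_shift a f2).
Qed.

End Cint_rV.

(** * Decay of the Fourier transform of a Schwartz function *)

Section continuous_rV.
Context (R : realType) (n : nat).
Local Notation E := 'rV[R]_n.

(** The sigma-algebra here is generated by the coordinates and is not by definition the Borel one.
    Rounding every coordinate down to a multiple of [1 / (k + 1)] gives functions that are constant
    on countably many measurable cells and converge to [f] pointwise. *)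
Lemma continuous_measurable_rV (f : E -> R) : continuous f ->
  measurable_fun setT f.
Proof.
move=> cf.
pose q (k : nat) (x : R) : R := (Num.floor (x * k.+1%:R))%:~R / k.+1%:R.
have qx k x : q k x <= x < q k x + k.+1%:R^-1.
  have k0 : 0 < k.+1%:R :> R by [].
  have /andP[h1 h2] := floor_itv (x * k.+1%:R).
  by rewrite /q ler_pdivrMr// h1/= -[X in _ + X]mul1r -mulrDl ltr_pdivlMr// -(intrD _ _ 1).
apply: (measurable_fun_cvg (h := fun k x => f (map_rV (fun=> q k) x))).
  move=> k _ Y mY; rewrite setTI.
  pose pt (z : 'rV[int]_n) : E := \row_i ((z ord0 i)%:~R / k.+1%:R).
  pose cell (z : 'rV[int]_n) : set E := \bigcap_(i in [set: 'I_n])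
     ((fun x : E => x ord0 i : measurableTypeR R) @^-1`
       `[(z ord0 i)%:~R / k.+1%:R, ((z ord0 i)%:~R + 1) / k.+1%:R[%classic).
  pose Z := [set z : 'rV[int]_n | Y (f (pt z))].
  rewrite (_ : _ @^-1` _ = \bigcup_z (if z \in Z then cell z else set0)).
    apply: countable_bigcupT_measurable; first exact: countableP.
    move=> z; case: ifP => // _; apply: fin_bigcap_measurable => // i _.
    rewrite -[X in measurable X]setTI; apply: measurable_coord_rV => //.
  rewrite -bigcup_mkcond; apply/seteqP; split => x /=.
    move=> Yx; pose z : 'rV[int]_n := \row_i Num.floor (x ord0 i * k.+1%:R).
    exists z.
      rewrite /Z /=; congr (Y (f _)): Yx; apply/rowP => i.
      by rewrite !mxE.
    move=> i _ /=; rewrite in_itv /= mxE.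
    have /andP[h1 h2] := floor_itv (x ord0 i * k.+1%:R).
    by rewrite ler_pdivrMr// h1/= ltr_pdivlMr// -(intrD _ _ 1).
  move=> [z Zz cz]; move: Zz; rewrite /Z /=; congr (Y (f _)); apply/rowP => i.
  have := cz i I; rewrite !mxE /= in_itv /= ler_pdivrMr// ltr_pdivlMr// /q => h.
  by congr (_%:~R / _); apply/esym/floor_def; rewrite intrD.
move=> x _.
suff gx : map_rV (fun=> q k) x @[k --> \oo] --> (x : E).
  exact: (cvg_comp _ _ gx (cf x)).
apply/cvg_ballP => e e0; near=> k; split=> // i j; rewrite ord1 mxE /ball /=.
have /andP[h1 h2] := qx k (x ord0 j).
rewrite ger0_norm ?subr_ge0//.
apply: (@lt_trans _ _ k.+1%:R^-1); first by rewrite ltrBlDl.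
by near: k; exact: (near_infty_natSinv_lt (PosNum e0)).
Unshelve. all: by end_near.
Qed.

Lemma is_derive_line (F : E -> R) (x v : E) (t l : R) :
  is_derive (x + t *: v) v F l -> is_derive t 1 (fun s => F (x + s *: v)) l.
Proof.
move=> [dF eF].
have H : (fun h : R => h^-1 *: (((fun s : R => F (x + s *: v)) \o shift t) (h *: (1 : R)) - F (x + t *: v)))
    = (fun h : R => h^-1 *: ((F \o shift (x + t *: v)) (h *: v) - F (x + t *: v))).
  apply/funext => h /=; congr (_ *: (F _ - _)).
  by rewrite scalerDl addrCA; congr (_ + _); rewrite /GRing.scale /= mulr1.
split; first by rewrite /derivable H.
by rewrite -eF /derive H.
Qed.

End continuous_rV.

Lemma is_derive_affine (R : realType) (t a b : R) :
  is_derive t 1 (fun h => h * a + b) a.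
Proof.
have H : is_derive t 1 (a *: @id R + cst b) (a * (1 : R) + 0).
  by apply: is_deriveD.
rewrite mulr1 addr0 in H.
rewrite (_ : (fun h => _) = a *: @id R + cst b); first exact: H.
by apply/funext => h /=; rewrite !fctE /= mulrC.
Qed.

Lemma is_derive_integral d (Y : measurableType d) (R : realType)
    (mu : {measure set Y -> \bar R}) (f df : R -> Y -> R) (G : Y -> R) (a : R) :
  (forall t, `|t - a| < 1 -> intble mu (f t)) ->
  (forall t y, `|t - a| < 1 -> is_derive t 1 (f^~ y) (df t y)) ->
  intble mu G -> (forall t y, `|t - a| < 1 -> `|df t y| <= G y) ->
  is_derive a 1 (fun t => \int[mu]_y f t y) (\int[mu]_y df a y).
Proof.
move=> If Df IG dfG.
have itvP t : `]a - 1, a + 1[%classic t -> `|t - a| < 1.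
  by rewrite /= in_itv /= ltr_norml => /andP[? ?]; apply/andP; split; lra.
have aa : `|a - a| < 1 by rewrite subrr normr0.
have := @cvg_differentiation_under_integral R _ Y mu f setT measurableT a (a - 1) (a + 1) _ _ _ G.
have -> : \int[mu]_y partial1of2 f a y = \int[mu]_y df a y.
  apply: eq_Rintegral => y _; rewrite partial1of2E.
  by have [_ <-] := Df a y aa.
move=> H.
have {}H : h^-1 *: ((fun x' : R => \int[mu]_y f x' y) (h + a) -
  (fun x' : R => \int[mu]_y f x' y) a) @[h --> 0^'] --> \int[mu]_y df a y.
  apply: H => //.
  - by rewrite /= in_itv /=; apply/andP; split; lra.
  - by move=> x /itvP /If.
  - by move=> x y /itvP /(Df _ y) [].
  - by move=> y; rewrite (le_trans _ (dfG a y aa)).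
  - move=> x y /itvP xa _; rewrite partial1of2E.
    by have [_ ->] := Df x y xa; exact: dfG.
have {}H : h^-1 *: (((fun x' : R => \int[mu]_y f x' y) \o shift a) (h *: (1 : R)) -
  (fun x' : R => \int[mu]_y f x' y) a) @[h --> 0^'] --> \int[mu]_y df a y.
  apply: cvg_trans H; apply: near_eq_cvg; near=> h => /=.
  by rewrite /GRing.scale /= mulr1.
split; first by apply/cvg_ex; exists (\int[mu]_y df a y).
exact/cvg_lim.
Unshelve. all: by end_near.
Qed.

(** * The integral of a partial derivative vanishes *)

Section integral_of_derivative.
Context (R : realType) (n : nat).
Local Notation E := 'rV[R]_n.
Local Notation mu := (lebesgue_rV R n).

Lemma jw_shift_le m (x y : E) : n1 y <= 1 -> jw m (x + y) <= 2 ^+ m * jw m x.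
Proof.
move=> y1; rewrite /jw -[leLHS]mul1r ler_pdivrMr ?exprn_gt0 ?ltr_wpDr ?n1_ge0//.
rewrite mulrAC ler_pdivlMr ?exprn_gt0 ?ltr_wpDr ?n1_ge0// mul1r -exprMn.
have := n1D (x + y) (- y); rewrite addrK n1N => h.
have := n1_ge0 x; have := n1_ge0 y; have := n1_ge0 (x + y) => ? ? ?.
by rewrite lerXn2r ?nnegrE; lra.
Qed.

Lemma n1Z (c : R) (x : E) : n1 (c *: x) = `|c| * n1 x.
Proof. by rewrite /n1 mulr_sumr; apply: eq_bigr => i _; rewrite mxE normrM. Qed.

Lemma n1_delta (j : 'I_n) : n1 (delta_mx ord0 j : E) = 1.
Proof.
rewrite /n1 (bigD1 j)//= mxE !eqxx/= normr1 big1 ?addr0// => i ij.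
by rewrite mxE eqxx (negbTE ij) normr0.
Qed.

(** By translation invariance the integral of [F (y + t *: e)] does not depend on [t]; its
    derivative at [t = 0] is the integral of [dF]. Integration by parts is thereby obtained without
    iterated integrals or boundary terms. *)
Lemma integral_derivative_eq0 (F dF : E -> R) (j : 'I_n) (M : R) :
  intble mu F -> (forall x, is_derive x (delta_mx ord0 j : E) F (dF x)) ->
  (forall x, `|dF x| <= M * jw (2 * n) x) ->
  \int[mu]_x dF x = 0.
Proof.
move=> IF DF dFM; pose e : E := delta_mx ord0 j.
have M0 : 0 <= M.
  by have := le_trans (normr_ge0 _) (dFM 0); rewrite pmulr_lge0 ?jw_gt0.
have mF := intble_meas IF.
have H : is_derive (0 : R) 1 (fun t => \int[mu]_y F (y + t *: e)) (\int[mu]_y dF (y + 0 *: e)).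
  apply: (is_derive_integral (f := fun t (y : E) => F (y + t *: e))
    (df := fun t y => dF (y + t *: e)) (G := fun y => M * 2 ^+ (2 * n) * jw (2 * n) y)).
  - by move=> t _; exact: intble_rV_shift.
  - by move=> t y _; apply: is_derive_line; exact: DF.
  - by apply: intbleZ; exact: intble_jw.
  - move=> t y; rewrite subr0 => t1; apply: le_trans (dFM _) _.
    by rewrite -mulrA ler_wpM2l// jw_shift_le// n1Z n1_delta mulr1 ltW.
have E0 : (fun t => \int[mu]_y F (y + t *: e)) = cst (\int[mu]_y F y).
  by apply/funext => t; rewrite /Rintegral integral_rV_shift.
rewrite E0 in H.
under eq_Rintegral do rewrite -[x in dF x](addr0) -(scale0r e).
case: H => _ <-; exact: derive_cst.
Qed.

End integral_of_derivative.

(** * Schwartz functions and integration by parts against characters *)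

Section schwartz_decay.
Context (R : realType) (d : nat).
Local Notation E := 'rV[R]_d.
Local Notation mu := (lebesgue_rV R d).
Implicit Types f g : E -> R.

Lemma partial_schwartz f s : real_schwartz f -> real_schwartz (partial s f).
Proof.
move=> hf t; have := hf (t ++ s).
have -> : partial (t ++ s) f = partial t (partial s f).
  by elim: t => //= i t ->.
by [].
Qed.

Lemma schwartz_measurable f : real_schwartz f -> measurable_fun setT f.
Proof.
move=> /(_ [::])[/= df _]; apply: continuous_measurable_rV => x.
exact: differentiable_continuous.
Qed.

Lemma schwartz_bound f m : real_schwartz f ->
  exists2 M, 0 <= M & forall x, `|f x| <= M * jw m x.
Proof.
move=> /(_ [::])[/= _ bf].
have [M0 hM0] := bf 0; have [Mm hMm] := bf m.
have M00 : 0 <= M0 by apply: le_trans (hM0 0); rewrite expr0 mul1r.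
have Mm0 : 0 <= Mm by apply: le_trans (hMm 0); rewrite mulr_ge0// exprn_ge0 ?enorm_ge0.
exists (2 ^+ m * (M0 + d%:R ^+ m * Mm)).
  by rewrite mulr_ge0 ?exprn_ge0// addr_ge0// mulr_ge0// exprn_ge0.
move=> x; rewrite ler_pdivlMr ?exprn_gt0 ?ltr_wpDr ?n1_ge0//.
have h : (1 + n1 x) ^+ m <= 2 ^+ m * (1 + n1 x ^+ m).
  have n0 := n1_ge0 x; case: (lerP (n1 x) 1) => h1.
    apply: (@le_trans _ _ (2 ^+ m)); first by rewrite lerXn2r ?nnegrE; lra.
    by rewrite ler_peMr ?exprn_ge0// lerDl exprn_ge0.
  apply: (@le_trans _ _ ((2 * n1 x) ^+ m)); first by rewrite lerXn2r ?nnegrE; lra.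
  by rewrite exprMn ler_wpM2l ?exprn_ge0// lerDr.
apply: le_trans (ler_wpM2l (normr_ge0 _) h) _.
rewrite mulrCA ler_wpM2l ?exprn_ge0// mulrDr mulr1 lerD//.
  by have := hM0 x; rewrite expr0 mul1r.
apply: (@le_trans _ _ (d%:R ^+ m * (enorm x ^+ m * `|f x|))); last first.
  by rewrite ler_wpM2l ?exprn_ge0.
rewrite mulrA -exprMn mulrC ler_wpM2r//.
by rewrite lerXn2r ?nnegrE ?n1_ge0 ?mulr_ge0 ?enorm_ge0 ?n1_le_enorm.
Qed.

Lemma schwartz_intble f : real_schwartz f -> intble mu f.
Proof.
move=> hf; have [M _ hM] := schwartz_bound (2 * d) hf.
by apply: (intble_dom (schwartz_measurable hf)) hM; apply/intbleZ/intble_jw.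
Qed.

Lemma schwartz_is_derive f x j : real_schwartz f ->
  is_derive x (delta_mx ord0 j : E) f (partial [:: j] f x).
Proof.
move=> /(_ [::])[/= df _]; split => //; exact: diff_derivable.
Qed.

(* The product of the character y |-> e^{i y.xi}, or rather of its real and
   imaginary parts, with a Schwartz function. *)
Lemma is_derive_line_trig (x xi : E) j (c : R -> R) (c' : R -> R) f :
  (forall t : R, is_derive t 1 c (c' t)) -> real_schwartz f ->
  is_derive x (delta_mx ord0 j : E) (fun y => c (dotp y xi) * f y)
    (xi ord0 j * (c' (dotp x xi) * f x) + c (dotp x xi) * partial [:: j] f x).
Proof.
move=> dc hf; set e : E := delta_mx ord0 j.
have dotE (h : R) y : dotp (h *: e + y) xi = h * xi ord0 j + dotp y xi.
  rewrite /dotp (eq_bigr (fun i => h * (e ord0 i * xi ord0 i) + y ord0 i * xi ord0 i)).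
    rewrite big_split/= -mulr_sumr (bigD1 j)//= mxE !eqxx/= mul1r big1 ?addr0//.
    by move=> i ij; rewrite mxE eqxx (negbTE ij) mul0r.
  by move=> i _; rewrite !mxE mulrDl mulrA.
have Dc : is_derive x e (fun y => c (dotp y xi)) (xi ord0 j * c' (dotp x xi)).
  have h1 : is_derive (0 : R) 1 (fun h => c (h * xi ord0 j + dotp x xi))
      (c' (dotp x xi) * xi ord0 j).
    have := @is_derive1_comp R c (fun h => h * xi ord0 j + dotp x xi) 0
      (c' (dotp x xi)) (xi ord0 j).
    apply; first by rewrite mul0r add0r; exact: dc.
    exact: is_derive_affine.
  have H : (fun h : R => h^-1 *: (((fun h => c (h * xi ord0 j + dotp x xi)) \o shift 0) (h *: (1 : R)) -
      (fun h => c (h * xi ord0 j + dotp x xi)) 0)) =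
     (fun h : R => h^-1 *: (((fun y => c (dotp y xi)) \o shift x) (h *: e) - c (dotp x xi))).
    apply/funext => h /=; rewrite dotE mul0r add0r addr0.
    by congr (_ *: (c (_ * _ + _) - _)); rewrite /GRing.scale /= mulr1.
  case: h1; rewrite /derivable /derive H => h2 h3.
  by split => //; rewrite mulrC.
have Df := schwartz_is_derive x j hf.
have H := is_deriveM Dc Df.
case: H => H1 H2; split; first exact: H1.
by rewrite [LHS]H2 /GRing.scale /=; ring.
Qed.

(** Integration by parts: the derivative of the product of [f] with the cosine or the sine has
    integral 0. *)
Lemma integral_trig_partial (xi : E) j f :
  real_schwartz f ->
  \int[mu]_y (cos (dotp y xi) * partial [:: j] f y) =
    xi ord0 j * \int[mu]_y (sin (dotp y xi) * f y) /\
  \int[mu]_y (sin (dotp y xi) * partial [:: j] f y) =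
    - (xi ord0 j * \int[mu]_y (cos (dotp y xi) * f y)).
Proof.
move=> hf; have hf' := partial_schwartz [:: j] hf.
have mtrig (c : R -> R) : measurable_fun setT c ->
    measurable_fun setT (fun y : E => c (dotp y xi)).
  by move=> mc; apply: (measurableT_comp mc); exact: measurable_dotp.
have mcos := mtrig _ (@measurable_cos R); have msin := mtrig _ (@measurable_sin R).
have dom (c : R -> R) g : measurable_fun setT (fun y : E => c (dotp y xi)) ->
    (forall t, `|c t| <= 1) -> real_schwartz g ->
    intble mu (fun y => c (dotp y xi) * g y).
  move=> mc c1 hg; apply: (@intble_dom _ _ _ mu (fun y => `|g y|)).
  - by apply: measurable_funM => //; exact: schwartz_measurable.
  - by apply: intble_norm; exact: schwartz_intble.
  - by move=> y; rewrite normrM -[leRHS]mul1r ler_wpM2r.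
have cos1 (t : R) : `|cos t| <= 1 by rewrite ler_norml cos_geN1 cos_le1.
have sin1 (t : R) : `|sin t| <= 1 by rewrite ler_norml sin_geN1 sin_le1.
have [M0 M00 hM0] := schwartz_bound (2 * d) hf.
have [M1 M10 hM1] := schwartz_bound (2 * d) hf'.
have bnd (c c' : R -> R) y : (forall t, `|c t| <= 1) -> (forall t, `|c' t| <= 1) ->
    `|xi ord0 j * (c' (dotp y xi) * f y) + c (dotp y xi) * partial [:: j] f y|
     <= (`|xi ord0 j| * M0 + M1) * jw (2 * d) y.
  move=> c1 c1'; rewrite (le_trans (ler_normD _ _))// mulrDl !normrM -mulrA lerD//.
    rewrite ler_wpM2l// -[leRHS]mul1r ler_pM//; exact: hM0.
  rewrite -[leRHS]mul1r ler_pM//; exact: hM1.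
have D1 y := @is_derive_line_trig y xi j cos (fun t => - sin t) f (fun t => is_derive_cos t) hf.
have D2 y := @is_derive_line_trig y xi j sin cos f (fun t => is_derive_sin t) hf.
have I1 := integral_derivative_eq0 (dom _ _ mcos cos1 hf) D1
  (fun y => bnd cos (fun t => - sin t) y cos1 (fun t => eq_ind_r (fun z => z <= 1) (sin1 t) (normrN (sin t)))).
have I2 := integral_derivative_eq0 (dom _ _ msin sin1 hf) D2
  (fun y => bnd sin cos y sin1 cos1).
split.
  move: I1; under eq_Rintegral do rewrite mulNr mulrN addrC.
  rewrite Rintegral_sub; [|exact: dom|apply: intbleZ; exact: dom].
  by rewrite Rintegral_scale; [move/eqP; rewrite subr_eq0 => /eqP|exact: dom].
move: I2; rewrite Rintegral_add; [|apply: intbleZ; exact: dom|exact: dom].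
by rewrite Rintegral_scale; [move/eqP; rewrite addrC addr_eq0 => /eqP|exact: dom].
Qed.

(** Each further factor [1 + n1 xi] costs one derivative of [f] in every direction; as the
    derivatives are Schwartz again, the induction on [m] runs over all Schwartz functions at
    once. *)
Lemma trig_integral_bound f m : real_schwartz f ->
  exists2 M, 0 <= M & forall xi : E,
    `|\int[mu]_y (cos (dotp y xi) * f y)| + `|\int[mu]_y (sin (dotp y xi) * f y)|
      <= M * jw m xi.
Proof.
move=> hf.
have mtrig (xi : E) (c : R -> R) : measurable_fun setT c ->
    measurable_fun setT (fun y : E => c (dotp y xi)).
  by move=> mc; apply: (measurableT_comp mc); exact: measurable_dotp.
pose A g (xi : E) := `|\int[mu]_y (cos (dotp y xi) * g y)| +
  `|\int[mu]_y (sin (dotp y xi) * g y)|.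
have bA g : real_schwartz g -> exists2 M, 0 <= M & forall xi, A g xi <= M.
  move=> hg; exists (2 * \int[mu]_y `|g y|).
    by rewrite mulr_ge0// Rintegral_ge0.
  have ig := intble_norm (schwartz_intble hg).
  have b (xi : E) (c : R -> R) : measurable_fun setT c -> (forall t, `|c t| <= 1) ->
      `|\int[mu]_y (c (dotp y xi) * g y)| <= \int[mu]_y `|g y|.
    move=> mc c1; apply: ler_norm_Rintegral => //.
      by apply: measurable_funM; [exact: mtrig|exact: schwartz_measurable].
    by move=> y; rewrite normrM -[leRHS]mul1r ler_wpM2r.
  move=> xi; rewrite mulr_natl mulr2n lerD//; apply: b.
  - exact: measurable_cos.
  - by move=> t; rewrite ler_norml cos_geN1 cos_le1.
  - exact: measurable_sin.
  - by move=> t; rewrite ler_norml sin_geN1 sin_le1.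
have step g (xi : E) j : real_schwartz g -> `|xi ord0 j| * A g xi = A (partial [:: j] g) xi.
  move=> hg; have [h1 h2] := integral_trig_partial xi j hg.
  by rewrite /A h1 h2 normrN !normrM mulrDr addrC.
have : exists2 M, 0 <= M & forall xi, (1 + n1 xi) ^+ m * A f xi <= M.
  elim: m f hf => [|m IH] g hg.
    by have [M M0 hM] := bA g hg; exists M => // xi; rewrite expr0 mul1r.
  have [M M0 hM] := IH g hg.
  have /choice[N hN] : forall j : 'I_d, exists N : R, 0 <= N /\
     forall xi, (1 + n1 xi) ^+ m * A (partial [:: j] g) xi <= N.
    by move=> j; have [N N0 hN] := IH _ (partial_schwartz [:: j] hg); exists N.
  exists (M + \sum_j N j).
    by rewrite addr_ge0// sumr_ge0// => j _; case: (hN j).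
  move=> xi; rewrite exprSr -mulrA mulrDl mul1r mulrDr lerD//.
  rewrite {2}/n1 mulr_suml mulr_sumr; apply: ler_sum => j _.
  by rewrite step//; case: (hN j).
move=> [M M0 hM]; exists M => // xi.
by rewrite ler_pdivlMr ?exprn_gt0 ?ltr_wpDr ?n1_ge0// mulrC; exact: hM.
Qed.

End schwartz_decay.

Section ifourier_decay.
Context (R : realType) (d : nat).
Local Notation E := 'rV[R]_d.
Local Notation mu := (lebesgue_rV R d).

Lemma dotpC (x y : E) : dotp x y = dotp y x.
Proof. by apply: eq_bigr => i _; rewrite mulrC. Qed.

Definition cF : R := (Num.sqrt (2 * pi) ^+ d)^-1.

Lemma cF_gt0 : 0 < cF.
Proof. by rewrite invr_gt0 exprn_gt0// sqrtr_gt0 mulr_gt0// pi_gt0. Qed.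

Lemma ifourierE (f : E -> R[i]) x :
  ifourier f x = cF%:C * Cint mu (fun y => expi (dotp x y) * f y).
Proof. by []. Qed.

Lemma schwartz_Cintble (f : schwartz R d) : Cintble mu (sval f).
Proof. by case: f => f [h1 h2]; split; exact: schwartz_intble. Qed.

Lemma Cmeasurable_char (xi : E) : Cmeasurable (fun y : E => expi (dotp xi y)).
Proof.
by apply: Cmeasurable_expi; apply: measurable_dotp => //; exact: measurable_cst.
Qed.

Lemma Cintble_char (xi : E) (f : E -> R[i]) : Cintble mu f ->
  Cintble mu (fun y => expi (dotp xi y) * f y).
Proof.
move=> hf; apply: (@Cintble_dom _ _ _ _ (fun y => 2 * cn (f y))).
- by apply: CmeasurableM; [exact: Cmeasurable_char|exact: Cintble_meas hf].
- by apply: intbleZ; exact: intble_cn.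
- by move=> y; apply: le_trans (cnM _ _) _; rewrite ler_wpM2r ?cn_ge0 ?cn_expi.
Qed.

Lemma measurable_ifourier (f : E -> R[i]) : Cmeasurable f -> Cmeasurable (ifourier f).
Proof.
move=> mf; apply: CmeasurableM; first exact: Cmeasurable_cst.
apply: (@Cmeasurable_Cint _ _ E E R mu (fun z => expi (dotp z.1 z.2) * f z.2)).
apply: CmeasurableM; last exact: (Cmeasurable_comp measurable_snd).
by apply: Cmeasurable_expi; apply: measurable_dotp; [exact: measurable_fst|exact: measurable_snd].
Qed.

Lemma ifourier_decay (f : schwartz R d) m :
  exists2 M, 0 <= M & forall xi, cn (ifourier (sval f) xi) <= M * jw m xi.
Proof.
case: f => f [h1 h2] /=.
have [M1 M10 b1] := trig_integral_bound m h1.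
have [M2 M20 b2] := trig_integral_bound m h2.
have I1 := schwartz_intble h1; have I2 := schwartz_intble h2.
have II g (xi : E) (c : R -> R) : intble mu g -> measurable_fun setT c ->
    (forall t, `|c t| <= 1) -> intble mu (fun y => c (dotp y xi) * g y).
  move=> ig mc c1; apply: (@intble_dom _ _ _ mu (fun y => `|g y|)).
  - apply: measurable_funM; last exact: intble_meas ig.
    apply: (measurableT_comp mc); apply: measurable_dotp => //; exact: measurable_cst.
  - exact: intble_norm.
  - by move=> y; rewrite normrM -[leRHS]mul1r ler_wpM2r.
have cos1 (t : R) : `|cos t| <= 1 by rewrite ler_norml cos_geN1 cos_le1.
have sin1 (t : R) : `|sin t| <= 1 by rewrite ler_norml sin_geN1 sin_le1.
exists (cF * (M1 + M2)); first by rewrite mulr_ge0 ?addr_ge0// ltW// cF_gt0.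
move=> xi; rewrite ifourierE; apply: le_trans (cnM _ _) _.
rewrite cn_real ger0_norm ?(ltW cF_gt0)// -mulrA ler_wpM2l ?(ltW cF_gt0)//.
rewrite mulrDl; apply: le_trans (lerD (b1 xi) (b2 xi)).
rewrite /cn /Cint /Cintegral /=.
have -> : \int[mu]_y complex.Re (expi (dotp xi y) * f y) =
    \int[mu]_y (cos (dotp y xi) * complex.Re (f y) - sin (dotp y xi) * complex.Im (f y)).
  by apply: eq_Rintegral => y _; rewrite cReM /= dotpC.
have -> : \int[mu]_y complex.Im (expi (dotp xi y) * f y) =
    \int[mu]_y (cos (dotp y xi) * complex.Im (f y) + sin (dotp y xi) * complex.Re (f y)).
  by apply: eq_Rintegral => y _; rewrite cImM /= dotpC.
rewrite (Rintegral_sub (II _ xi cos I1 (@measurable_cos R) cos1)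
  (II _ xi sin I2 (@measurable_sin R) sin1)).
rewrite (Rintegral_add (II _ xi cos I2 (@measurable_cos R) cos1)
  (II _ xi sin I1 (@measurable_sin R) sin1)).
apply: le_trans (lerD (ler_normB _ _) (ler_normD _ _)) _.
lra.
Qed.

End ifourier_decay.

(** * Gaussians are Schwartz functions *)

Section gaussians.
Context (R : realType) (d : nat).
Local Notation E := 'rV[R]_d.
Local Notation mu := (lebesgue_rV R d).

Lemma is_derive_of_line (F : E -> R) (x v : E) (l : R) :
  is_derive (0 : R) 1 (fun h => F (h *: v + x)) l -> is_derive x v F l.
Proof.
have H : (fun h : R => h^-1 *: (((fun h => F (h *: v + x)) \o shift 0) (h *: (1 : R)) -
      (fun h => F (h *: v + x)) 0)) =
     (fun h : R => h^-1 *: ((F \o shift x) (h *: v) - F x)).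
  apply/funext => h /=; rewrite scale0r add0r addr0.
  by congr (_ *: (F (_ *: _ + _) - _)); rewrite /GRing.scale /= mulr1.
by case; rewrite /derivable /derive H.
Qed.

Definition sumsq (b : 'I_d -> R) (x : E) : R := \sum_i b i * x ord0 i ^+ 2.

Definition gaussian (b : 'I_d -> R) (x : E) : R := expR (- sumsq b x).

Lemma is_derive_gaussian b x j :
  is_derive x (delta_mx ord0 j : E) (gaussian b)
    (- 2 * b j * x ord0 j * gaussian b x).
Proof.
apply: is_derive_of_line; set e : E := delta_mx ord0 j.
have qE (h : R) : - sumsq b (h *: e + x) =
    (h * (- b j * h + (- 2 * b j * x ord0 j))) - sumsq b x.
  rewrite /sumsq (bigD1 j)//= [in RHS](bigD1 j)//= !mxE !eqxx/= mulr1.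
  rewrite (eq_bigr (fun i => b i * x ord0 i ^+ 2)); first by ring.
  by move=> i ij; rewrite !mxE eqxx (negbTE ij) mulr0 add0r.
rewrite /gaussian; under eq_fun do rewrite qE.
set q := fun h : R => h * (- b j * h + (- 2 * b j * x ord0 j)) - sumsq b x.
have Dq : is_derive (0 : R) 1 q (- 2 * b j * x ord0 j).
  have H1 := is_derive_affine (0 : R) (- b j) (- 2 * b j * x ord0 j).
  have H2 := is_deriveB (is_deriveM (is_derive_id (0 : R) 1) H1)
    (is_derive_cst (sumsq b x) (0 : R) 1).
  have -> : q = @id R * (fun h => h * - b j + - 2 * b j * x ord0 j) - cst (sumsq b x).
    by apply/funext => h; rewrite /q !fctE /= [- b j * h]mulrC.
  case: H2 => H3 H4; split; first exact: H3.
  by rewrite [LHS]H4 /GRing.scale /=; ring.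
have := is_derive1_comp (is_derive_expR (q 0)) Dq.
rewrite {2}/q mul0r add0r mulrC.
by [].
Qed.

Lemma is_derive_char (c c' : R -> R) x (xi : E) j :
  (forall t : R, is_derive t 1 c (c' t)) ->
  is_derive x (delta_mx ord0 j : E) (fun y => c (dotp y xi))
    (xi ord0 j * c' (dotp x xi)).
Proof.
move=> dc; apply: is_derive_of_line; set e : E := delta_mx ord0 j.
have dotE (h : R) : dotp (h *: e + x) xi = h * xi ord0 j + dotp x xi.
  rewrite /dotp (eq_bigr (fun i => h * (e ord0 i * xi ord0 i) + x ord0 i * xi ord0 i)).
    rewrite big_split/= -mulr_sumr (bigD1 j)//= mxE !eqxx/= mul1r big1 ?addr0//.
    by move=> i ij; rewrite mxE eqxx (negbTE ij) mul0r.
  by move=> i _; rewrite !mxE mulrDl mulrA.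
under eq_fun do rewrite dotE; rewrite mulrC.
have := @is_derive1_comp R c (fun h => h * xi ord0 j + dotp x xi) 0
      (c' (dotp x xi)) (xi ord0 j).
apply; first by rewrite mul0r add0r; exact: dc.
exact: is_derive_affine.
Qed.

Lemma is_derive_coord (x : E) i j :
  is_derive x (delta_mx ord0 j : E) (fun y : E => y ord0 i) ((i == j)%:R).
Proof.
apply: is_derive_of_line.
rewrite (_ : (fun h => _) = fun h : R => h * (i == j)%:R + x ord0 i).
  exact: is_derive_affine.
by apply/funext => h; rewrite !mxE eqxx.
Qed.

(** Polynomials times a character times a Gaussian, presented by generators: stability under
    differentiation, differentiability and decay then follow by induction, with no formula for the
    iterated derivatives. *)
Inductive gauss_class (b : 'I_d -> R) (z : E) : (E -> R) -> Prop :=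
| gauss_cos : gauss_class b z (fun x => cos (dotp x z) * gaussian b x)
| gauss_sin : gauss_class b z (fun x => sin (dotp x z) * gaussian b x)
| gauss_add f g : gauss_class b z f -> gauss_class b z g ->
    gauss_class b z (fun x => f x + g x)
| gauss_scale c f : gauss_class b z f -> gauss_class b z (fun x => c * f x)
| gauss_coord i f : gauss_class b z f -> gauss_class b z (fun x => x ord0 i * f x).

Lemma gauss_class_derive b z f j : gauss_class b z f ->
  exists2 g, gauss_class b z g &
    forall x, is_derive x (delta_mx ord0 j : E) f (g x).
Proof.
have trig (c c' : R -> R) x : (forall t : R, is_derive t 1 c (c' t)) ->
   is_derive x (delta_mx ord0 j : E) (fun x => c (dotp x z) * gaussian b x)
   (z ord0 j * (c' (dotp x z) * gaussian b x) +
    (- 2 * b j) * (x ord0 j * (c (dotp x z) * gaussian b x))).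
  move=> dc; have [H1 H2] := is_deriveM (is_derive_char x z j dc) (is_derive_gaussian b x j).
  split; first exact: H1.
  by rewrite [LHS]H2 /GRing.scale /=; ring.
elim => [| |f1 g1 _ [f1' F1 D1] _ [g1' G1 D2]|c f1 _ [f1' F1 D1]|i f1 F [f1' F1 D1]].
- eexists; last by move=> x; exact: (trig _ _ x (fun t => is_derive_cos t)).
  apply: gauss_add; last by apply/gauss_scale/gauss_coord; exact: gauss_cos.
  rewrite (_ : (fun x => _) = fun x => - z ord0 j * (sin (dotp x z) * gaussian b x)).
    by apply: gauss_scale; exact: gauss_sin.
  by apply/funext => x; rewrite !mulNr mulrN.
- eexists; last by move=> x; exact: (trig _ _ x (fun t => is_derive_sin t)).
  apply: gauss_add; last by apply/gauss_scale/gauss_coord; exact: gauss_sin.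
  by apply: gauss_scale; exact: gauss_cos.
- exists (fun x => f1' x + g1' x); first exact: gauss_add.
  by move=> x; exact: (is_deriveD (D1 x) (D2 x)).
- exists (fun x => c * f1' x); first exact: gauss_scale.
  by move=> x; exact: (is_deriveZ c (D1 x)).
- exists (fun x : E => x ord0 i * f1' x + (i == j)%:R * f1 x).
    by apply: gauss_add; [exact: gauss_coord|exact: gauss_scale].
  move=> x; have [H1 H2] := is_deriveM (is_derive_coord x i j) (D1 x).
  split; first exact: H1.
  by rewrite [LHS]H2 /GRing.scale /= [f1 x * _]mulrC.
Qed.

Lemma gauss_class_differentiable b z f x : gauss_class b z f -> differentiable f x.
Proof.
have dcoord i : differentiable (fun y : E => y ord0 i) x.
  exact: differentiable_coord.
have dsum (F : 'I_d -> E -> R) : (forall i, differentiable (F i) x) ->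
    differentiable (fun y => \sum_i F i y) x.
  move=> h; rewrite (_ : (fun y => _) = \sum_i F i); first exact: differentiable_sum.
  by apply/funext => y; rewrite fct_sumE.
have dc (F : E -> R) (c : R -> R) : (forall t : R, derivable c t 1) ->
    differentiable F x -> differentiable (fun y => c (F y)) x.
  move=> h1 h2; apply: (@differentiable_comp _ _ _ _ F c) => //.
  exact/derivable1_diffP.
have ddot : differentiable (fun y : E => dotp y z) x.
  apply: dsum => i; apply: (@differentiableM _ _ (fun y : E => y ord0 i) (cst (z ord0 i))) => //.
have dgauss : differentiable (gaussian b) x.
  apply: (dc _ expR) => //.
  apply: (@differentiableN _ _ _ (sumsq b)).
  apply: dsum => i.
  apply: (@differentiableM _ _ (cst (b i)) (fun y : E => y ord0 i ^+ 2)) => //.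
  exact: (@differentiableM _ _ (fun y : E => y ord0 i) (fun y : E => y ord0 i)).
elim => [| |f1 g1 _ D1 _ D2|c f1 _ D1|i f1 _ D1].
- apply: (@differentiableM _ _ (fun y : E => cos (dotp y z)) (gaussian b)) => //.
  by apply: dc => // t; case: (is_derive_cos t).
- apply: (@differentiableM _ _ (fun y : E => sin (dotp y z)) (gaussian b)) => //.
  by apply: dc => // t; case: (is_derive_sin t).
- exact: (differentiableD D1 D2).
- exact: (@differentiableM _ _ (cst c) f1).
- exact: (@differentiableM _ _ (fun y : E => y ord0 i) f1).
Qed.

(** The quadratic form dominates [c * n1 x ^+ 2], and [1 + y <= expR y], raised to the power [m],
    absorbs the polynomial once [m * a <= c]. *)
Lemma gaussian_bound b m : (forall i, 0 < b i) ->
  exists2 M, 0 <= M & forall x : E, (1 + n1 x) ^+ m * gaussian b x <= M.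
Proof.
(* A positive lower bound for all the [b i] that also makes sense for [d = 0]. The successors in the
   constants [c] and [a] below avoid divisions by zero in the same way. *)
move=> b0; pose beta := (1 + \sum_i (b i)^-1)^-1.
have s0 : 0 < 1 + \sum_i (b i)^-1.
  by rewrite ltr_wpDr// sumr_ge0// => i _; rewrite invr_ge0 ltW.
have beta0 : 0 < beta by rewrite invr_gt0.
have betab i : beta <= b i.
  rewrite -[b i]invrK lef_pV2 ?posrE ?invr_gt0// (bigD1 i)//= addrCA lerDl.
  by rewrite addr_ge0// sumr_ge0// => k _; rewrite invr_ge0 ltW.
pose c := beta / d.+1%:R ^+ 2.
have c0 : 0 < c by rewrite divr_gt0// exprn_gt0.
have qc x : c * n1 x ^+ 2 <= sumsq b x.
  apply: (@le_trans _ _ (beta * enorm x ^+ 2)).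
    rewrite /c -mulrA ler_wpM2l ?(ltW beta0)// mulrC ler_pdivrMr ?exprn_gt0//.
    rewrite -exprMn lerXn2r ?nnegrE ?n1_ge0 ?mulr_ge0 ?enorm_ge0//.
    rewrite mulrC; apply: le_trans (n1_le_enorm x) _.
    by rewrite ler_wpM2r ?enorm_ge0// ler_nat.
  rewrite sqr_enorm /dotp mulr_sumr; apply: ler_sum => i _.
  by rewrite -expr2 ler_wpM2r ?sqr_ge0.
pose a := c / m.+1%:R.
have a0 : 0 < a by rewrite divr_gt0.
exists ((2 * (1 + a^-1)) ^+ m).
  by rewrite exprn_ge0// mulr_ge0// addr_ge0// invr_ge0 ltW.
move=> x; rewrite /gaussian expRN ler_pdivrMr ?expR_gt0//.
have n0 := n1_ge0 x.
apply: (@le_trans _ _ ((2 * (1 + a^-1)) ^+ m * (1 + a * n1 x ^+ 2) ^+ m)).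
  rewrite -exprMn lerXn2r ?nnegrE.
  - by [].
  - lra.
  - have ai : 0 <= a^-1 by rewrite invr_ge0 ltW.
    have := mulr_ge0 (ltW a0) (sqr_ge0 (n1 x)) => ?.
    by rewrite mulr_ge0 ?mulr_ge0//; lra.
  apply: (@le_trans _ _ (2 * (1 + n1 x ^+ 2))); first by nra.
  rewrite -mulrA ler_wpM2l// mulrDl mul1r mulrDr mulr1 mulKf ?gt_eqF//.
  have := mulr_ge0 (ltW a0) (sqr_ge0 (n1 x)).
  have : 0 <= a^-1 by rewrite invr_ge0 ltW.
  by lra.
rewrite ler_wpM2l ?exprn_ge0// ?mulr_ge0// ?addr_ge0 ?invr_ge0 ?(ltW a0)//.
apply: (@le_trans _ _ (expR (a * n1 x ^+ 2) ^+ m)).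
  rewrite lerXn2r ?nnegrE ?expR_ge0 ?expR_ge1Dx//.
  by rewrite addr_ge0// mulr_ge0 ?sqr_ge0 ?ltW.
rewrite -expRM_natl ler_expR; apply: le_trans (qc x).
rewrite mulrA ler_wpM2r ?sqr_ge0// /a mulrCA ger_pMr//.
by rewrite ler_pdivrMr// mul1r ler_nat.
Qed.

Lemma gauss_class_bound b z f : gauss_class b z f ->
  exists M m, 0 <= M /\ forall x, `|f x| <= M * ((1 + n1 x) ^+ m * gaussian b x).
Proof.
have J x m : 0 <= (1 + n1 x) ^+ m by rewrite exprn_ge0 ?addr_ge0 ?n1_ge0.
have J1 x m k : (m <= k)%N -> (1 + n1 x) ^+ m <= (1 + n1 x) ^+ k.
  by move=> mk; rewrite ler_weXn2l// lerDl n1_ge0.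
have G x : 0 <= gaussian b x by exact: expR_ge0.
elim => [| |f1 g1 _ [M1 [m1 [p1 h1]]] _ [M2 [m2 [p2 h2]]]|c f1 _ [M1 [m1 [p1 h1]]]|i f1 _ [M1 [m1 [p1 h1]]]].
- exists 1, 0%N; split=> // x; rewrite expr0 !mul1r normrM (ger0_norm (G x)).
  by rewrite -[leRHS]mul1r ler_wpM2r// ler_norml cos_geN1 cos_le1.
- exists 1, 0%N; split=> // x; rewrite expr0 !mul1r normrM (ger0_norm (G x)).
  by rewrite -[leRHS]mul1r ler_wpM2r// ler_norml sin_geN1 sin_le1.
- exists (M1 + M2), (maxn m1 m2); split; first exact: addr_ge0.
  move=> x; apply: le_trans (ler_normD _ _) _; rewrite mulrDl lerD//.
    by apply: le_trans (h1 x) _; rewrite ler_wpM2l// ler_wpM2r// J1// leq_maxl.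
  by apply: le_trans (h2 x) _; rewrite ler_wpM2l// ler_wpM2r// J1// leq_maxr.
- exists (`|c| * M1), m1; split; first exact: mulr_ge0.
  by move=> x; rewrite normrM -mulrA ler_wpM2l.
- exists M1, m1.+1; split=> // x; rewrite normrM exprS.
  rewrite (_ : M1 * _ = (1 + n1 x) * (M1 * ((1 + n1 x) ^+ m1 * gaussian b x))); last by ring.
  by rewrite ler_pM// ler_wpDl// ler_coord_n1.
Qed.

Lemma gauss_class_schwartz b z f : (forall i, 0 < b i) -> gauss_class b z f ->
  real_schwartz f.
Proof.
move=> b0 hf s; have {hf}: gauss_class b z (partial s f).
  elim: s => //= i s /(gauss_class_derive i) [g hg D].
  rewrite (_ : (fun x => _) = g)//; apply/funext => x.
  by case: (D x).
move: (partial s f) => g hg; split.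
  by move=> x; exact: gauss_class_differentiable hg.
move=> m; have [M [k [M0 hM]]] := gauss_class_bound hg.
have [N N0 hN] := gaussian_bound (m + k) b0.
exists (M * N) => x.
apply: (@le_trans _ _ ((1 + n1 x) ^+ m * (M * ((1 + n1 x) ^+ k * gaussian b x)))).
  apply: ler_pM => //; first by rewrite exprn_ge0 ?enorm_ge0.
  rewrite lerXn2r ?nnegrE ?enorm_ge0 ?addr_ge0 ?n1_ge0//.
  by rewrite ler_wpDl// enorm_le_n1.
by rewrite mulrCA ler_wpM2l// mulrA -exprD hN.
Qed.

Lemma gaussian_schwartz b : (forall i, 0 < b i) -> real_schwartz (gaussian b).
Proof.
move=> b0; apply: (gauss_class_schwartz (z := 0) b0).
rewrite (_ : gaussian b = fun x => cos (dotp x 0) * gaussian b x).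
  exact: gauss_cos.
apply/funext => x; rewrite (_ : dotp x 0 = 0) ?cos0 ?mul1r//.
by rewrite /dotp big1// => i _; rewrite mxE mulr0.
Qed.

Definition boxb (r : R) (c x : E) : bool := [forall i, `|x ord0 i - c ord0 i| <= r].

Lemma boxbE r c x : (boxb r c x)%:R = \prod_i (`|x ord0 i - c ord0 i| <= r)%R%:R :> R.
Proof.
rewrite /boxb; case: forallP => [h|h].
  by rewrite big1// => i _; rewrite h.
have /existsP[i hi] : [exists i, ~~ (`|x ord0 i - c ord0 i| <= r)].
  by rewrite -negb_forall; apply/negP => /forallP.
by rewrite (bigD1 i)//= (negbTE hi) mul0r.
Qed.

Lemma measurable_boxb d' (T : measurableType d') r c (f : T -> E) :
  measurable_fun setT f -> measurable_fun setT (fun x => (boxb r c (f x))%:R : R).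
Proof.
move=> mf; under eq_fun do rewrite boxbE.
apply: measurable_prod => i _.
apply: (@measurableT_comp _ _ _ _ _ _ (fun b : bool => b%:R : R)) => //.
apply: measurable_fun_ler => //.
by apply: measurableT_comp => //; apply: measurable_funB => //; exact: measurable_rV_coord.
Qed.

Lemma integral_boxb r c : 0 <= r ->
  (\int[mu]_x ((boxb r c x)%:R)%:E = ((2 * r) ^+ d)%:E)%E.
Proof.
move=> r0; under eq_integral do rewrite boxbE.
rewrite (@ge0_integral_prod_rV R d (fun i (y : R) => (`|y - c ord0 i| <= r)%R%:R) (fun=> 2 * r)).
- by rewrite prodr_const card_ord.
- move=> i; apply: (@measurableT_comp _ _ _ _ _ _ (fun b : bool => b%:R : R)) => //.
  apply: measurable_fun_ler => //.
  by apply: measurableT_comp => //; exact: measurable_funB.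
- by move=> i x; exact: ler0n.
move=> i; pose I := `[c ord0 i - r, c ord0 i + r]%classic : set (measurableTypeR R).
transitivity (\int[@lebesgue_measure R]_x (\1_I x)%:E)%E.
  apply: eq_integral => y _; rewrite indicE mem_setE in_itv /= ler_norml.
  congr ((nat_of_bool _)%:R%:E); apply/andP/andP => -[? ?]; split; lra.
have mI : measurable I by exact: measurable_itv.
transitivity (@lebesgue_measure R I).
  by rewrite -[in RHS](setIT I); exact: (integral_indic _ measurableT mI).
rewrite lebesgue_measure_itv /= lte_fin.
case: ifPn => h; first by congr EFin; ring.
congr EFin; lra.
Qed.

Lemma intble_boxb r c : 0 <= r -> intble mu (fun x => (boxb r c x)%:R).
Proof.
move=> r0; apply: intble_ge0P.
- by apply: measurable_boxb; exact: measurable_id.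
- by move=> x; exact: ler0n.
- by rewrite integral_boxb// ltry.
Qed.

(** The Gaussian is bounded below on a cube. The separation argument asks only for the sign of this
    constant, so its value is not computed. *)
Lemma gaussian_integral_gt0 b : (forall i, 0 < b i) -> 0 < \int[mu]_x gaussian b x.
Proof.
move=> b0; have ig := schwartz_intble (gaussian_schwartz b0).
pose c := expR (- \sum_i b i).
have : \int[mu]_x (c * (boxb 1 0 x)%:R) <= \int[mu]_x gaussian b x.
  apply: ler_Rintegral => //; first exact/intbleZ/intble_boxb.
  move=> x; rewrite /boxb; case: forallP => h; last by rewrite mulr0 expR_ge0.
  rewrite mulr1 ler_expR lerN2; apply: ler_sum => i _.
  rewrite ger_pMr// -real_normK ?num_real//.
  by rewrite expr_le1//; have := h i; rewrite mxE subr0.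
apply: lt_le_trans.
rewrite Rintegral_scale; last exact: intble_boxb.
by rewrite /Rintegral integral_boxb//= mulr_gt0 ?expR_gt0// exprn_gt0// mulr1.
Qed.

(** Along the ray [t *: xi] the cosine transform [C] satisfies [C' = - t * Q * C]: differentiate
    under the integral sign, then integrate by parts, the derivative of a Gaussian being a multiple
    of a coordinate times the Gaussian. Hence [C t * expR (t^2 * Q / 2)] is constant, and its values
    at 0 and 1 are compared. *)
Lemma gaussian_cos_integral b (xi : E) : (forall i, 0 < b i) ->
  \int[mu]_y (cos (dotp y xi) * gaussian b y) =
  (\int[mu]_y gaussian b y) * expR (- \sum_i xi ord0 i ^+ 2 / (4 * b i)).
Proof.
move=> b0; have hg := gaussian_schwartz b0.
pose C (t : R) := \int[mu]_y (cos (dotp y (t *: xi)) * gaussian b y).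
pose Q := \sum_i xi ord0 i ^+ 2 / (2 * b i).
have dotZ t (y : E) : dotp y (t *: xi) = t * dotp y xi.
  by rewrite /dotp mulr_sumr; apply: eq_bigr => i _; rewrite mxE; ring.
have ig := schwartz_intble hg.
have mtrig (c : R -> R) (z : E) : measurable_fun setT c ->
    measurable_fun setT (fun y : E => c (dotp y z)).
  by move=> mc; apply: (measurableT_comp mc); exact: measurable_dotp.
have iT (c : R -> R) (z : E) g : measurable_fun setT c -> (forall t, `|c t| <= 1) ->
    intble mu g -> intble mu (fun y => c (dotp y z) * g y).
  move=> mc c1 igg; apply: (@intble_dom _ _ _ mu (fun y => `|g y|)).
  - by apply: measurable_funM; [exact: mtrig|exact: intble_meas igg].
  - exact: intble_norm.
  - by move=> y; rewrite normrM -[leRHS]mul1r ler_wpM2r.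
have cos1 (t : R) : `|cos t| <= 1 by rewrite ler_norml cos_geN1 cos_le1.
have sin1 (t : R) : `|sin t| <= 1 by rewrite ler_norml sin_geN1 sin_le1.
have iyg i : intble mu (fun y : E => y ord0 i * gaussian b y).
  apply: schwartz_intble; apply: (gauss_class_schwartz (z := 0) b0).
  apply: gauss_coord.
  rewrite (_ : gaussian b = fun x => cos (dotp x 0) * gaussian b x); first exact: gauss_cos.
  apply/funext => x; rewrite (_ : dotp x 0 = 0) ?cos0 ?mul1r//.
  by rewrite /dotp big1// => k _; rewrite mxE mulr0.
have partialg j : partial [:: j] (gaussian b) = fun x => (- 2 * b j) * (x ord0 j * gaussian b x).
  by apply/funext => x; have [_ H] := is_derive_gaussian b x j; rewrite /= H; ring.
have DC (a : R) : is_derive a 1 C (\int[mu]_y (- sin (dotp y (a *: xi)) * dotp y xi * gaussian b y)).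
  apply: (is_derive_integral (f := fun t (y : E) => cos (dotp y (t *: xi)) * gaussian b y)
    (df := fun t (y : E) => - sin (dotp y (t *: xi)) * dotp y xi * gaussian b y)
    (G := fun y : E => \sum_i `|xi ord0 i * (y ord0 i * gaussian b y)|)).
  - by move=> t _; apply: iT => //; exact: measurable_cos.
  - move=> t y _; under eq_fun do rewrite dotZ.
    have H1 : is_derive t 1 (fun t => t * dotp y xi) (dotp y xi).
      by have := is_derive_affine t (dotp y xi) 0; under eq_fun do rewrite addr0.
    have [H2 H3] := is_deriveM (is_derive1_comp (is_derive_cos _) H1)
      (is_derive_cst (gaussian b y) t 1).
    split; first exact: H2.
    by rewrite [LHS]H3 /GRing.scale /= dotZ; ring.
  - rewrite /intble (_ : EFin \o _ = fun y : E => (\sum_i (`|xi ord0 i * (y ord0 i * gaussian b y)|%:E))%E).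
      by apply: integrable_sum => // i _; exact/intble_norm/intbleZ/iyg.
    by apply/funext => y /=; rewrite sumEFin.
  - move=> t y _; rewrite -mulrA normrM normrN -[leRHS]mul1r ler_pM//.
    rewrite /dotp mulr_suml; apply: le_trans (ler_norm_sum _ _ _) _.
    by apply: ler_sum => i _; rewrite [y ord0 i * xi ord0 i]mulrC mulrA.
have DC2 (a : R) : is_derive a 1 C (- a * Q * C a).
  suff -> : - a * Q * C a = \int[mu]_y (- sin (dotp y (a *: xi)) * dotp y xi * gaussian b y) by exact: DC.
  have -> : \int[mu]_y (- sin (dotp y (a *: xi)) * dotp y xi * gaussian b y) =
     \int[mu]_y \sum_i (- xi ord0 i * (sin (dotp y (a *: xi)) * (y ord0 i * gaussian b y))).
    apply: eq_Rintegral => y _; rewrite /dotp mulr_sumr mulr_suml; apply: eq_bigr => i _.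
    by ring.
  have -> : \int[mu]_y \sum_i (- xi ord0 i * (sin (dotp y (a *: xi)) * (y ord0 i * gaussian b y))) =
     \sum_i (- xi ord0 i * \int[mu]_y (sin (dotp y (a *: xi)) * (y ord0 i * gaussian b y))).
    rewrite /Rintegral; under eq_integral do rewrite -sumEFin.
    have ii i : intble mu (fun y : E => - xi ord0 i * (sin (dotp y (a *: xi)) * (y ord0 i * gaussian b y))).
      by apply: intbleZ; apply: iT => //; exact: measurable_sin.
    rewrite integral_sum//.
    under eq_bigr => i _ do rewrite (integral_intble (ii i)).
    rewrite sumEFin /=; apply: eq_bigr => i _; rewrite Rintegral_scale//.
    by apply: iT => //; exact: measurable_sin.
  rewrite /Q mulr_sumr mulr_suml; apply: eq_bigr => i _.
  have [_] := integral_trig_partial (a *: xi) i hg.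
  rewrite partialg mxE.
  have -> : \int[mu]_y (sin (dotp y (a *: xi)) * (-2 * b i * (y ord0 i * gaussian b y))) =
     (- 2 * b i) * \int[mu]_y (sin (dotp y (a *: xi)) * (y ord0 i * gaussian b y)).
    rewrite -Rintegral_scale; first by apply: eq_Rintegral => y _; ring.
    by apply: iT => //; exact: measurable_sin.
  rewrite -/(C a) => H.
  have -> : \int[mu]_y (sin (dotp y (a *: xi)) * (y ord0 i * gaussian b y)) = a * xi ord0 i * C a / (2 * b i).
    have := b0 i => bi0; apply: (mulfI (x := - 2 * b i)); first by rewrite mulf_neq0 ?oppr_eq0 ?pnatr_eq0 ?gt_eqF.
    by rewrite H; field; rewrite gt_eqF.
  by field; rewrite gt_eqF//; exact: b0.
have C0 : C 0 = \int[mu]_y gaussian b y.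
  apply: eq_Rintegral => y _; rewrite scale0r (_ : dotp y 0 = 0) ?cos0 ?mul1r//.
  by rewrite /dotp big1// => i _; rewrite mxE mulr0.
have C1 : C 1 = \int[mu]_y (cos (dotp y xi) * gaussian b y) by rewrite /C scale1r.
have cstC : forall x : R, is_derive x 1 (fun t => C t * expR (t * (t * (Q / 2)))) 0.
  move=> x.
  have H1 : is_derive x 1 (fun t => t * (t * (Q / 2))) (x * Q).
    have [H2 H3] := is_deriveM (is_derive_id x (1 : R)) (is_derive_affine x (Q / 2) 0).
    rewrite (_ : (fun t => _) = id * (fun h => h * (Q / 2) + 0)); last first.
      by apply/funext => h; rewrite fctE addr0.
    split; first exact: H2.
    by rewrite [LHS]H3 /GRing.scale /=; field.
  have [H2 H3] := is_deriveM (DC2 x) (is_derive1_comp (is_derive_expR _) H1).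
  split; first exact: H2.
  by rewrite [LHS]H3 /GRing.scale /=; ring.
have := is_derive_0_is_cst 0 1 cstC.
rewrite /= !mul0r expR0 mulr1 !mul1r C0 C1 => ->.
rewrite -mulrA -expRD (_ : Q / 2 + _ = 0) ?expR0 ?mulr1//.
rewrite /Q mulr_suml -sumrB big1// => i _; have := b0 i => bi0.
by field; rewrite gt_eqF.
Qed.

End gaussians.

(** * Uniqueness of the Fourier transform *)

Lemma Rintegral_lim0 d (T : measurableType d) (R : realType)
    (mu : {measure set T -> \bar R}) (f_ : nat -> T -> R) (f g : T -> R) :
  (forall n, measurable_fun setT (f_ n)) -> intble mu g ->
  (forall n x, `|f_ n x| <= g x) -> (forall x, f_ n x @[n --> \oo] --> f x) ->
  (forall n, \int[mu]_x f_ n x = 0) -> \int[mu]_x f x = 0.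
Proof.
move=> mf ig fg cf f0.
have H : (\int[mu]_x (f_ n x)%:E @[n --> \oo] --> \int[mu]_x (f x)%:E)%E.
  apply: (@dominated_cvg _ _ _ mu setT measurableT (fun n x => (f_ n x)%:E)
    (fun x => (f x)%:E) (fun x => (g x)%:E)) => //.
  - by move=> n; apply/measurable_EFinP.
  - by move=> x _; apply: cvg_EFin; [exact: nearW|exact: cf].
  - by move=> n x _; rewrite lee_fin.
have E0 n : (\int[mu]_x (f_ n x)%:E)%E = 0%:E.
  by rewrite integral_intble ?f0//; exact: intble_dom ig (fg n).
have {}H : (0%:E : \bar R) @[n --> \oo] --> (\int[mu]_x (f x)%:E)%E.
  by move: H; under eq_fun do rewrite E0.
by rewrite /Rintegral -(cvg_lim _ H)// lim_cst.
Qed.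

(* A pi-lambda argument: a null integral over every open box forces a null function. *)
Section box_generation.
Context (R : realType) (d : nat).
Local Notation E := 'rV[R]_d.

Definition obox (a b : 'I_d -> R) : set E := [set x | forall i, a i < x ord0 i < b i].

Definition oboxes : set (set E) := [set A | exists a b, A = obox a b].

Lemma oboxes_setI : setI_closed oboxes.
Proof.
move=> _ _ [a [b ->]] [a' [b' ->]].
exists (fun i => Num.max (a i) (a' i)), (fun i => Num.min (b i) (b' i)).
apply/seteqP; split => x /=.
  by move=> [h h'] i; rewrite gt_max lt_min; move: (h i) (h' i) => /andP[-> ->] /andP[-> ->].
move=> h; split => i; have := h i; rewrite gt_max lt_min.
  by move=> /andP[/andP[-> _] /andP[-> _]].
by move=> /andP[/andP[_ ->] /andP[_ ->]].
Qed.

Lemma measurable_obox a b : measurable (obox a b).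
Proof.
rewrite (_ : obox a b = \bigcap_(i in [set: 'I_d])
     ((fun x : E => x ord0 i : measurableTypeR R) @^-1` `]a i, b i[%classic)).
  apply: fin_bigcap_measurable => // i _.
  by rewrite -[X in measurable X]setTI; apply: measurable_coord_rV.
apply/seteqP; split => x /=; first by move=> h i _ /=; rewrite in_itv /=; exact: h.
by move=> h i; have := h i I; rewrite /= in_itv.
Qed.

Lemma measurable_oboxesE : @measurable _ E = <<s oboxes >>.
Proof.
apply/seteqP; split; last first.
  apply: smallest_sub.
    split; [exact: measurable0|by move=> A mA; rewrite setTD; exact: measurableC|].
    by move=> F mF; exact: bigcup_measurable.
  by move=> _ [a [b ->]]; exact: measurable_obox.
pose T := g_sigma_algebraType oboxes.
have mid : measurable_fun [set: T] (id : T -> E).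
  apply: measurable_rVP => i.
  suff H : @measurable _ (measurableTypeR R) `<=`
      [set B | @measurable _ T ((fun x : T => (x : E) ord0 i) @^-1` B)].
    by move=> _ B mB; rewrite setTI; exact: H.
  have -> : @measurable _ (measurableTypeR R) = <<s @RGenOpens.G R >>.
    exact: RGenOpens.measurableE.
  apply: smallest_sub.
    split => /=.
    - by rewrite preimage_set0; exact: measurable0.
    - by move=> B mB; rewrite setTD preimage_setC; exact: measurableC.
    - by move=> F mF; rewrite preimage_bigcup; exact: bigcup_measurable.
  move=> _ [x [y ->]] /=.
  rewrite (_ : _ @^-1` _ = \bigcup_n obox (fun j => if j == i then x else - n%:R)
                                    (fun j => if j == i then y else n%:R)).
    apply: bigcup_measurable => n _; apply: sub_sigma_algebra.
    by do 2 eexists.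
  apply/seteqP; split => z /=.
    rewrite in_itv /= => zi.
    exists (Num.truncn (n1 z)).+1 => // j; case: eqP => [->//|_].
    rewrite -ltr_norml; apply: le_lt_trans (ler_coord_n1 z j) _.
    by rewrite truncnS_gt.
  by move=> [n _ /(_ i)]; rewrite eqxx in_itv.
by move=> A mA; have := mid measurableT A mA; rewrite setTI.
Qed.

Lemma ae0_of_oboxes (H : E -> R) : intble (lebesgue_rV R d) H ->
  (forall a b, \int[lebesgue_rV R d]_x (H x * \1_(obox a b) x) = 0) ->
  {ae lebesgue_rV R d, forall x, H x = 0}.
Proof.
set mu := lebesgue_rV R d => iH hbox; have mH := intble_meas iH.
have mHA A : measurable A -> measurable_fun setT (fun x => H x * \1_A x).
  by move=> mA; apply: measurable_funM => //; exact: measurable_indic.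
have bHA A x : `|H x * \1_A x| <= `|H x|.
  rewrite normrM ler_piMr// indicE; case: (_ \in _); rewrite ?normr1 ?normr0//.
have iHA A : measurable A -> intble mu (fun x => H x * \1_A x).
  by move=> mA; apply: (intble_dom (mHA _ mA) (intble_norm iH)) => x.
pose D := [set A : set E | measurable A /\ \int[mu]_x (H x * \1_A x) = 0].
have nds : ndseq_closed D.
  move=> F ndF DF; have mF n : measurable (F n) by case: (DF n).
  split; first exact: bigcup_measurable.
  apply: (@Rintegral_lim0 _ _ _ mu (fun n x => H x * \1_(F n) x) _ (fun x => `|H x|)) => //.
  - by move=> n; exact: mHA.
  - exact: intble_norm.
  - move=> x; apply: cvgMr.
    have [[n _ Fnx]|nF] := pselect ((\bigcup_n F n) x).
      rewrite indicE mem_set; last by exists n.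
      apply: cvg_near_cst; exists n => // m /= nm; rewrite indicE mem_set//.
      by move: x Fnx; apply/subsetPset/ndF.
    rewrite indicE memNset//; apply: cvg_near_cst; apply: nearW => n.
    by rewrite indicE memNset// => Fnx; apply: nF; exists n.
  - by move=> n; case: (DF n).
have DT : D setT.
  have -> : [set: E] = \bigcup_n obox (fun=> - n%:R) (fun=> n%:R).
    apply/seteqP; split => // z _; exists (Num.truncn (n1 z)).+1 => // j.
    rewrite -ltr_norml; apply: le_lt_trans (ler_coord_n1 z j) _.
    by rewrite truncnS_gt.
  apply: nds.
    move=> m n mn; apply/subsetPset => x h i; have := h i.
    have mn' : m%:R <= n%:R :> R by rewrite ler_nat.
    by move=> /andP[? ?]; apply/andP; split; lra.
  by move=> n; split; [exact: measurable_obox|exact: hbox].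
have lD : lambda_system setT D.
  split => //.
  move=> A B BA [mA A0] [mB B0]; split; first exact: measurableD.
  rewrite (_ : (fun x => _) = fun x => H x * \1_A x - H x * \1_B x); last first.
    apply/funext => x; rewrite -mulrBr; congr (_ * _).
    rewrite !indicE; have [xB|xB] := pselect (B x).
      by rewrite in_setD (mem_set xB) (mem_set (BA x xB)) subrr.
    by rewrite in_setD (memNset xB) andbT subr0.
  by rewrite Rintegral_sub ?A0 ?B0 ?subrr//; exact: iHA.
have mD A : measurable A -> D A.
  rewrite measurable_oboxesE; apply: (lambda_system_subset oboxes_setI lD) => //.
  by move=> _ [a [b ->]]; split; [exact: measurable_obox|exact: hbox].
have h A : A `<=` setT -> measurable A ->
    (\int[mu]_(x in A) (EFin \o H) x = \int[mu]_(x in A) (cst 0 : E -> \bar R) x)%E.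
  move=> _ mA; rewrite integral0; have [_ HA0] := mD A mA.
  rewrite integral_mkcond -[RHS]/(0%:E) -HA0 -integral_intble; last exact: iHA.
  apply: eq_integral => x _; rewrite patchE indicE.
  by case: ifP => _ /=; rewrite ?mulr1 ?mulr0.
have := @integral_ae_eq _ E R mu setT measurableT (cst 0%E) (EFin \o H) iH (measurable_cst _) h.
by apply: filterS => x /(_ I) [].
Qed.

End box_generation.

(** * Gaussians separate functions *)

Section gaussian_separation.
Context (R : realType) (d : nat).
Local Notation E := 'rV[R]_d.
Local Notation mu := (lebesgue_rV R d).

(** Polynomials with values in [[0, 1]] on [[0, 1]], of the kind used in elementary proofs of the
    Stone-Weierstrass theorem. Taking [n] off the exponent [n ^ 2] settles the borderline [t = 1/2],
    where the limit is 0, as it must be for an open box. *)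
Definition cutoff (n : nat) (t : R) : R := 1 - (1 - t ^+ (n ^ 2)) ^+ (2 ^ (n ^ 2 - n)).

Lemma bernoulli_ge (x : R) k : 0 <= x -> 1 + k%:R * x <= (1 + x) ^+ k.
Proof.
move=> x0; elim: k => [|k IH]; first by rewrite mul0r addr0 expr0.
rewrite exprS (@le_trans _ _ ((1 + x) * (1 + k%:R * x)))//; last by rewrite ler_wpM2l//; lra.
have k0 : 0 <= k%:R :> R by [].
by rewrite -natr1; nra.
Qed.

Lemma bernoulli_sub (x : R) k : 0 <= x <= 1 -> 1 - k%:R * x <= (1 - x) ^+ k.
Proof.
move=> /andP[x0 x1]; elim: k => [|k IH]; first by rewrite mul0r subr0 expr0.
rewrite exprS (@le_trans _ _ ((1 - x) * (1 - k%:R * x)))//; last by rewrite ler_wpM2l//; lra.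
have k0 : 0 <= k%:R :> R by [].
by rewrite -natr1; nra.
Qed.

Lemma cutoff_itv n t : 0 <= t <= 1 -> 0 <= cutoff n t <= 1.
Proof.
move=> /andP[t0 t1].
have h : 0 <= 1 - t ^+ (n ^ 2) <= 1.
  by have := exprn_ge0 (n ^ 2) t0; have := exprn_ile1 (n ^ 2) t0 t1; move=> *; apply/andP; split; lra.
have /andP[h0 h1] := h.
have := exprn_ge0 (2 ^ (n ^ 2 - n)) h0; have := exprn_ile1 (2 ^ (n ^ 2 - n)) h0 h1.
by rewrite /cutoff => *; apply/andP; split; lra.
Qed.

(* The height 2^(n^2 - n) t^(n^2) = ((2 t)^n / 2)^n tends to infinity for
   2 t > 1 and to 0 for 2 t <= 1. *)
Lemma cutoff_height n t : (2 ^ (n ^ 2 - n))%:R * t ^+ (n ^ 2) = ((2 * t) ^+ n / 2) ^+ n :> R.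
Proof.
rewrite natrX expr_div_n -exprM -mulnn exprMn.
have -> : (2 : R) ^+ (n * n) = 2 ^+ (n * n - n) * 2 ^+ n.
  by rewrite -exprD subnK//; case: n => // n; rewrite leq_pmulr.
by rewrite [RHS]mulrAC mulfK// expf_neq0// pnatr_eq0.
Qed.

(** With [a = t^(n^2)] and [k] the outer exponent, Bernoulli's inequality gives
    [1 - (1 - a)^k <= k a] when the limit is 0. When the limit is 1, [(1 - a)^k (1 + a)^k <= 1]
    gives [(1 - a)^k <= 1 / (1 + k a)]. Both errors are at most [2^-n]. *)
Lemma cvg_cutoff t : 0 <= t <= 1 ->
  cutoff n t @[n --> \oo] --> ((2^-1 < t)%R%:R : R).
Proof.
move=> t01; have /andP[t0 t1] := t01.
have half : (2^-1 : R) ^+ n @[n --> \oo] --> (0 : R).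
  by apply: cvg_expr; rewrite ger0_norm ?invr_ge0// invf_lt1// ltr1n.
case: ltP => ht.
  have H1 : (fun n => 1 - (2^-1 : R) ^+ n) @ \oo --> (1 : R).
    rewrite -[X in _ --> X]subr0; apply: cvgB => //; exact: cvg_cst.
  have H2 : (fun _ : nat => (1 : R)) @ \oo --> (1 : R) by exact: cvg_cst.
  apply: (squeeze_cvgr _ H1 H2).
  have t2 : 0 < 2 * t - 1 by lra.
  near=> n; have /andP[_ ->] := cutoff_itv n t01; rewrite andbT /cutoff lerD2l lerN2.
  set a := t ^+ (n ^ 2); set k := (2 ^ (n ^ 2 - n))%N.
  have a01 : 0 <= a <= 1 by rewrite exprn_ge0//= exprn_ile1.
  have /andP[a0 a1] := a01.
  have hk : 2 ^+ n <= 1 + k%:R * a.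
    rewrite /k /a cutoff_height.
    (* From then on the base [(2 t)^n / 2] is at least 2, and its [n]-th power is at least [2^n]. *)
    have : 2 * 2 <= (2 * t) ^+ n.
      have := bernoulli_ge n (ltW t2); rewrite (_ : 1 + (2 * t - 1) = 2 * t); last by ring.
      apply: le_trans; rewrite -lerBlDl -ler_pdivrMr//.
      near: n; exact: nbhs_infty_ger.
    move=> h4; apply: (@le_trans _ _ (((2 * t) ^+ n / 2) ^+ n)); last by rewrite lerDr.
    by rewrite lerXn2r ?nnegrE//; lra.
  have hb := bernoulli_ge k a0.
  have P : (1 - a) ^+ k * (1 + a) ^+ k <= 1.
    rewrite -exprMn exprn_ile1//; nra.
  have p1 : 0 <= (1 - a) ^+ k by rewrite exprn_ge0//; lra.
  have p2 : 0 < 2 ^+ n :> R by rewrite exprn_gt0.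
  rewrite exprVn -[leRHS]mul1r ler_pdivlMr//.
  apply: le_trans P; rewrite ler_wpM2l//; lra.
have H2 : (fun _ : nat => (0 : R)) @ \oo --> (0 : R) by exact: cvg_cst.
apply: (squeeze_cvgr _ H2 half); near=> n.
have /andP[-> _] := cutoff_itv n t01 => /=.
have a01 : 0 <= t ^+ (n ^ 2) <= 1 by rewrite exprn_ge0//= exprn_ile1.
have := bernoulli_sub (2 ^ (n ^ 2 - n)) a01; rewrite cutoff_height => h.
rewrite /cutoff; apply: (@le_trans _ _ (((2 * t) ^+ n / 2) ^+ n)); first lra.
have h2 : 0 <= (2 * t) ^+ n <= 1.
  by rewrite exprn_ge0 ?exprn_ile1 ?mulr_ge0//=; lra.
have /andP[h3 h4] := h2.
by rewrite lerXn2r ?nnegrE; lra.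
Unshelve. all: by end_near.
Qed.

(** Monomials in one-dimensional Gaussians are again Gaussians up to a constant, so orthogonality
    extends to polynomials in them, in particular to cutoffs, and in the limit to indicators of
    boxes. *)
Lemma gauss_separates (h : E -> R) m :
  measurable_fun setT h -> intble mu (fun x => h x * jw m x) ->
  (forall (al : 'I_d -> R) (z : E), (forall i, 0 < al i) ->
    \int[mu]_x (h x * expR (- \sum_i al i * (x ord0 i - z ord0 i) ^+ 2)) = 0) ->
  {ae mu, forall x, h x = 0}.
Proof.
move=> mh ih hG.
(* The extra Gaussian makes the function integrable and never vanishes, so that [H] can stand for
   [h]. *)
pose H x := h x * gaussian (fun=> 1) x.
have iH : intble mu H.
  have [M M0 hM] := @gaussian_bound R d (fun=> 1) m (fun=> ltr01).
  apply: (@intble_abs_dom _ _ _ mu (fun x => M * (h x * jw m x))).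
  - apply: measurable_funM => //; apply: schwartz_measurable; exact: gaussian_schwartz.
  - exact: intbleZ.
  - move=> x; rewrite mulrCA !normrM ler_wpM2l// (ger0_norm (expR_ge0 _)) (ger0_norm M0).
    rewrite (ger0_norm (ltW (jw_gt0 _ _))) ler_pdivlMr ?exprn_gt0 ?ltr_wpDr ?n1_ge0//.
    by rewrite mulrC.
have mH := intble_meas iH.
suff : {ae mu, forall x, H x = 0}.
  apply: filterS => x /eqP; rewrite mulf_eq0 => /orP[/eqP //|].
  by rewrite gt_eqF// expR_gt0.
apply: ae0_of_oboxes => // a b.
have [ab|/existsNP[i0 /negP]] := pselect (forall i, a i < b i); last first.
  rewrite -leNgt => ba.
  rewrite (_ : obox a b = set0).
    by under eq_Rintegral do rewrite indic0 mulr0; rewrite Rintegral_cst// mul0r.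
  by apply/seteqP; split => x //= /(_ i0) /andP[h1 h2]; have := lt_trans h1 h2; rewrite ltNge ba.
pose r i := (b i - a i) / 2; pose c i := (a i + b i) / 2.
have r0 i : 0 < r i by rewrite divr_gt0// subr_gt0.
(* With this exponent [th i] exceeds 1/2 exactly on the slab [a i < x_i < b i]. *)
pose kap i := ln 2 / r i ^+ 2.
have kap0 i : 0 < kap i by rewrite divr_gt0 ?exprn_gt0// ln_gt0// ltr1n.
pose th i (x : E) := expR (- (kap i * (x ord0 i - c i) ^+ 2)).
have mth i : measurable_fun setT (th i).
  apply: (measurableT_comp (@measurable_expR R)); apply: measurable_funN.
  apply: measurable_funM => //; apply: measurable_funX; apply: measurable_funB => //.
  exact: measurable_coord_rV.
have th01 i x : 0 <= th i x <= 1.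
  by rewrite expR_ge0 -expR0 ler_expR oppr_le0 mulr_ge0 ?sqr_ge0// ltW.
have thbox i x : (2^-1 < th i x) = (a i < x ord0 i < b i).
  rewrite -[2^-1]lnK ?posrE ?invr_gt0// ltr_expR lnV ?posrE// ltrN2.
  rewrite /kap mulrAC ltr_pdivrMr ?exprn_gt0// ltr_pM2l ?ln_gt0 ?ltr1n//.
  rewrite -[(x ord0 i - c i) ^+ 2]real_normK ?num_real// ltr_pXn2r ?nnegrE ?(ltW (r0 i))//.
  by rewrite ltr_norml /c /r; apply/andP/andP => -[? ?]; split; lra.
pose PM (m : 'I_d -> nat) x := \prod_i th i x ^+ m i.
have mPM m' : measurable_fun setT (PM m').
  by apply: measurable_prod => i _; exact: measurable_funX.
have PM01 m' x : 0 <= PM m' x <= 1.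
  apply/andP; split; first by apply: prodr_ge0 => i _; rewrite exprn_ge0//; case/andP: (th01 i x).
  by apply: prodr_ile1 => i _; have /andP[h1 h2] := th01 i x; rewrite exprn_ge0 ?exprn_ile1.
(* completing the square in each variable *)
have PM0 m' : \int[mu]_x (H x * PM m' x) = 0.
  pose al i := 1 + (m' i)%:R * kap i.
  have al0 i : 0 < al i by rewrite ltr_wpDr// mulr_ge0// ltW.
  pose z : E := \row_i ((m' i)%:R * kap i * c i / al i).
  pose K := \sum_i ((m' i)%:R * kap i * c i ^+ 2 - al i * z ord0 i ^+ 2).
  have E0 x : H x * PM m' x = expR (- K) *
      (h x * expR (- \sum_i al i * (x ord0 i - z ord0 i) ^+ 2)).
    rewrite mulrCA -expRD /H /gaussian /PM -mulrA; congr (_ * _).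
    under eq_bigr do rewrite -expRM_natl.
    rewrite -expR_sum -expRD; congr expR.
    rewrite /sumsq /K -!sumrN -!big_split; apply: eq_bigr => i _ /=.
    have := al0 i; rewrite /z mxE /al => ai.
    by field; rewrite gt_eqF.
  under eq_Rintegral do rewrite E0.
  rewrite Rintegral_scale ?hG ?mulr0//.
  apply: (@intble_abs_dom _ _ _ mu (fun x => expR K * (H x * PM m' x))).
  - apply: measurable_funM => //; apply: (measurableT_comp (@measurable_expR R)).
    apply: measurable_funN; apply: measurable_sum => i; apply: measurable_funM => //.
    by apply: measurable_funX; apply: measurable_funB => //; exact: measurable_coord_rV.
  - apply: intbleZ; apply: (@intble_abs_dom _ _ _ mu H) => //.
      exact: measurable_funM.
    by move=> x; rewrite normrM ler_piMr// ger0_norm; have /andP[] := PM01 m' x.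
  - by move=> x; rewrite E0 mulrA -expRD subrr expR0 mul1r.
(* Orthogonality is required against [q] times every monomial; this is what makes the class stable
   under multiplication by powers of [th i]. Together with differences it then contains products of
   cutoffs. *)
pose A (q : E -> R) := [/\ measurable_fun setT q, forall x, 0 <= q x <= 1 &
   forall m', \int[mu]_x (H x * (q x * PM m' x)) = 0].
have iA (q : E -> R) m' : measurable_fun setT q -> (forall x, 0 <= q x <= 1) ->
    intble mu (fun x => H x * (q x * PM m' x)).
  move=> mq q01; apply: (@intble_abs_dom _ _ _ mu H) => //.
    by apply: measurable_funM => //; exact: measurable_funM.
  move=> x; rewrite normrM ler_piMr//.
  have /andP[h1 h2] := q01 x; have /andP[h3 h4] := PM01 m' x.
  by rewrite ger0_norm ?mulr_ge0// mulr_ile1.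
have A1 : A (fun=> 1).
  split=> //; first by move=> x; rewrite ler01 lexx.
  by move=> m'; under eq_Rintegral do rewrite mul1r.
have Amul q i n : A q -> A (fun x => th i x ^+ n * q x).
  move=> [mq q01 qA]; split.
  - by apply: measurable_funM => //; exact: measurable_funX.
  - move=> x; have /andP[h1 h2] := th01 i x; have /andP[h3 h4] := q01 x.
    by rewrite mulr_ge0 ?exprn_ge0//= mulr_ile1 ?exprn_ge0 ?exprn_ile1.
  move=> m'; rewrite -[RHS](qA (fun j => (m' j + (j == i) * n)%N)).
  apply: eq_Rintegral => x _.
  suff -> : PM (fun j => (m' j + (j == i) * n)%N) x = th i x ^+ n * PM m' x by ring.
  rewrite /PM (bigD1 i)//= [in RHS](bigD1 i)//= eqxx mul1n exprD mulrA.
  rewrite [th i x ^+ n * _]mulrC; congr (_ * _); apply: eq_bigr => j /negbTE ->.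
  by rewrite mul0n addn0.
have Asub q q' : A q -> A q' -> (forall x, q' x <= q x) -> A (fun x => q x - q' x).
  move=> [mq q01 qA] [mq' q01' qA'] qq'; split.
  - exact: measurable_funB.
  - move=> x; have /andP[h1 h2] := q01 x; have /andP[h3 h4] := q01' x.
    by have := qq' x; move=> *; apply/andP; split; lra.
  move=> m'; under eq_Rintegral do rewrite mulrBl mulrBr.
  by rewrite Rintegral_sub ?qA ?qA' ?subrr//; exact: iA.
have Apow q i n k : A q -> A (fun x => (1 - th i x ^+ n) ^+ k * q x).
  move=> Aq; elim: k => [|k IH].
    by rewrite (_ : (fun x => _) = q)//; apply/funext => x; rewrite expr0 mul1r.
  rewrite (_ : (fun x => _) = (fun x => (1 - th i x ^+ n) ^+ k * q x -
     th i x ^+ n * ((1 - th i x ^+ n) ^+ k * q x))).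
    apply: Asub => //; first exact: Amul.
    move=> x; rewrite ler_piMl//; last by have /andP[h1 h2] := th01 i x; exact: exprn_ile1.
    by case: IH => _ /(_ x) /andP[].
  by apply/funext => x; rewrite exprS; ring.
have Acut q i n : A q -> A (fun x => cutoff n (th i x) * q x).
  move=> Aq; rewrite (_ : (fun x => _) = (fun x => q x -
     (1 - th i x ^+ (n ^ 2)) ^+ (2 ^ (n ^ 2 - n)) * q x)).
    apply: Asub => //; first exact: Apow.
    move=> x; case: Aq => _ /(_ x) /andP[q0 q1] _.
    have /andP[h1 h2] := th01 i x.
    have h3 : 0 <= 1 - th i x ^+ (n ^ 2) <= 1.
      by rewrite subr_ge0 exprn_ile1//= lerBlDl lerDr exprn_ge0.
    by have /andP[h4 h5] := h3; rewrite ler_piMl// exprn_ile1.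
  by apply/funext => x; rewrite /cutoff; ring.
have Aprod n (s : seq 'I_d) : A (fun x => \prod_(i <- s) cutoff n (th i x)).
  elim: s => [|i s IH].
    by rewrite (_ : (fun x => _) = fun=> 1)//; apply/funext => x; rewrite big_nil.
  rewrite (_ : (fun x => _) = fun x => cutoff n (th i x) * \prod_(i <- s) cutoff n (th i x)).
    exact: Acut.
  by apply/funext => x; rewrite big_cons.
apply: (@Rintegral_lim0 _ _ _ mu (fun n x => H x * \prod_i cutoff n (th i x)) _ (fun x => `|H x|)).
- by move=> n; apply: measurable_funM => //; case: (Aprod n (index_enum 'I_d)).
- exact: intble_norm.
- move=> n x; rewrite normrM ler_piMr//; case: (Aprod n (index_enum 'I_d)) => _ /(_ x) /andP[h0 h1] _.
  by rewrite ger0_norm.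
- move=> x; apply: cvgMr.
  have -> : \1_(obox a b) x = \prod_i (2^-1 < th i x)%R%:R :> R.
    rewrite indicE; have [xb|xb] := pselect (obox a b x).
      by rewrite mem_set// big1// => i _; rewrite thbox xb.
    rewrite memNset//; apply/esym; move/existsNP : xb => [i /negP hi].
    by rewrite (bigD1 i)//= thbox (negbTE hi) mul0r.
  elim: (index_enum 'I_d) => [|i s IH].
    by under eq_cvg do rewrite big_nil; rewrite big_nil; exact: cvg_cst.
  under eq_cvg do rewrite big_cons; rewrite big_cons; apply: cvgM => //.
  exact: cvg_cutoff.
- move=> n; case: (Aprod n (index_enum 'I_d)) => _ _ /(_ (fun=> 0%N)).
  congr (_ = _); apply: eq_Rintegral => x _; congr (_ * _).
  by rewrite /PM [X in _ * X]big1 ?mulr1// => i _; rewrite expr0.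
Qed.

End gaussian_separation.

(** * Sobolev spaces on the Fourier side *)

Section sobolev_fourier.
Context (R : realType) (d : nat).
Local Notation E := 'rV[R]_d.
Local Notation mu := (lebesgue_rV R d).
Implicit Types (g : E -> R[i]) (s : R).

Lemma bracket2_gt0 s (x : E) : 0 < bracket2 s x.
Proof. by rewrite powR_gt0// ltr_wpDr// dotpxx_ge0. Qed.

Lemma measurable_bracket2 s : measurable_fun setT (@bracket2 R d s).
Proof.
apply: (measurableT_comp (measurable_powR s)); apply: measurable_funD => //.
by apply: measurable_dotp; exact: measurable_id.
Qed.

(** A natural exponent above the absolute value of [s], through which the real powers of the Sobolev
    weight are compared with the integer powers of [1 + n1]. *)
Definition pw s : nat := (Num.truncn `|s|).+1.

Lemma ler_pw s : `|s| <= (pw s)%:R.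
Proof. by rewrite ltW// truncnS_gt. Qed.

Lemma bracket2_le s (x : E) : bracket2 s x <= (1 + n1 x) ^+ (2 * pw s).
Proof.
have h1 : 1 <= 1 + dotp x x by rewrite lerDl dotpxx_ge0.
apply: (@le_trans _ _ ((1 + dotp x x) `^ (pw s)%:R)).
  by apply: ler_powR => //; apply: le_trans (ler_pw s); rewrite ler_norm.
rewrite powR_mulrn ?(le_trans _ h1)// exprM lerXn2r ?nnegrE//.
- exact: le_trans h1.
- exact: sqr_ge0.
- by rewrite sqrrD expr1n mul1r -addrA lerD2l ler_wpDl ?dotp_le_n1// mulrn_wge0// n1_ge0.
Qed.

Lemma bracket2_ge s (x : E) : jw (2 * pw s) x <= bracket2 s x.
Proof.
have -> : bracket2 s x = (bracket2 (- s) x)^-1 by rewrite /bracket2 powRN invrK.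
rewrite lef_pV2 ?posrE ?bracket2_gt0 ?exprn_gt0 ?ltr_wpDr ?n1_ge0//.
by apply: le_trans (bracket2_le _ _) _; rewrite /pw normrN.
Qed.

(** A class independent of the Sobolev exponent in which pairings with transforms of Schwartz
    functions converge and in which the transform is determined almost everywhere. *)
Definition tempered g := Cmeasurable g /\ exists m, intble mu (fun x => cn (g x) * jw m x).

Lemma jwM m k (x : E) : jw m x * jw k x = jw (m + k) x.
Proof. by rewrite /jw exprD invfM. Qed.

Lemma intble_jw_widen g m k : Cmeasurable g -> (m <= k)%N ->
  intble mu (fun x => cn (g x) * jw m x) -> intble mu (fun x => cn (g x) * jw k x).
Proof.
move=> mg mk ig; apply: (intble_dom _ ig).
  apply: measurable_funM; first exact: measurable_cn.
  by apply: measurable_jw; exact: measurable_id.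
move=> x; rewrite ger0_norm ?mulr_ge0 ?cn_ge0 ?(ltW (jw_gt0 _ _))//.
rewrite -(subnKC mk) -jwM ler_wpM2l ?cn_ge0// ler_piMr ?jw_le1// ltW//; exact: jw_gt0.
Qed.

Lemma temperedD g g' : tempered g -> tempered g' -> tempered (fun x => g x + g' x).
Proof.
move=> [mg [m ig]] [mg' [m' ig']]; split; first exact: CmeasurableD.
exists (m + m')%N.
apply: (intble_dom _ (intbleD (intble_jw_widen mg (leq_addr m' m) ig)
                              (intble_jw_widen mg' (leq_addl m m') ig'))).
  apply: measurable_funM; first by apply: measurable_cn; exact: CmeasurableD.
  by apply: measurable_jw; exact: measurable_id.
move=> x; rewrite ger0_norm ?mulr_ge0 ?cn_ge0 ?(ltW (jw_gt0 _ _))//.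
by rewrite -mulrDl ler_wpM2r ?cnD// ltW// jw_gt0.
Qed.

Lemma temperedZ (c : R[i]) g : tempered g -> tempered (fun x => c * g x).
Proof.
move=> [mg [m ig]]; split; first by apply: CmeasurableM => //; exact: Cmeasurable_cst.
exists m; apply: (intble_dom _ (intbleZ (cn c) ig)).
  apply: measurable_funM; last by apply: measurable_jw; exact: measurable_id.
  by apply: measurable_cn; apply: CmeasurableM => //; exact: Cmeasurable_cst.
move=> x; rewrite ger0_norm ?mulr_ge0 ?cn_ge0 ?(ltW (jw_gt0 _ _))//.
by rewrite mulrA ler_wpM2r ?cnM// ltW// jw_gt0.
Qed.

Lemma cn2_sqmod (z : R[i]) : cn z ^+ 2 <= 2 * sqmod z.
Proof.
rewrite /sqmod /cn -(real_normK (num_real (complex.Re z))).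
rewrite -(real_normK (num_real (complex.Im z))).
move: `|_| `|_| => a b; rewrite -subr_ge0.
by rewrite (_ : _ - _ = (a - b) ^+ 2) ?sqr_ge0//; ring.
Qed.

Lemma weighted_intble s g : weighted_L2 s g ->
  intble mu (fun x => bracket2 s x * sqmod (g x)).
Proof.
move=> [mg goo]; apply: intble_ge0P => //.
  by apply: measurable_funM; [exact: measurable_bracket2|exact: measurable_sqmod].
by move=> x; rewrite mulr_ge0 ?sqmod_ge0 ?ltW ?bracket2_gt0.
Qed.

Lemma weighted_L2P s g : Cmeasurable g ->
  intble mu (fun x => bracket2 s x * sqmod (g x)) -> weighted_L2 s g.
Proof.
move=> mg ig; split => //.
by rewrite integral_intble// ltry.
Qed.

Lemma weighted_tempered s g : weighted_L2 s g -> tempered g.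
Proof.
move=> wg; have ig := weighted_intble wg; have [mg _] := wg; split => //.
(* The square of this weight has order [2 * d + 2 * pw s]: the first part is integrable and the
   second compensates the inverse of the bracket. *)
exists (d + pw s)%N; apply: (intble_dom _ (intbleD (intbleZ 2 ig) (intble_jw R d))).
  apply: measurable_funM; first exact: measurable_cn.
  by apply: measurable_jw; exact: measurable_id.
move=> x; rewrite ger0_norm ?mulr_ge0 ?cn_ge0 ?(ltW (jw_gt0 _ _))//.
have c0 := cn_ge0 (g x); have b0 := bracket2_gt0 s x.
have h1 := bracket2_ge s x; have h2 := cn2_sqmod (g x).
set J := jw (d + pw s) x; have J0 : 0 < J by exact: jw_gt0.
have J2 : J ^+ 2 = jw (2 * d) x * jw (2 * pw s) x.
  by rewrite expr2 /J !jwM; congr jw; rewrite !mul2n -!addnn addnACA.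
have Jd0 : 0 < jw (2 * d) x by exact: jw_gt0.
(* AM-GM *)
have h3 : 2 * (cn (g x) * J) <= bracket2 s x * cn (g x) ^+ 2 + J ^+ 2 / bracket2 s x.
  rewrite -subr_ge0.
  rewrite (_ : _ - _ = (bracket2 s x * cn (g x) - J) ^+ 2 / bracket2 s x).
    by rewrite divr_ge0 ?sqr_ge0// ltW.
  by field; rewrite gt_eqF.
have h4 : J ^+ 2 / bracket2 s x <= jw (2 * d) x.
  by rewrite ler_pdivrMr// J2 ler_wpM2l// ltW.
have h5 : bracket2 s x * cn (g x) ^+ 2 <= bracket2 s x * (2 * sqmod (g x)).
  by rewrite ler_wpM2l// ltW.
have h6 := mulr_ge0 c0 (ltW J0).
by lra.
Qed.

Lemma tempered_ifourier g (f : schwartz R d) : tempered g ->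
  Cintble mu (fun x => g x * ifourier (sval f) x).
Proof.
move=> [mg [m ig]]; have [M M0 hM] := ifourier_decay f m.
apply: (Cintble_dom _ (intbleZ M ig)).
  apply: CmeasurableM => //; apply: measurable_ifourier.
  exact: Cintble_meas (schwartz_Cintble f).
move=> x; apply: le_trans (cnM _ _) _.
by rewrite mulrCA ler_wpM2l ?cn_ge0.
Qed.

Lemma dist_ifourierE g (f : schwartz R d) :
  dist_ifourier g f = Cint mu (fun x => g x * ifourier (sval f) x).
Proof. by []. Qed.

Lemma dist_ifourierD g g' : tempered g -> tempered g' ->
  dist_ifourier (fun x => g x + g' x) = dist_ifourier g + dist_ifourier g'.
Proof.
move=> tg tg'; apply/funext => f.
have -> : (dist_ifourier g + dist_ifourier g') f =
   (Cint mu (fun x => g x * ifourier (sval f) x) + Cint mu (fun x => g' x * ifourier (sval f) x) : R[i]) by [].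
rewrite dist_ifourierE -CintD; try exact: tempered_ifourier.
by apply: eq_Cint => x; rewrite mulrDl.
Qed.

Lemma dist_ifourierZ (a : R) g : tempered g ->
  dist_ifourier (fun x => a%:C * g x) = a *: dist_ifourier g.
Proof.
move=> tg; apply/funext => f.
have -> : (a *: dist_ifourier g) f = (a%:C * Cint mu (fun x => g x * ifourier (sval f) x) : R[i]).
  rewrite -[LHS]/(a *: (dist_ifourier g f)) -dist_ifourierE; case: (dist_ifourier g f) => p q.
  by apply: complex_ext; rewrite /GRing.scale /= mul0r ?subr0 ?addr0.
rewrite dist_ifourierE -CintZ; last exact: tempered_ifourier.
by apply: eq_Cint => x; rewrite mulrA.
Qed.

Lemma dist_ifourier0 : dist_ifourier (fun _ : E => 0) = 0.
Proof.
apply/funext => f; rewrite dist_ifourierE.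
by under eq_fun do rewrite mul0r; rewrite Cint0.
Qed.

Lemma dist_ifourier_ae g g' : Cmeasurable g -> Cmeasurable g' ->
  {ae mu, forall x, g x = g' x} -> dist_ifourier g = dist_ifourier g'.
Proof.
move=> mg mg' gg'; apply/funext => f; rewrite !dist_ifourierE.
have mf := measurable_ifourier (Cintble_meas (schwartz_Cintble f)).
apply: ae_eq_Cint; do ?exact: CmeasurableM.
by apply: filterS gg' => x ->.
Qed.

(** The test function is the Gaussian with coefficients [1 / (4 al)], modulated by the character of
    frequency [- z], which moves the centre of the transform to [z]. *)
Lemma gaussian_ifourier (al : 'I_d -> R) (z : E) : (forall i, 0 < al i) ->
  exists f : schwartz R d, exists2 K : R, 0 < K & forall x, ifourier (sval f) x =
     (K * expR (- \sum_i al i * (x ord0 i - z ord0 i) ^+ 2))%:C.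
Proof.
move=> al0; pose b i := (4 * al i)^-1.
have b0 i : 0 < b i by rewrite invr_gt0 mulr_gt0.
have h1 : real_schwartz (fun x : E => cos (dotp x z) * gaussian b x).
  exact: gauss_class_schwartz b0 (gauss_cos b z).
have h2 : real_schwartz (fun x : E => - 1 * (sin (dotp x z) * gaussian b x)).
  exact: gauss_class_schwartz b0 (gauss_scale (-1) (gauss_sin b z)).
pose F (x : E) := (cos (dotp x z) * gaussian b x) +i* (- 1 * (sin (dotp x z) * gaussian b x)).
pose f : schwartz R d := exist _ F (conj h1 h2).
have ig := schwartz_intble (gaussian_schwartz b0).
exists f, (cF R d * \int[mu]_x gaussian b x).
  by rewrite mulr_gt0 ?cF_gt0// gaussian_integral_gt0.
move=> x.
have E1 y : expi (dotp x y) * sval f y = expi (dotp y (x - z)) * (gaussian b y)%:C.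
  have -> : sval f y = expi (- dotp y z) * (gaussian b y)%:C.
    by apply: complex_ext; rewrite /= cosN sinN; ring.
  rewrite mulrA -expiD; congr (expi _ * _).
  by rewrite /dotp -sumrB; apply: eq_bigr => i _; rewrite !mxE; ring.
rewrite ifourierE (eq_Cint _ E1).
have ic : Cintble mu (fun y => expi (dotp y (x - z)) * (gaussian b y)%:C).
  under eq_fun do rewrite dotpC; apply: Cintble_char; split => //=.
  exact: intble0.
have -> : Cint mu (fun y => expi (dotp y (x - z)) * (gaussian b y)%:C) =
   (\int[mu]_y (cos (dotp y (x - z)) * gaussian b y))%:C.
  (* The reflection of the variable conjugates the integrand, so the integral is real and reduces to
     the cosine integral. *)
  set I := Cint _ _.
  have Ic : cj I = I.
    rewrite /I -Cint_cj// -(Cint_opp (Cintble_meas ic)); apply: eq_Cint => y.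
    have -> : dotp (- y) (x - z) = - dotp y (x - z).
      by rewrite /dotp -sumrN; apply: eq_bigr => i _; rewrite !mxE mulNr.
    have -> : gaussian b (- y) = gaussian b y.
      by rewrite /gaussian /sumsq; congr expR; congr (- _); apply: eq_bigr => i _; rewrite mxE sqrrN.
    by rewrite cjM expiN; congr (_ * _); apply: complex_ext => //=; rewrite oppr0.
  have I0 : complex.Im I = 0 by move: Ic; case: I => p q [] /=; lra.
  apply: complex_ext; last exact: I0.
  by rewrite /I /Cint /Cintegral /=; apply: eq_Rintegral => y _; rewrite mulr0 subr0.
rewrite gaussian_cos_integral// -mulrA; apply: complex_ext; rewrite /= ?mulr0 ?mul0r ?addr0 ?subr0//.
congr (_ * (_ * expR (- _))); apply: eq_bigr => i _; rewrite !mxE /b; have := al0 i => ai.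
by field; rewrite gt_eqF.
Qed.

(** Tested against modulated Gaussians, the difference is orthogonal to real Gaussians of all
    centres and widths; as these are real, [gauss_separates] applies to the real and the imaginary
    part separately. *)
Lemma dist_ifourier_inj g g' : tempered g -> tempered g' ->
  dist_ifourier g = dist_ifourier g' -> {ae mu, forall x, g x = g' x}.
Proof.
move=> tg tg' gg'.
pose h (x : E) : R[i] := g x - g' x.
have th : tempered h.
  rewrite /h; have := temperedD tg (temperedZ (-1) tg').
  by under eq_fun do rewrite mulN1r.
have h0 (f : schwartz R d) : Cint mu (fun x => h x * ifourier (sval f) x) = 0.
  have := congr1 (fun u : dist R d => (u f : R[i])) gg'; rewrite !dist_ifourierE.
  move/eqP; rewrite -subr_eq0 -CintB; try exact: tempered_ifourier.
  by move=> /eqP H; rewrite -[RHS]H; apply: eq_Cint => x; rewrite mulrBl.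
have [mh [m ih]] := th.
have mJ : measurable_fun setT (jw m : E -> R) by apply: measurable_jw; exact: measurable_id.
have HG al (z : E) : (forall i, 0 < al i) ->
   \int[mu]_x (complex.Re (h x) * expR (- \sum_i al i * (x ord0 i - z ord0 i) ^+ 2)) = 0 /\
   \int[mu]_x (complex.Im (h x) * expR (- \sum_i al i * (x ord0 i - z ord0 i) ^+ 2)) = 0.
  move=> al0; have [f [K K0 hf]] := gaussian_ifourier z al0.
  set G := fun x : E => expR (- \sum_i al i * (x ord0 i - z ord0 i) ^+ 2).
  have [i1 i2] := tempered_ifourier f th.
  have := h0 f; rewrite /Cint /Cintegral => -[H1 H2].
  have e1 x : complex.Re (h x * ifourier (sval f) x) = K * (complex.Re (h x) * G x).
    by rewrite hf; case: (h x) => p q /=; rewrite mulr0 subr0 mulrCA.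
  have e2 x : complex.Im (h x * ifourier (sval f) x) = K * (complex.Im (h x) * G x).
    by rewrite hf; case: (h x) => p q /=; rewrite mulr0 add0r mulrCA.
  have mG : measurable_fun setT G.
    apply: (measurableT_comp (@measurable_expR R)).
    apply: measurable_funN; apply: measurable_sum => i; apply: measurable_funM => //.
    by apply: measurable_funX; apply: measurable_funB => //; exact: measurable_rV_coord.
  have j1 : intble mu (fun x => complex.Re (h x) * G x).
    apply: (intble_abs_dom _ (intbleZ K^-1 i1)).
      by apply: measurable_funM => //; case: mh.
    by move=> x; rewrite e1 mulKf ?gt_eqF.
  have j2 : intble mu (fun x => complex.Im (h x) * G x).
    apply: (intble_abs_dom _ (intbleZ K^-1 i2)).
      by apply: measurable_funM => //; case: mh.
    by move=> x; rewrite e2 mulKf ?gt_eqF.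
  have {}H1 : K * \int[mu]_x (complex.Re (h x) * G x) = 0.
    rewrite -Rintegral_scale// -[RHS]H1; apply: eq_Rintegral => x _.
    by rewrite -e1.
  have {}H2 : K * \int[mu]_x (complex.Im (h x) * G x) = 0.
    rewrite -Rintegral_scale// -[RHS]H2; apply: eq_Rintegral => x _.
    by rewrite -e2.
  by split; apply/eqP; [move/eqP : H1|move/eqP : H2]; rewrite mulf_eq0 gt_eqF.
have a1 : {ae mu, forall x, complex.Re (h x) = 0}.
  apply: (@gauss_separates _ _ _ m).
  - by case: mh.
  - apply: (intble_dom _ ih); first by apply: measurable_funM => //; case: mh.
    move=> x; rewrite normrM (ger0_norm (ltW (jw_gt0 _ _))) ler_wpM2r ?ler_Re_cn//.
    by rewrite ltW// jw_gt0.
  - by move=> al z /(HG al z)[].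
have a2 : {ae mu, forall x, complex.Im (h x) = 0}.
  apply: (@gauss_separates _ _ _ m).
  - by case: mh.
  - apply: (intble_dom _ ih); first by apply: measurable_funM => //; case: mh.
    move=> x; rewrite normrM (ger0_norm (ltW (jw_gt0 _ _))) ler_wpM2r ?ler_Im_cn//.
    by rewrite ltW// jw_gt0.
  - by move=> al z /(HG al z)[].
apply: filterS2 a1 a2 => x r1 r2.
by apply/eqP; rewrite -subr_eq0; apply/eqP; exact: complex_ext.
Qed.

(** [fourier] chooses some representative, possibly for another Sobolev exponent; injectivity within
    the class [tempered] identifies it with [g] up to a null set. *)
Lemma fourierP s g : weighted_L2 s g ->
  tempered (fourier (dist_ifourier g)) /\
  {ae mu, forall x, fourier (dist_ifourier g) x = g x}.
Proof.
move=> wg; rewrite /fourier; case: xgetP => [g' _ [[s' ws'] e]|/(_ g)[]]; last first.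
  by split => //; exists s.
split; first exact: weighted_tempered ws'.
exact: (dist_ifourier_inj (weighted_tempered ws') (weighted_tempered wg) (esym e)).
Qed.

Lemma sobolevP s (u : dist R d) : sobolev s u ->
  weighted_L2 s (fourier u) /\ u = dist_ifourier (fourier u).
Proof.
move=> [g wg ->]; have [[mF _] h] := fourierP wg; have [mg goo] := wg.
split; last by apply: dist_ifourier_ae => //; apply: filterS h => x ->.
split => //; rewrite (_ : integral _ _ _ = (\int[mu]_x (bracket2 s x * sqmod (g x))%:E)%E)//.
apply: ae_eq_integral => //.
- apply/measurable_EFinP/measurable_funM; [exact: measurable_bracket2|exact: measurable_sqmod].
- apply/measurable_EFinP/measurable_funM; [exact: measurable_bracket2|exact: measurable_sqmod].
- by apply: filterS h => x -> _.
Qed.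

Lemma weighted_L2D s g g' : weighted_L2 s g -> weighted_L2 s g' ->
  weighted_L2 s (fun x => g x + g' x).
Proof.
move=> wg wg'; have ig := weighted_intble wg; have ig' := weighted_intble wg'.
have [mg _] := wg; have [mg' _] := wg'.
apply: weighted_L2P; first exact: CmeasurableD.
apply: (intble_dom _ (intbleZ 2 (intbleD ig ig'))).
  apply: measurable_funM; first exact: measurable_bracket2.
  by apply: measurable_sqmod; exact: CmeasurableD.
move=> x; have b0 := bracket2_gt0 s x.
rewrite ger0_norm ?mulr_ge0 ?sqmod_ge0 ?(ltW b0)// -mulrDr mulrCA ler_wpM2l ?(ltW b0)//.
rewrite -subr_ge0 (_ : _ - _ = sqmod (g x - g' x)) ?sqmod_ge0//.
by rewrite /sqmod !cReD !cImD cReN cImN; ring.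
Qed.

Lemma weighted_L2Z s (c : R[i]) g : weighted_L2 s g -> weighted_L2 s (fun x => c * g x).
Proof.
move=> wg; have ig := weighted_intble wg; have [mg _] := wg.
have mc : Cmeasurable (fun x => c * g x).
  by apply: CmeasurableM => //; exact: Cmeasurable_cst.
apply: weighted_L2P => //.
apply: (intble_dom _ (intbleZ (sqmod c) ig)).
  by apply: measurable_funM; [exact: measurable_bracket2|exact: measurable_sqmod].
move=> x; have b0 := bracket2_gt0 s x.
rewrite ger0_norm ?mulr_ge0 ?sqmod_ge0 ?(ltW b0)// mulrCA ler_wpM2l ?(ltW b0)//.
by rewrite /sqmod cReM cImM le_eqVlt; apply/orP; left; apply/eqP; ring.
Qed.

Lemma sobolev_norm_ge0 s (u : dist R d) : 0 <= sobolev_norm s u.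
Proof. exact: sqrtr_ge0. Qed.

Lemma sqr_sobolev_norm s (u : dist R d) : sobolev_norm s u ^+ 2 =
  \int[mu]_x (bracket2 s x * sqmod (fourier u x)).
Proof.
rewrite sqr_sqrtr// Rintegral_ge0// => x _.
by rewrite mulr_ge0 ?sqmod_ge0// ltW// bracket2_gt0.
Qed.

Lemma sqr_sobolev_norm_ifourier s s' g : weighted_L2 s' g ->
  sobolev_norm s (dist_ifourier g) ^+ 2 = \int[mu]_x (bracket2 s x * sqmod (g x)).
Proof.
move=> wg; rewrite sqr_sobolev_norm; have [[mF _] h] := fourierP wg; have [mg _] := wg.
apply: ae_eq_Rintegral.
- by apply: measurable_funM; [exact: measurable_bracket2|exact: measurable_sqmod].
- by apply: measurable_funM; [exact: measurable_bracket2|exact: measurable_sqmod].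
- by apply: filterS h => x ->.
Qed.

Lemma sobolevD s (u v : dist R d) : sobolev s u -> sobolev s v ->
  sobolev s (u + v) /\ {ae mu, forall x, fourier (u + v) x = fourier u x + fourier v x}.
Proof.
move=> /sobolevP[wu eu] /sobolevP[wv ev].
have e : u + v = dist_ifourier (fun x => fourier u x + fourier v x).
  by rewrite (dist_ifourierD (weighted_tempered wu) (weighted_tempered wv)) -eu -ev.
have w := weighted_L2D wu wv.
split; first by exists (fun x => fourier u x + fourier v x).
by rewrite [in fourier (u + v)]e; have [_] := fourierP w.
Qed.

Lemma sobolevZ s (a : R) (u : dist R d) : sobolev s u ->
  sobolev s (a *: u) /\ {ae mu, forall x, fourier (a *: u) x = a%:C * fourier u x}.
Proof.
move=> /sobolevP[wu eu].
have e : a *: u = dist_ifourier (fun x => a%:C * fourier u x).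
  by rewrite (dist_ifourierZ _ (weighted_tempered wu)) -eu.
have w := weighted_L2Z a%:C wu.
split; first by exists (fun x => a%:C * fourier u x).
by rewrite [in fourier (a *: u)]e; have [_] := fourierP w.
Qed.

Definition herm g := forall x, g (- x) = cj (g x).

(** The transform of a real test function is hermitian as well, so reflecting the variable shows
    that the pairing equals its own conjugate. *)
Lemma hermitian_real_dist g : tempered g -> herm g -> real_dist (dist_ifourier g).
Proof.
move=> tg hg f rf.
have ig := tempered_ifourier f tg.
have iF := schwartz_Cintble f.
have hF : herm (ifourier (sval f)).
  move=> x; rewrite !ifourierE cjM; congr (_ * _).
    by apply: complex_ext => //=; rewrite oppr0.
  transitivity (Cint mu (fun y => cj (expi (dotp x y) * sval f y))); last first.
    by apply: Cint_cj; exact: Cintble_char.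
  apply: eq_Cint => y; rewrite cjM -expiN; congr (expi _ * _).
    by rewrite /dotp -sumrN; apply: eq_bigr => i _; rewrite mxE mulNr.
  by apply: complex_ext; have := rf y; case: (sval f y) => p q //= ->; rewrite oppr0.
rewrite dist_ifourierE; set I := Cint _ _.
have : cj I = I.
  transitivity (Cint mu (fun y => cj (g y * ifourier (sval f) y))).
    by apply/esym; exact: Cint_cj.
  rewrite -(Cint_opp (Cintble_meas (Cintble_cj ig))); apply: eq_Cint => y.
  by rewrite hg hF -cjM cjK.
by case: I => p q [] /=; lra.
Qed.

End sobolev_fourier.

(** * Convolutions and exponential weights *)

Section convolution.
Context (R : realType) (d : nat).
Local Notation E := 'rV[R]_d.
Local Notation mu := (lebesgue_rV R d).
Implicit Types f g : E -> R[i].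

Definition convol f g (z : E) : R[i] := Cint mu (fun y => f (z - y) * g y).

Lemma measurable_sub2 : measurable_fun setT (fun z : E * E => z.2 - z.1).
Proof. by apply: measurable_rVB; [exact: measurable_snd|exact: measurable_fst]. Qed.

Lemma measurable_rev (z : E) : measurable_fun setT (fun y : E => z - y).
Proof. by apply: measurable_rVB; [exact: measurable_cst|exact: measurable_id]. Qed.

Lemma Cmeasurable_conv_integrand f g z : Cmeasurable f -> Cmeasurable g ->
  Cmeasurable (fun y : E => f (z - y) * g y).
Proof.
move=> mf mg; apply: CmeasurableM => //.
exact: (Cmeasurable_comp (measurable_rev z) mf).
Qed.

Lemma intble_rev (F : E -> R) (z : E) : intble mu F -> intble mu (fun y => F (z - y)).
Proof.
move=> iF; have := intble_rV_opp (intble_rV_shift z iF).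
by congr intble; apply/funext => y; rewrite addrC.
Qed.

Lemma Rintegral_rev (F : E -> R) (z : E) : measurable_fun setT F ->
  \int[mu]_y F (z - y) = \int[mu]_y F y.
Proof.
move=> mF; rewrite /Rintegral -(integral_rV_shift z mF).
have mFz : measurable_fun setT (fun y : E => F (y + z)).
  apply: (measurableT_comp mF); apply: measurable_rVD => //; exact: measurable_cst.
rewrite -(integral_rV_opp mFz); congr fine; apply: eq_integral => y _.
by rewrite addrC.
Qed.

Lemma convolC f g z : Cmeasurable f -> Cmeasurable g -> convol f g z = convol g f z.
Proof.
move=> mf mg; rewrite /convol.
have mh := Cmeasurable_conv_integrand z mf mg.
rewrite -(Cint_shift z mh).
have mh' : Cmeasurable (fun y : E => f (z - (y + z)) * g (y + z)).
  apply: (@Cmeasurable_comp _ E R _ E (fun y : E => y + z) (fun y : E => f (z - y) * g y) _ mh).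
  by apply: measurable_rVD; [exact: measurable_id|exact: measurable_cst].
rewrite -(Cint_opp mh'); apply: eq_Cint => y.
by rewrite mulrC opprD opprK addrCA subrr addr0 [- y + z]addrC.
Qed.

(* If f is the Fourier transform of u, then [sharp f] is that of the conjugate of u. *)
Definition sharp f (z : E) : R[i] := cj (f (- z)).

Lemma sharpK f : sharp (sharp f) = f.
Proof. by apply/funext => z; rewrite /sharp opprK cjK. Qed.

Lemma Cmeasurable_sharp f : Cmeasurable f -> Cmeasurable (sharp f).
Proof.
move=> mf; apply: Cmeasurable_cj.
by apply: (Cmeasurable_comp _ mf); exact: measurable_rVN.
Qed.

(** Conjugation commutes with products. Applied to [f] and [sharp f] it makes the transform of a
    squared modulus hermitian. *)
Lemma conv_sharp f g z : Cintble mu (fun y => f (- z - y) * g y) ->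
  convol (sharp f) (sharp g) z = sharp (convol f g) z.
Proof.
move=> hi; rewrite /sharp /convol -Cint_cj//.
rewrite -(Cint_opp (Cintble_meas (Cintble_cj hi))); apply: eq_Cint => y.
by rewrite cjM opprB opprK [- z + y]addrC.
Qed.

Lemma Cintble_conv_prod f g : Cintble mu f -> Cintble mu g ->
  Cintble (mu \x mu)%E (fun z : E * E => f (z.2 - z.1) * g z.1).
Proof.
move=> hf hg; have mf := Cintble_meas hf; have mg := Cintble_meas hg.
pose F (z : E * E) := cn (f (z.2 - z.1)) * cn (g z.1).
have msub := measurable_sub2.
have mF : measurable_fun setT F.
  apply: measurable_funM; apply: measurable_cn; first exact: (Cmeasurable_comp msub mf).
  exact: (Cmeasurable_comp measurable_fst mg).
apply: (Cintble_prod (F := F) (g := fun y => (\int[mu]_x cn (f x)) * cn (g y))) => //.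
- apply: CmeasurableM; first exact: (Cmeasurable_comp msub mf).
  exact: (Cmeasurable_comp measurable_fst mg).
- by apply: intbleZ; exact: intble_cn.
- by move=> z; exact: cnM.
move=> y; have ia := intble_cn hf.
have e : (fun x => (F (y, x))%:E) = (fun x : E => ((cn (g y)) * (cn (f (x - y))))%:E).
  by apply/funext => x; rewrite /F mulrC.
rewrite e -[leLHS]/(\int[mu]_x ((cn (g y)) * (cn (f (x - y))))%:E)%E.
rewrite integral_intble; last by apply: intbleZ; exact: (intble_rV_shift (- y) ia).
rewrite Rintegral_scale; last exact: (intble_rV_shift (- y) ia).
by rewrite lee_fin mulrC /Rintegral (integral_rV_shift (- y) (intble_meas ia)).
Qed.

Lemma Cmeasurable_conv f g : Cmeasurable f -> Cmeasurable g -> Cmeasurable (convol f g).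
Proof.
move=> mf mg.
apply: (@Cmeasurable_Cint _ _ E E R mu (fun z => f (z.1 - z.2) * g z.2)).
apply: CmeasurableM; last exact: (Cmeasurable_comp measurable_snd mg).
apply: (Cmeasurable_comp _ mf).
by apply: measurable_rVB; [exact: measurable_fst|exact: measurable_snd].
Qed.

Lemma Cintble_prod_swap (F : E * E -> R[i]) : Cintble (mu \x mu)%E F ->
  Cintble (mu \x mu)%E (fun z => F (z.2, z.1)).
Proof. by move=> [h1 h2]; split; [exact: (intble_prod_swap h1)|exact: (intble_prod_swap h2)]. Qed.

Lemma Cintble_conv f g : Cintble mu f -> Cintble mu g -> Cintble mu (convol f g).
Proof.
move=> hf hg; have := Cintble_Cint (Cintble_prod_swap (Cintble_conv_prod hf hg)).
by [].
Qed.

(** The convolution theorem. The integrand of the convolution is known to be integrable only for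
    almost every [z], hence the comparison almost everywhere at the end. *)
Lemma ifourier_mul f g (x : E) : Cintble mu f -> Cintble mu g ->
  ifourier f x * ifourier g x = (cF R d)%:C * ifourier (convol f g) x.
Proof.
move=> hf hg; rewrite !ifourierE mulrACA -mulrA; do 2 congr (_ * _).
have mf := Cintble_meas hf; have mg := Cintble_meas hg.
have mchar : Cmeasurable (fun y : E => expi (dotp x y)) by exact: Cmeasurable_char.
rewrite -CintZ; last exact: Cintble_char.
transitivity (Cint mu (fun y => Cint mu (fun z => expi (dotp x z) * (f (z - y) * g y)))).
  apply: eq_Cint => y.
  have hs := Cintble_shift (- y) (Cintble_char x hf).
  rewrite -(Cint_shift (- y) (Cintble_meas (Cintble_char x hf))) -CintZr//.
  apply: eq_Cint => z; rewrite mulrACA -expiD; congr (expi _ * _).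
  by rewrite /dotp -big_split; apply: eq_bigr => i _ /=; rewrite !mxE; ring.
rewrite (@Cfubini _ _ E E R mu mu (fun p => expi (dotp x p.2) * (f (p.2 - p.1) * g p.1))); last first.
  have hp := Cintble_conv_prod hf hg.
  apply: (Cintble_dom _ (intbleZ 2 (intble_cn hp))).
    apply: CmeasurableM; last exact: Cintble_meas hp.
    exact: (Cmeasurable_comp measurable_snd mchar).
  by move=> p; apply: le_trans (cnM _ _) _; rewrite ler_wpM2r ?cn_ge0 ?cn_expi.
have := Cintble_prod_swap (Cintble_conv_prod hf hg) => hsw.
have hae : {ae mu, forall z, Cintble mu (fun y => f (z - y) * g y)}.
  have [h1 h2] := hsw.
  by apply: filterS2 (intble_section h1) (intble_section h2) => z ? ?; split.
apply: ae_eq_Cint.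
- apply: (@Cmeasurable_Cint _ _ E E R mu (fun z => expi (dotp x z.1) * (f (z.1 - z.2) * g z.2))).
  apply: CmeasurableM; first exact: (Cmeasurable_comp measurable_fst mchar).
  exact: Cintble_meas hsw.
- by apply: CmeasurableM => //; exact: Cmeasurable_conv.
- by apply: filterS hae => z hz /=; exact: (CintZ (expi (dotp x z)) hz).
Qed.

Lemma ifourier_swap (c f : E -> R[i]) : Cintble mu c -> Cintble mu f ->
  Cint mu (fun x => ifourier c x * f x) = Cint mu (fun z => c z * ifourier f z).
Proof.
move=> hc hf; have mc := Cintble_meas hc; have mf := Cintble_meas hf.
pose H (p : E * E) := expi (dotp p.1 p.2) * (f p.1 * c p.2).
have mH : Cmeasurable H.
  apply: CmeasurableM; last apply: CmeasurableM.
  - by apply: Cmeasurable_expi; apply: measurable_dotp; [exact: measurable_fst|exact: measurable_snd].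
  - exact: (Cmeasurable_comp measurable_fst mf).
  - exact: (Cmeasurable_comp measurable_snd mc).
have iH : Cintble (mu \x mu)%E H.
  pose G (p : E * E) := 2 * (cn (f p.1) * cn (c p.2)).
  apply: (Cintble_prod (F := G) (g := fun x => (2 * \int[mu]_y cn (c y)) * cn (f x))) => //.
  - apply: measurable_funM => //; apply: measurable_funM; apply: measurable_cn.
      exact: (Cmeasurable_comp measurable_fst mf).
    exact: (Cmeasurable_comp measurable_snd mc).
  - by apply: intbleZ; exact: intble_cn.
  - move=> p; apply: le_trans (cnM _ _) _; apply: ler_pM; rewrite ?cn_ge0 ?cn_expi//.
    exact: cnM.
  move=> x; rewrite (_ : (fun y => _) = fun y => (2 * cn (f x) * cn (c y))%:E); last first.
    by apply/funext => y; rewrite /G mulrA.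
  rewrite -[leLHS]/(\int[mu]_y (2 * cn (f x) * cn (c y))%:E)%E.
  rewrite integral_intble; last by apply: intbleZ; exact: intble_cn.
  rewrite Rintegral_scale; last exact: intble_cn.
  by rewrite lee_fin mulrAC.
transitivity ((cF R d)%:C * Cint mu (fun x => Cint mu (fun y => H (x, y)))).
  rewrite -CintZ; last exact: Cintble_Cint iH.
  apply: eq_Cint => x; rewrite ifourierE -mulrA; congr (_ * _).
  rewrite -CintZr; last exact: Cintble_char.
  by apply: eq_Cint => y; rewrite /H /=; ring.
rewrite Cfubini// -CintZ; last exact: (Cintble_Cint (Cintble_prod_swap iH)).
apply: eq_Cint => y; rewrite ifourierE mulrCA; congr (_ * _).
rewrite -CintZ; last exact: Cintble_char.
by apply: eq_Cint => x; rewrite /H /= dotpC; ring.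
Qed.

(** The multiplication formula [ifourier_swap] moves the transform from the product to the test
    function; the factor [cF] comes from the symmetric normalisation of [ifourier]. *)
Lemma dist_of_fun_mul f g : Cintble mu f -> Cintble mu g ->
  dist_of_fun (fun x => ifourier f x * ifourier g x) =
  dist_ifourier (fun z => (cF R d)%:C * convol f g z).
Proof.
move=> hf hg; apply/funext => h.
rewrite dist_ifourierE.
transitivity (Cint mu (fun x => ifourier (fun z => (cF R d)%:C * convol f g z) x * sval h x)).
  apply: eq_Cint => x; rewrite ifourier_mul//; congr (_ * _).
  rewrite !ifourierE mulrCA; congr (_ * _).
  rewrite -CintZ; last by apply: Cintble_char; exact: Cintble_conv.
  by apply: eq_Cint => y; ring.
apply: ifourier_swap; last exact: schwartz_Cintble.
by apply: CintbleZ; exact: Cintble_conv.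
Qed.

End convolution.

(** * Pointwise bounds by exponential weights *)

Section exponential_weights.
Context (R : realType) (d : nat).
Local Notation E := 'rV[R]_d.
Local Notation mu := (lebesgue_rV R d).
Implicit Types (f g : E -> R[i]) (w : R).

(* The exponential makes the weight submultiplicative under convolution, and the
   polynomial factor makes it integrable; hence [conv_bound]. *)
Definition wt w (x : E) : R := expR (- (w * n1 x)) * jw (2 * d) x.

Lemma wt_gt0 w x : 0 < wt w x.
Proof. by rewrite mulr_gt0 ?expR_gt0 ?jw_gt0. Qed.

Lemma wt_ge0 w x : 0 <= wt w x.
Proof. exact: ltW (wt_gt0 w x). Qed.

Lemma wtN w x : wt w (- x) = wt w x.
Proof. by rewrite /wt n1N jwN. Qed.

Lemma wt_le w w' x : w' <= w -> wt w x <= wt w' x.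
Proof.
move=> h; rewrite ler_wpM2r ?(ltW (jw_gt0 _ _))// ler_expR lerN2 ler_wpM2r ?n1_ge0//.
Qed.

Lemma wt_le_jw w x : 0 <= w -> wt w x <= jw (2 * d) x.
Proof.
move=> w0; rewrite ler_piMl ?(ltW (jw_gt0 _ _))// -expR0 ler_expR oppr_le0.
by rewrite mulr_ge0 ?n1_ge0.
Qed.

Lemma wt_split w w' x : wt (w + w') x = expR (- (w' * n1 x)) * wt w x.
Proof. by rewrite /wt mulrA -expRD; congr (expR _ * _); ring. Qed.

Lemma measurable_wt d' (T : measurableType d') (a : T -> R) (b : T -> E) :
  measurable_fun setT a -> measurable_fun setT b ->
  measurable_fun setT (fun x => wt (a x) (b x)).
Proof.
move=> ma mb; apply: measurable_funM; last exact: measurable_jw.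
apply: (measurableT_comp (@measurable_expR R)); apply: measurable_funN.
by apply: measurable_funM => //; exact: measurable_n1.
Qed.

Lemma intble_wt w : 0 <= w -> intble mu (wt w).
Proof.
move=> w0; apply: (intble_dom _ (intble_jw R d)).
  by apply: measurable_wt; [exact: measurable_cst|exact: measurable_id].
by move=> x; rewrite ger0_norm ?wt_ge0 ?wt_le_jw.
Qed.

(** The power of 2 is that of [jw_conv], and the factor 2 counts its two summands, which have the
    same integral. *)
Definition Cconv : R := 2 ^+ (2 * d) * (2 * \int[mu]_y jw (2 * d) y).

Lemma Cconv_ge0 : 0 <= Cconv.
Proof.
rewrite !mulr_ge0 ?exprn_ge0// Rintegral_ge0// => y _; exact: ltW (jw_gt0 _ _).
Qed.

Definition wbound (A w : R) f := Cmeasurable f /\ forall x, cn (f x) <= A * wt w x.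

Lemma wbound_ge0 A w f : wbound A w f -> 0 <= A.
Proof.
move=> [_ /(_ 0) h]; have := le_trans (cn_ge0 _) h.
by rewrite pmulr_lge0 ?wt_gt0.
Qed.

Lemma conv_dom A B w f g z : 0 <= w -> wbound A w f -> wbound B w g ->
  forall y, cn (f (z - y) * g y) <=
    A * B * 2 ^+ (2 * d) * wt w z * (jw (2 * d) (z - y) + jw (2 * d) y).
Proof.
move=> w0 hf hg y.
have A0 := wbound_ge0 hf; have B0 := wbound_ge0 hg.
case: hf hg => _ hf [_ hg].
apply: le_trans (cnM _ _) _.
apply: le_trans (ler_pM (cn_ge0 _) (cn_ge0 _) (hf _) (hg _)) _.
have h1 : expR (- (w * n1 (z - y)) + - (w * n1 y)) <= expR (- (w * n1 z)).
  rewrite ler_expR -opprD lerN2 -mulrDr ler_wpM2l//.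
  by have := n1D (z - y) y; rewrite subrK.
have h2 := jw_conv (2 * d) z y.
rewrite /wt; move: h1 h2; rewrite expRD.
have := expR_ge0 (- (w * n1 (z - y))); have := expR_ge0 (- (w * n1 y)).
have := ltW (jw_gt0 (2 * d) (z - y)); have := ltW (jw_gt0 (2 * d) y).
set a := jw _ (z - y); set b := jw _ y; set c := jw _ z.
set e1 := expR (- (w * n1 (z - y))); set e2 := expR (- (w * n1 y)).
move=> b0 a0 p2 p1 h1 h2.
rewrite [leLHS](_ : _ = A * B * (e1 * e2 * (a * b))); last by ring.
rewrite [leRHS](_ : _ =
  A * B * (expR (- (w * n1 z)) * (2 ^+ (2 * d) * c * (a + b)))); last by ring.
rewrite ler_wpM2l ?mulr_ge0//.
by apply: ler_pM => //; exact: mulr_ge0.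
Qed.

Lemma intble_conv_dom z : intble mu (fun y => jw (2 * d) (z - y) + jw (2 * d) y).
Proof. by apply: intbleD; [apply: intble_rev|]; exact: intble_jw. Qed.

Lemma Cintble_conv_integrand A B w f g z : 0 <= w -> wbound A w f -> wbound B w g ->
  Cintble mu (fun y => f (z - y) * g y).
Proof.
move=> w0 hf hg.
apply: (Cintble_dom _ (intbleZ _ (intble_conv_dom z)) (conv_dom z w0 hf hg)).
by case: hf hg => mf _ [mg _]; exact: Cmeasurable_conv_integrand.
Qed.

Lemma conv_bound A B w f g : 0 <= w -> wbound A w f -> wbound B w g ->
  wbound (A * B * Cconv) w (convol f g).
Proof.
move=> w0 hf hg; split.
  by case: hf hg => mf _ [mg _]; exact: Cmeasurable_conv.
move=> z; have mh : Cmeasurable (fun y : E => f (z - y) * g y).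
  by case: hf hg => mf _ [mg _]; exact: Cmeasurable_conv_integrand.
apply: le_trans (cn_Cint mh (intbleZ _ (intble_conv_dom z)) (conv_dom z w0 hf hg)) _.
rewrite Rintegral_scale; last exact: intble_conv_dom.
rewrite Rintegral_add; [|by apply: intble_rev; exact: intble_jw|exact: intble_jw].
rewrite Rintegral_rev; last exact: intble_meas (intble_jw R d).
by rewrite /Cconv le_eqVlt; apply/orP; left; apply/eqP; ring.
Qed.

Lemma wbound_Cintble A w f : 0 <= w -> wbound A w f -> Cintble mu f.
Proof. by move=> w0 [mf hf]; apply: (Cintble_dom mf (intbleZ A (intble_wt w0))). Qed.

(** Apply [1 + x <= expR x] to [x = y / m] and raise to the power [m]. Only the independence of the
    constant from [y] matters. *)
Lemma exp_poly_bound m (y : R) : 0 <= y -> (1 + y) ^+ m <= m.+1%:R ^+ m * expR y.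
Proof.
move=> y0; case: m => [|m].
  by rewrite !expr0 mul1r -expR0 ler_expR.
have h : 1 + y <= m.+2%:R * expR (y / m.+1%:R).
  apply: (@le_trans _ _ (m.+2%:R * (1 + y / m.+1%:R))); last first.
    by rewrite ler_wpM2l// expR_ge1Dx.
  rewrite mulrDr mulr1 lerD ?ler1n// mulrCA ler_peMr//.
  by rewrite ler_pdivlMr// mul1r ler_nat.
apply: (@le_trans _ _ ((m.+2%:R * expR (y / m.+1%:R)) ^+ m.+1)).
  by rewrite lerXn2r ?nnegrE ?addr_ge0// mulr_ge0// expR_ge0.
by rewrite exprMn -expRM_natl mulrCA divff ?mulr1// pnatr_eq0.
Qed.

Definition Kwt (s : R) : R :=
  (2 * pw s).+1%:R ^+ (2 * pw s) * \int[mu]_x jw (2 * d) x.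

Lemma Kwt_ge0 s : 0 <= Kwt s.
Proof.
by rewrite mulr_ge0 ?exprn_ge0// Rintegral_ge0// => y _; exact: ltW (jw_gt0 _ _).
Qed.

(** Squaring leaves at least one unit of exponential rate, which absorbs the polynomial bracket. A
    single bound of rate 1 therefore places [f] in all Sobolev spaces simultaneously. *)
Lemma wbound_sobolev_dom A f s x : wbound A 1 f ->
  bracket2 s x * sqmod (f x) <= (A ^+ 2 * (2 * pw s).+1%:R ^+ (2 * pw s)) * jw (2 * d) x.
Proof.
move=> hf; have A0 := wbound_ge0 hf; case: hf => _ /(_ x) hf.
have b0 := ltW (bracket2_gt0 s x); have n0 := n1_ge0 x.
have J0 := jw_gt0 (2 * d) x; have J1 := jw_le1 (2 * d) x.
have h1 : sqmod (f x) <= A ^+ 2 * (expR (- n1 x) * jw (2 * d) x).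
  apply: le_trans (sqmod_le_cn _) _.
  apply: (@le_trans _ _ ((A * wt 1 x) ^+ 2)).
    by apply: lerXn2r => //; rewrite nnegrE ?cn_ge0//; exact: mulr_ge0 A0 (wt_ge0 _ _).
  rewrite exprMn ler_wpM2l ?sqr_ge0// /wt mul1r expr2 mulrACA.
  rewrite -[leRHS]mul1r -[X in _ <= X]mulr1 [leRHS]mulr1 mul1r.
  apply: ler_pM; rewrite ?mulr_ge0 ?expR_ge0 ?(ltW J0)//.
    by rewrite ler_piMr ?expR_ge0// -expR0 ler_expR oppr_le0.
  by rewrite ler_piMr ?(ltW J0).
have h2 := le_trans (bracket2_le s x) (exp_poly_bound (2 * pw s) n0).
apply: le_trans (ler_pM b0 (sqmod_ge0 _) h2 h1) _.
rewrite [leLHS](_ : _ = A ^+ 2 * (2 * pw s).+1%:R ^+ (2 * pw s) * (jw (2 * d) x * (expR (n1 x) * expR (- n1 x)))); last by ring.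
by rewrite -expRD subrr expR0 mulr1.
Qed.

Lemma wbound_weighted A f s : wbound A 1 f -> weighted_L2 s f.
Proof.
move=> hf; have [mf _] := hf; apply: weighted_L2P => //.
apply: (intble_dom _ (intbleZ _ (intble_jw R d))).
  by apply: measurable_funM; [exact: measurable_bracket2|exact: measurable_sqmod].
move=> x; rewrite ger0_norm; first exact: (wbound_sobolev_dom s x hf).
by rewrite mulr_ge0 ?sqmod_ge0// ltW// bracket2_gt0.
Qed.

Lemma wbound_sobolev_norm A f s : wbound A 1 f ->
  sobolev_norm s (dist_ifourier f) ^+ 2 <= A ^+ 2 * Kwt s.
Proof.
move=> hf; have wf := wbound_weighted s hf.
rewrite (sqr_sobolev_norm_ifourier s wf).
apply: (@le_trans _ _ (\int[mu]_x ((A ^+ 2 * (2 * pw s).+1%:R ^+ (2 * pw s)) * jw (2 * d) x))).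
  apply: ler_Rintegral; first exact: weighted_intble wf.
    by apply: intbleZ; exact: intble_jw.
  by move=> x; exact: wbound_sobolev_dom.
by rewrite Rintegral_scale ?mulrA//; exact: intble_jw.
Qed.

Lemma wbound_weaken A w w' f : w' <= w -> wbound A w f -> wbound A w' f.
Proof.
move=> h hf; have A0 := wbound_ge0 hf; case: hf => mf hf; split => // x.
by apply: le_trans (hf x) _; rewrite ler_wpM2l// wt_le.
Qed.

Lemma wboundD A B w f g : wbound A w f -> wbound B w g ->
  wbound (A + B) w (fun x => f x + g x).
Proof.
move=> [mf hf] [mg hg]; split; first exact: CmeasurableD.
by move=> x; apply: le_trans (cnD _ _) _; rewrite mulrDl lerD.
Qed.

Lemma wbound_sharp A w f : wbound A w f -> wbound A w (sharp f).
Proof.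
move=> [mf hf]; split; first exact: Cmeasurable_sharp.
by move=> x; rewrite /sharp cn_cj -wtN.
Qed.

End exponential_weights.

(** * Duhamel integrals on the Fourier side *)

Section time_integrals.
Context (R : realType).
Local Notation lam := (@lebesgue_measure R).

Lemma Rintegral_itv (f : R -> R) (t : R) :
  \int[lam]_s (if 0 <= s <= t then f s else 0) = \int[lam]_(s in `[0, t]) f s.
Proof.
by rewrite [RHS]Rintegral_mkcond; apply: eq_Rintegral => s _; rewrite patchE mem_setE in_itv.
Qed.

Lemma Cint_itv (f : R -> R[i]) (t : R) :
  Cintegral lam `[0, t] f = Cint lam (fun s => if 0 <= s <= t then f s else 0).
Proof.
rewrite /Cint /Cintegral -!Rintegral_itv; congr (_ +i* _);
  by apply: eq_Rintegral => s _; case: ifP.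
Qed.

Lemma measurable_itvb d (T : measurableType d) (a b c : T -> R) :
  measurable_fun setT a -> measurable_fun setT b -> measurable_fun setT c ->
  measurable_fun setT (fun x => a x <= b x <= c x).
Proof.
by move=> ma mb mc; apply: measurable_and; exact: measurable_fun_ler.
Qed.

Lemma lebesgue_itvE (a b : R) : lam `[a, b]%classic = (if a < b then b - a else 0)%:E.
Proof. by have -> := lebesgue_measure_itv `[a, b]; rewrite /= lte_fin; case: ifP. Qed.

Lemma intble_itv (a b c : R) : intble lam (fun s => if a <= s <= b then c else 0).
Proof.
have h : intble lam (fun s => if a <= s <= b then 1 else 0).
  apply: intble_ge0P.
  - apply: measurable_fun_ifT; [|exact: measurable_cst|exact: measurable_cst].
    apply: measurable_itvb; [exact: measurable_cst|exact: measurable_id|exact: measurable_cst].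
  - by move=> s; case: ifP.
  have -> : (\int[lam]_s (if (a <= s <= b)%R then 1 else 0)%:E =
      \int[lam]_s (\1_(`[a, b]%classic) s)%:E)%E.
    by apply: eq_integral => s _; rewrite indicE mem_setE in_itv /=; case: ifP.
  have -> : (\int[lam]_s (\1_(`[a, b]%classic) s)%:E = lam `[a, b]%classic)%E.
    by rewrite integral_indic// setIT.
  by rewrite lebesgue_itvE ltry.
move: (intbleZ c h); congr intble; apply/funext => s.
by case: ifP; rewrite ?mulr1 ?mulr0.
Qed.

Lemma Rintegral_itv_cst (a b c : R) : a <= b ->
  \int[lam]_s (if a <= s <= b then c else 0) = c * (b - a).
Proof.
move=> ab; transitivity (\int[lam]_(s in `[a, b]) c).
  by rewrite [RHS]Rintegral_mkcond; apply: eq_Rintegral => s _; rewrite patchE mem_setE in_itv.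
rewrite Rintegral_cst//; congr (_ * _).
have -> : fine (lam `[a, b]%classic) = if a < b then b - a else 0 by rewrite lebesgue_itvE.
by move: ab; rewrite le_eqVlt => /orP[/eqP ->|->] //; rewrite ltxx subrr.
Qed.

Lemma intble_exp_itv (a W t c : R) : 0 <= a ->
  intble lam (fun s => if 0 <= s <= t then c * expR (- ((W - s) * a)) else 0).
Proof.
move=> a0; apply: (intble_dom _ (intble_itv 0 t (`|c| * expR (- ((W - t) * a))))).
  apply: measurable_fun_ifT; [|apply: measurable_funM => //|exact: measurable_cst].
    by apply: measurable_itvb; [exact: measurable_cst|exact: measurable_id|exact: measurable_cst].
  apply: (measurableT_comp (@measurable_expR R)); apply: measurable_funN.
  by apply: measurable_funM => //; apply: measurable_funB.
move=> s; case: ifP => [/andP[s0 st]|_]; last by rewrite normr0.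
rewrite normrM ler_wpM2l// ger0_norm ?expR_ge0// ler_expR lerN2 ler_wpM2r//.
by rewrite lerD2l lerN2.
Qed.

(** The part with the factor [a] is an exact derivative in [s] and integrates to at most the value
    at [t]; the other part is at most [t] times that value. Integration in time thus removes the
    factor [1 + a]. *)
Lemma Rintegral_exp_itv (a W t : R) : 0 <= a -> 0 <= t ->
  \int[lam]_s (if 0 <= s <= t then (1 + a) * expR (- ((W - s) * a)) else 0) <=
  (t + 1) * expR (- ((W - t) * a)).
Proof.
move=> a0 t0; have i1 := intble_exp_itv W t 1 a0; have i2 := intble_exp_itv W t a a0.
rewrite (_ : (\int[lam]_s _) =
  \int[lam]_s ((if 0 <= s <= t then 1 * expR (- ((W - s) * a)) else 0) +
               (if 0 <= s <= t then a * expR (- ((W - s) * a)) else 0))); last first.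
  by apply: eq_Rintegral => s _; case: ifP => _; [rewrite mulrDl|rewrite addr0].
rewrite Rintegral_add// [leRHS]mulrDl mul1r lerD//.
  apply: (@le_trans _ _ (\int[lam]_s (if 0 <= s <= t then expR (- ((W - t) * a)) else 0))).
    apply: ler_Rintegral => //; first exact: intble_itv.
    move=> s; case: ifP => // /andP[s0 st]; rewrite mul1r ler_expR lerN2 ler_wpM2r//.
    by rewrite lerD2l lerN2.
  by rewrite Rintegral_itv_cst// subr0 mulrC.
rewrite Rintegral_itv; move: t0; rewrite le_eqVlt => /orP[/eqP <-|t0].
  by rewrite set_itv1 Rintegral_set1 expR_ge0.
pose F (s : R) := expR (- ((W - s) * a)).
have DF (s : R) : is_derive s 1 F (a * expR (- ((W - s) * a))).
  have h := is_derive_affine s a (- (W * a)).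
  have [h1 h2] := @is_derive1_comp R expR (fun s : R => s * a + - (W * a)) s _ _ (is_derive_expR _) h.
  rewrite (_ : F = expR \o (fun s : R => s * a + - (W * a))); last first.
    by apply/funext => z; rewrite /F /=; congr expR; ring.
  split => //; rewrite h2 mulrC; congr (_ * expR _); ring.
have cF (s : R) : {for s, continuous F}.
  by apply: differentiable_continuous; apply/derivable1_diffP; have [] := DF s.
rewrite /Rintegral (@continuous_FTC2 R (fun s => a * expR (- ((W - s) * a))) F)//.
- by rewrite -EFinB /= /F gerBl expR_ge0.
- apply: continuous_subspaceT => s.
  by apply: cvgM; [exact: cvg_cst|exact: cF].
- split; [by move=> s _; have [] := DF s|apply: cvg_at_right_filter; exact: cF|].
  by apply: cvg_at_left_filter; exact: cF.
- by move=> s _; rewrite derive1E; have [_] := DF s.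
Qed.

End time_integrals.

Section duhamel_integral.
Context (R : realType) (d : nat).
Local Notation E := 'rV[R]_d.
Local Notation mu := (lebesgue_rV R d).
Local Notation lam := (@lebesgue_measure R).
Local Notation RE := (measurableTypeR R * E)%type.
Implicit Types (f g k : R -> E -> R[i]).

Definition jmeas f := Cmeasurable (fun p : RE => f p.1 p.2).

Lemma jmeas_comp dY (Y : measurableType dY) (a : Y -> measurableTypeR R) (b : Y -> E) f :
  measurable_fun setT a -> measurable_fun setT b -> jmeas f ->
  Cmeasurable (fun y => f (a y) (b y)).
Proof.
move=> ma mb mf; exact: (Cmeasurable_comp (measurable_fun_pair ma mb) mf).
Qed.

Lemma jmeas_section f t : jmeas f -> Cmeasurable (f t).
Proof.
by move=> mf; apply: (jmeas_comp (a := fun _ : E => t)) mf; [exact: measurable_cst|exact: measurable_id].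
Qed.

Lemma jmeas_conv f g : jmeas f -> jmeas g -> jmeas (fun t => convol (f t) (g t)).
Proof.
move=> mf mg.
apply: (@Cmeasurable_Cint _ _ RE E R mu (fun z => f z.1.1 (z.1.2 - z.2) * g z.1.1 z.2)).
have m1 : measurable_fun setT (fun z : RE * E => z.1.1).
  exact: (measurableT_comp measurable_fst measurable_fst).
have m2 : measurable_fun setT (fun z : RE * E => z.1.2).
  exact: (measurableT_comp measurable_snd measurable_fst).
apply: CmeasurableM.
  by apply: jmeas_comp mf => //; apply: measurable_rVB => //; exact: measurable_snd.
by apply: jmeas_comp mg => //; exact: measurable_snd.
Qed.

(** The time interval enters through a test in the integrand, so that [duh] integrates a jointly
    measurable function over the whole line. *)
Definition duh_integrand k f g t x (s : R) : R[i] :=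
  if 0 <= s <= t then k (t - s) x * convol (f s) (g s) x else 0.

Definition duh k f g t x := Cint lam (duh_integrand k f g t x).

Lemma Cmeasurable_duh_integrand k f g : jmeas k -> jmeas f -> jmeas g ->
  Cmeasurable (fun p : RE * measurableTypeR R => duh_integrand k f g p.1.1 p.1.2 p.2).
Proof.
move=> mk mf mg.
have m1 : measurable_fun setT (fun z : RE * measurableTypeR R => z.1.1).
  exact: (measurableT_comp measurable_fst measurable_fst).
have m2 : measurable_fun setT (fun z : RE * measurableTypeR R => z.1.2).
  exact: (measurableT_comp measurable_snd measurable_fst).
apply: Cmeasurable_if.
- by apply: measurable_itvb => //; exact: measurable_snd.
- apply: CmeasurableM; last first.
    exact: (jmeas_comp measurable_snd m2 (jmeas_conv mf mg)).
  by apply: jmeas_comp mk => //; apply: measurable_funB => //; exact: measurable_snd.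
- exact: Cmeasurable_cst.
Qed.

Lemma jmeas_duh k f g : jmeas k -> jmeas f -> jmeas g -> jmeas (duh k f g).
Proof.
move=> mk mf mg; have h := Cmeasurable_duh_integrand mk mf mg.
exact: (Cmeasurable_Cint _ h).
Qed.

Lemma Cmeasurable_duh_section k f g t x : jmeas k -> jmeas f -> jmeas g ->
  Cmeasurable (duh_integrand k f g t x).
Proof.
move=> mk mf mg; have h := Cmeasurable_duh_integrand mk mf mg.
apply: (Cmeasurable_comp (h := fun s : measurableTypeR R => ((t, x) : RE, s)) _ h).
by apply: measurable_fun_pair; [exact: measurable_cst|exact: measurable_id].
Qed.

(* The exponential rate [W - t] decreases with time: integrating in time gains the factor
   [1 + n1 x] (see [Rintegral_exp_itv]), which pays for the derivative in the wave kernel. *)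
Definition xbound (T W A : R) f := jmeas f /\
  forall t, 0 <= t <= T -> forall x, cn (f t x) <= A * wt (W - t) x.

(** The factor [1 + n1 x] is the growth that integration in time can pay for, and [rho] records what
    exceeds it: 1 for the kernels of [u] and [n], and [1 + n1] for that of the time derivative of
    [n]. *)
Definition kbound (C : R) (rho : E -> R) k := [/\ jmeas k, (forall x, 0 <= rho x) &
  forall t x, 0 <= t -> cn (k t x) <= C * (1 + n1 x) * rho x].

Section bounds.
Variables (T W : R).
Hypotheses (T0 : 0 <= T) (TW : T <= W).

Lemma xbound_wbound A f t : 0 <= t <= T -> xbound T W A f -> wbound A (W - t) (f t).
Proof. by move=> tT [mf hf]; split; [exact: jmeas_section|exact: hf]. Qed.

Lemma xbound_ge0 A f : xbound T W A f -> 0 <= A.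
Proof.
move=> h; have z : (0 : R) <= 0 <= T by rewrite lexx.
exact: wbound_ge0 (xbound_wbound z h).
Qed.

Lemma conv_xbound A B f g t x : xbound T W A f -> xbound T W B g -> 0 <= t <= T ->
  cn (convol (f t) (g t) x) <= A * B * Cconv R d * wt (W - t) x.
Proof.
move=> hf hg tT.
have w0 : 0 <= W - t by rewrite subr_ge0; case/andP: tT => _ /le_trans; apply.
by have [_] := conv_bound w0 (xbound_wbound tT hf) (xbound_wbound tT hg); exact.
Qed.

Definition duh_dom (C A B : R) (rho : E -> R) (t : R) (x : E) (s : R) : R :=
  (C * A * B * Cconv R d * rho x * jw (2 * d) x) *
  (if 0 <= s <= t then (1 + n1 x) * expR (- ((W - s) * n1 x)) else 0).

Lemma intble_duh_dom C A B rho t x : intble lam (duh_dom C A B rho t x).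
Proof. by apply: intbleZ; apply: intble_exp_itv; exact: n1_ge0. Qed.

Lemma duh_integrand_dom C rho A B k f g t x s :
  kbound C rho k -> xbound T W A f -> xbound T W B g -> t <= T ->
  cn (duh_integrand k f g t x s) <= duh_dom C A B rho t x s.
Proof.
move=> [_ _ hk] hf hg tT; rewrite /duh_integrand /duh_dom.
case: ifP => [/andP[s0 st]|_]; last by rewrite cn0 mulr0.
apply: le_trans (cnM _ _) _.
have sT : 0 <= s <= T by rewrite s0 (le_trans st).
have ts : 0 <= t - s by rewrite subr_ge0.
apply: le_trans (ler_pM (cn_ge0 _) (cn_ge0 _) (hk _ x ts) (conv_xbound x hf hg sT)) _.
by rewrite /wt le_eqVlt; apply/orP; left; apply/eqP; ring.
Qed.

Lemma Cintble_duh C rho A B k f g t x :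
  kbound C rho k -> xbound T W A f -> xbound T W B g -> t <= T ->
  Cintble lam (duh_integrand k f g t x).
Proof.
move=> hk hf hg tT.
apply: (Cintble_dom _ (intble_duh_dom C A B rho t x)).
  by case: hk hf hg => mk _ _ [mf _] [mg _]; exact: Cmeasurable_duh_section.
by move=> s; exact: duh_integrand_dom.
Qed.

Lemma Rintegral_duh_dom C rho A B k f g t x : 0 <= C ->
  kbound C rho k -> xbound T W A f -> xbound T W B g -> 0 <= t <= T ->
  \int[lam]_s duh_dom C A B rho t x s <=
  C * A * B * Cconv R d * (T + 1) * rho x * wt (W - t) x.
Proof.
move=> C0 hk hf hg /andP[t0 tT].
have [_ r0 _] := hk; have J0 := ltW (jw_gt0 (2 * d) x).
have A0 := xbound_ge0 hf; have B0 := xbound_ge0 hg.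
rewrite Rintegral_scale; last by apply: intble_exp_itv; exact: n1_ge0.
have := Rintegral_exp_itv W (n1_ge0 x) t0; set I := Rintegral _ _ _ => hI.
rewrite (_ : _ * wt _ _ = C * A * B * Cconv R d * rho x * jw (2 * d) x *
  ((T + 1) * expR (- ((W - t) * n1 x)))); last by rewrite /wt; ring.
move: (Cconv_ge0 R d); set c := Cconv R d; move: c => c c0.
apply: ler_wpM2l; first by rewrite !mulr_ge0.
apply: le_trans hI _; rewrite ler_wpM2r ?expR_ge0//; lra.
Qed.

Lemma duh_bound C rho A B k f g t x : 0 <= C ->
  kbound C rho k -> xbound T W A f -> xbound T W B g -> 0 <= t <= T ->
  cn (duh k f g t x) <= C * A * B * Cconv R d * (T + 1) * rho x * wt (W - t) x.
Proof.
move=> C0 hk hf hg tT; have [_ tT'] := andP tT.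
apply: le_trans (Rintegral_duh_dom x C0 hk hf hg tT).
apply: cn_Cint (intble_duh_dom C A B rho t x) _.
- by case: hk hf hg => mk _ _ [mf _] [mg _]; exact: Cmeasurable_duh_section.
- by move=> s; exact: duh_integrand_dom.
Qed.

Lemma duh_sub C rho A B A' B' k f g f' g' t x : 
  kbound C rho k -> xbound T W A f -> xbound T W B g ->
  xbound T W A' f' -> xbound T W B' g' -> 0 <= t <= T ->
  duh k f g t x - duh k f' g' t x =
  duh k (fun s y => f s y - f' s y) g t x + duh k f' (fun s y => g s y - g' s y) t x.
Proof.
move=> hk hf hg hf' hg' /andP[t0 tT].
have hff : xbound T W (A + A') (fun s y => f s y - f' s y).
  case: hf hf' => mf hf [mf' hf']; split; first exact: CmeasurableB.
  by move=> s sT y; apply: le_trans (cnB _ _) _; rewrite mulrDl lerD// ?hf ?hf'.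
have hgg : xbound T W (B + B') (fun s y => g s y - g' s y).
  case: hg hg' => mg hg [mg' hg']; split; first exact: CmeasurableB.
  by move=> s sT y; apply: le_trans (cnB _ _) _; rewrite mulrDl lerD// ?hg ?hg'.
rewrite /duh -[LHS](CintB (Cintble_duh x hk hf hg tT) (Cintble_duh x hk hf' hg' tT)).
rewrite -[RHS](CintD (Cintble_duh x hk hff hg tT) (Cintble_duh x hk hf' hgg tT)).
apply: eq_Cint => s; rewrite /duh_integrand.
case: ifP => [/andP[s0 st]|_]; last by rewrite subr0 addr0.
have sT : 0 <= s <= T by rewrite s0 (le_trans st).
have w0 : 0 <= W - s by rewrite subr_ge0; case/andP: sT => _ /le_trans; apply.
rewrite -mulrBr -mulrDr; congr (_ * _); rewrite /convol.
have wf := xbound_wbound sT hf; have wg := xbound_wbound sT hg.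
have wf' := xbound_wbound sT hf'; have wg' := xbound_wbound sT hg'.
have wff := xbound_wbound sT hff; have wgg := xbound_wbound sT hgg.
rewrite -[LHS](CintB (Cintble_conv_integrand x w0 wf wg) (Cintble_conv_integrand x w0 wf' wg')).
rewrite -[RHS](CintD (Cintble_conv_integrand x w0 wff wg) (Cintble_conv_integrand x w0 wf' wgg)).
by apply: eq_Cint => y; ring.
Qed.

Lemma duhZ C rho A B k f g (a b c : R[i]) t x :
  kbound C rho k -> xbound T W A f -> xbound T W B g -> 0 <= t <= T ->
  duh (fun s y => a * k s y) (fun s y => b * f s y) (fun s y => c * g s y) t x =
  a * b * c * duh k f g t x.
Proof.
move=> hk hf hg /andP[t0 tT].
rewrite /duh -(CintZ _ (Cintble_duh x hk hf hg tT)).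
apply: eq_Cint => s; rewrite /duh_integrand.
case: ifP => [/andP[s0 st]|_]; last by rewrite mulr0.
have sT : 0 <= s <= T by rewrite s0 (le_trans st).
have w0 : 0 <= W - s by rewrite subr_ge0; case/andP: sT => _ /le_trans; apply.
have -> : convol (fun y => b * f s y) (fun y => c * g s y) x = b * c * convol (f s) (g s) x.
  rewrite /convol -(CintZ _ (Cintble_conv_integrand x w0 (xbound_wbound sT hf) (xbound_wbound sT hg))).
  by apply: eq_Cint => y; ring.
by ring.
Qed.

End bounds.
End duhamel_integral.

(** * Picard iteration *)

Section geometric_limits.
Context (R : realType).
Local Notation q := (2^-1 : R).

Lemma expr_half_ge0 m : 0 <= q ^+ m.
Proof. by rewrite exprn_ge0// invr_ge0. Qed.

Lemma cvg_half (c : R) : (fun m => c * q ^+ m) @ \oo --> 0.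
Proof.
have half1 : `|q| < 1 by rewrite ger0_norm ?invr_ge0// invf_lt1// ltr1n.
rewrite -[X in _ --> X](mulr0 c); apply: cvgM; [exact: cvg_cst|exact: cvg_expr].
Qed.

Lemma cvg_geo (u : nat -> R) (l c : R) :
  (forall m, `|u m - l| <= c * q ^+ m) -> u @ \oo --> l.
Proof.
move=> h; apply/cvgrPdist_le => e e0.
move/cvgrPdist_le : (cvg_half c) => /(_ _ e0); apply: filterS => m.
rewrite sub0r normrN => hm; rewrite distrC.
by apply: le_trans (h m) (le_trans (ler_norm _) hm).
Qed.

Lemma geo_small (a c : R) : (forall m, a <= c * q ^+ m) -> a <= 0.
Proof.
move=> h; apply: (cvgr_to_ge (cvg_half c)).
by apply: nearW.
Qed.

(* [a m - 2 c 2^-m] increases and [a m + 2 c 2^-m] decreases. *)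
Lemma geo_limit (a : nat -> R) (c : R) : 0 <= c ->
  (forall m, `|a m.+1 - a m| <= c * q ^+ m) ->
  exists l, forall m, `|a m - l| <= 2 * c * q ^+ m.
Proof.
move=> c0 h; pose b m := a m - 2 * c * q ^+ m; pose t m := a m + 2 * c * q ^+ m.
have qS m : 2 * c * q ^+ m.+1 = c * q ^+ m.
  by rewrite exprS mulrACA mulrA divff ?mul1r// pnatr_eq0.
have bn : {homo b : n m / (n <= m)%N >-> n <= m}.
  apply/nondecreasing_seqP => m; rewrite /b qS.
  by have := h m; rewrite ler_norml => /andP[? _]; lra.
have tn : {homo t : n m / (n <= m)%N >-> n >= m}.
  apply/nonincreasing_seqP => m; rewrite /t qS.
  by have := h m; rewrite ler_norml => /andP[_ ?]; lra.
have bt m : b m <= t m.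
  rewrite /b /t lerD2l; apply: (@le_trans _ _ 0); first rewrite oppr_le0.
    by rewrite !mulr_ge0// expr_half_ge0.
  by rewrite !mulr_ge0// expr_half_ge0.
have bc : cvgn b.
  apply: (nondecreasing_is_cvgn bn); exists (t 0%N) => _ [m _ <-].
  by apply: le_trans (bt m) (tn _ _ (leq0n m)).
exists (limn b) => m; rewrite ler_norml.
have h1 := nondecreasing_cvgn_le bn bc m.
have h2 : limn b <= t m.
  apply: limr_le => //; exists m => // j /= mj.
  by apply: le_trans (bt j) (tn _ _ mj).
by apply/andP; split; move: h1 h2; rewrite /b /t => h1 h2; lra.
Qed.

Lemma cReB (z w : R[i]) : complex.Re (z - w) = complex.Re z - complex.Re w.
Proof. by rewrite !RI. Qed.

Lemma cImB (z w : R[i]) : complex.Im (z - w) = complex.Im z - complex.Im w.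
Proof. by rewrite !RI. Qed.

Lemma cjB (z w : R[i]) : cj (z - w) = cj z - cj w.
Proof. by rewrite cjD; congr (_ + _); case: w => a b; apply: complex_ext. Qed.

Lemma Cgeo_limit (a : nat -> R[i]) (c : R) : 0 <= c ->
  (forall m, cn (a m.+1 - a m) <= c * q ^+ m) ->
  exists l, forall m, cn (a m - l) <= 4 * c * q ^+ m.
Proof.
move=> c0 h.
have [|l1 h1] := @geo_limit (fun m => complex.Re (a m)) c c0.
  by move=> m; rewrite -cReB; exact: le_trans (ler_Re_cn _) (h m).
have [|l2 h2] := @geo_limit (fun m => complex.Im (a m)) c c0.
  by move=> m; rewrite -cImB; exact: le_trans (ler_Im_cn _) (h m).
exists (l1 +i* l2) => m; rewrite /cn cReB cImB /=.
apply: (le_trans (lerD (h1 m) (h2 m))).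
by rewrite -!mulrA -mulrDl; move: (c * _) => z; lra.
Qed.

End geometric_limits.

(** * Dependence of Duhamel integrals on their arguments and on time *)

Section duhamel_estimates.
Context (R : realType) (d : nat).
Local Notation E := 'rV[R]_d.
Local Notation mu := (lebesgue_rV R d).
Local Notation lam := (@lebesgue_measure R).
Implicit Types (f g k : R -> E -> R[i]).

Definition sharpt f (t : R) : E -> R[i] := sharp (f t).

Lemma jmeas_sharpt f : jmeas f -> jmeas (sharpt f).
Proof.
move=> mf; apply: Cmeasurable_cj; apply: jmeas_comp mf; first exact: measurable_fst.
by apply: measurable_rVN; exact: measurable_snd.
Qed.

Lemma xbound_sharpt (T W A : R) f : xbound T W A f -> xbound T W A (sharpt f).
Proof.
move=> [mf hf]; split; first exact: jmeas_sharpt.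
by move=> t tT x; rewrite /sharpt /sharp cn_cj -wtN hf.
Qed.

Lemma sharptB f g : sharpt (fun s y => f s y - g s y) =
  fun s y => sharpt f s y - sharpt g s y.
Proof.
by apply/funext => s; apply/funext => y; rewrite /sharpt /sharp cjB.
Qed.

Section bounds.
Variables (T W : R).
Hypotheses (T0 : 0 <= T) (TW : T <= W).

Definition Kduh (C : R) : R := C * Cconv R d * (T + 1).

Lemma Kduh_ge0 C : 0 <= C -> 0 <= Kduh C.
Proof. rewrite /Kduh; have := Cconv_ge0 R d; move: (Cconv R d) => c c0 C0.
by rewrite !mulr_ge0// addr_ge0. Qed.

Lemma duh_diff_bound C rho A B A' B' a b k f g f' g' t x : 0 <= C ->
  kbound C rho k -> xbound T W A f -> xbound T W B g ->
  xbound T W A' f' -> xbound T W B' g' ->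
  xbound T W a (fun s y => f s y - f' s y) ->
  xbound T W b (fun s y => g s y - g' s y) -> 0 <= t <= T ->
  cn (duh k f g t x - duh k f' g' t x) <=
    Kduh C * (a * B + A' * b) * rho x * wt (W - t) x.
Proof.
move=> C0 hk hf hg hf' hg' ha hb tT.
rewrite (duh_sub TW x hk hf hg hf' hg' tT).
apply: (le_trans (cnD _ _)).
apply: (le_trans (lerD (duh_bound T0 TW x C0 hk ha hg tT) (duh_bound T0 TW x C0 hk hf' hb tT))).
by rewrite le_eqVlt /Kduh; apply/orP; left; apply/eqP; ring.
Qed.

Definition klip (C : R) (m : nat) k := [/\ jmeas k,
  (forall t x, 0 <= t -> cn (k t x) <= C * (1 + n1 x) ^+ m) &
  (forall s t x, 0 <= s -> s <= t -> cn (k t x - k s x) <= C * (1 + n1 x) ^+ m * (t - s))].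

Lemma wt2_poly m (x : E) : (1 + n1 x) ^+ m * wt 2 x <= m.+1%:R ^+ m * wt 1 x.
Proof.
rewrite (_ : 2 = 1 + 1 :> R)// wt_split mulrA; apply: ler_wpM2r; first exact: wt_ge0.
rewrite mul1r; apply: (le_trans (ler_wpM2r (expR_ge0 _) (exp_poly_bound m (n1_ge0 x)))).
by rewrite -mulrA -expRD subrr expR0 mulr1.
Qed.

(** The difference consists of the change of the kernel over [[0, s]] and of the new slice [[s, t]],
    both linear in [t - s]. Of the two units of rate that are left at time [T], one absorbs the
    polynomial growth of the kernel and one survives in the bound. *)
Lemma duh_lipschitz C m A B k f g : T + 2 <= W -> 0 <= C -> klip C m k ->
  xbound T W A f -> xbound T W B g ->
  exists2 M, 0 <= M & forall s t x, 0 <= s -> s <= t -> t <= T ->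
    cn (duh k f g t x - duh k f g s x) <= M * (t - s) * wt 1 x.
Proof.
move=> TW2 C0 [mk hk1 hk2] hf hg.
pose D := A * B * Cconv R d.
have D0 : 0 <= D by apply: mulr_ge0 (Cconv_ge0 R d); exact: mulr_ge0 (xbound_ge0 T0 hf) (xbound_ge0 T0 hg).
pose P (x : E) : R := C * D * (m.+1%:R ^+ m * wt 1 x).
have P0 x : 0 <= P x.
  by apply: mulr_ge0; [exact: mulr_ge0|apply: mulr_ge0 (wt_ge0 _ _); exact: exprn_ge0].
exists (C * D * m.+1%:R ^+ m * (T + 1)).
  apply: mulr_ge0; last exact: addr_ge0.
  by apply: mulr_ge0; [exact: mulr_ge0|exact: exprn_ge0].
move=> s t x s0 st tT.
have t0 := le_trans s0 st; have sT := le_trans st tT.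
have hc r : 0 <= r <= T -> C * (1 + n1 x) ^+ m * cn (convol (f r) (g r) x) <= P x.
  move=> rT; have h := conv_xbound TW x hf hg rT.
  rewrite /P -[leRHS]mulrA -[leLHS]mulrA; apply: ler_wpM2l => //.
  apply: (@le_trans _ _ ((1 + n1 x) ^+ m * (D * wt (W - r) x))).
    by rewrite ler_wpM2l ?exprn_ge0 ?addr_ge0 ?n1_ge0.
  rewrite mulrCA ler_wpM2l//; apply: le_trans (wt2_poly m x).
  rewrite ler_wpM2l ?exprn_ge0 ?addr_ge0 ?n1_ge0// wt_le//.
  by case/andP: rT => _ rT; lra.
have m1 := Cmeasurable_duh_section t x mk hf.1 hg.1.
have m2 := Cmeasurable_duh_section s x mk hf.1 hg.1.
pose G (r : R) := (if 0 <= r <= s then P x * (t - s) else 0) + (if s <= r <= t then P x else 0).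
have iG : intble lam G by apply: intbleD; exact: intble_itv.
have hG r : cn (duh_integrand k f g t x r - duh_integrand k f g s x r) <= G r.
  rewrite /duh_integrand /G.
  have [r0|r0] := leP 0 r => /=; last first.
    rewrite subrr cn0 add0r; by case: ifP => // _; exact: P0.
  have [rs|rs] := leP r s => /=.
    rewrite (le_trans rs st) -mulrBl; apply: le_trans (cnM _ _) _.
    apply: (@le_trans _ _ (P x * (t - s))).
      have sr : 0 <= s - r by rewrite subr_ge0.
      have tr : s - r <= t - r by rewrite lerD2r.
      apply: le_trans (ler_wpM2r (cn_ge0 _) (hk2 _ _ x sr tr)) _.
      rewrite opprB addrA subrK mulrAC ler_wpM2r ?subr_ge0//; apply: hc.
      by rewrite r0 (le_trans rs).
    by rewrite lerDl; case: ifP => // _; exact: P0.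
  rewrite (ltW rs) /= subr0 add0r; case: ifP => [rt|_]; last by rewrite cn0.
  apply: le_trans (cnM _ _) _.
  have tr : 0 <= t - r by rewrite subr_ge0.
  apply: le_trans (ler_wpM2r (cn_ge0 _) (hk1 _ x tr)) _.
  by apply: hc; rewrite r0 (le_trans rt).
have iD r0 : r0 <= T -> Cmeasurable (duh_integrand k f g r0 x : measurableTypeR R -> R[i]) -> Cintble lam (duh_integrand k f g r0 x).
  move=> r0T mr; apply: (Cintble_dom mr (intble_itv 0 r0 (P x))) => r.
  rewrite /duh_integrand; case: ifP => [/andP[r1 r2]|_]; last by rewrite cn0.
  apply: le_trans (cnM _ _) _.
  have tr : 0 <= r0 - r by rewrite subr_ge0.
  apply: le_trans (ler_wpM2r (cn_ge0 _) (hk1 _ x tr)) _.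
  by apply: hc; rewrite r1 (le_trans r2).
rewrite /duh -[X in cn X](CintB (iD t tT m1) (iD s sT m2)).
apply: (le_trans (cn_Cint (mu := lam) (CmeasurableB m1 m2) iG hG)).
rewrite Rintegral_add; [|exact: intble_itv|exact: intble_itv].
rewrite !Rintegral_itv_cst// subr0.
rewrite (_ : _ * wt 1 x = P x * (t - s) * T + P x * (t - s)); last by rewrite /P; ring.
by rewrite lerD2r ler_wpM2l// mulr_ge0// subr_ge0.
Qed.

End bounds.
End duhamel_estimates.

(** * The Picard iterates and their limit *)

Section picard.
Context (R : realType) (d : nat).
Local Notation E := 'rV[R]_d.
Local Notation q := (2^-1 : R).
Variables (T W C A : R) (k1 k2 Lu Ln : R -> E -> R[i]).
Hypotheses (T0 : 0 <= T) (TW : T <= W) (C0 : 0 <= C).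
Hypotheses (hk1 : kbound C (fun=> 1) k1) (hk2 : kbound C (fun=> 1) k2).
Hypotheses (hLu : xbound T W A Lu) (hLn : xbound T W A Ln).
Local Notation D := (Kduh d T C).
(** Used twice: the quadratic term, at most [4 * D * A * A], does not exceed [A], so the bound
    [2 * A] is preserved; and differences of iterates are multiplied by at most [4 * D * A], that is
    by 1/2. *)
Hypothesis small : 8 * D * A <= 1.

Let A0 : 0 <= A := xbound_ge0 T0 hLu.
Let D0 : 0 <= D := Kduh_ge0 d T0 C0.

(** Outside [[0, T]] nothing bounds the iterates. Setting them to 0 there makes them converge at
    every time, so that the limit is jointly measurable. *)
Definition cut (f : R -> E -> R[i]) (t : R) (x : E) : R[i] :=
  if 0 <= t <= T then f t x else 0.

Lemma jmeas_cut f : jmeas f -> jmeas (cut f).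
Proof.
move=> mf; apply: Cmeasurable_if; [|exact: mf|exact: Cmeasurable_cst].
by apply: measurable_itvb; [exact: measurable_cst|exact: measurable_fst|exact: measurable_cst].
Qed.

Definition rhs1 (u n : R -> E -> R[i]) t x := Lu t x + duh k1 u n t x.
Definition rhs2 (u : R -> E -> R[i]) t x := Ln t x + duh k2 u (sharpt u) t x.

Fixpoint picard m : (R -> E -> R[i]) * (R -> E -> R[i]) :=
  if m is p.+1 then
    (cut (rhs1 (picard p).1 (picard p).2), cut (rhs2 (picard p).1))
  else (fun _ _ => 0, fun _ _ => 0).

Lemma xbound_rhs k L u n B : kbound C (fun=> 1) k -> xbound T W A L ->
  xbound T W (2 * A) u -> xbound T W (2 * A) n -> B = 2 * A ->
  xbound T W B (cut (fun t x => L t x + duh k u n t x)).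
Proof.
move=> hk hL hu hn ->; have [mk _ _] := hk; split.
  by apply: jmeas_cut; apply: CmeasurableD; [exact: hL.1|exact: (jmeas_duh mk hu.1 hn.1)].
move=> t tT x; rewrite /cut tT; apply: le_trans (cnD _ _) _.
apply: (le_trans (lerD (hL.2 _ tT x) (duh_bound T0 TW x C0 hk hu hn tT))).
rewrite mulr1 -mulrDl ler_wpM2r ?wt_ge0// mulr_natl mulr2n lerD2l.
rewrite (_ : _ * (T + 1) = 4 * D * A * A); last by rewrite /Kduh; ring.
by rewrite ler_piMl//; move: small; nra.
Qed.

Lemma xbound_zero B : 0 <= B -> xbound T W B (fun _ (_ : E) => 0).
Proof.
move=> B0; split; first exact: Cmeasurable_cst.
by move=> t _ x; rewrite cn0 mulr_ge0// wt_ge0.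
Qed.

Lemma xbound_picard m : xbound T W (2 * A) (picard m).1 /\ xbound T W (2 * A) (picard m).2.
Proof.
elim: m => [|m [h1 h2]] /=.
  by split; apply: xbound_zero; rewrite mulr_ge0.
by split; apply: xbound_rhs => //; exact: xbound_sharpt.
Qed.

Let qm_ge0 m : 0 <= 2 * A * q ^+ m.
Proof. by rewrite !mulr_ge0 ?expr_half_ge0. Qed.

Lemma picard_step k L u u' n n' e : kbound C (fun=> 1) k -> xbound T W A L ->
  xbound T W (2 * A) u -> xbound T W (2 * A) n ->
  xbound T W (2 * A) u' -> xbound T W (2 * A) n' ->
  xbound T W e (fun s y => u s y - u' s y) -> xbound T W e (fun s y => n s y - n' s y) ->
  xbound T W (e / 2) (fun s y => cut (fun t x => L t x + duh k u n t x) s y -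
                                 cut (fun t x => L t x + duh k u' n' t x) s y).
Proof.
move=> hk hL hu hn hu' hn' heu hen.
have e0 := xbound_ge0 T0 heu.
split.
  apply: CmeasurableB; [exact: (xbound_rhs hk hL hu hn erefl).1|].
  exact: (xbound_rhs hk hL hu' hn' erefl).1.
move=> t tT x; rewrite /cut tT opprD addrACA subrr add0r.
apply: (le_trans (duh_diff_bound T0 TW x C0 hk hu hn hu' hn' heu hen tT)).
rewrite mulr1 ler_wpM2r ?wt_ge0//.
rewrite (_ : _ * (_ + _) = (4 * D * A) * e); last by ring.
rewrite mulrC ler_wpM2l//; move: small; lra.
Qed.

Lemma picard_diff m :
  xbound T W (2 * A * q ^+ m) (fun s y => (picard m.+1).1 s y - (picard m).1 s y) /\
  xbound T W (2 * A * q ^+ m) (fun s y => (picard m.+1).2 s y - (picard m).2 s y).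
Proof.
elim: m => [|m [h1 h2]].
  rewrite expr0 mulr1; have [a1 a2] := xbound_picard 1.
  split; [move: a1|move: a2]; congr (xbound T W _ _);
    by apply/funext => s; apply/funext => y; rewrite subr0.
have [a1 a2] := xbound_picard m; have [b1 b2] := xbound_picard m.+1.
rewrite exprSr mulrA; split; first exact: (picard_step hk1 hLu b1 b2 a1 a2 h1 h2).
have h3 := xbound_sharpt h1; rewrite sharptB in h3.
exact: (picard_step hk2 hLn b1 (xbound_sharpt b1) a1 (xbound_sharpt a1) h1 h3).
Qed.

Lemma cut_out f t x : ~~ (0 <= t <= T) -> cut f t x = 0.
Proof. by rewrite /cut => /negbTE ->. Qed.

(** [sel] is one of the two projections, so that one argument serves both unknowns. The limit is
    chosen pointwise, and the uniform geometric rate passes to it. *)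
Lemma picard_limit (sel : (R -> E -> R[i]) * (R -> E -> R[i]) -> R -> E -> R[i]) :
  (forall m, xbound T W (2 * A) (sel (picard m))) ->
  (forall m, xbound T W (2 * A * q ^+ m)
      (fun s y => sel (picard m.+1) s y - sel (picard m) s y)) ->
  (forall m t x, ~~ (0 <= t <= T) -> sel (picard m) t x = 0) ->
  exists f, xbound T W (2 * A) f /\
    forall m, xbound T W (8 * A * q ^+ m) (fun s y => sel (picard m) s y - f s y).
Proof.
move=> hb hd ho.
have hex (p : R * E) : exists l, forall m,
    cn (sel (picard m) p.1 p.2 - l) <= 8 * A * q ^+ m * wt (W - p.1) p.2.
  case: p => t x /=.
  have [||l hl] := @Cgeo_limit _ (fun m => sel (picard m) t x) (2 * A * wt (W - t) x).
  - by apply: mulr_ge0 (wt_ge0 _ _); exact: mulr_ge0.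
  - move=> m; rewrite mulrAC; case: (boolP (0 <= t <= T)) => tT; first exact: (hd m).2.
    by rewrite !ho// subrr cn0 mulr_ge0// wt_ge0.
  exists l => m; apply: le_trans (hl m) _.
  by rewrite le_eqVlt; apply/orP; left; apply/eqP; ring.
have [F hF] := choice hex.
have mF : Cmeasurable (F : measurableTypeR R * E -> R[i]).
  split.
    apply: (@measurable_fun_cvg _ _ _ _ (fun m p => complex.Re (sel (picard m) p.1 p.2))).
      by move=> m; have [[]] := hb m.
    move=> p _; apply: (@cvg_geo _ _ _ (8 * A * wt (W - p.1) p.2)) => m.
    by rewrite -cReB mulrAC; apply: le_trans (ler_Re_cn _) (hF p m).
  apply: (@measurable_fun_cvg _ _ _ _ (fun m p => complex.Im (sel (picard m) p.1 p.2))).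
    by move=> m; have [[]] := hb m.
  move=> p _; apply: (@cvg_geo _ _ _ (8 * A * wt (W - p.1) p.2)) => m.
  by rewrite -cImB mulrAC; apply: le_trans (ler_Im_cn _) (hF p m).
pose f t x := F (t, x).
have jf : jmeas f.
  by move: mF; rewrite /jmeas /f; congr Cmeasurable; apply/funext => -[].
exists f; split; first split => //.
  move=> t tT x; rewrite -subr_le0; apply: (@geo_small _ _ (8 * A * wt (W - t) x)) => m.
  have h1 := hF (t, x) m; have h2 := (hb m).2 t tT x.
  have h3 := cnB (sel (picard m) t x) (sel (picard m) t x - F (t, x)).
  move: h3; rewrite opprB addrC subrK => h3.
  rewrite lerBlDr mulrAC /f; apply: le_trans h3 _.
  by rewrite addrC; apply: lerD.
move=> m; split; first by apply: CmeasurableB => //; exact: (hb m).1.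
by move=> t _ x; exact: (hF (t, x) m).
Qed.

(** The defect in the equation is at most a constant times [2^-m] for every [m]. The factors [a] and
    [b] are kept general because the first equation multiplies [u] by [n] and the second [u] by its
    conjugate. *)
Lemma limit_solves k L (a b : nat -> R -> E -> R[i]) u n v (v' : nat -> R -> E -> R[i]) :
  kbound C (fun=> 1) k -> xbound T W A L ->
  (forall m, xbound T W (2 * A) (a m)) -> (forall m, xbound T W (2 * A) (b m)) ->
  xbound T W (2 * A) u -> xbound T W (2 * A) n ->
  (forall m, xbound T W (8 * A * q ^+ m) (fun s y => a m s y - u s y)) ->
  (forall m, xbound T W (8 * A * q ^+ m) (fun s y => b m s y - n s y)) ->
  (forall m, xbound T W (8 * A * q ^+ m) (fun s y => v' m s y - v s y)) ->
  (forall m, v' m.+1 = cut (fun t x => L t x + duh k (a m) (b m) t x)) ->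
  forall t x, 0 <= t <= T -> v t x = L t x + duh k u n t x.
Proof.
move=> hk hL ha hb hu hn hau hbn hv' ev t x tT.
apply: subr0_eq; apply: cn_eq0.
apply: (@geo_small _ _ (16 * A * wt (W - t) x)) => m.
have h1 := (hv' m.+1).2 t tT x; rewrite ev /cut tT in h1.
have h2 := duh_diff_bound T0 TW x C0 hk (ha m) (hb m) hu hn (hau m) (hbn m) tT.
set z := duh k (a m) (b m) t x in h1 h2 *; set w := duh k u n t x in h2 *.
have -> : v t x - (L t x + w) = (z - w) - (L t x + z - v t x) by ring.
apply: le_trans (cnB _ _) _; apply: (le_trans (lerD h2 h1)).
rewrite exprS; move: (wt_ge0 (W - t) x) (expr_half_ge0 R m).
set w' := wt _ _; set p := q ^+ m => w0 p0.
rewrite [leLHS](_ : _ = (4 * (8 * D * A) + 4) * (A * p * w')); last first.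
  have -> : 8 * A * (q * p) = 4 * A * p by field.
  by ring.
rewrite [leRHS](_ : _ = 16 * (A * p * w')); last by ring.
apply: ler_wpM2r; first by apply: mulr_ge0 => //; exact: mulr_ge0.
by move: small; set X := 8 * _ * _ => hX; lra.
Qed.

Lemma picard_solution : exists u n, [/\ xbound T W (2 * A) u, xbound T W (2 * A) n,
  (forall t x, 0 <= t <= T -> u t x = Lu t x + duh k1 u n t x) &
  (forall t x, 0 <= t <= T -> n t x = Ln t x + duh k2 u (sharpt u) t x)].
Proof.
have [u [hu du]] := @picard_limit fst (fun m => (xbound_picard m).1)
  (fun m => (picard_diff m).1) (fun m t x h => match m with 0%N => erefl | p.+1 => cut_out _ _ h end).
have [n [hn dn]] := @picard_limit snd (fun m => (xbound_picard m).2)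
  (fun m => (picard_diff m).2) (fun m t x h => match m with 0%N => erefl | p.+1 => cut_out _ _ h end).
exists u, n; split => //.
  apply: (@limit_solves k1 Lu (fun m => (picard m).1) (fun m => (picard m).2) u n u
    (fun m => (picard m).1)) => //; by move=> m; have [] := xbound_picard m.
apply: (@limit_solves k2 Ln (fun m => (picard m).1) (fun m => sharpt (picard m).1) u (sharpt u) n
    (fun m => (picard m).2)) => //.
- by move=> m; have [] := xbound_picard m.
- by move=> m; apply: xbound_sharpt; have [] := xbound_picard m.
- exact: xbound_sharpt.
- by move=> m; rewrite -sharptB; exact: xbound_sharpt.
Qed.

End picard.

(** * The explicit local solution *)

Section multipliers.
Context (R : realType) (d : nat).
Local Notation E := 'rV[R]_d.
Local Notation mu := (lebesgue_rV R d).
Implicit Types (m k f : R -> E -> R[i]) (g : E -> R[i]).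

Lemma lipschitz_of_derive (f df : R -> R) (a b : R) :
  (forall x : R, is_derive x 1 f (df x)) -> (forall x, `|df x| <= 1) ->
  `|f a - f b| <= `|a - b|.
Proof.
move=> Df df1.
have cf (x : R) : {for x, continuous f}.
  by apply: differentiable_continuous; apply/derivable1_diffP; have [] := Df x.
have key (u v : R) : u <= v -> `|f v - f u| <= `|v - u|.
  move=> uv; have [|c _ ->] := @MVT_segment R f df u v uv (fun x _ => Df x).
    by apply: continuous_subspaceT => x; exact: cf.
  by rewrite normrM ler_piMl.
case: (leP a b) => [|/ltW] h; last exact: key.
by rewrite distrC [leRHS]distrC; exact: key.
Qed.

Lemma sin_lip (a b : R) : `|sin a - sin b| <= `|a - b|.
Proof.
apply: (@lipschitz_of_derive _ cos) => x; rewrite ler_norml.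
by rewrite cos_geN1 cos_le1.
Qed.

Lemma cos_lip (a b : R) : `|cos a - cos b| <= `|a - b|.
Proof.
apply: (@lipschitz_of_derive _ (fun x => - sin x)) => x; rewrite normrN ler_norml.
by rewrite sin_geN1 sin_le1.
Qed.

Lemma cos_norm_le1 (a : R) : `|cos a| <= 1.
Proof. by rewrite ler_norml cos_geN1 cos_le1. Qed.

Lemma sin_norm_le1 (a : R) : `|sin a| <= 1.
Proof. by rewrite ler_norml sin_geN1 sin_le1. Qed.

Definition mS (t : R) (x : E) : R[i] := expi (- (t * enorm x ^+ 2)).
Definition mC (t : R) (x : E) : R[i] := (cos (t * enorm x))%:C.
Definition mW (t : R) (x : E) : R[i] :=
  (sin (t * enorm x) / enorm x)%:C * (- enorm x ^+ 2)%:C.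
Definition mN (t : R) (x : E) : R[i] := mC t x * (- enorm x ^+ 2)%:C.

(** Cancelling the quotient is also correct at frequency 0, where both sides vanish. *)
Lemma mWE t (x : E) : mW t x = (- (enorm x * sin (t * enorm x)))%:C.
Proof.
rewrite /mW -[LHS]/((_ +i* _) * (_ +i* _)) ; apply: complex_ext; rewrite RI /=; last by ring.
have [->|h] := eqVneq (enorm x) 0; first by rewrite mulr0 sin0; ring.
by field.
Qed.

Lemma mNE t (x : E) : mN t x = (- (enorm x ^+ 2 * cos (t * enorm x)))%:C.
Proof. by apply: complex_ext; rewrite RI /=; ring. Qed.

Let menorm : measurable_fun setT (fun p : measurableTypeR R * E => enorm p.2).
Proof. by apply: measurable_enorm; exact: measurable_snd. Qed.

Let mtenorm : measurable_fun setT (fun p : measurableTypeR R * E => p.1 * enorm p.2).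
Proof. by apply: measurable_funM => //; exact: measurable_fst. Qed.

Lemma jmeas_mS : jmeas mS.
Proof.
apply: Cmeasurable_expi; apply: measurable_funN; apply: measurable_funM.
  exact: measurable_fst.
exact: measurable_funX.
Qed.

Lemma jmeas_mC : jmeas mC.
Proof. by apply: Cmeasurable_real; exact: (measurableT_comp (@measurable_cos R) mtenorm). Qed.

Lemma jmeas_mW : jmeas mW.
Proof.
rewrite /jmeas; under eq_fun do rewrite mWE.
apply: Cmeasurable_real; apply: measurable_funN; apply: measurable_funM => //.
exact: (measurableT_comp (@measurable_sin R) mtenorm).
Qed.

Lemma jmeas_mN : jmeas mN.
Proof.
rewrite /jmeas; under eq_fun do rewrite mNE.
apply: Cmeasurable_real; apply: measurable_funN; apply: measurable_funM.
  exact: measurable_funX.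
exact: (measurableT_comp (@measurable_cos R) mtenorm).
Qed.

Lemma enorm_le_J (x : E) : enorm x <= 1 + n1 x.
Proof. by apply: le_trans (enorm_le_n1 x) _; rewrite lerDr. Qed.

Lemma J_ge1 (x : E) : 1 <= 1 + n1 x.
Proof. by rewrite lerDl n1_ge0. Qed.

Lemma enormX_le (i j : nat) (x : E) : (i <= j)%N -> enorm x ^+ i <= (1 + n1 x) ^+ j.
Proof.
move=> ij; apply: (@le_trans _ _ ((1 + n1 x) ^+ i)); last by rewrite ler_weXn2l// J_ge1.
by apply: lerXn2r (enorm_le_J x); rewrite nnegrE ?enorm_ge0 ?addr_ge0 ?n1_ge0.
Qed.

(** The exponent 3, common to the four kernels, is dictated by [mN], whose time derivative grows
    like the cube of the frequency. *)
Lemma klip_mS : klip 2 3 mS.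
Proof.
split; first exact: jmeas_mS.
  move=> t x _; apply: (le_trans (cn_expi _)).
  by rewrite ler_peMr// exprn_ege1// J_ge1.
move=> s t x s0 st; rewrite /mS /cn cReB cImB /=.
apply: (le_trans (lerD (cos_lip _ _) (sin_lip _ _))).
rewrite -opprD normrN -mulrBl normrM (ger0_norm (sqr_ge0 _)) ger0_norm ?subr_ge0//.
rewrite [leRHS](_ : _ = (t - s) * (1 + n1 x) ^+ 3 + (t - s) * (1 + n1 x) ^+ 3); last by ring.
by apply: lerD; rewrite ler_wpM2l ?subr_ge0// enormX_le.
Qed.

Lemma klip_mC : klip 2 3 mC.
Proof.
split; first exact: jmeas_mC.
  move=> t x _; rewrite cn_real; apply: (le_trans (cos_norm_le1 _)).
  by rewrite mulr_ege1// ?ler1n// exprn_ege1// J_ge1.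
move=> s t x s0 st; rewrite /cn cReB cImB /= subrr normr0 addr0.
apply: (le_trans (cos_lip _ _)).
rewrite -mulrBl normrM (ger0_norm (enorm_ge0 _)) ger0_norm ?subr_ge0//.
rewrite mulrC ler_wpM2r ?subr_ge0//; apply: (le_trans (@enormX_le 1 3 x isT)).
by rewrite ler_peMl ?ler1n// exprn_ge0// addr_ge0 ?n1_ge0.
Qed.

Lemma klip_mW : klip 2 3 mW.
Proof.
have J0 (x : E) : 0 <= (1 + n1 x) ^+ 3 by rewrite exprn_ge0// addr_ge0 ?n1_ge0.
split; first exact: jmeas_mW.
  move=> t x _; rewrite mWE cn_real normrN normrM (ger0_norm (enorm_ge0 _)).
  apply: (@le_trans _ _ (enorm x ^+ 1)); first by rewrite ler_piMr ?enorm_ge0 ?sin_norm_le1.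
  apply: (le_trans (@enormX_le 1 3 x isT)).
  by rewrite ler_peMl ?ler1n.
move=> s t x s0 st; rewrite !mWE /cn cReB cImB /= subrr normr0 addr0 -opprD normrN -mulrBr.
rewrite normrM (ger0_norm (enorm_ge0 _)).
apply: (le_trans (ler_wpM2l (enorm_ge0 _) (sin_lip _ _))).
rewrite -mulrBl normrM (ger0_norm (enorm_ge0 _)) ger0_norm ?subr_ge0//.
rewrite mulrCA mulrC ler_wpM2r ?subr_ge0//; apply: (le_trans (@enormX_le 2 3 x isT)).
by rewrite ler_peMl ?ler1n.
Qed.

Lemma klip_mN : klip 2 3 mN.
Proof.
have J0 (x : E) : 0 <= (1 + n1 x) ^+ 3 by rewrite exprn_ge0// addr_ge0 ?n1_ge0.
split; first exact: jmeas_mN.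
  move=> t x _; rewrite mNE cn_real normrN normrM (ger0_norm (sqr_ge0 _)).
  apply: (@le_trans _ _ (enorm x ^+ 2)); first by rewrite ler_piMr ?sqr_ge0 ?cos_norm_le1.
  apply: (le_trans (@enormX_le 2 3 x isT)).
  by rewrite ler_peMl ?ler1n.
move=> s t x s0 st; rewrite !mNE /cn cReB cImB /= subrr normr0 addr0 -opprD normrN -mulrBr.
rewrite normrM (ger0_norm (sqr_ge0 _)).
apply: (le_trans (ler_wpM2l (sqr_ge0 _) (cos_lip _ _))).
rewrite -mulrBl normrM (ger0_norm (enorm_ge0 _)) ger0_norm ?subr_ge0//.
rewrite mulrCA -exprSr mulrC ler_wpM2r ?subr_ge0//; apply: (le_trans (@enormX_le 3 3 x isT)).
by rewrite ler_peMl ?ler1n.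
Qed.

Definition scalek (c : R[i]) m (t : R) (x : E) : R[i] := c * m t x.

Lemma jmeas_scalek c m : jmeas m -> jmeas (scalek c m).
Proof. by move=> hm; apply: CmeasurableM => //; exact: Cmeasurable_cst. Qed.

Lemma klip_scalek c C j m : klip C j m -> klip (cn c * C) j (scalek c m).
Proof.
move=> [mm h1 h2]; split; first exact: jmeas_scalek.
  move=> t x t0; apply: le_trans (cnM _ _) _.
  by rewrite -mulrA ler_wpM2l ?cn_ge0 ?h1.
move=> s t x s0 st; rewrite /scalek -mulrBr; apply: le_trans (cnM _ _) _.
by rewrite -!mulrA ler_wpM2l ?cn_ge0// mulrA h2.
Qed.

Lemma kbound_scalek c C rho m : kbound C rho m -> kbound (cn c * C) rho (scalek c m).
Proof.
move=> [mm r0 h]; split => //; first exact: jmeas_scalek.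
move=> t x t0; apply: le_trans (cnM _ _) _.
by rewrite -!mulrA ler_wpM2l ?cn_ge0// mulrA h.
Qed.

Lemma kbound_mS : kbound 2 (fun=> 1) mS.
Proof.
split => //; first exact: jmeas_mS.
move=> t x _; rewrite mulr1; apply: (le_trans (cn_expi _)).
by rewrite ler_peMr// J_ge1.
Qed.

Lemma kbound_mW : kbound 2 (fun=> 1) mW.
Proof.
split => //; first exact: jmeas_mW.
move=> t x _; rewrite mulr1 mWE cn_real normrN normrM (ger0_norm (enorm_ge0 _)).
apply: (@le_trans _ _ (enorm x)); first by rewrite ler_piMr ?enorm_ge0 ?sin_norm_le1.
by apply: (le_trans (enorm_le_J x)); rewrite ler_peMl ?ler1n// addr_ge0 ?n1_ge0.
Qed.

Lemma kbound_mN : kbound 2 (fun x => 1 + n1 x) mN.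
Proof.
split; first exact: jmeas_mN.
  by move=> x; rewrite addr_ge0 ?n1_ge0.
move=> t x _; rewrite mNE cn_real normrN normrM (ger0_norm (sqr_ge0 _)).
apply: (@le_trans _ _ (enorm x ^+ 2)); first by rewrite ler_piMr ?sqr_ge0 ?cos_norm_le1.
apply: (le_trans (@enormX_le 2 2 x isT)).
by rewrite -mulrA -expr2 ler_peMl ?ler1n// sqr_ge0.
Qed.

Lemma multiplier_ifourier (m g : E -> R[i]) s : Cmeasurable m -> weighted_L2 s g ->
  multiplier m (dist_ifourier g) = dist_ifourier (fun x => m x * g x).
Proof.
move=> mm wg; have [[mF _] h] := fourierP wg; apply: dist_ifourier_ae.
- exact: CmeasurableM.
- by apply: CmeasurableM => //; case: wg.
- by apply: filterS h => x ->.
Qed.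

Lemma dist_ifourierB g g' : tempered g -> tempered g' ->
  dist_ifourier (fun x => g x - g' x) = dist_ifourier g - dist_ifourier g'.
Proof.
move=> tg tg'.
rewrite -scaleN1r -(dist_ifourierZ _ tg') -dist_ifourierD//; last exact: temperedZ.
congr dist_ifourier; apply/funext => x; congr (_ + _).
by case: (g' x) => a b; apply: complex_ext => /=; ring.
Qed.

Lemma wbound_poly A (m : E -> R[i]) (j : nat) g : Cmeasurable m -> 0 <= A ->
  (forall x, cn (m x) <= 2 * (1 + n1 x) ^+ j) -> wbound A 2 g ->
  wbound (2 * A * j.+1%:R ^+ j) 1 (fun x => m x * g x).
Proof.
move=> mm A0 hm [mg hg]; split; first exact: CmeasurableM.
move=> x; apply: le_trans (cnM _ _) _.
apply: (le_trans (ler_pM (cn_ge0 _) (cn_ge0 _) (hm x) (hg x))).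
rewrite mulrACA -!mulrA; do 2 (apply: ler_wpM2l => //).
exact: wt2_poly.
Qed.

Definition lipbound (T M : R) (f : R -> E -> R[i]) := 0 <= M /\
  forall s t x, 0 <= s -> s <= t -> t <= T -> cn (f t x - f s x) <= M * (t - s) * wt 1 x.

Lemma lipbound_mul T C j A m g : klip C j m -> 0 <= C -> wbound A 2 g ->
  lipbound T (C * A * j.+1%:R ^+ j) (fun t x => m t x * g x).
Proof.
move=> [mm h1 h2] C0 hg; have A0 := wbound_ge0 hg; case: hg => mg hg.
split; first by apply: mulr_ge0; [exact: mulr_ge0|exact: exprn_ge0].
move=> s t x s0 st _; rewrite -mulrBl; apply: le_trans (cnM _ _) _.
apply: (le_trans (ler_pM (cn_ge0 _) (cn_ge0 _) (h2 _ _ x s0 st) (hg x))).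
have h := wt2_poly j x; set w1 := wt 1 x in h *; set w2 := wt 2 x in h *.
rewrite [leLHS](_ : _ = C * A * (t - s) * ((1 + n1 x) ^+ j * w2)); last by ring.
rewrite [leRHS](_ : _ = C * A * (t - s) * (j.+1%:R ^+ j * w1)); last by ring.
by apply: ler_wpM2l h; apply: mulr_ge0; [exact: mulr_ge0|rewrite subr_ge0].
Qed.

Lemma lipboundD T (M M' : R) f f' : lipbound T M f -> lipbound T M' f' ->
  lipbound T (M + M') (fun t x => f t x + f' t x).
Proof.
move=> [M0 h] [M0' h']; split; first exact: addr_ge0.
move=> s t x s0 st tT; rewrite opprD addrACA; apply: le_trans (cnD _ _) _.
by rewrite !mulrDl lerD ?h ?h'.
Qed.

Lemma lipbound_duh T W C j A B k f (g : R -> E -> R[i]) : 0 <= T -> T + 2 <= W -> 0 <= C -> klip C j k ->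
  xbound T W A f -> xbound T W B g -> exists M, lipbound T M (duh k f g).
Proof.
move=> T0 TW C0 hk hf hg.
have TW' : T <= W by apply: le_trans TW; rewrite lerDl.
by have [M M0 h] := duh_lipschitz T0 TW' TW C0 hk hf hg; exists M; split.
Qed.

Lemma lipbound_le T M M' f : M <= M' -> lipbound T M f -> lipbound T M' f.
Proof.
move=> MM [M0 h]; split => [|s t x s0 st tT]; first exact: le_trans MM.
apply: le_trans (h s t x s0 st tT) _; rewrite ler_wpM2r ?wt_ge0//.
by rewrite ler_wpM2r// subr_ge0.
Qed.

Lemma eq_lipbound T M f f' : (forall t x, 0 <= t <= T -> f t x = f' t x) ->
  lipbound T M f -> lipbound T M f'.
Proof.
move=> e [M0 h]; split => // s t x s0 st tT.
by rewrite -!e ?h// ?s0 ?(le_trans st)// (le_trans s0).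
Qed.

Lemma lipbound_norm T M f s t x : lipbound T M f -> 0 <= s <= T -> 0 <= t <= T ->
  cn (f s x - f t x) <= M * `|s - t| * wt 1 x.
Proof.
move=> [M0 h] /andP[s0 sT] /andP[t0 tT]; case: (leP s t) => [st|/ltW ts].
  by rewrite -cnN opprB ler0_norm ?subr_le0// opprB h.
by rewrite ger0_norm ?subr_ge0// h.
Qed.

End multipliers.

(** * Trajectories prescribed on the Fourier side *)

Section explicit_trajectory.
Context (R : realType) (d : nat).
Local Notation E := 'rV[R]_d.

Definition traj (u n m : R -> E -> R[i]) (t : R) : triple R d :=
  (dist_ifourier (u t), dist_ifourier (n t), dist_ifourier (m t)).

(** A Lipschitz bound in time that holds pointwise in frequency, with weight [wt 1], gives Lipschitz
    continuity in every Sobolev norm by [wbound_sobolev_norm]. *)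
Lemma CHkl_traj (k l T Bu Bn Bm M : R) (u n m : R -> E -> R[i]) :
  (forall t, 0 <= t <= T -> [/\ wbound Bu 1 (u t), wbound Bn 1 (n t) & wbound Bm 1 (m t)]) ->
  (forall t, 0 <= t <= T -> herm (n t) /\ herm (m t)) ->
  lipbound T M u -> lipbound T M n -> lipbound T M m ->
  CHkl k l T (traj u n m).
Proof.
move=> hb hh lu ln lm t tT; split.
  have [wu wn wm] := hb _ tT; have [hn hm] := hh _ tT.
  split; first by exists (u t) => //; exact: wbound_weighted wu.
    split; first by exists (n t) => //; exact: wbound_weighted wn.
    by apply: hermitian_real_dist => //; exact: weighted_tempered (wbound_weighted 0 wn).
  split; first by exists (m t) => //; exact: wbound_weighted wm.
  by apply: hermitian_real_dist => //; exact: weighted_tempered (wbound_weighted 0 wm).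
move=> e e0; have [M0 _] := lu.
pose K := Kwt d k + Kwt d l + Kwt d (l - 1).
have K0 : 0 <= K by apply: addr_ge0; [apply: addr_ge0|]; exact: Kwt_ge0.
have P0 : 0 < M * Num.sqrt K + 1 by rewrite ltr_wpDl// mulr_ge0 ?sqrtr_ge0.
exists (e / (M * Num.sqrt K + 1)); first exact: divr_gt0.
move=> s sT hst.
have diff (f : R -> E -> R[i]) B q : lipbound T M f -> wbound B 1 (f s) -> wbound B 1 (f t) ->
    sobolev_norm q (dist_ifourier (f s) - dist_ifourier (f t)) ^+ 2 <=
    (M * `|s - t|) ^+ 2 * Kwt d q.
  move=> lf ws wt1.
  rewrite -dist_ifourierB; [|exact: weighted_tempered (wbound_weighted 0 ws)|
                             exact: weighted_tempered (wbound_weighted 0 wt1)].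
  apply: wbound_sobolev_norm; split; first exact: CmeasurableB ws.1 wt1.1.
  by move=> x; exact: (lipbound_norm x lf sT tT).
have [us ns ms] := hb _ sT; have [ut nt mt] := hb _ tT.
have h : Hkl_norm k l (traj u n m s - traj u n m t) <= M * `|s - t| * Num.sqrt K.
  rewrite -[leRHS]ger0_norm; last by rewrite !mulr_ge0 ?sqrtr_ge0.
  rewrite -sqrtr_sqr; apply: ler_wsqrtr.
  have -> : (M * `|s - t| * Num.sqrt K) ^+ 2 = (M * `|s - t|) ^+ 2 * Kwt d k +
      (M * `|s - t|) ^+ 2 * Kwt d l + (M * `|s - t|) ^+ 2 * Kwt d (l - 1).
    by rewrite [LHS]exprMn sqr_sqrtr// /K [LHS]mulrDr; congr (_ + _); rewrite [LHS]mulrDr.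
  apply: lerD; first apply: lerD.
  - exact: (diff u Bu).
  - exact: (diff n Bn).
  - exact: (diff m Bm).
apply: le_lt_trans h _; rewrite mulrAC.
apply: (@le_lt_trans _ _ ((M * Num.sqrt K + 1) * `|s - t|)).
  by rewrite ler_wpM2r// lerDl.
by move: hst; rewrite ltr_pdivlMr// mulrC.
Qed.

End explicit_trajectory.

(** * Frequency truncation and the Duhamel formula for distributions *)

Section truncation.
Context (R : realType) (d : nat).
Local Notation E := 'rV[R]_d.
Local Notation mu := (lebesgue_rV R d).
Local Notation lam := (@lebesgue_measure R).
Implicit Types (g : E -> R[i]) (f k m : R -> E -> R[i]).

Definition trunc (N : R) g (x : E) : R[i] := if enorm x <= N then g x else 0.

Lemma Cmeasurable_trunc N g : Cmeasurable g -> Cmeasurable (trunc N g).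
Proof.
move=> mg; apply: Cmeasurable_if; [|exact: mg|exact: Cmeasurable_cst].
by apply: measurable_fun_ler; [apply: measurable_enorm; exact: measurable_id|exact: measurable_cst].
Qed.

Lemma cn_trunc N g x : cn (trunc N g x) <= cn (g x).
Proof. by rewrite /trunc; case: ifP => // _; rewrite cn0 cn_ge0. Qed.

Lemma wbound_trunc N A w g : wbound A w g -> wbound A w (trunc N g).
Proof.
move=> [mg hg]; split; first exact: Cmeasurable_trunc.
by move=> x; apply: le_trans (cn_trunc _ _ _) (hg x).
Qed.

Lemma trunc_sharp N g : trunc N (sharp g) = sharp (trunc N g).
Proof.
apply/funext => x; rewrite /trunc /sharp enormN; case: ifP => // _.
by apply: complex_ext => //=; rewrite oppr0.
Qed.

Lemma low_freq_ifourier N s g : weighted_L2 s g -> Cintble mu (trunc N g) ->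
  low_freq N (dist_ifourier g) = ifourier (trunc N g).
Proof.
move=> wg ig; have [[mF _] h] := fourierP wg; apply/funext => x.
rewrite /low_freq !ifourierE; congr (_ * _); apply: ae_eq_Cint.
- by apply: CmeasurableM; [exact: Cmeasurable_char|exact: (Cmeasurable_trunc N mF)].
- by apply: CmeasurableM; [exact: Cmeasurable_char|exact: Cintble_meas ig].
- by apply: filterS h => y hy; rewrite /trunc; case: ifP => // _; rewrite hy.
Qed.

Lemma cj_ifourier g x : Cintble mu g -> cj (ifourier g x) = ifourier (sharp g) x.
Proof.
move=> ig; rewrite !ifourierE cjM; congr (_ * _).
  by apply: complex_ext => //=; rewrite oppr0.
have ic := Cintble_char x ig.
rewrite -(Cint_cj ic) -(Cint_opp (Cintble_meas (Cintble_cj ic))); apply: eq_Cint => y.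
rewrite cjM -expiN; congr (expi _ * _).
by rewrite /dotp -sumrN; apply: eq_bigr => i _; rewrite mxE mulrN opprK.
Qed.

Lemma sqmod_cj (z : R[i]) : (sqmod z)%:C = z * cj z.
Proof. by case: z => a b; apply: complex_ext; rewrite /sqmod /=; ring. Qed.

Definition trunct N f (t : R) : E -> R[i] := trunc N (f t).

Lemma jmeas_trunct N f : jmeas f -> jmeas (trunct N f).
Proof.
move=> mf; apply: Cmeasurable_if; [|exact: mf|exact: Cmeasurable_cst].
apply: measurable_fun_ler; last exact: measurable_cst.
by apply: measurable_enorm; exact: measurable_snd.
Qed.

Lemma xbound_trunct T W A N f : xbound T W A f -> xbound T W A (trunct N f).
Proof.
move=> [mf hf]; split; first exact: jmeas_trunct.
by move=> t tT x; apply: le_trans (cn_trunc _ _ _) (hf t tT x).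
Qed.

Lemma xbound_weaken T W W' A f : 0 <= T -> W' <= W -> xbound T W A f -> xbound T W' A f.
Proof.
move=> T0 WW hf; have A0 := xbound_ge0 T0 hf; case: hf => mf hf; split => // t tT x.
by apply: le_trans (hf t tT x) _; rewrite ler_wpM2l// wt_le// lerD2r.
Qed.

(* Giving up one unit of the exponential rate makes the truncation error O(e^-N). *)
Lemma xbound_trunct_diff T W A N f : 0 <= T -> xbound T W A f ->
  xbound T (W - 1) (A * expR (- N)) (fun s y => trunct N f s y - f s y).
Proof.
move=> T0 hf; have A0 := xbound_ge0 T0 hf; case: hf => mf hf; split.
  by apply: CmeasurableB => //; exact: jmeas_trunct.
move=> t tT x; have p0 := mulr_ge0 A0 (expR_ge0 (- N)).
rewrite /trunct /trunc; case: (leP (enorm x) N) => h.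
  by rewrite subrr cn0 mulr_ge0// wt_ge0.
rewrite sub0r cnN; apply: le_trans (hf t tT x) _.
rewrite -mulrA; apply: ler_wpM2l => //.
rewrite (_ : W - t = (W - 1 - t) + 1); last by ring.
rewrite wt_split mul1r; apply: ler_wpM2r; first exact: wt_ge0.
by rewrite ler_expR lerN2; exact: ltW (lt_le_trans h (enorm_le_n1 x)).
Qed.

Lemma cvg_expN (a : R -> R) (l K : R) :
  (forall N, `|a N - l| <= K * expR (- N)) -> a N @[N --> +oo] --> l.
Proof.
move=> h; apply/cvgrPdist_le => e e0.
have g0 : (fun N : R => K * expR (- N)) @ +oo --> 0.
  rewrite -[X in _ --> X](mulr0 K); apply: cvgM; first exact: cvg_cst.
  exact: cvgr_expR.
move/cvgrPdist_le : g0 => /(_ _ e0); apply: filterS => N.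
rewrite sub0r normrN => hN; rewrite distrC.
by apply: le_trans (h N) (le_trans (ler_norm _) hN).
Qed.

Section fixed.
Variables (T W C A B : R) (rho : E -> R).
Hypotheses (T0 : 0 <= T) (TW : T + 2 <= W) (C0 : 0 <= C).
Hypothesis rhoJ : forall x, rho x <= 1 + n1 x.

Let TW' : T <= W.
Proof. by apply: le_trans TW; rewrite lerDl. Qed.

(** At least two units of rate remain at time [t], and one of them pays for [rho]. *)
Lemma rho_wt t x : 0 <= rho x -> 0 <= t <= T -> rho x * wt (W - t) x <= 2 * wt 1 x.
Proof.
move=> r0 /andP[_ tT]; have h := wt2_poly 1 x; rewrite !expr1 in h.
apply: le_trans h; apply: ler_pM => //; first exact: wt_ge0.
by apply: wt_le; move: TW; lra.
Qed.

Lemma duh_wbound k f (g : R -> E -> R[i]) t : kbound C rho k -> xbound T W A f -> xbound T W B g ->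
  0 <= t <= T -> wbound (C * A * B * Cconv R d * (T + 1) * 2) 1 (duh k f g t).
Proof.
move=> hk hf hg tT; have [mk r0 _] := hk.
split; first exact: jmeas_section (jmeas_duh mk hf.1 hg.1).
move=> x; apply: (le_trans (duh_bound T0 TW' x C0 hk hf hg tT)).
rewrite -[leLHS]mulrA -[leRHS]mulrA; apply: ler_wpM2l; last exact: rho_wt.
have A0 := xbound_ge0 T0 hf; have B0 := xbound_ge0 T0 hg.
move: (Cconv_ge0 R d); set c := Cconv R d; move: c => c c0.
by rewrite !mulr_ge0 ?addr_ge0.
Qed.

(** [duhamel] integrates in time after pairing with a test function, whereas [duh] integrates in
    time at fixed frequency; this exchanges the two. *)
Lemma duh_fubini k f (g : R -> E -> R[i]) t (h : schwartz R d) :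
  kbound C rho k -> xbound T W A f -> xbound T W B g -> 0 <= t <= T ->
  Cint lam (fun s => Cint mu (fun x => duh_integrand k f g t x s * ifourier (sval h) x)) =
  Cint mu (fun x => duh k f g t x * ifourier (sval h) x).
Proof.
move=> hk hf hg tT; have [mk r0 _] := hk; have [t0 tT'] := andP tT.
have A0 := xbound_ge0 T0 hf; have B0 := xbound_ge0 T0 hg.
have [M M0 hM] := ifourier_decay h 0.
have hM' x : cn (ifourier (sval h) x) <= M.
  by apply: le_trans (hM x) _; rewrite /jw expr0 invr1 mulr1.
have mF : Cmeasurable (ifourier (sval h)).
  by apply: measurable_ifourier; exact: Cintble_meas (schwartz_Cintble h).
pose Q (p : E * measurableTypeR R) := duh_integrand k f g t p.1 p.2 * ifourier (sval h) p.1.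
have mQ : Cmeasurable Q.
  apply: CmeasurableM; last exact: (Cmeasurable_comp measurable_fst mF).
  have mD := Cmeasurable_duh_integrand mk hf.1 hg.1.
  apply: (Cmeasurable_comp (h := fun p : E * measurableTypeR R =>
    (((t : measurableTypeR R), p.1), p.2)) _ mD).
  apply: measurable_fun_pair; last exact: measurable_snd.
  by apply: measurable_fun_pair; [exact: measurable_cst|exact: measurable_fst].
have hQ x s : cn (Q (x, s)) <= M * duh_dom W C A B rho t x s.
  apply: le_trans (cnM _ _) _; rewrite mulrC.
  by apply: ler_pM; rewrite ?cn_ge0//; exact: (duh_integrand_dom TW' x s hk hf hg tT').
pose K := C * A * B * Cconv R d * (T + 1) * 2.
have iQ : Cintble (mu \x lam)%E Q.
  apply: (Cintble_prod (F := fun p => cn (Q p)) (g := fun x => (M * K) * wt 1 x)) => //.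
  - exact: measurable_cn.
  - by apply: intbleZ; exact: intble_wt.
  move=> x; have iq : intble lam (fun s => cn (Q (x, s))).
    apply: (intble_dom _ (intbleZ M (intble_duh_dom W C A B rho t x))).
      apply: measurable_cn; apply: (Cmeasurable_comp (h := fun s : measurableTypeR R => (x, s)) _ mQ).
      by apply: measurable_fun_pair; [exact: measurable_cst|exact: measurable_id].
    by move=> s; rewrite ger0_norm ?cn_ge0.
  rewrite -[leLHS]/(\int[lam]_s (cn (Q (x, s)))%:E)%E integral_intble// lee_fin.
  apply: (@le_trans _ _ (\int[lam]_s (M * duh_dom W C A B rho t x s))).
    by apply: ler_Rintegral => //; apply: intbleZ; exact: intble_duh_dom.
  rewrite Rintegral_scale; last exact: intble_duh_dom.
  rewrite -[leRHS]mulrA; apply: ler_wpM2l => //.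
  apply: (le_trans (Rintegral_duh_dom T0 x C0 hk hf hg tT)).
  rewrite -[leLHS]mulrA /K -[leRHS]mulrA; apply: ler_wpM2l; last exact: rho_wt.
  move: (Cconv_ge0 R d); set c := Cconv R d; move: c => c c0.
  by rewrite !mulr_ge0 ?addr_ge0.
rewrite -(Cfubini iQ); apply: eq_Cint => x.
by rewrite /Q /= CintZr//; exact: (Cintble_duh TW' x hk hf hg tT').
Qed.

End fixed.

(** For fixed [N] the integral in [duhamel] is the pairing with the Duhamel integral of the
    truncated factors. Replacing these by the full ones costs one unit of rate and an error of order
    [expR (- N)], whence the limit. *)
Lemma duhamel_trunc (T W C A B : R) (rho : E -> R) (m : R -> E -> R[i])
    (Aop : R -> dist R d -> dist R d) (F : R -> R -> E -> R[i])
    (f g : R -> E -> R[i]) t :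
  0 <= T -> T + 3 <= W -> 0 <= C -> (forall x, rho x <= 1 + n1 x) ->
  kbound C rho (scalek (cF R d)%:C m) -> xbound T W A f -> xbound T W B g ->
  (forall a D h, 0 <= a -> wbound D 2 h ->
     Aop a (dist_ifourier h) = dist_ifourier (fun x => m a x * h x)) ->
  (forall N s, 0 <= s <= T ->
     F N s = fun x => ifourier (trunc N (f s)) x * ifourier (trunc N (g s)) x) ->
  0 <= t <= T ->
  duhamel Aop F t (dist_ifourier (duh (scalek (cF R d)%:C m) f g t)).
Proof.
move=> T0 TW C0 rhoJ hk hf hg hA hF tT h.
set k := scalek _ m in hk *; have [mk r0 _] := hk; have [t0 tT'] := andP tT.
have TW2 : T + 2 <= W by apply: le_trans TW; lra.
have TW1 : T + 2 <= W - 1 by move: TW; lra.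
have TW0 : T <= W by move: TW; lra.
have TWm : T <= W - 1 by move: TW; lra.
have A0 := xbound_ge0 T0 hf; have B0 := xbound_ge0 T0 hg.
pose I N := Cintegral lam `[0, t] (fun s => Aop (t - s) (dist_of_fun (F N s)) h).
have eI N : I N = Cint mu (fun x => duh k (trunct N f) (trunct N g) t x * ifourier (sval h) x).
  rewrite -(duh_fubini T0 TW2 C0 rhoJ h hk (xbound_trunct N hf) (xbound_trunct N hg) tT).
  rewrite /I Cint_itv; apply: eq_Cint => s; case: ifP => [/andP[s0 st]|sn]; last first.
    rewrite -[LHS](@Cint0 _ _ R mu); apply: eq_Cint => x.
    by rewrite /duh_integrand sn mul0r.
  have sT : 0 <= s <= T by rewrite s0 (le_trans st).
  have w2 : 2 <= W - s by case/andP: sT => _; move: TW; lra.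
  have w0 : 0 <= W - s by apply: le_trans w2.
  have wf := wbound_trunc N (xbound_wbound sT hf).
  have wg := wbound_trunc N (xbound_wbound sT hg).
  rewrite hF// dist_of_fun_mul; [|exact: wbound_Cintble wf|exact: wbound_Cintble wg].
  have wc := conv_bound w0 wf wg.
  have wcc : wbound (cn (cF R d)%:C * (A * B * Cconv R d)) 2
      (fun z => (cF R d)%:C * convol (trunc N (f s)) (trunc N (g s)) z).
    apply: wbound_weaken w2 _; case: wc => mc hc; split.
      by apply: CmeasurableM => //; exact: Cmeasurable_cst.
    by move=> x; apply: le_trans (cnM _ _) _; rewrite -mulrA ler_wpM2l ?cn_ge0.
  rewrite (hA _ _ _ _ wcc) ?subr_ge0// dist_ifourierE; apply: eq_Cint => x.
  rewrite /duh_integrand s0 st /= /k /scalek /trunct; congr (_ * _).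
  by rewrite mulrA; congr (_ * _); rewrite mulrC.
have [M M0 hM] := ifourier_decay h 0.
have hM' x : cn (ifourier (sval h) x) <= M.
  by apply: le_trans (hM x) _; rewrite /jw expr0 invr1 mulr1.
have mF : Cmeasurable (ifourier (sval h)).
  by apply: measurable_ifourier; exact: Cintble_meas (schwartz_Cintble h).
pose K := Kduh d T C * (A * B + A * B) * 2.
have key N : cn (I N - dist_ifourier (duh k f g t) h) <=
    (M * K * \int[mu]_x wt 1 x) * expR (- N).
  have hfN := xbound_weaken T0 (lexx _) (xbound_trunct N hf).
  have W1 : W - 1 <= W by lra.
  have af := xbound_weaken T0 W1 hf; have ag := xbound_weaken T0 W1 hg.
  have bf := xbound_weaken T0 W1 (xbound_trunct N hf).
  have bg := xbound_weaken T0 W1 (xbound_trunct N hg).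
  have df := xbound_trunct_diff N T0 hf; have dg := xbound_trunct_diff N T0 hg.
  have tw1 := weighted_tempered (wbound_weighted 0 (duh_wbound T0 TW2 C0 rhoJ hk (xbound_trunct N hf) (xbound_trunct N hg) tT)).
  have tw2 := weighted_tempered (wbound_weighted 0 (duh_wbound T0 TW2 C0 rhoJ hk hf hg tT)).
  rewrite eI dist_ifourierE.
  rewrite -[X in cn X](CintB (tempered_ifourier h tw1) (tempered_ifourier h tw2)).
  apply: (@le_trans _ _ (\int[mu]_x ((M * K * expR (- N)) * wt 1 x))).
    apply: cn_Cint.
    - apply: CmeasurableB; first exact: Cintble_meas (tempered_ifourier h tw1).
      exact: Cintble_meas (tempered_ifourier h tw2).
    - by apply: intbleZ; exact: intble_wt.
    move=> x; rewrite -mulrBl mulrC; apply: le_trans (cnM _ _) _.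
    rewrite -[leRHS]mulrA -[leRHS]mulrA; apply: ler_pM; rewrite ?cn_ge0//.
    apply: (le_trans (duh_diff_bound T0 TWm x C0 hk bf bg af ag df dg tT)).
    rewrite [leLHS](_ : _ = (Kduh d T C * (A * B + A * B) * expR (- N)) *
       (rho x * wt (W - 1 - t) x)); last by ring.
    rewrite [leRHS](_ : _ = (Kduh d T C * (A * B + A * B) * expR (- N)) *
       (2 * wt 1 x)); last by rewrite /K; ring.
    apply: ler_wpM2l; last exact: (rho_wt TW1 rhoJ (r0 x) tT).
    apply: mulr_ge0 (expR_ge0 _); apply: mulr_ge0; first exact: Kduh_ge0.
    by apply: addr_ge0; exact: mulr_ge0.
  rewrite Rintegral_scale; last exact: intble_wt.
  by rewrite mulrAC.
split.
  apply: cvg_expN => N; rewrite -cReB; exact: le_trans (ler_Re_cn _) (key N).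
by apply: cvg_expN => N; rewrite -cImB; exact: le_trans (ler_Im_cn _) (key N).
Qed.

Lemma schrodinger_ifourier a D g : wbound D 2 g ->
  schrodinger a (dist_ifourier g) = dist_ifourier (fun x => mS a x * g x).
Proof.
move=> hg; have l12 : 1 <= 2 :> R by rewrite ler1n.
apply: (@multiplier_ifourier _ _ _ _ 0); first exact: (jmeas_section a (@jmeas_mS R d)).
by apply: wbound_weighted; exact: wbound_weaken l12 hg.
Qed.

Lemma W0_ifourier s a g : weighted_L2 s g ->
  W0 a (dist_ifourier g) = dist_ifourier (fun x => mC a x * g x).
Proof.
by move=> hg; apply: (multiplier_ifourier _ hg); exact: (jmeas_section a (@jmeas_mC R d)).
Qed.

Lemma W1_ifourier s a g : weighted_L2 s g ->
  W1 a (dist_ifourier g) = dist_ifourier (fun x => (sin (a * enorm x) / enorm x)%:C * g x).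
Proof.
move=> hg; apply: (multiplier_ifourier _ hg); apply: Cmeasurable_real.
have me : measurable_fun setT (fun x : E => enorm x) by apply: measurable_enorm; exact: measurable_id.
apply: measurable_funM.
  by apply: (measurableT_comp (@measurable_sin R)); apply: measurable_funM => //; exact: measurable_cst.
have -> : (fun x : E => (enorm x)^-1) = (fun x => enorm x `^ (-1)).
  by apply/funext => x; rewrite powR_inv1// enorm_ge0.
exact: (measurableT_comp (measurable_powR (-1))).
Qed.

Lemma laplacian_ifourier D g : wbound D 2 g ->
  (exists D', wbound D' 1 (fun x => (- enorm x ^+ 2)%:C * g x)) /\
  laplacian (dist_ifourier g) = dist_ifourier (fun x => (- enorm x ^+ 2)%:C * g x).
Proof.
move=> hg; have D0 := wbound_ge0 hg.
have mm : Cmeasurable (fun x : E => (- enorm x ^+ 2)%:C).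
  apply: Cmeasurable_real; apply: measurable_funN; apply: measurable_funX.
  by apply: measurable_enorm; exact: measurable_id.
split; last first.
  apply: (multiplier_ifourier mm (s := 0)); apply: wbound_weighted.
  by apply: wbound_weaken hg; rewrite ler1n.
eexists; apply: (wbound_poly (j := 2) mm D0 _ hg) => x.
rewrite cn_real normrN ger0_norm ?sqr_ge0//; apply: (le_trans (@enormX_le _ _ 2 2 x isT)).
by rewrite ler_peMl ?ler1n// sqr_ge0.
Qed.

Lemma W1_laplacian_ifourier a D g : wbound D 2 g ->
  W1 a (laplacian (dist_ifourier g)) = dist_ifourier (fun x => mW a x * g x).
Proof.
move=> hg; have [[D' h] ->] := laplacian_ifourier hg.
rewrite (W1_ifourier _ (wbound_weighted 0 h)); congr dist_ifourier.
by apply/funext => x; rewrite mulrA.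
Qed.

Lemma W0_laplacian_ifourier a D g : wbound D 2 g ->
  W0 a (laplacian (dist_ifourier g)) = dist_ifourier (fun x => mN a x * g x).
Proof.
move=> hg; have [[D' h] ->] := laplacian_ifourier hg.
rewrite (W0_ifourier _ (wbound_weighted 0 h)); congr dist_ifourier.
by apply/funext => x; rewrite mulrA.
Qed.

End truncation.

(** * The solution with prescribed Fourier data *)

Section explicit_solution.
Context (R : realType) (d : nat).
Local Notation E := 'rV[R]_d.
Local Notation mu := (lebesgue_rV R d).
Implicit Types (g phih psih : E -> R[i]) (m k f u n : R -> E -> R[i]).

(** The constant of the convolution theorem is moved into the kernels, and [kU] carries in addition
    the factor [-i] of the Duhamel formula for [u]. *)
Definition kS : R -> E -> R[i] := scalek (cF R d)%:C (@mS R d).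
Definition kU : R -> E -> R[i] := scalek (- (0 +i* 1)) kS.
Definition kW : R -> E -> R[i] := scalek (cF R d)%:C (@mW R d).
Definition kN : R -> E -> R[i] := scalek (cF R d)%:C (@mN R d).
Definition Cker : R := cn (cF R d)%:C * 2.

Definition linu phih : R -> E -> R[i] := fun t x => mS t x * phih x.
Definition linn psih : R -> E -> R[i] := fun t x => mC t x * psih x.
Definition linm psih : R -> E -> R[i] := fun t x => mW t x * psih x.

Lemma Cker_ge0 : 0 <= Cker.
Proof. by rewrite mulr_ge0 ?cn_ge0. Qed.

Lemma cn_Ni : cn (- (0 +i* 1) : R[i]) = 1.
Proof. by rewrite /cn /= oppr0 normr0 add0r normrN normr1. Qed.

Lemma kbound_kS : kbound Cker (fun=> 1) kS.
Proof. exact: kbound_scalek (@kbound_mS R d). Qed.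

Lemma kbound_kU : kbound Cker (fun=> 1) kU.
Proof. by have := kbound_scalek (- (0 +i* 1)) kbound_kS; rewrite cn_Ni mul1r. Qed.

Lemma kbound_kW : kbound Cker (fun=> 1) kW.
Proof. exact: kbound_scalek (@kbound_mW R d). Qed.

Lemma kbound_kN : kbound Cker (fun x => 1 + n1 x) kN.
Proof. exact: kbound_scalek (@kbound_mN R d). Qed.

Lemma klip_kU : klip Cker 3 kU.
Proof.
have := klip_scalek (- (0 +i* 1)) (klip_scalek (cF R d)%:C (@klip_mS R d)).
by rewrite cn_Ni mul1r.
Qed.

Lemma klip_kW : klip Cker 3 kW.
Proof. exact: klip_scalek (@klip_mW R d). Qed.

Lemma klip_kN : klip Cker 3 kN.
Proof. exact: klip_scalek (@klip_mN R d). Qed.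

Lemma duh_scalek T W C rho A B (c : R[i]) k f (g : R -> E -> R[i]) t x : T <= W ->
  kbound C rho k -> xbound T W A f -> xbound T W B g -> 0 <= t <= T ->
  duh (scalek c k) f g t x = c * duh k f g t x.
Proof.
move=> TW hk hf hg tT; have := duhZ TW c 1 1 x hk hf hg tT; rewrite !mulr1 => <-.
have e1 (h : R -> E -> R[i]) : (fun s y => 1 * h s y) = h.
  by apply/funext => s; apply/funext => y; rewrite mul1r.
by rewrite !e1.
Qed.

Lemma xbound_lin T W A m g : 0 <= T -> jmeas m ->
  (forall t x, cn (m t x) <= 2) -> wbound A W g ->
  xbound T W (2 * A) (fun t x => m t x * g x).
Proof.
move=> T0 mm m2 hg; have A0 := wbound_ge0 hg; case: hg => mg hg; split.
  by apply: CmeasurableM => //; exact: (Cmeasurable_comp measurable_snd mg).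
move=> t /andP[t0 _] x; apply: le_trans (cnM _ _) _.
apply: (le_trans (ler_pM (cn_ge0 _) (cn_ge0 _) (m2 t x) (hg x))).
by rewrite -mulrA; do 2 (apply: ler_wpM2l => //); rewrite wt_le// gerBl.
Qed.

Lemma xbound_linu T W A phih : 0 <= T -> wbound A W phih -> xbound T W (2 * A) (linu phih).
Proof.
move=> T0; apply: xbound_lin => //; first exact: jmeas_mS.
by move=> t x; exact: cn_expi.
Qed.

Lemma xbound_linn T W A psih : 0 <= T -> wbound A W psih -> xbound T W (2 * A) (linn psih).
Proof.
move=> T0; apply: xbound_lin => //; first exact: jmeas_mC.
by move=> t x; rewrite cn_real (le_trans (cos_norm_le1 _))// ler1n.
Qed.

Lemma cj_real (a : R) : cj a%:C = a%:C.
Proof. by apply: complex_ext => //=; rewrite oppr0. Qed.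

Lemma herm_mul (m : E -> R) g : (forall x, m (- x) = m x) -> herm g ->
  herm (fun x => (m x)%:C * g x).
Proof. by move=> hm hg x; rewrite hm hg cjM cj_real. Qed.

Lemma hermD g g' : herm g -> herm g' -> herm (fun x => g x + g' x).
Proof. by move=> hg hg' x; rewrite hg hg' cjD. Qed.

Lemma herm_linn psih t : herm psih -> herm (linn psih t).
Proof. by apply: herm_mul => x; rewrite enormN. Qed.

Lemma herm_linm psih t : herm psih -> herm (linm psih t).
Proof.
move=> hp x; rewrite /linm !mWE.
by apply: (@herm_mul (fun x => - (enorm x * sin (t * enorm x))) psih) => // y; rewrite enormN.
Qed.

(** The convolution of [f] with [sharp f] is hermitian, by [conv_sharp] and commutativity, and a
    real kernel that is even in frequency keeps it so. This is what makes the wave components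
    real. *)
Lemma herm_duh T W A C rho (r : R -> E -> R) f t : T <= W ->
  (forall s x, r s (- x) = r s x) -> kbound C rho (fun s x => (r s x)%:C) ->
  xbound T W A f -> 0 <= t <= T -> herm (duh (fun s x => (r s x)%:C) f (sharpt f) t).
Proof.
move=> TW rN hk hf tT x; have [_ tT'] := andP tT.
rewrite /duh -(Cint_cj (Cintble_duh TW x hk hf (xbound_sharpt hf) tT')).
apply: eq_Cint => s; rewrite /duh_integrand; case: ifP => [/andP[s0 st]|_]; last first.
  by apply: complex_ext => //=; rewrite oppr0.
have sT : 0 <= s <= T by rewrite s0 (le_trans st).
have w0 : 0 <= W - s by rewrite subr_ge0; case/andP: sT => _ /le_trans; apply.
have wf := xbound_wbound sT hf; have wg := wbound_sharp wf.
rewrite rN cjM cj_real; congr (_ * _).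
have h := conv_sharp (Cintble_conv_integrand (- x) w0 wf wg).
rewrite sharpK convolC in h; [|exact: wg.1|exact: wf.1].
by rewrite /sharpt h /sharp cjK.
Qed.

Lemma wbound0 w : wbound 0 w (fun _ : E => 0 : R[i]).
Proof. by split=> [|x]; [exact: Cmeasurable_cst|rewrite cn0 mul0r]. Qed.

Lemma kW_real : kW = fun t x => (cF R d * - (enorm x * sin (t * enorm x)))%:C.
Proof.
apply/funext => t; apply/funext => x; rewrite /kW /scalek mWE.
by apply: complex_ext => /=; ring.
Qed.

Lemma kN_real : kN = fun t x => (cF R d * - (enorm x ^+ 2 * cos (t * enorm x)))%:C.
Proof.
apply/funext => t; apply/funext => x; rewrite /kN /scalek mNE.
by apply: complex_ext => /=; ring.
Qed.

(** Only [u] and [n] come from the fixed point; the time derivative of [n] is then given by its own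
    formula. Of the initial rate [T + 3], the part [T] is consumed by time and one unit each by the
    truncation and by polynomial factors; the last unit controls the Sobolev norms. *)
Lemma explicit_solution (k l T A : R) phih psih : 0 <= T ->
  wbound A (T + 3) phih -> wbound A (T + 3) psih -> herm psih ->
  8 * Kduh d T Cker * (2 * A) <= 1 ->
  exists u n, [/\ xbound T (T + 3) (2 * (2 * A)) u, xbound T (T + 3) (2 * (2 * A)) n,
    (forall t x, 0 <= t <= T -> u t x = linu phih t x + duh kU u n t x),
    (forall t x, 0 <= t <= T -> n t x = linn psih t x + duh kW u (sharpt u) t x) &
    local_solution k l T (dist_ifourier phih, dist_ifourier psih, 0)
      (traj u n (fun t x => linm psih t x + duh kN u (sharpt u) t x))].
Proof.
move=> T0 hphi hpsi rpsi small.
have TW3 : T + 3 <= T + 3 by [].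
have TW2 : T + 2 <= T + 3 by lra.
have TW : T <= T + 3 by lra.
have C0 := Cker_ge0.
have hLu := xbound_linu T0 hphi; have hLn := xbound_linn T0 hpsi.
have [u [n [hu hn eu en]]] :=
  picard_solution T0 TW C0 kbound_kU kbound_kW hLu hLn small.
exists u, n; split => //.
have hus := xbound_sharpt hu.
have W2 : 2 <= T + 3 by lra.
have phi2 := wbound_weaken W2 hphi; have psi2 := wbound_weaken W2 hpsi.
have l12 : 1 <= 2 :> R by lra.
have phi1 := wbound_weaken l12 phi2; have psi1 := wbound_weaken l12 psi2.
have A0 := wbound_ge0 hphi.
have rho1 (x : E) : (1 : R) <= 1 + n1 x by rewrite lerDl n1_ge0.
have duhS t : 0 <= t <= T -> exists D, wbound D 1 (duh kS u n t).
  by move=> tT; eexists; exact: (duh_wbound T0 TW2 C0 rho1 kbound_kS hu hn tT).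
have duhW t : 0 <= t <= T -> exists D, wbound D 1 (duh kW u (sharpt u) t).
  by move=> tT; eexists; exact: (duh_wbound T0 TW2 C0 rho1 kbound_kW hu hus tT).
have duhN t : 0 <= t <= T -> exists D, wbound D 1 (duh kN u (sharpt u) t).
  by move=> tT; eexists; exact: (duh_wbound T0 TW2 C0 (fun x => lexx _) kbound_kN hu hus tT).
have wb f B t : 0 <= t <= T -> xbound T (T + 3) B f -> wbound B 1 (f t).
  move=> tT hf; apply: wbound_weaken (xbound_wbound tT hf).
  by case/andP: tT => _; lra.
have hm t : 0 <= t <= T -> wbound (2 * A * 4%:R ^+ 3 +
    Cker * (2 * (2 * A)) * (2 * (2 * A)) * Cconv R d * (T + 1) * 2) 1
    (fun x => linm psih t x + duh kN u (sharpt u) t x).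
  move=> tT; apply: wboundD.
    apply: (wbound_poly (j := 3)) => //; first exact: (jmeas_section t (@jmeas_mW R d)).
    by case/andP: tT => t0 _ x; have [_ h _] := @klip_mW R d; exact: h.
  exact: (duh_wbound T0 TW2 C0 (fun x => lexx _) kbound_kN hu hus tT).
split.
  have [Mu lu'] := lipbound_duh T0 TW2 C0 klip_kU hu hn.
  have [Mn ln'] := lipbound_duh T0 TW2 C0 klip_kW hu hus.
  have [Mm lm'] := lipbound_duh T0 TW2 C0 klip_kN hu hus.
  have p2 : 0 <= 2 :> R by [].
  have lu := lipboundD (lipbound_mul T (@klip_mS R d) p2 phi2) lu'.
  have ln := lipboundD (lipbound_mul T (@klip_mC R d) p2 psi2) ln'.
  have lm := lipboundD (lipbound_mul T (@klip_mW R d) p2 psi2) lm'.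
  have [u0 _] := lu; have [n0 _] := ln; have [m0 _] := lm.
  set a := _ + _ in lu u0; set b := _ + _ in ln n0; set c := _ + _ in lm m0.
  apply: (@CHkl_traj _ _ k l T _ _ _ (a + b + c)).
  - by move=> t tT; split; [exact: wb tT hu|exact: wb tT hn|exact: hm tT].
  - move=> t tT; split.
      have h : herm (fun x => linn psih t x + duh kW u (sharpt u) t x).
        apply: hermD; first exact: herm_linn.
        have hk := kbound_kW; rewrite kW_real in hk *.
        by apply: (herm_duh TW _ hk hu tT) => s x; rewrite enormN.
      by move=> x; rewrite !en//; exact: h.
    apply: hermD; first exact: herm_linm.
    have hk := kbound_kN; rewrite kN_real in hk *.
    by apply: (herm_duh TW _ hk hu tT) => s x; rewrite enormN.
  - apply: (@lipbound_le _ _ T a); first by lra.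
    by apply: eq_lipbound lu => t x tT; rewrite eu.
  - apply: (@lipbound_le _ _ T b); first by lra.
    by apply: eq_lipbound ln => t x tT; rewrite en.
  - by apply: (@lipbound_le _ _ T c) lm; lra.
exists (fun t => dist_ifourier (duh kS u n t)),
  (fun t => dist_ifourier (duh kW u (sharpt u) t)),
  (fun t => dist_ifourier (duh kN u (sharpt u) t)) => t tT.
have lowu N s : 0 <= s <= T ->
    low_freq N (dist_ifourier (u s)) = ifourier (trunc N (u s)).
  move=> sT; have w := wb _ _ _ sT hu; apply: (low_freq_ifourier (wbound_weighted 0 w)).
  by apply: (wbound_Cintble _ (wbound_trunc N w)).
have lown N s : 0 <= s <= T ->
    low_freq N (dist_ifourier (n s)) = ifourier (trunc N (n s)).
  move=> sT; have w := wb _ _ _ sT hn; apply: (low_freq_ifourier (wbound_weighted 0 w)).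
  by apply: (wbound_Cintble _ (wbound_trunc N w)).
have sq N s : 0 <= s <= T -> sqmod_trunc (fun t => dist_ifourier (u t)) N s =
    fun x => ifourier (trunc N (u s)) x * ifourier (trunc N (sharpt u s)) x.
  move=> sT; apply/funext => x; rewrite /sqmod_trunc lowu// sqmod_cj cj_ifourier ?trunc_sharp//.
  by apply: (wbound_Cintble _ (wbound_trunc N (wb _ _ _ sT hu))).
have [t0 tT'] := andP tT.
split; split.
- apply: (duhamel_trunc T0 TW3 C0 rho1 kbound_kS hu hn _ _ tT).
    by move=> a D g _ hg; exact: schrodinger_ifourier hg.
  by move=> N s sT; apply/funext => x; rewrite /prod_trunc /= lowu// lown.
- apply: (duhamel_trunc T0 TW3 C0 rho1 kbound_kW hu hus _ sq tT).
  by move=> a D g _ hg; exact: W1_laplacian_ifourier hg.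
- apply: (duhamel_trunc T0 TW3 C0 (fun x => lexx _) kbound_kN hu hus _ sq tT).
  by move=> a D g _ hg; exact: W0_laplacian_ifourier hg.
- move=> f; rewrite (schrodinger_ifourier t phi2) /traj /= !dist_ifourierE.
  have t1 : tempered (linu phih t) := weighted_tempered (wbound_weighted 0 (wb _ _ _ tT hLu)).
  have [D1 w1] := duhS _ tT; have t2 := weighted_tempered (wbound_weighted 0 w1).
  rewrite -(CintZ _ (tempered_ifourier f t2)).
  rewrite -[RHS](CintB (tempered_ifourier f t1) (CintbleZ _ (tempered_ifourier f t2))).
  apply: eq_Cint => x; rewrite eu// /kU (duh_scalek _ _ TW kbound_kS hu hn tT).
  by rewrite mulrDl; congr (_ + _); rewrite !mulNr mulrA.
- rewrite /traj /= (W0_ifourier _ (wbound_weighted 0 psi1)).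
  rewrite -(@dist_ifourier0 R d) (W1_ifourier _ (wbound_weighted 0 (wbound0 1))).
  have -> : (fun x : E => (sin (t * enorm x) / enorm x)%:C * 0) = fun=> (0 : R[i]).
    by apply/funext => x; rewrite mulr0.
  rewrite dist_ifourier0 addr0.
  have t1 : tempered (linn psih t) := weighted_tempered (wbound_weighted 0 (wb _ _ _ tT hLn)).
  have [D1 w1] := duhW _ tT; have t2 := weighted_tempered (wbound_weighted 0 w1).
  rewrite -[RHS](dist_ifourierD t1 t2); congr dist_ifourier.
  by apply/funext => x; rewrite en.
rewrite /traj /= (W1_laplacian_ifourier t psi2).
rewrite -(@dist_ifourier0 R d) (W0_ifourier _ (wbound_weighted 0 (wbound0 1))).
have -> : (fun x : E => mC t x * 0) = fun=> (0 : R[i]).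
  by apply/funext => x; rewrite mulr0.
rewrite dist_ifourier0 add0r.
have t1 : tempered (linm psih t).
  apply: weighted_tempered (wbound_weighted 0 (wbound_poly (j := 3) _ A0 _ psi2)).
    exact: (jmeas_section t (@jmeas_mW R d)).
  by move=> x; have [_ h _] := @klip_mW R d; exact: h.
have [D1 w1] := duhN _ tT; have t2 := weighted_tempered (wbound_weighted 0 w1).
exact: (dist_ifourierD t1 t2).
Qed.

End explicit_solution.

(** * Second derivatives of scalar functions of the solution *)

Section sobolev_triples.
Context (R : realType) (d : nat).
Local Notation mu := (lebesgue_rV R d).
Implicit Types (x y : triple R d) (k l s : R).

Lemma sobolev0 s : sobolev s (0 : dist R d).
Proof.
exists (fun=> 0); last by rewrite dist_ifourier0.
exact: (wbound_weighted s (@wbound0 R d 1)).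
Qed.

Lemma real_dist_lin (a : R) (u v : dist R d) : real_dist u -> real_dist v ->
  real_dist (a *: u + v).
Proof.
move=> hu hv f rf.
have -> : (a *: u + v) f = a%:C * (u f : R[i]) + (v f : R[i]) :> R[i].
  rewrite -[LHS]/(a *: (u f) + v f); congr (_ + _); case: (u f) => p q.
  by apply: complex_ext; rewrite /GRing.scale /= mul0r ?subr0 ?addr0.
by rewrite RI cImM hu// hv// /=; ring.
Qed.

Lemma Hkl_lin k l (a : R) x y : Hkl k l x -> Hkl k l y -> Hkl k l (a *: x + y).
Proof.
move=> [x1 [x2 rx2] [x3 rx3]] [y1 [y2 ry2] [y3 ry3]]; split.
- exact: (sobolevD (sobolevZ a x1).1 y1).1.
- by split; [exact: (sobolevD (sobolevZ a x2).1 y2).1|exact: real_dist_lin].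
- by split; [exact: (sobolevD (sobolevZ a x3).1 y3).1|exact: real_dist_lin].
Qed.

Lemma Hkl0 k l : Hkl k l (0 : triple R d).
Proof.
have r0 : real_dist (0 : dist R d) by move=> f _.
by split; [exact: sobolev0|split; [exact: sobolev0|]|split; [exact: sobolev0|]].
Qed.

Lemma HklZ k l (a : R) x : Hkl k l x -> Hkl k l (a *: x).
Proof. by move=> hx; rewrite -[_ *: _]addr0; apply: Hkl_lin => //; exact: Hkl0. Qed.

Lemma HklB k l x y : Hkl k l x -> Hkl k l y -> Hkl k l (x - y).
Proof. by move=> hx hy; rewrite addrC -scaleN1r; exact: Hkl_lin. Qed.

Lemma sqr_sobolev_normZ s (a : R) (u : dist R d) : sobolev s u ->
  sobolev_norm s (a *: u) ^+ 2 = a ^+ 2 * sobolev_norm s u ^+ 2.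
Proof.
move=> hu; have [h1 h2] := sobolevZ a hu.
have [w1 _] := sobolevP h1; have [w2 _] := sobolevP hu.
rewrite !sqr_sobolev_norm -Rintegral_scale; last exact: weighted_intble w2.
have mb := @measurable_bracket2 R d s.
apply: ae_eq_Rintegral.
- by apply: measurable_funM => //; apply: measurable_sqmod; case: w1.
- apply: measurable_funM; first exact: measurable_cst.
  by apply: measurable_funM => //; apply: measurable_sqmod; case: w2.
- apply: filterS h2 => z ->; rewrite mulrCA; congr (_ * _).
  by rewrite /sqmod cReM cImM /=; ring.
Qed.

Lemma Hkl_normZ k l (a : R) x : Hkl k l x ->
  Hkl_norm k l (a *: x) = `|a| * Hkl_norm k l x.
Proof.
move=> [x1 [x2 _] [x3 _]]; rewrite /Hkl_norm.
have -> : `|a| = Num.sqrt (a ^+ 2) by rewrite sqrtr_sqr.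
rewrite -sqrtrM ?sqr_ge0//; congr Num.sqrt.
by rewrite !mulrDr; congr (_ + _ + _); exact: sqr_sobolev_normZ.
Qed.

Lemma Hkl_norm_ge0 k l x : 0 <= Hkl_norm k l x.
Proof. exact: sqrtr_ge0. Qed.

Lemma CHkl_normP k l (T c t : R) (U : R -> triple R d) : 0 <= t <= T ->
  (CHkl_norm k l T U <= c%:E)%E -> Hkl_norm k l (U t) <= c.
Proof.
move=> tT h; rewrite -lee_fin; apply: le_trans h.
by apply: ereal_sup_ubound; exists t => //=; rewrite in_itv.
Qed.

Lemma linear_mapZ k l (T a t : R) (L : triple R d -> R -> triple R d) x :
  linear_map k l T L -> Hkl k l x -> 0 <= t <= T -> L (a *: x) t = a *: L x t.
Proof.
move=> hL hx tT.
have L0 : L 0 t = 0.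
  have := hL 1 0 0 (Hkl0 k l) (Hkl0 k l) t tT.
  by rewrite scaler0 addr0 scale1r => /eqP; rewrite -subr_eq subrr => /eqP <-.
by have := hL a x 0 hx (Hkl0 k l) t tT; rewrite addr0 L0 addr0.
Qed.

End sobolev_triples.

(** * A second-order Taylor argument on the line *)

Section second_derivative.
Context (R : realType).

Lemma is_derive_epsdelta (f : R -> R) (x b : R) :
  (forall e, 0 < e -> exists2 dl, 0 < dl & forall h, `|h| < dl ->
     `|f (x + h) - f x - h * b| <= e * `|h|) -> is_derive x 1 f b.
Proof.
move=> H.
have c : (fun h : R => h^-1 *: (f (h *: (1 : R) + x) - f x)) @ 0^' --> b.
  apply/cvgrPdist_le => e e0; have [dl dl0 hd] := H e e0.
  near=> h.
  have h0 : h != 0 by near: h; exact: nbhs_dnbhs_neq.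
  have hdl : `|h| < dl by near: h; apply: dnbhs0_lt.
  rewrite /GRing.scale /= mulr1 distrC (addrC h).
  have -> : h^-1 * (f (x + h) - f x) - b = h^-1 * (f (x + h) - f x - h * b) by field.
  rewrite normrM normfV ler_pdivrMl ?normr_gt0// [leRHS]mulrC.
  exact: hd.
split; first by apply/cvg_ex; exists b.
exact: (@cvg_lim _ _ _ _ _ _ _ c).
Unshelve. all: by end_near.
Qed.

Lemma small_quadratic (p q : R) :
  (forall e, 0 < e -> exists2 dl, 0 < dl & forall z, 0 < z -> z < dl ->
     `|z * p + z ^+ 2 * q| <= e * z ^+ 2) -> q = 0.
Proof.
move=> H.
have p0 : p = 0.
  apply/eqP; rewrite -normr_le0 leNgt; apply/negP => pp.
  have [dl dl0 hd] := H 1 ltr01.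
  (* At this [z] the quadratic terms amount to at most half of the linear one, which contradicts the
     bound for [e = 1]. *)
  pose z := Num.min (dl / 2) (`|p| / (2 * (1 + `|q|))).
  have q1 : 0 < 1 + `|q| by rewrite ltr_pwDl.
  have z0 : 0 < z by rewrite lt_min !divr_gt0// mulr_gt0.
  have zd : z < dl by apply: (@le_lt_trans _ _ (dl / 2)); [rewrite ge_min lexx|lra].
  have zp : z * (2 * (1 + `|q|)) <= `|p|.
    by rewrite -ler_pdivlMr ?mulr_gt0// ge_min lexx orbT.
  have h1 := hd z z0 zd; rewrite mul1r in h1.
  have h2 : z * `|p| <= z ^+ 2 + z ^+ 2 * `|q|.
    have -> : z * `|p| = `|z * p + z ^+ 2 * q - z ^+ 2 * q|.
      by rewrite addrK normrM gtr0_norm.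
    apply: le_trans (ler_normB _ _) _; rewrite lerD//.
    by rewrite normrM ger0_norm ?sqr_ge0.
  have h3 : `|p| <= z * (1 + `|q|).
    by rewrite -(ler_pM2l z0); apply: le_trans h2 _; rewrite expr2; lra.
  by move: zp pp; rewrite mulrCA; lra.
apply/eqP; rewrite -normr_le0; apply/ler_addgt0Pl => e e0; rewrite addr0.
have [dl dl0 hd] := H e e0.
have z0 : 0 < dl / 2 by lra.
have zd : dl / 2 < dl by lra.
have := hd _ z0 zd; rewrite p0 mulr0 add0r normrM ger0_norm ?sqr_ge0// mulrC.
by rewrite ler_pM2r// exprn_gt0.
Qed.

(** The function [a z - z * b 0 - z^2 * c / 2] has derivative o(z) and, by the mean value theorem,
    is itself o(z^2). Comparing it with the cubic expansion for positive [z] leaves a linear and a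
    quadratic term, and [small_quadratic] makes the latter vanish. *)
Lemma second_order_taylor (a b : R -> R) (z0 a1 a2 c Q : R) : 0 < z0 -> 0 <= Q ->
  (forall z : R, `|z| < z0 -> is_derive z 1 a (b z)) ->
  (forall e, 0 < e -> exists2 dl, 0 < dl & forall z, 0 <= z -> z < dl ->
     `|b z - b 0 - z * c| <= e * z) ->
  (forall z, 0 <= z -> z < z0 -> `|a z - z * a1 - z ^+ 2 * a2| <= Q * z ^+ 3) ->
  c = 2 * a2.
Proof.
move=> z00 Q0 Da hb ha.
suff : a2 - c / 2 = 0 by lra.
apply: (@small_quadratic (a1 - b 0)) => e e0.
have e20 : 0 < e / 2 by lra.
have [dl dl0 hd] := hb _ e20.
have Q1 : 0 < 2 * (Q + 1) by rewrite mulr_gt0// ltr_wpDl.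
exists (Num.min z0 (Num.min dl (e / (2 * (Q + 1))))).
  by rewrite !lt_min z00 dl0 divr_gt0.
move=> z zp; rewrite !lt_min => /andP[zz0 /andP[zdl ze]].
have a00 : a 0 = 0.
  have := ha 0 (lexx _) z00; rewrite !expr0n /= !mul0r !mulr0 !subr0.
  by rewrite normr_le0 => /eqP.
pose g := fun y : R => a y - (y * b 0 + y ^+ 2 * (c / 2)).
have Dg (y : R) : `|y| < z0 -> is_derive y 1 g (b y - b 0 - y * c).
  move=> yz; have h1 := Da y yz.
  have h2 : is_derive y 1 (fun y : R => y * b 0 + y ^+ 2 * (c / 2)) (b 0 + y * c).
    apply: is_derive_epsdelta => e' e'0.
    have c1 : 0 < `|c / 2| + 1 by rewrite ltr_wpDl.
    exists (e' / (`|c / 2| + 1)); first exact: divr_gt0.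
    move=> h; rewrite ltr_pdivlMr// => hh.
    have -> : (y + h) * b 0 + (y + h) ^+ 2 * (c / 2) - (y * b 0 + y ^+ 2 * (c / 2)) -
      h * (b 0 + y * c) = (h * (c / 2)) * h by field.
    rewrite normrM ler_wpM2r// normrM; apply: le_trans (ltW hh).
    by rewrite ler_wpM2l// lerDl.
  rewrite (_ : b y - b 0 - y * c = b y - (b 0 + y * c)); last by ring.
  exact: is_deriveB.
have cg y : `|y| < z0 -> {for y, continuous g}.
  move=> yz; apply: differentiable_continuous; apply/derivable1_diffP.
  by have [] := Dg y yz.
have [y yz hy] : exists2 y, y \in `[0, z] & g z - g 0 = (b y - b 0 - y * c) * (z - 0).
  apply: MVT_segment; first exact: ltW.
    move=> y; rewrite in_itv /= => /andP[y0 yz]; apply: Dg.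
    by rewrite ger0_norm ?(ltW y0)// (lt_trans yz).
  apply: continuous_in_subspaceT => y; rewrite inE /= in_itv /= => /andP[y0 yz].
  by apply: cg; rewrite ger0_norm// (le_lt_trans yz).
move: yz; rewrite in_itv /= => /andP[y0 yz].
have hg : `|g z| <= e / 2 * z ^+ 2.
  have -> : g z = (b y - b 0 - y * c) * z.
    have g0 : g 0 = 0 by rewrite /g a00 expr0n /= !mul0r addr0 subr0.
    by rewrite -[RHS]/(_ * z) -{2}(subr0 z) -hy g0 subr0.
  rewrite normrM (ger0_norm (ltW zp)) expr2 mulrA; apply: ler_wpM2r; first exact: ltW.
  apply: (le_trans (hd y y0 (le_lt_trans yz zdl))).
  by rewrite ler_wpM2l// ltW.
have h3 := ha z (ltW zp) zz0.
have h4 : Q * z ^+ 3 <= e / 2 * z ^+ 2.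
  rewrite exprS mulrA; apply: ler_wpM2r; first exact: sqr_ge0.
  move: ze; rewrite ltr_pdivlMr// => ze.
  by move: zp Q0 ze; nra.
have -> : z * (a1 - b 0) + z ^+ 2 * (a2 - c / 2) =
    g z - (a z - z * a1 - z ^+ 2 * a2) by rewrite /g; ring.
apply: le_trans (ler_normB _ _) _.
have -> : e * z ^+ 2 = e / 2 * z ^+ 2 + e / 2 * z ^+ 2 by field.
by apply: lerD => //; exact: le_trans h3 h4.
Qed.

End second_derivative.

(** * Second Fréchet derivatives seen through a linear functional *)

Section frechet_functional.
Context (R : realType) (d : nat).
Variables (k l T : R) (S : triple R d -> R -> triple R d) (ell : triple R d -> R) (Lam : R).
Hypothesis Lam0 : 0 <= Lam.
Hypothesis ell_lin : forall a x y, Hkl k l x -> Hkl k l y ->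
  ell (a *: x + y) = a * ell x + ell y.
Hypothesis ell_bd : forall x, Hkl k l x -> `|ell x| <= Lam * Hkl_norm k l x.

Let ellB x y : Hkl k l x -> Hkl k l y -> ell (x - y) = ell x - ell y.
Proof. by move=> hx hy; rewrite addrC -scaleN1r ell_lin// mulN1r addrC. Qed.

Let ellZ a x : Hkl k l x -> ell (a *: x) = a * ell x.
Proof.
move=> hx; have h0 := @Hkl0 R d k l.
have e0 : ell 0 = 0.
  have := ell_lin 1 h0 h0; rewrite scaler0 addr0 mul1r; lra.
by rewrite -[_ *: _]addr0 ell_lin// e0 addr0.
Qed.

(** Along the ray [z *: h], the real function [ell (S (z *: h) t)] has derivative
    [ell (DS (z *: h) h t)], whose own right derivative at 0 is [ell (B h h t)]. This brings the
    statement to [second_order_taylor]. *)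
Lemma frechet_functional (DS B : triple R d -> triple R d -> R -> triple R d)
    (r rho : R) (h : triple R d) (t a1 a2 Q z0 : R) :
  0 < r -> 0 < rho ->
  (forall x, Hkl_ball k l r x -> Hkl k l (S x t)) ->
  (forall x, Hkl_ball k l rho x -> is_frechet_derivative k l T S x (DS x)) ->
  (forall x, Hkl k l x -> bounded_linear k l T (B x)) ->
  (forall h, Hkl k l h -> linear_map k l T (B^~ h)) ->
  (forall e, 0 < e -> exists2 delta, 0 < delta &
        forall x, Hkl k l x -> Hkl_norm k l x < delta ->
          op_bound k l T (e * Hkl_norm k l x)
            (fun h => DS x h - DS 0 h - B x h)) ->
  Hkl k l h -> 0 <= t <= T -> 0 < z0 -> 0 <= Q ->
  (forall z, 0 <= z -> z < z0 ->
     `|ell (S (z *: h) t) - z * a1 - z ^+ 2 * a2| <= Q * z ^+ 3) ->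
  ell (B h h t) = 2 * a2.
Proof.
move=> r0 rho0 hSm hDS hB hBl hD2 hh tT z00 Q0 hexp.
pose H := Hkl_norm k l h; have H0 : 0 <= H := Hkl_norm_ge0 k l h.
have H1 : 0 < H + 1 by rewrite ltr_wpDl.
have nz z : Hkl_norm k l (z *: h) = `|z| * H by rewrite Hkl_normZ.
pose z1 := Num.min z0 (Num.min (r / (H + 1)) (rho / (H + 1))).
have z10 : 0 < z1 by rewrite !lt_min z00 !divr_gt0.
have lt_ball z q : 0 < q -> `|z| < q / (H + 1) -> Hkl_norm k l (z *: h) < q.
  rewrite ltr_pdivlMr// nz => q0 hz; apply: le_lt_trans hz.
  by rewrite ler_wpM2l// lerDl.
have ballr z : `|z| < z1 -> Hkl_ball k l r (z *: h).
  by rewrite !lt_min => /andP[_ /andP[h1 _]]; split; [exact: HklZ|exact: lt_ball].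
have ballrho z : `|z| < z1 -> Hkl_ball k l rho (z *: h).
  by rewrite !lt_min => /andP[_ /andP[_ h1]]; split; [exact: HklZ|exact: lt_ball].
have HDS z : `|z| < z1 -> Hkl k l (DS (z *: h) h t).
  move=> hz; have [[c _ _] _] := hDS _ (ballrho z hz).
  by have [] := c h hh t tT.
have HB : Hkl k l (B h h t).
  by have [c _ _] := hB h hh; have [] := c h hh t tT.
apply: (@second_order_taylor _ (fun z => ell (S (z *: h) t)) (fun z => ell (DS (z *: h) h t))
  z1 a1 a2 _ Q) => //.
- move=> z hz; apply: is_derive_epsdelta => e e0.
  have [[_ lin _] hf] := hDS _ (ballrho z hz).
  (* Adding 1 to each factor keeps the divisions meaningful when [Lam] or the norm of [h] is 0. *)
  have L1 : 0 < (Lam + 1) * (H + 1) by rewrite mulr_gt0// ltr_wpDl.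
  have e1 : 0 < e / ((Lam + 1) * (H + 1)) by rewrite divr_gt0.
  have [dl dl0 hdl] := hf _ e1.
  exists (Num.min (dl / (H + 1)) (z1 - `|z|)).
    by rewrite lt_min divr_gt0//= subr_gt0.
  move=> y; rewrite lt_min => /andP[y1 y2].
  have zy : `|z + y| < z1.
    by apply: le_lt_trans (ler_normD _ _) _; rewrite addrC -ltrBrDr.
  have h1 := hdl (y *: h) (HklZ y hh) (lt_ball _ _ dl0 y1).
  have h2 := CHkl_normP tT h1.
  rewrite -scalerDl in h2.
  have m1 := hSm _ (ballr _ zy); have m2 := hSm _ (ballr _ hz).
  have m3 := HDS z hz.
  have h3 : Hkl_norm k l (S ((z + y) *: h) t - S (z *: h) t - y *: DS (z *: h) h t) <=
     e / ((Lam + 1) * (H + 1)) * (`|y| * H).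
    by rewrite -nz -(linear_mapZ y lin hh tT).
  have m4 := HklZ y m3.
  rewrite -(ellZ y m3) -(ellB m1 m2) -(ellB (HklB m1 m2) m4).
  apply: le_trans (ell_bd (HklB (HklB m1 m2) m4)) _.
  apply: (le_trans (ler_wpM2l Lam0 h3)).
  have -> : Lam * (e / ((Lam + 1) * (H + 1)) * (`|y| * H)) =
     (e * `|y|) * ((Lam * H) / ((Lam + 1) * (H + 1))) by ring.
  rewrite ler_piMr//; first by rewrite mulr_ge0// ltW.
  by rewrite ler_pdivrMr// mul1r; apply: ler_pM => //; rewrite lerDl.
- move=> e e0.
  have L1 : 0 < (Lam + 1) * (H + 1) ^+ 2.
    by rewrite mulr_gt0 ?exprn_gt0// ltr_wpDl.
  have e1 : 0 < e / ((Lam + 1) * (H + 1) ^+ 2) by rewrite divr_gt0.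
  have [dl dl0 hdl] := hD2 _ e1.
  exists (Num.min (dl / (H + 1)) z1); first by rewrite lt_min divr_gt0.
  move=> z zp; rewrite lt_min => /andP[zd zz].
  have az : `|z| < z1 by rewrite ger0_norm.
  have azd : `|z| < dl / (H + 1) by rewrite ger0_norm.
  have h1 := hdl (z *: h) (HklZ z hh) (lt_ball _ _ dl0 azd) h hh.
  have h2 := CHkl_normP tT h1.
  have a0 : `|0 : R| < z1 by rewrite normr0.
  have m1 := HDS z az; have m0 := HDS 0 a0; rewrite scale0r in m0 *.
  have m4 := HklZ z HB.
  rewrite -(ellZ z HB) -(ellB m1 m0) -(ellB (HklB m1 m0) m4).
  apply: le_trans (ell_bd (HklB (HklB m1 m0) m4)) _.
  rewrite -(linear_mapZ z (hBl h hh) hh tT).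
  apply: (le_trans (ler_wpM2l Lam0 h2)).
  rewrite nz (ger0_norm zp) -/H.
  have -> : Lam * (e / ((Lam + 1) * (H + 1) ^+ 2) * (z * H) * H) =
     (e * z) * ((Lam * H ^+ 2) / ((Lam + 1) * (H + 1) ^+ 2)) by ring.
  rewrite ler_piMr//; first by rewrite mulr_ge0// ltW.
  rewrite ler_pdivrMr// mul1r.
  apply: ler_pM => //; [exact: sqr_ge0|by rewrite lerDl|].
  by rewrite lerXn2r ?nnegrE ?(ltW H1)// lerDl.
move=> z zp; rewrite lt_min => /andP[zz _]; exact: hexp.
Qed.

End frechet_functional.

(** * Expansion of the solution along a ray of data *)

Section expansion.
Context (R : realType) (d : nat).
Local Notation E := 'rV[R]_d.
Local Notation mu := (lebesgue_rV R d).
Implicit Types (phih psih : E -> R[i]) (k f u n : R -> E -> R[i]).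

Lemma duh_scale2 T W C rho A B (b c : R[i]) k f (g : R -> E -> R[i]) t x : T <= W ->
  kbound C rho k -> xbound T W A f -> xbound T W B g -> 0 <= t <= T ->
  duh k (fun s y => b * f s y) (fun s y => c * g s y) t x = b * c * duh k f g t x.
Proof.
move=> TW hk hf hg tT; have := duhZ TW 1 b c x hk hf hg tT; rewrite mul1r => <-.
have -> // : (fun s y => 1 * k s y) = k.
by apply/funext => s; apply/funext => y; rewrite mul1r.
Qed.

(** The deviations from the linear flow are quadratic in [a] and multiply a factor of order [a], so
    the error is cubic. The constant is [4 * 2 + 4 = 12] from the two differences, doubled by
    [rho_wt]. *)
Lemma quadratic_remainder T W rho k u n u1 n1' a t x : 0 <= T -> T + 2 <= W ->
  (forall x, rho x <= 1 + n1 x) -> kbound (Cker R d) rho k ->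
  xbound T W a u1 -> xbound T W a n1' -> xbound T W (2 * a) u -> xbound T W (2 * a) n ->
  xbound T W (Kduh d T (Cker R d) * (2 * a) * (2 * a)) (fun s y => u s y - u1 s y) ->
  xbound T W (Kduh d T (Cker R d) * (2 * a) * (2 * a)) (fun s y => n s y - n1' s y) ->
  0 <= t <= T ->
  cn (duh k u n t x - duh k u1 n1' t x) <=
    24 * Kduh d T (Cker R d) ^+ 2 * a ^+ 3 * wt 1 x.
Proof.
move=> T0 TW2 rhoJ hk hu1 hn1 hu hn du dn tT; have [_ r0 _] := hk.
have TW : T <= W by move: TW2; lra.
have a0 := xbound_ge0 T0 hu1; have C0 := @Cker_ge0 R d; have K0 := Kduh_ge0 d T0 C0.
apply: (le_trans (duh_diff_bound T0 TW x C0 hk hu hn hu1 hn1 du dn tT)).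
move: K0; set D := Kduh _ _ _ => K0.
rewrite [leLHS](_ : _ = 12 * D ^+ 2 * a ^+ 3 * (rho x * wt (W - t) x)); last by ring.
rewrite [leRHS](_ : _ = 12 * D ^+ 2 * a ^+ 3 * (2 * wt 1 x)); last by ring.
apply: ler_wpM2l; last exact: (rho_wt TW2 rhoJ (r0 x) tT).
by apply: mulr_ge0; [apply: mulr_ge0 => //; exact: sqr_ge0|exact: exprn_ge0].
Qed.

Lemma wboundZ (A w : R) (z : R) (g : E -> R[i]) : 0 <= z -> wbound A w g ->
  wbound (z * A) w (fun x => z%:C * g x).
Proof.
move=> z0 [mg hg]; split; first by apply: CmeasurableM => //; exact: Cmeasurable_cst.
move=> x; apply: le_trans (cnM _ _) _; rewrite cn_real ger0_norm// -mulrA.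
by rewrite ler_wpM2l.
Qed.

(** Uniqueness identifies [S (z *: h)] with the constructed solution, whose bilinear terms differ
    from those of the linear flow by O(z^3). Only the components that are tested later, [u] and the
    time derivative of [n], are expanded. *)
Lemma solution_expansion (k l T r A : R) (S : triple R d -> R -> triple R d) phih psih :
  0 <= T -> well_posed k l T r S ->
  wbound A (T + 3) phih -> wbound A (T + 3) psih -> herm psih ->
  let h : triple R d := (dist_ifourier phih, dist_ifourier psih, 0) in
  exists z0 Q, [/\ 0 < z0, 0 <= Q & forall z, 0 <= z -> z < z0 ->
    exists u n m : R -> E -> R[i], forall t, 0 <= t <= T ->
    [/\ S (z *: h) t = traj u n m t,
        exists D, wbound D 1 (u t), exists D, wbound D 1 (m t),
        forall x, cn (u t x - (z%:C * linu phih t x +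
          (z ^+ 2)%:C * duh (@kU R d) (linu phih) (linn psih) t x)) <= Q * z ^+ 3 * wt 1 x &
        forall x, cn (m t x - (z%:C * linm psih t x +
          (z ^+ 2)%:C * duh (@kN R d) (linu phih) (sharpt (linu phih)) t x)) <=
          Q * z ^+ 3 * wt 1 x]].
Proof.
move=> T0 hS hphi hpsi rpsi h.
have C0 := @Cker_ge0 R d; have K0 := Kduh_ge0 d T0 C0; have A0 := wbound_ge0 hphi.
have hn0 := Hkl_norm_ge0 k l h.
have W2 : 1 <= T + 3 by lra.
have TW2 : T + 2 <= T + 3 by lra.
have TW : T <= T + 3 by lra.
have hh : Hkl k l h.
  split; first by exists phih => //; exact: wbound_weighted (wbound_weaken W2 hphi).
    split; first by exists psih => //; exact: wbound_weighted (wbound_weaken W2 hpsi).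
    apply: hermitian_real_dist => //.
    exact: weighted_tempered (wbound_weighted 0 (wbound_weaken W2 hpsi)).
  by split; [exact: sobolev0|move=> f _].
have [r0 _ uniq _] := hS.
move: K0; set D := Kduh d T (Cker R d) => K0.
have P1 : 0 < 16 * D * A + 1 by rewrite ltr_wpDl// mulr_ge0// mulr_ge0.
have P2 : 0 < Hkl_norm k l h + 1 by rewrite ltr_wpDl.
(* The first bound gives the smallness required by the Picard iteration, and the second keeps
   [z *: h] in the ball where uniqueness holds. *)
exists (Num.min (1 / (16 * D * A + 1)) (r / (Hkl_norm k l h + 1))).
exists (24 * D ^+ 2 * (2 * A) ^+ 3).
split; first by rewrite lt_min !divr_gt0.
  by apply: mulr_ge0; [apply: mulr_ge0 => //; exact: sqr_ge0|rewrite exprn_ge0 ?mulr_ge0].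
move=> z z0; rewrite lt_min !ltr_pdivlMr// => /andP[z1 z2].
have zphi := wboundZ z0 hphi; have zpsi := wboundZ z0 hpsi.
have zherm : herm (fun x => z%:C * psih x) by apply: (herm_mul (m := fun=> z)).
have small : 8 * D * (2 * (z * A)) <= 1.
  by rewrite [leLHS](_ : _ = z * (16 * D * A)); [move: z1 z0; lra|ring].
have [u [n [hu hn eu en sol]]] := explicit_solution k l T0 zphi zpsi zherm small.
set Lz := linu _ in eu; set Nz := linn _ in en.
pose m t x := linm (fun y => z%:C * psih y) t x + duh (@kN R d) u (sharpt u) t x.
rewrite -/m in sol.
exists u, n, m => t tT.
have t1 : tempered phih := weighted_tempered (wbound_weighted 0 (wbound_weaken W2 hphi)).
have t2 : tempered psih := weighted_tempered (wbound_weighted 0 (wbound_weaken W2 hpsi)).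
have eh : z *: h = (dist_ifourier (fun x => z%:C * phih x),
    dist_ifourier (fun x => z%:C * psih x), 0).
  by rewrite (dist_ifourierZ _ t1) (dist_ifourierZ _ t2) -[in RHS](scaler0 _ z).
have hus := xbound_sharpt hu.
have hL : xbound T (T + 3) (2 * (z * A)) Lz := xbound_linu T0 zphi.
have hN : xbound T (T + 3) (2 * (z * A)) Nz := xbound_linn T0 zpsi.
have eL : Lz = fun s y => z%:C * linu phih s y.
  by apply/funext => s; apply/funext => y; rewrite /Lz /linu mulrCA.
have eN : Nz = fun s y => z%:C * linn psih s y.
  by apply/funext => s; apply/funext => y; rewrite /Nz /linn mulrCA.
have hl := xbound_linu T0 hphi; have hln := xbound_linn T0 hpsi.
have du : xbound T (T + 3) (D * (2 * (2 * (z * A))) * (2 * (2 * (z * A))))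
    (fun s y => u s y - Lz s y).
  split; first exact: CmeasurableB hu.1 hL.1.
  move=> s sT x; rewrite eu// addrC addKr.
  apply: (le_trans (duh_bound T0 TW x C0 (@kbound_kU R d) hu hn sT)).
  by rewrite le_eqVlt /D /Kduh; apply/orP; left; apply/eqP; ring.
have dn : xbound T (T + 3) (D * (2 * (2 * (z * A))) * (2 * (2 * (z * A))))
    (fun s y => n s y - Nz s y).
  split; first exact: CmeasurableB hn.1 hN.1.
  move=> s sT x; rewrite en// addrC addKr.
  apply: (le_trans (duh_bound T0 TW x C0 (@kbound_kW R d) hu hus sT)).
  by rewrite le_eqVlt /D /Kduh; apply/orP; left; apply/eqP; ring.
have dus := xbound_sharpt du; rewrite sharptB in dus.
have eq3 : 24 * D ^+ 2 * (2 * (z * A)) ^+ 3 = 24 * D ^+ 2 * (2 * A) ^+ 3 * z ^+ 3 by ring.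
have zz : (z ^+ 2)%:C = z%:C * z%:C :> R[i] by apply: complex_ext => /=; ring.
split.
- have hb : Hkl_ball k l r (z *: h).
    split; first exact: HklZ.
    rewrite (Hkl_normZ z hh) (ger0_norm z0); apply: le_lt_trans z2.
    by rewrite ler_wpM2l// lerDl.
  rewrite -eh in sol; exact: esym (uniq _ _ hb sol t tT).
- exists (2 * (2 * (z * A))); apply: wbound_weaken (xbound_wbound tT hu).
  by case/andP: tT => _; lra.
- eexists; apply: wboundD; last exact: (duh_wbound T0 TW2 C0 (fun x => lexx _) (@kbound_kN R d) hu hus tT).
  apply: (wbound_poly (j := 3) _ _ _ (wbound_weaken _ zpsi)).
  + exact: (jmeas_section t (@jmeas_mW R d)).
  + exact: mulr_ge0.
  + by case/andP: tT => t0 _ x; have [_ hh' _] := @klip_mW R d; exact: hh'.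
  + by lra.
- move=> x; have := quadratic_remainder x T0 TW2 (fun x => J_ge1 x) (@kbound_kU R d) hL hN hu hn du dn tT.
  rewrite -/D eq3 {1}eL {1}eN (duh_scale2 _ _ x TW (@kbound_kU R d) hl hln tT) -zz.
  congr (cn _ <= _); rewrite eu// /Lz -[linu _ t x]/(mS t x * (z%:C * phih x)) opprD addrA.
  by congr (_ - _); rewrite /linu mulrCA addrC addKr.
- move=> x; have := quadratic_remainder x T0 TW2 (fun x => lexx _) (@kbound_kN R d) hL
    (xbound_sharpt hL) hu hus du dus tT.
  have eLs : sharpt Lz = fun s y => z%:C * sharpt (linu phih) s y.
    by apply/funext => s; apply/funext => y; rewrite eL /sharpt /sharp cjM cj_real.
  rewrite -/D eq3 {1}eL eLs (duh_scale2 _ _ x TW (@kbound_kN R d) hl (xbound_sharpt hl) tT) -zz.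
  congr (cn _ <= _); rewrite /m opprD addrA; congr (_ - _).
  by rewrite /linm mulrCA addrC addKr.
Qed.

End expansion.

(** * Integrals of a Fourier transform over a box *)

Section box_functional.
Context (R : realType) (d : nat).
Local Notation E := 'rV[R]_d.
Local Notation mu := (lebesgue_rV R d).

(** Abstracts [Re] and [Im]: the quadratic term of [u] has a sign in its imaginary part, that of the
    time derivative of [n] in its real part. *)
Definition realpart (p : R[i] -> R) := [/\
  forall a z w, p (a%:C * z + w) = a * p z + p w,
  forall z, `|p z| <= cn z, forall z, p z ^+ 2 <= sqmod z &
  forall f : E -> R[i], Cmeasurable f -> measurable_fun setT (fun x => p (f x))].

Lemma realpart_Re : realpart (@complex.Re R).
Proof.
split.
- by move=> a z w; rewrite RI cReM /= mul0r subr0.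
- exact: ler_Re_cn.
- by move=> z; rewrite lerDl sqr_ge0.
- by move=> f [].
Qed.

Lemma realpart_Im : realpart (@complex.Im R).
Proof.
split.
- by move=> a z w; rewrite RI cImM /= mul0r addr0.
- exact: ler_Im_cn.
- by move=> z; rewrite lerDr sqr_ge0.
- by move=> f [].
Qed.

Variables (p : R[i] -> R) (c : E).
Hypothesis hp : realpart p.
Local Notation bx x := ((boxb 1 c x)%:R : R).

Definition boxint (g : E -> R[i]) : R := \int[mu]_x (bx x * p (g x)).

Let mbx : measurable_fun setT (fun x : E => bx x).
Proof. by apply: measurable_boxb; exact: measurable_id. Qed.

Lemma bx_ge0 x : 0 <= bx x. Proof. exact: ler0n. Qed.

Lemma bx_le1 x : bx x <= 1. Proof. by case: boxb. Qed.

Let mpg g : Cmeasurable g -> measurable_fun setT (fun x => bx x * p (g x)).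
Proof. by move=> mg; have [_ _ _ h] := hp; apply: measurable_funM => //; exact: h. Qed.

(** The square of the norm dual to H^s of the indicator of the box; its root bounds the functional
    [distint] on H^s. *)
Definition boxweight (s : R) : R := \int[mu]_x (bx x * bracket2 (- s) x).

Lemma bracket2N s (x : E) : bracket2 (- s) x = (bracket2 s x)^-1.
Proof. by rewrite /bracket2 powRN. Qed.

Lemma boxb_n1 (r : R) (a x : E) : boxb r a x -> n1 x <= n1 a + d%:R * r.
Proof.
move=> /forallP h; rewrite -{1}(subrK a x) addrC; apply: (le_trans (n1D _ _)).
rewrite lerD2l; apply: (@le_trans _ _ (\sum_(i < d) r)).
  by apply: ler_sum => i _; rewrite !mxE; exact: h.
by rewrite sumr_const card_ord mulr_natl.
Qed.

Lemma intble_boxweight s : intble mu (fun x => bx x * bracket2 (- s) x).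
Proof.
pose K := (1 + (n1 c + d%:R)) ^+ (2 * pw (- s)).
apply: (intble_dom _ (intbleZ K (intble_boxb c ler01))).
  by apply: measurable_funM => //; exact: measurable_bracket2.
move=> x; rewrite ger0_norm; last by rewrite mulr_ge0 ?bx_ge0// ltW// bracket2_gt0.
rewrite mulrC; case: (boolP (boxb 1 c x)) => hb; last by rewrite !mulr0.
rewrite !mulr1; apply: le_trans (bracket2_le _ _) _.
apply: lerXn2r; rewrite ?nnegrE ?addr_ge0 ?n1_ge0// lerD2l.
by have := boxb_n1 hb; rewrite mulr1.
Qed.

(* Young's inequality; the optimal [lambda] gives Cauchy-Schwarz in [boxint_bound]. *)
Lemma young s g x (lambda : R) : 0 < lambda ->
  `|bx x * p (g x)| <= lambda / 2 * (bx x * bracket2 (- s) x) +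
     (2 * lambda)^-1 * (bracket2 s x * sqmod (g x)).
Proof.
move=> l0; have [_ _ hsq _] := hp.
have b0 := bracket2_gt0 s x; have s0 := sqmod_ge0 (g x).
rewrite bracket2N; move: b0; set b := bracket2 s x => b0.
case: (boolP (boxb 1 c x)) => hb; last first.
  rewrite !mul0r normr0 mulr0 add0r.
  by rewrite !mulr_ge0// ?invr_ge0 ?mulr_ge0// ltW.
rewrite !mul1r; have h := hsq (g x).
apply: (@le_trans _ _ (lambda / 2 * b^-1 + (2 * lambda)^-1 * (b * p (g x) ^+ 2))); last first.
  by rewrite lerD2l ler_wpM2l ?invr_ge0 ?mulr_ge0 ?(ltW l0)// ler_wpM2l// ltW.
rewrite -(real_normK (num_real (p (g x)))); set y := `|p (g x)|.
rewrite -subr_ge0.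
have -> : lambda / 2 * b^-1 + (2 * lambda)^-1 * (b * y ^+ 2) - y =
   (2 * lambda * b)^-1 * (lambda - b * y) ^+ 2.
  by field; rewrite !gt_eqF.
by rewrite mulr_ge0 ?sqr_ge0// invr_ge0 !mulr_ge0// ltW.
Qed.

Lemma intble_box s g : weighted_L2 s g -> intble mu (fun x => bx x * p (g x)).
Proof.
move=> wg; apply: (intble_dom (mpg wg.1)
  (intbleD (intbleZ (1 / 2) (intble_boxweight s)) (intbleZ ((2 * 1)^-1) (weighted_intble wg)))).
by move=> x; exact: young.
Qed.

(** Cauchy-Schwarz, by inserting in [young] the parameter [lambda] equal to the quotient of the two
    square roots. Both are first increased by [w] so that the quotient is defined and positive. *)
Lemma boxint_bound s g : weighted_L2 s g ->
  `|boxint g| <= Num.sqrt (boxweight s) * Num.sqrt (\int[mu]_x (bracket2 s x * sqmod (g x))).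
Proof.
move=> wg; have P0 : 0 <= boxweight s.
  by apply: Rintegral_ge0 => x _; rewrite mulr_ge0 ?bx_ge0// ltW// bracket2_gt0.
have N0 : 0 <= \int[mu]_x (bracket2 s x * sqmod (g x)).
  by apply: Rintegral_ge0 => x _; rewrite mulr_ge0 ?sqmod_ge0// ltW// bracket2_gt0.
set N := Rintegral _ _ _ in N0 *.
have key (la : R) : 0 < la -> `|boxint g| <= la / 2 * boxweight s + (2 * la)^-1 * N.
  move=> l0; rewrite /boxweight /N.
  rewrite -(Rintegral_scale _ (intble_boxweight s)) -(Rintegral_scale _ (weighted_intble wg)).
  rewrite -Rintegral_add; [|apply: intbleZ; exact: intble_boxweight|
                            apply: intbleZ; exact: weighted_intble wg].
  apply: ler_norm_Rintegral; first exact: mpg wg.1.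
    apply: intbleD; apply: intbleZ; [exact: intble_boxweight|exact: weighted_intble wg].
  by move=> x; exact: young.
set P := boxweight s in P0 key *.
have sP := sqr_sqrtr P0; have sN := sqr_sqrtr N0.
have sP0 := sqrtr_ge0 P; have sN0 := sqrtr_ge0 N.
set a := Num.sqrt P in sP sP0 *; set b := Num.sqrt N in sN sN0 *.
apply/ler_addgt0Pl => e e0.
(* Taking [w] below [et] and below 1 makes the excess [w * (a + b + w)] at most [e]. *)
pose et := e / (1 + a + b + 1).
have d0 : 0 < 1 + a + b + 1 by move: sP0 sN0; lra.
have et0 : 0 < et by rewrite divr_gt0.
have ae : 0 < a + Num.min et 1 by rewrite ltr_wpDl// lt_min et0 ltr01.
have be : 0 < b + Num.min et 1 by rewrite ltr_wpDl// lt_min et0 ltr01.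
set w := Num.min et 1 in ae be.
have w0 : 0 < w by rewrite lt_min et0 ltr01.
have w1 : w <= 1 by rewrite ge_min lexx orbT.
have we : w * (1 + a + b + 1) <= e by rewrite -ler_pdivlMr// ge_min lexx.
apply: (le_trans (key _ (divr_gt0 be ae))).
have h1 : P <= (a + w) ^+ 2 by rewrite -sP; apply: lerXn2r; rewrite ?nnegrE ?(ltW ae)// lerDl ltW.
have h2 : N <= (b + w) ^+ 2 by rewrite -sN; apply: lerXn2r; rewrite ?nnegrE ?(ltW be)// lerDl ltW.
apply: (@le_trans _ _ ((a + w) * (b + w))).
  have -> : (a + w) * (b + w) = (b + w) / (a + w) / 2 * (a + w) ^+ 2 +
     (2 * ((b + w) / (a + w)))^-1 * (b + w) ^+ 2.
    by field; rewrite !gt_eqF.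
  apply: lerD; apply: ler_wpM2l => //; first by rewrite !divr_ge0// ltW.
  by rewrite invr_ge0 mulr_ge0// divr_ge0// ltW.
have -> : (a + w) * (b + w) = a * b + w * (a + b + w) by ring.
rewrite addrC lerD2r; apply: le_trans we; rewrite ler_wpM2l ?(ltW w0)//; lra.
Qed.

Lemma boxint_ae s s' g g' : weighted_L2 s g -> weighted_L2 s' g' ->
  {ae mu, forall x, g x = g' x} -> boxint g = boxint g'.
Proof.
move=> wg wg' h; apply: ae_eq_Rintegral; [exact: mpg wg.1|exact: mpg wg'.1|].
by apply: filterS h => x ->.
Qed.

Lemma boxint_lin s (a : R) g g' : weighted_L2 s g -> weighted_L2 s g' ->
  boxint (fun x => a%:C * g x + g' x) = a * boxint g + boxint g'.
Proof.
move=> wg wg'; have [hl _ _ _] := hp.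
have i1 := intble_box wg; have i2 := intble_box wg'.
rewrite /boxint -(Rintegral_scale a i1) -Rintegral_add//; last exact: intbleZ.
by apply: eq_Rintegral => x _; rewrite hl; ring.
Qed.

Definition distint (u : dist R d) : R := boxint (fourier u).

Lemma distint_lin s (a : R) (u v : dist R d) : sobolev s u -> sobolev s v ->
  distint (a *: u + v) = a * distint u + distint v.
Proof.
move=> hu hv; have [wu _] := sobolevP hu; have [wv _] := sobolevP hv.
have [ha ea] := sobolevZ a hu; have [hD eD] := sobolevD ha hv.
have [wD _] := sobolevP hD.
rewrite -(boxint_lin _ wu wv); apply: (boxint_ae (s' := s) wD).
  by apply: weighted_L2D => //; exact: weighted_L2Z.
by apply: filterS2 eD ea => x -> ->.
Qed.

Lemma distint_bound s (u : dist R d) : sobolev s u ->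
  `|distint u| <= Num.sqrt (boxweight s) * sobolev_norm s u.
Proof. by move=> /sobolevP[wu _]; exact: boxint_bound. Qed.

Lemma distint_ifourier D g : wbound D 1 g -> distint (dist_ifourier g) = boxint g.
Proof.
move=> hg; have wg := wbound_weighted 0 hg.
have [w1 _] : weighted_L2 0 (fourier (dist_ifourier g)) /\ dist_ifourier g = dist_ifourier (fourier (dist_ifourier g)).
  by apply: sobolevP; exists g.
by apply: (boxint_ae w1 wg); have [] := fourierP wg.
Qed.

Lemma boxint_expansion (D D1 D2 Q z : R) g g1 g2 :
  wbound D 1 g -> wbound D1 1 g1 -> wbound D2 1 g2 ->
  (forall x, cn (g x - (z%:C * g1 x + (z ^+ 2)%:C * g2 x)) <= Q * wt 1 x) ->
  `|boxint g - z * boxint g1 - z ^+ 2 * boxint g2| <= Q * \int[mu]_x (wt 1 x : R).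
Proof.
move=> hg h1 h2 hr; have [hl hc _ _] := hp.
have wg := wbound_weighted 0 hg; have w1 := wbound_weighted 0 h1.
have w2 := wbound_weighted 0 h2.
have w3 : weighted_L2 0 (fun x => (z ^+ 2)%:C * g2 x) by exact: weighted_L2Z.
have w4 : weighted_L2 0 (fun x => z%:C * g1 x + (z ^+ 2)%:C * g2 x).
  by apply: weighted_L2D => //; exact: weighted_L2Z.
have i2 := intble_box w2.
have e2 : boxint (fun x => (z ^+ 2)%:C * g2 x) = z ^+ 2 * boxint g2.
  rewrite /boxint -(Rintegral_scale _ i2); apply: eq_Rintegral => x _.
  have := hl (z ^+ 2) (g2 x) 0; have := hl 1 0 0.
  rewrite !addr0 mulr0 mul1r => e0 ->.
  have -> : p 0 = 0 by lra.
  by rewrite addr0 mulrCA.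
have e4 := boxint_lin z w1 w3; rewrite e2 in e4.
rewrite (_ : _ - _ = boxint g - boxint (fun x => z%:C * g1 x + (z ^+ 2)%:C * g2 x)); last first.
  by rewrite e4; ring.
have ig := intble_box wg; have i4 := intble_box w4.
rewrite /boxint -(Rintegral_sub ig i4).
have iw := intble_wt (R := R) d (ler01 : 0 <= 1 :> R).
rewrite -(Rintegral_scale _ iw); apply: ler_norm_Rintegral.
- by apply: measurable_funB; [exact: mpg wg.1|exact: mpg w4.1].
- exact: intbleZ.
move=> x; apply: le_trans (hr x); rewrite -mulrBr normrM ger0_norm ?bx_ge0//.
have -> : p (g x) - p (z%:C * g1 x + (z ^+ 2)%:C * g2 x) =
    p (g x - (z%:C * g1 x + (z ^+ 2)%:C * g2 x)).
  set y := z%:C * g1 x + _; have := hl (-1) y (g x); rewrite mulN1r [X in _ = X]addrC => <-; congr p.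
  by rewrite addrC; congr (_ + _); case: y => a b; apply: complex_ext => /=; ring.
apply: le_trans (hc _); rewrite ler_piMl//; exact: bx_le1.
Qed.

End box_functional.

(** * The quadratic term at high frequency *)

Section second_derivative_bound.
Context (R : realType) (d : nat).
Local Notation E := 'rV[R]_d.
Local Notation mu := (lebesgue_rV R d).
Local Notation lam := (@lebesgue_measure R).
Implicit Types (phih psih : E -> R[i]).

Lemma sobolev_le_Hkl_norm (k l : R) (x : triple R d) :
  sobolev_norm k x.1.1 <= Hkl_norm k l x /\ sobolev_norm (l - 1) x.2 <= Hkl_norm k l x.
Proof.
have h1 := sqr_ge0 (sobolev_norm k x.1.1); have h2 := sqr_ge0 (sobolev_norm l x.1.2).
have h3 := sqr_ge0 (sobolev_norm (l - 1) x.2).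
split.
  rewrite -[leLHS](ger0_norm (sobolev_norm_ge0 _ _)) -sqrtr_sqr; apply: ler_wsqrtr; lra.
rewrite -[leLHS](ger0_norm (sobolev_norm_ge0 _ _)) -sqrtr_sqr; apply: ler_wsqrtr; lra.
Qed.

(** The tested quadratic term equals the functional applied to [B h h], and is bounded by the dual
    norm of the box times the bilinear bound. What will be contradicted is that [M] depends neither
    on the data nor on the box nor on the time. *)
Lemma second_derivative_bound (k l T r : R) (S : triple R d -> R -> triple R d) :
  0 <= T -> well_posed k l T r S -> twice_frechet_differentiable_at0 k l T S ->
  exists M, forall A phih psih (c : E) t,
    wbound A (T + 3) phih -> wbound A (T + 3) psih -> herm psih -> 0 <= t <= T ->
    let H := Hkl_norm k l ((dist_ifourier phih, dist_ifourier psih, 0) : triple R d) in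
    `|2 * boxint (@complex.Im R) c (duh (@kU R d) (linu phih) (linn psih) t)| <=
      Num.sqrt (boxweight c k) * (M * H * H) /\
    `|2 * boxint (@complex.Re R) c (duh (@kN R d) (linu phih) (sharpt (linu phih)) t)| <=
      Num.sqrt (boxweight c (l - 1)) * (M * H * H).
Proof.
move=> T0 hS [DS [B [[rho rho0 hDS] hB hBl [M hM] hD2]]]; exists M.
move=> A phih psih c t hphi hpsi rpsi tT.
pose h : triple R d := (dist_ifourier phih, dist_ifourier psih, 0).
rewrite -/h; set H := Hkl_norm k l h.
have C0 := @Cker_ge0 R d.
have TW2 : T + 2 <= T + 3 by lra.
have W1 : 1 <= T + 3 by lra.
have W2 : 2 <= T + 3 by lra.
have A0 := wbound_ge0 hphi.
have hl := xbound_linu T0 hphi; have hln := xbound_linn T0 hpsi.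
have hls := xbound_sharpt hl.
have tW : 1 <= T + 3 - t by case/andP: tT => _; lra.
have w1 := wbound_weaken tW (xbound_wbound tT hl).
have w2 := duh_wbound T0 TW2 C0 (fun x => J_ge1 x) (@kbound_kU R d) hl hln tT.
have w3 : wbound (2 * A * 4%:R ^+ 3) 1 (linm psih t).
  apply: (wbound_poly (j := 3) _ A0 _ (wbound_weaken W2 hpsi)).
    exact: (jmeas_section t (@jmeas_mW R d)).
  by case/andP: tT => t0 _ x; have [_ h' _] := @klip_mW R d; exact: h'.
have w4 := duh_wbound T0 TW2 C0 (fun x => lexx _) (@kbound_kN R d) hl hls tT.
have hh : Hkl k l h.
  split; first by exists phih => //; exact: wbound_weighted (wbound_weaken W1 hphi).
    split; first by exists psih => //; exact: wbound_weighted (wbound_weaken W1 hpsi).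
    apply: hermitian_real_dist => //.
    exact: weighted_tempered (wbound_weighted 0 (wbound_weaken W1 hpsi)).
  by split; [exact: sobolev0|move=> f _].
have [z0 [Q [z00 Q0 hexp]]] := solution_expansion T0 hS hphi hpsi rpsi.
have [r0 sol _ _] := hS.
have hSm x : Hkl_ball k l r x -> Hkl k l (S x t).
  move=> hx; have := sol x hx; case: x hx => -[x1 x2] x3 hx [hC _].
  by have [] := hC t tT.
have HB : Hkl k l (B h h t) by have [c' _ _] := hB h hh; have [] := c' h hh t tT.
have nB : Hkl_norm k l (B h h t) <= M * H * H.
  exact: (CHkl_normP tT (hM h hh h hh)).
pose I := \int[mu]_x (wt 1 x : R).
have I0 : 0 <= I by apply: Rintegral_ge0 => x _; exact: wt_ge0.
have QI0 : 0 <= Q * I by exact: mulr_ge0.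
split.
  pose ell (x : triple R d) := distint (@complex.Im R) c x.1.1.
  have hp := @realpart_Im R d.
  have ell_lin a x y : Hkl k l x -> Hkl k l y -> ell (a *: x + y) = a * ell x + ell y.
    by move=> [x1 _ _] [y1 _ _]; exact: (distint_lin c hp a x1 y1).
  have ell_bd x : Hkl k l x -> `|ell x| <= Num.sqrt (boxweight c k) * Hkl_norm k l x.
    move=> [x1 _ _]; apply: (le_trans (distint_bound c hp x1)).
    by apply: ler_wpM2l; [exact: sqrtr_ge0|have [] := sobolev_le_Hkl_norm k l x].
  rewrite -(frechet_functional (sqrtr_ge0 _) ell_lin ell_bd r0 rho0 hSm hDS hB hBl hD2 hh tT z00 QI0
      (a1 := boxint (@complex.Im R) c (linu phih t))).
    apply: (le_trans (ell_bd _ HB)); apply: ler_wpM2l nB; exact: sqrtr_ge0.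
  move=> z zp zz; have [u [n [m hu]]] := hexp z zp zz.
  have [-> [D hD] _ hr _] := hu t tT.
  rewrite /ell /traj /= (distint_ifourier c hp hD) [leRHS]mulrAC.
  exact: (boxint_expansion c hp hD w1 w2 hr).
pose ell (x : triple R d) := distint (@complex.Re R) c x.2.
have hp := @realpart_Re R d.
have ell_lin a x y : Hkl k l x -> Hkl k l y -> ell (a *: x + y) = a * ell x + ell y.
  by move=> [_ _ [x1 _]] [_ _ [y1 _]]; exact: (distint_lin c hp a x1 y1).
have ell_bd x : Hkl k l x -> `|ell x| <= Num.sqrt (boxweight c (l - 1)) * Hkl_norm k l x.
  move=> [_ _ [x1 _]]; apply: (le_trans (distint_bound c hp x1)).
  by apply: ler_wpM2l; [exact: sqrtr_ge0|have [] := sobolev_le_Hkl_norm k l x].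
rewrite -(frechet_functional (sqrtr_ge0 _) ell_lin ell_bd r0 rho0 hSm hDS hB hBl hD2 hh tT z00 QI0
    (a1 := boxint (@complex.Re R) c (linm psih t))).
  apply: (le_trans (ell_bd _ HB)); apply: ler_wpM2l nB; exact: sqrtr_ge0.
move=> z zp zz; have [u [n [m hu]]] := hexp z zp zz.
have [-> _ [D hD] _ hr] := hu t tT.
rewrite /ell /traj /= (distint_ifourier c hp hD) [leRHS]mulrAC.
exact: (boxint_expansion c hp hD w3 w4 hr).
Qed.

End second_derivative_bound.

(** * Signs of the quadratic terms at small times *)

Section duhamel_sign.
Context (R : realType) (d : nat).
Local Notation E := 'rV[R]_d.
Local Notation mu := (lebesgue_rV R d).
Local Notation lam := (@lebesgue_measure R).

(** A pointwise bound passes through the integrals in frequency and in time. [p] stands for [Re] or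
    [Im], which commute with [Cint] because complex integrals are defined by components. *)
Lemma duh_part_le (p : R[i] -> R) (T W C A B : R) (rho : E -> R) (k f g : R -> E -> R[i])
    t x (b : E -> R) :
  (forall F, p (Cint mu F) = \int[mu]_x p (F x)) ->
  (forall F, Cintble mu F -> intble mu (fun x => p (F x))) ->
  (forall F, p (Cint lam F) = \int[lam]_x p (F x)) ->
  (forall F, Cintble lam F -> intble lam (fun x => p (F x))) ->
  p 0 = 0 ->
  T <= W -> kbound C rho k -> xbound T W A f -> xbound T W B g -> 0 <= t <= T ->
  intble mu b ->
  (forall s y, 0 <= s <= t -> p (k (t - s) x * (f s (x - y) * g s y)) <= - b y) ->
  p (duh k f g t x) <= - (t * \int[mu]_y b y).
Proof.
move=> hp1 hi1 hp2 hi2 p0 TW hk hf hg /andP[t0 tT] ib hb.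
rewrite /duh hp2; set J := \int[mu]_y b y.
apply: (@le_trans _ _ (\int[lam]_s (if 0 <= s <= t then - J else 0))); last first.
  by rewrite Rintegral_itv_cst// subr0 mulNr mulrC.
apply: ler_Rintegral.
- exact: hi2 (Cintble_duh TW x hk hf hg tT).
- exact: intble_itv.
move=> s; rewrite /duh_integrand; case: ifP => [st|_]; last by rewrite p0.
have [s0 st'] := andP st.
have sT : 0 <= s <= T by rewrite s0 (le_trans st').
have w0 : 0 <= W - s by rewrite subr_ge0; case/andP: sT => _ /le_trans; apply.
have ic := Cintble_conv_integrand x w0 (xbound_wbound sT hf) (xbound_wbound sT hg).
rewrite /convol -(CintZ _ ic) hp1 -(Rintegral_opp ib); apply: ler_Rintegral.
- by apply: hi1; exact: CintbleZ.
- exact: intbleN.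
- by move=> y; exact: hb.
Qed.

Lemma cos_ge_half (a : R) : `|a| <= 2^-1 -> 2^-1 <= cos a.
Proof.
move=> h; have := cos_lip 0 a; rewrite cos0 sub0r normrN => h1.
have := ler_norm (1 - cos a); lra.
Qed.

(** The factor [-i] moves the cosine into the imaginary part, which is why the term of [u] is tested
    with [Im]. *)
Lemma expiM_Im (a q : R) : complex.Im (- (0 +i* 1) * expi (- a) * q%:C) = - (cos a * q).
Proof. by rewrite /expi cosN sinN /=; ring. Qed.

Section phases.
Variables (ph ps : E -> R) (L t s : R) (x y : E).
Hypotheses (ph0 : forall z, 0 <= ph z) (ps0 : forall z, 0 <= ps z).
Hypotheses (phL : forall z, ph z != 0 -> enorm z <= L) (psL : forall z, ps z != 0 -> enorm z <= L).
Hypotheses (xL : enorm x <= L) (L1 : 1 <= L) (st : 0 <= s <= t) (tL : t * L ^+ 2 <= 2^-1).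

(** All phases have this form. The Schrodinger ones are quadratic in the frequency; the wave ones
    are linear, and are below [L ^+ 2] too because [L] is at least 1. *)
Let phase_le (a b : R) : 0 <= a -> a <= L ^+ 2 -> 0 <= b -> b <= L ^+ 2 ->
  (t - s) * a + s * b <= 2^-1.
Proof.
move=> a0 aL b0 bL; have [s0 st'] := andP st.
apply: le_trans tL; have ts : 0 <= t - s by rewrite subr_ge0.
rewrite (_ : t * L ^+ 2 = (t - s) * L ^+ 2 + s * L ^+ 2); last by ring.
by apply: lerD; apply: ler_wpM2l.
Qed.

Let sqL (z : E) : enorm z <= L -> enorm z ^+ 2 <= L ^+ 2.
Proof.
by move=> h; apply: lerXn2r; rewrite ?nnegrE ?enorm_ge0 ?(le_trans (enorm_ge0 z)).
Qed.

Let leL (z : E) : enorm z <= L -> enorm z <= L ^+ 2.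
Proof.
move=> h; apply: (le_trans h); rewrite expr2 ler_peMl//.
by rewrite (le_trans _ L1).
Qed.

(** The kernel and the linear flow of [u] combine into one oscillating factor, and the wave flow
    contributes a cosine; two cosines that are at least 1/2 give the factor 1/4. *)
Lemma schrodinger_phase :
  complex.Im (kU (t - s) x * (linu (fun z => (ph z)%:C) s (x - y) * linn (fun z => (ps z)%:C) s y)) <=
  - (cF R d / 4 * (ph (x - y) * ps y)).
Proof.
have [s0 st'] := andP st.
have -> : kU (t - s) x * (linu (fun z => (ph z)%:C) s (x - y) * linn (fun z => (ps z)%:C) s y) =
    - (0 +i* 1) * expi (- ((t - s) * enorm x ^+ 2 + s * enorm (x - y) ^+ 2)) *
    (cF R d * cos (s * enorm y) * (ph (x - y) * ps y))%:C.
  rewrite /kU /kS /scalek /linu /linn /mS /mC opprD expiD.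
  have -> : (cF R d * cos (s * enorm y) * (ph (x - y) * ps y))%:C =
     (cF R d)%:C * (cos (s * enorm y))%:C * ((ph (x - y))%:C * (ps y)%:C) :> R[i].
    by apply: complex_ext => /=; ring.
  by ring.
rewrite expiM_Im lerN2.
have [->|h1] := eqVneq (ph (x - y)) 0; first by rewrite mul0r !mulr0.
have [->|h2] := eqVneq (ps y) 0; first by rewrite mulr0 !mulr0.
have c1 : 2^-1 <= cos ((t - s) * enorm x ^+ 2 + s * enorm (x - y) ^+ 2).
  apply: cos_ge_half; rewrite ger0_norm; last first.
    by rewrite addr_ge0// mulr_ge0 ?sqr_ge0// subr_ge0.
  by apply: phase_le; rewrite ?sqr_ge0// sqL// phL.
have c2 : 2^-1 <= cos (s * enorm y).
  apply: cos_ge_half; rewrite ger0_norm; last by rewrite mulr_ge0 ?enorm_ge0.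
  have := phase_le (lexx 0) (sqr_ge0 L) (enorm_ge0 y) (leL (psL h2)).
  by rewrite mulr0 add0r.
have q0 : 0 <= cF R d * (ph (x - y) * ps y).
  by rewrite mulr_ge0 ?(ltW (cF_gt0 R d))// mulr_ge0.
rewrite [leLHS](_ : _ = 2^-1 * 2^-1 * (cF R d * (ph (x - y) * ps y))); last by field.
rewrite [leRHS](_ : _ = cos ((t - s) * enorm x ^+ 2 + s * enorm (x - y) ^+ 2) *
   cos (s * enorm y) * (cF R d * (ph (x - y) * ps y))); last by ring.
by apply: ler_wpM2r => //; apply: ler_pM; rewrite ?invr_ge0.
Qed.

(** The sign comes from the Laplacian. The phases of [u] and of its conjugate are subtracted, and as
    both lie between 0 and 1/2, so does the modulus of the difference. *)
Lemma wave_phase :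
  complex.Re (kN (t - s) x * (linu (fun z => (ph z)%:C) s (x - y) *
    sharpt (linu (fun z => (ph z)%:C)) s y)) <=
  - (cF R d / 4 * enorm x ^+ 2 * (ph (x - y) * ph (- y))).
Proof.
have [s0 st'] := andP st.
have -> : kN (t - s) x * (linu (fun z => (ph z)%:C) s (x - y) *
    sharpt (linu (fun z => (ph z)%:C)) s y) =
    expi (s * enorm y ^+ 2 - s * enorm (x - y) ^+ 2) *
    (cF R d * - (enorm x ^+ 2 * cos ((t - s) * enorm x)) * (ph (x - y) * ph (- y)))%:C.
  rewrite kN_real /sharpt /sharp /linu /mS cjM -expiN opprK cj_real enormN expiD.
  have e (a b c : R) : (a * b * c)%:C = a%:C * b%:C * c%:C :> R[i].
    by apply: complex_ext => /=; ring.
  have e2 (a b : R) : (a * b)%:C = a%:C * b%:C :> R[i].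
    by apply: complex_ext => /=; ring.
  by rewrite !e2; ring.
rewrite cReM /= mulr0 subr0.
have [->|h1] := eqVneq (ph (x - y)) 0; first by rewrite mul0r !mulr0 oppr0.
have [->|h2] := eqVneq (ph (- y)) 0; first by rewrite mulr0 !mulr0 oppr0.
have yL : enorm y <= L by rewrite -enormN phL.
have c1 : 2^-1 <= cos (s * enorm y ^+ 2 - s * enorm (x - y) ^+ 2).
  apply: cos_ge_half; rewrite ler_norml.
  have a1 := phase_le (lexx 0) (sqr_ge0 L) (sqr_ge0 (enorm y)) (sqL yL).
  have a2 := phase_le (lexx 0) (sqr_ge0 L) (sqr_ge0 (enorm (x - y))) (sqL (phL h1)).
  rewrite !mulr0 !add0r in a1 a2.
  have b1 := mulr_ge0 s0 (sqr_ge0 (enorm y)).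
  have b2 := mulr_ge0 s0 (sqr_ge0 (enorm (x - y))).
  by apply/andP; split; lra.
have c2 : 2^-1 <= cos ((t - s) * enorm x).
  apply: cos_ge_half; rewrite ger0_norm; last by rewrite mulr_ge0 ?enorm_ge0 ?subr_ge0.
  have := phase_le (enorm_ge0 x) (leL xL) (lexx 0) (sqr_ge0 L).
  by rewrite mulr0 addr0.
have q0 : 0 <= cF R d * enorm x ^+ 2 * (ph (x - y) * ph (- y)).
  by apply: mulr_ge0; [exact: mulr_ge0 (ltW (cF_gt0 R d)) (sqr_ge0 _)|exact: mulr_ge0].
rewrite [leLHS](_ : _ = - (cos (s * enorm y ^+ 2 - s * enorm (x - y) ^+ 2) *
   cos ((t - s) * enorm x) * (cF R d * enorm x ^+ 2 * (ph (x - y) * ph (- y))))); last by ring.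
rewrite lerN2.
rewrite [leLHS](_ : _ = 2^-1 * 2^-1 * (cF R d * enorm x ^+ 2 * (ph (x - y) * ph (- y)))); last by field.
by apply: ler_wpM2r => //; apply: ler_pM; rewrite ?invr_ge0.
Qed.

End phases.

End duhamel_sign.

(** * Bumps at low and at high frequency *)

Section boxes.
Context (R : realType) (d : nat).
Local Notation E := 'rV[R]_d.
Local Notation mu := (lebesgue_rV R d).
Local Notation bx r c x := ((boxb r c x)%:R : R).
Variable j : 'I_d.

Definition far (N : R) : E := N *: delta_mx ord0 j.
(** A point of a box of radius at most 2 whose centre has [n1] at most [N] satisfies
    [n1 x <= N + 2 * d], hence [n1 x <= Cbox * N] for [N >= 1]. *)
Definition Cbox : R := 1 + 2 * d%:R.

Lemma Cbox_ge1 : 1 <= Cbox.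
Proof. by rewrite lerDl mulr_ge0. Qed.

Lemma Rintegral_boxb (r : R) (c : E) : 0 <= r -> \int[mu]_x (bx r c x) = (2 * r) ^+ d.
Proof. by move=> r0; rewrite /Rintegral integral_boxb. Qed.

Lemma n1_far N : 0 <= N -> n1 (far N) = N.
Proof. by move=> N0; rewrite n1Z n1_delta mulr1 ger0_norm. Qed.

Lemma boxb_le (r r' : R) (c x : E) : r <= r' -> boxb r c x -> boxb r' c x.
Proof. by move=> rr /forallP h; apply/forallP => i; exact: le_trans (h i) rr. Qed.

Lemma boxb_shift (r r' : R) (c c' x y : E) : boxb r c x -> boxb r' c' y ->
  boxb (r + r') (c - c') (x - y).
Proof.
move=> /forallP hx /forallP hy; apply/forallP => i; rewrite !mxE.
rewrite (_ : _ - _ = (x ord0 i - c ord0 i) - (y ord0 i - c' ord0 i)); last by ring.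
by apply: le_trans (ler_normB _ _) _; apply: lerD.
Qed.

Lemma boxbN (r : R) (c x : E) : boxb r c (- x) = boxb r (- c) x.
Proof.
by apply: eq_forallb => i; rewrite !mxE -normrN opprD !opprK.
Qed.

Lemma near_n1 (r : R) (c x : E) N : 1 <= N -> r <= 2 -> n1 c <= N -> boxb r c x -> n1 x <= Cbox * N.
Proof.
move=> N1 r2 cN /(boxb_le r2) /boxb_n1 h; apply: (le_trans h).
rewrite mulrDl mul1r lerD// [leRHS]mulrC (mulrC d%:R) -[leLHS]mul1r.
by apply: ler_pM => //; rewrite mulr_ge0.
Qed.

Lemma far_lower (r : R) (x : E) N : 4 <= N -> r <= 2 -> boxb r (far N) x -> N / 2 <= enorm x.
Proof.
move=> N4 r2 /forallP /(_ j); rewrite !mxE !eqxx mulr1 => h.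
apply: le_trans (ler_coord_enorm x j); apply: le_trans (ler_norm _).
by move: h; rewrite ler_norml => /andP[h _]; lra.
Qed.

(** On the box around [far N], [1 + enorm x ^+ 2] lies between [N^2 / 4] and [(1 + Cbox^2) * N^2];
    the sum of the powers of both ends serves either sign of [s]. *)
Definition Cbr (s : R) : R := (4^-1) `^ s + (1 + Cbox ^+ 2) `^ s.

Lemma Cbr_ge0 s : 0 <= Cbr s.
Proof. by rewrite addr_ge0 ?powR_ge0. Qed.

Lemma ler_powR_between (lo hi y s : R) : 0 < lo -> lo <= y -> y <= hi ->
  y `^ s <= lo `^ s + hi `^ s.
Proof.
move=> lo0 ly yh; have y0 := lt_le_trans lo0 ly; have h0 := lt_le_trans y0 yh.
have [s0|s0] := leP 0 s.
  apply: (@le_trans _ _ (hi `^ s)); last by rewrite lerDr powR_ge0.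
  by apply: ge0_ler_powR => //; rewrite nnegrE ltW.
apply: (@le_trans _ _ (lo `^ s)); last by rewrite lerDl powR_ge0.
rewrite -(opprK s) !(powRN _ (- s)) lef_pV2 ?posrE ?powR_gt0//.
by apply: ge0_ler_powR => //; rewrite ?nnegrE ltW// oppr_gt0.
Qed.

Lemma bracket2_far s (x : E) N : 1 <= N -> N / 2 <= enorm x -> n1 x <= Cbox * N ->
  bracket2 s x <= Cbr s * N `^ (2 * s).
Proof.
move=> N1 hN hx; rewrite /bracket2 -sqr_enorm.
have N0 : 0 <= N by apply: le_trans N1.
have e1 : enorm x <= Cbox * N := le_trans (enorm_le_n1 x) hx.
have h1 : 4^-1 * N ^+ 2 <= 1 + enorm x ^+ 2.
  apply: (@le_trans _ _ (enorm x ^+ 2)); last by rewrite lerDr.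
  rewrite (_ : 4^-1 * N ^+ 2 = (N / 2) ^+ 2); last by field.
  by apply: lerXn2r => //; rewrite nnegrE ?enorm_ge0// divr_ge0.
have h2 : 1 + enorm x ^+ 2 <= (1 + Cbox ^+ 2) * N ^+ 2.
  rewrite mulrDl mul1r; apply: lerD; first by rewrite exprn_ege1.
  rewrite -exprMn; apply: lerXn2r; rewrite ?nnegrE ?enorm_ge0//.
  by apply: le_trans e1; exact: enorm_ge0.
have N2 : 0 < N ^+ 2 by rewrite exprn_gt0// (lt_le_trans _ N1).
have lo0 : 0 < 4^-1 * N ^+ 2 by rewrite mulr_gt0.
apply: (le_trans (ler_powR_between s lo0 h1 h2)).
have p (a : R) : 0 <= a -> (a * N ^+ 2) `^ s = a `^ s * N `^ (2 * s).
  by move=> a0; rewrite (powRM s a0 (ltW N2)) powRrM powR_mulrn.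
by rewrite !p ?invr_ge0 ?addr_ge0 ?sqr_ge0// -mulrDl.
Qed.

Lemma boxweight_far s N : 4 <= N ->
  boxweight (far N) s <= 2 ^+ d * Cbr (- s) * N `^ (2 * - s).
Proof.
move=> N4; have N1 : 1 <= N by lra.
have N0 : 0 <= N by lra.
rewrite /boxweight.
apply: (@le_trans _ _ (\int[mu]_x (Cbr (- s) * N `^ (2 * - s) * bx 1 (far N) x))).
  apply: ler_Rintegral; first exact: intble_boxweight.
    by apply: intbleZ; exact: intble_boxb.
  move=> x; case: (boolP (boxb 1 (far N) x)) => hb; last by rewrite mul0r mulr0.
  rewrite mul1r mulr1; apply: bracket2_far => //.
    by apply: far_lower hb => //; rewrite ler1n.
  by apply: (near_n1 (r := 1) (c := far N)) => //; rewrite ?ler1n// n1_far.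
rewrite Rintegral_scale; last exact: intble_boxb.
by rewrite Rintegral_boxb// mulr1 mulrC mulrA.
Qed.

Lemma wbound_compact (f : E -> R) (K rad w : R) : 0 <= w -> 0 <= rad ->
  measurable_fun setT f -> (forall x, 0 <= f x) -> (forall x, f x <= K) ->
  (forall x, f x != 0 -> n1 x <= rad) ->
  exists A, wbound A w (fun x => (f x)%:C).
Proof.
move=> w0 r0 mf f0 fK fr; have K0 : 0 <= K := le_trans (f0 0) (fK 0).
(* A lower bound for the weight on the support of [f]. *)
pose m := expR (- (w * rad)) * ((1 + rad) ^+ (2 * d))^-1.
have m0 : 0 < m by rewrite mulr_gt0 ?expR_gt0// invr_gt0 exprn_gt0// ltr_wpDr.
exists (K / m); split; first exact: Cmeasurable_real.
move=> x; rewrite cn_real ger0_norm//.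
have [->|h] := eqVneq (f x) 0.
  by apply: mulr_ge0; [apply: divr_ge0 => //; exact: ltW|exact: wt_ge0].
apply: le_trans (fK x) _; rewrite mulrAC ler_pdivlMr//; apply: ler_wpM2l => //.
have hx := fr x h; have n0 := n1_ge0 x.
rewrite /m /wt; apply: ler_pM; rewrite ?expR_ge0 ?invr_ge0 ?exprn_ge0 ?addr_ge0//.
  by rewrite ler_expR lerN2 ler_wpM2l.
rewrite /jw lef_pV2 ?posrE ?exprn_gt0 ?ltr_wpDr//.
by apply: lerXn2r; rewrite ?nnegrE ?addr_ge0// lerD2l.
Qed.

Lemma wbound_leA (A A' w : R) (f : E -> R[i]) : A <= A' -> wbound A w f -> wbound A' w f.
Proof.
move=> AA [mf hf]; split => // x; apply: le_trans (hf x) _.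
by rewrite ler_wpM2r// wt_ge0.
Qed.

Lemma mbx (r : R) (c : E) : measurable_fun setT (fun x : E => bx r c x).
Proof. by apply: measurable_boxb; exact: measurable_id. Qed.

Lemma bx01 (r : R) (c x : E) : 0 <= bx r c x /\ bx r c x <= 1.
Proof. by case: boxb; split. Qed.

(* The data that violate the bounds: frequencies near 0 ([low]) interacting with
   frequencies near [N], normalised to have Sobolev norm of order one. *)
Definition low (x : E) : R := bx 1 0 x.
Definition high (s N : R) (x : E) : R := N `^ (- s) * bx 2 (far N) x.
Definition high2 (s N : R) (x : E) : R := high s N x + high s N (- x).
Definition lowhigh (s N : R) (x : E) : R := low x + high s N x.

Lemma low_ge0 x : 0 <= low x. Proof. by have [] := bx01 1 0 x. Qed.
Lemma high_ge0 s N x : 0 <= high s N x.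
Proof. by rewrite mulr_ge0 ?powR_ge0//; have [] := bx01 2 (far N) x. Qed.
Lemma high2_ge0 s N x : 0 <= high2 s N x.
Proof. by rewrite addr_ge0 ?high_ge0. Qed.
Lemma lowhigh_ge0 s N x : 0 <= lowhigh s N x.
Proof. by rewrite addr_ge0 ?high_ge0 ?low_ge0. Qed.

Lemma measurable_low : measurable_fun setT low. Proof. exact: mbx. Qed.
Lemma measurable_high s N : measurable_fun setT (high s N).
Proof. by apply: measurable_funM; [exact: measurable_cst|exact: mbx]. Qed.
Lemma measurable_high2 s N : measurable_fun setT (high2 s N).
Proof.
apply: measurable_funD; first exact: measurable_high.
by apply: (measurableT_comp (measurable_high s N)); apply: measurable_rVN; exact: measurable_id.
Qed.
Lemma measurable_lowhigh s N : measurable_fun setT (lowhigh s N).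
Proof. by apply: measurable_funD; [exact: measurable_low|exact: measurable_high]. Qed.

Lemma low_supp N x : 1 <= N -> low x != 0 -> n1 x <= Cbox * N.
Proof.
move=> N1; rewrite /low; case: (boolP (boxb 1 0 x)) => hb; rewrite ?eqxx// => _.
apply: (near_n1 (r := 1) (c := 0)) => //; first by rewrite ler1n.
by rewrite /n1 big1 ?(le_trans _ N1)// => i _; rewrite mxE normr0.
Qed.

Lemma high_supp s N x : 1 <= N -> high s N x != 0 -> n1 x <= Cbox * N.
Proof.
move=> N1; rewrite /high; case: (boolP (boxb 2 (far N) x)) => hb; rewrite ?mulr0 ?eqxx// => _.
by apply: (near_n1 (r := 2) (c := far N)) => //; rewrite n1_far// (le_trans _ N1).
Qed.

Lemma addr_neq0_or (a b : R) : a + b != 0 -> a != 0 \/ b != 0.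
Proof.
by have [->|h] := eqVneq a 0; [rewrite add0r; right|left].
Qed.

Lemma high2_supp s N x : 1 <= N -> high2 s N x != 0 -> n1 x <= Cbox * N.
Proof.
move=> N1 /addr_neq0_or[|]; first exact: high_supp.
by rewrite -(n1N x); exact: high_supp.
Qed.

Lemma lowhigh_supp s N x : 1 <= N -> lowhigh s N x != 0 -> n1 x <= Cbox * N.
Proof. by move=> N1 /addr_neq0_or[]; [exact: low_supp|exact: high_supp]. Qed.

Lemma low_le1 x : low x <= 1. Proof. by have [] := bx01 1 0 x. Qed.
Lemma high_le s N x : high s N x <= N `^ (- s).
Proof. by rewrite ler_piMr ?powR_ge0//; have [] := bx01 2 (far N) x. Qed.

Definition Clow (s : R) : R := (1 + Cbox) ^+ (2 * pw s) * 2 ^+ d.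
Definition Chigh (s : R) : R := 4 ^+ d * Cbr s.

Lemma norm_low s x : bracket2 s x * low x ^+ 2 <= (1 + Cbox) ^+ (2 * pw s) * low x.
Proof.
have := low_supp (N := 1) (lexx 1) (x := x); rewrite /low.
case: boxb => h; last by rewrite expr0n /= !mulr0.
rewrite expr1n !mulr1; apply: (le_trans (bracket2_le s x)).
have := h (oner_neq0 _); rewrite mulr1 => hx.
by apply: lerXn2r; rewrite ?nnegrE ?addr_ge0 ?n1_ge0 ?(le_trans _ Cbox_ge1)// lerD2l.
Qed.

Lemma powR_sq_cancel (s N : R) : 0 < N -> N `^ (2 * s) * (N `^ (- s)) ^+ 2 = 1.
Proof.
move=> N0; rewrite -powR_mulrn ?powR_ge0// -powRrM -powRD; last by rewrite (gt_eqF N0) implybT.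
by rewrite (_ : _ + _ = 0) ?powRr0//; ring.
Qed.

Lemma norm_high s N x : 4 <= N -> bracket2 s x * high s N x ^+ 2 <= Cbr s * bx 2 (far N) x.
Proof.
move=> N4; have N1 : 1 <= N by lra.
rewrite /high; case: (boolP (boxb 2 (far N) x)) => hb; last by rewrite mulr0 expr0n /= !mulr0.
rewrite !mulr1; have h := bracket2_far s N1 (far_lower N4 (lexx _) hb) _.
have hx : n1 x <= Cbox * N by apply: (near_n1 (r := 2) (c := far N)) => //; rewrite n1_far//; lra.
apply: (le_trans (ler_wpM2r (sqr_ge0 _) (h hx))).
by rewrite -mulrA powR_sq_cancel ?mulr1//; lra.
Qed.

Lemma bracket2_opp s (x : E) : bracket2 s (- x) = bracket2 s x.
Proof. by rewrite /bracket2 -!sqr_enorm enormN. Qed.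

Lemma sobolev_norm_real s (f : E -> R) (A : R) (G : E -> R) (c : R) :
  wbound A 1 (fun x => (f x)%:C) -> intble mu G -> \int[mu]_x G x <= c ->
  (forall x, bracket2 s x * f x ^+ 2 <= G x) ->
  sobolev_norm s (dist_ifourier (fun x => (f x)%:C)) ^+ 2 <= c.
Proof.
move=> hf iG cG fG; have wf := wbound_weighted s hf.
rewrite (sqr_sobolev_norm_ifourier s wf); apply: le_trans cG.
apply: ler_Rintegral => //; first exact: weighted_intble wf.
by move=> x; rewrite /sqmod /= expr0n addr0.
Qed.

Lemma sobolev_low s A : wbound A 1 (fun x => (low x)%:C) ->
  sobolev_norm s (dist_ifourier (fun x => (low x)%:C)) ^+ 2 <= Clow s.
Proof.
move=> h; apply: (sobolev_norm_real h _ _ (norm_low s)).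
  by apply: intbleZ; exact: intble_boxb.
rewrite Rintegral_scale; last exact: intble_boxb.
by rewrite Rintegral_boxb// mulr1.
Qed.

Lemma sqrD_le (a b : R) : (a + b) ^+ 2 <= 2 * a ^+ 2 + 2 * b ^+ 2.
Proof. by rewrite -subr_ge0 (_ : _ - _ = (a - b) ^+ 2) ?sqr_ge0//; ring. Qed.

Lemma sobolev_lowhigh s N A : 4 <= N -> wbound A 1 (fun x => (lowhigh s N x)%:C) ->
  sobolev_norm s (dist_ifourier (fun x => (lowhigh s N x)%:C)) ^+ 2 <=
    2 * Clow s + 2 * Chigh s.
Proof.
move=> N4 h.
have i1 : intble mu (fun x => (1 + Cbox) ^+ (2 * pw s) * low x) by apply: intbleZ; exact: intble_boxb.
have i2 : intble mu (fun x => Cbr s * bx 2 (far N) x) by apply: intbleZ; exact: intble_boxb.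
apply: (sobolev_norm_real (G := fun x => 2 * ((1 + Cbox) ^+ (2 * pw s) * low x) +
   2 * (Cbr s * bx 2 (far N) x)) h).
- by apply: intbleD; exact: intbleZ.
- rewrite Rintegral_add; [|exact: intbleZ|exact: intbleZ].
  rewrite (Rintegral_scale _ i1) (Rintegral_scale _ i2).
  rewrite Rintegral_scale; last exact: intble_boxb.
  rewrite Rintegral_scale; last exact: intble_boxb.
  rewrite !Rintegral_boxb// mulr1 /Clow /Chigh (mulrC (Cbr s)).
  by rewrite (_ : 2 * 2 = 4 :> R)//; ring.
move=> x; apply: (@le_trans _ _ (2 * (bracket2 s x * low x ^+ 2) + 2 * (bracket2 s x * high s N x ^+ 2))).
  rewrite [leRHS](_ : _ = bracket2 s x * (2 * low x ^+ 2 + 2 * high s N x ^+ 2)); last by ring.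
  by apply: ler_wpM2l (sqrD_le _ _); exact: ltW (bracket2_gt0 _ _).
by apply: lerD; apply: ler_wpM2l => //; [exact: norm_low|exact: norm_high].
Qed.

Lemma sobolev_high2 s N A : 4 <= N -> wbound A 1 (fun x => (high2 s N x)%:C) ->
  sobolev_norm s (dist_ifourier (fun x => (high2 s N x)%:C)) ^+ 2 <= 4 * Chigh s.
Proof.
move=> N4 h.
have i1 : intble mu (fun x => Cbr s * bx 2 (far N) x) by apply: intbleZ; exact: intble_boxb.
have i2 : intble mu (fun x => Cbr s * bx 2 (- far N) x) by apply: intbleZ; exact: intble_boxb.
apply: (sobolev_norm_real (G := fun x => 2 * (Cbr s * bx 2 (far N) x) +
   2 * (Cbr s * bx 2 (- far N) x)) h).
- by apply: intbleD; exact: intbleZ.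
- rewrite Rintegral_add; [|exact: intbleZ|exact: intbleZ].
  rewrite (Rintegral_scale _ i1) (Rintegral_scale _ i2).
  rewrite Rintegral_scale; last exact: intble_boxb.
  rewrite Rintegral_scale; last exact: intble_boxb.
  rewrite !Rintegral_boxb// /Chigh.
  by rewrite (_ : 2 * 2 = 4 :> R); [|ring]; rewrite le_eqVlt; apply/orP; left; apply/eqP; ring.
move=> x; apply: (@le_trans _ _ (2 * (bracket2 s x * high s N x ^+ 2) +
    2 * (bracket2 s (- x) * high s N (- x) ^+ 2))).
  rewrite bracket2_opp.
  rewrite [leRHS](_ : _ = bracket2 s x * (2 * high s N x ^+ 2 + 2 * high s N (- x) ^+ 2)); last by ring.
  by apply: ler_wpM2l (sqrD_le _ _); exact: ltW (bracket2_gt0 _ _).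
apply: lerD; apply: ler_wpM2l => //; first exact: norm_high.
by rewrite -boxbN; exact: norm_high.
Qed.

Lemma herm_even (f : E -> R) : (forall x, f (- x) = f x) -> herm (fun x => (f x)%:C).
Proof. by move=> hf x; rewrite hf cj_real. Qed.

Lemma boxint_le (p : R[i] -> R) (c : E) (g : E -> R[i]) (kappa s : R) :
  realpart d p -> weighted_L2 s g ->
  (forall x, boxb 1 c x -> p (g x) <= - kappa) -> 0 <= kappa ->
  kappa * 2 ^+ d <= `|boxint p c g|.
Proof.
move=> hp wg h k0; apply: (@le_trans _ _ (- boxint p c g)); last by rewrite -normrN ler_norm.
rewrite lerNr /boxint.
apply: (@le_trans _ _ (\int[mu]_x (- kappa * bx 1 c x))).
  apply: ler_Rintegral; first exact: (intble_box c hp wg).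
    by apply: intbleZ; exact: intble_boxb.
  by move=> x; case: (boolP (boxb 1 c x)) => hb; rewrite ?mul0r ?mulr0// mul1r mulr1 h.
rewrite Rintegral_scale; last exact: intble_boxb.
by rewrite Rintegral_boxb// mulr1 mulNr.
Qed.

Lemma powR_unbounded (a K : R) : 0 < a -> exists2 N, 4 <= N & K < N `^ a.
Proof.
move=> a0; have p4 : 0 <= 4 `^ a by exact: powR_ge0.
have Y0 : 0 <= `|K| + 1 + 4 `^ a by rewrite !addr_ge0.
have ai : 0 <= a^-1 by rewrite invr_ge0 ltW.
(* The summand [4 ^ a] makes this number at least 4, and its power [a] exceeds [K]. *)
exists ((`|K| + 1 + 4 `^ a) `^ a^-1).
  have e4 : 4 = (4 `^ a) `^ a^-1 :> R by rewrite -powRrM divff ?lt0r_neq0// powRr1.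
  rewrite [leLHS]e4.
  by apply: ge0_ler_powR; rewrite ?nnegrE// lerDr addr_ge0.
rewrite -powRrM mulVf ?lt0r_neq0// powRr1//.
by apply: (le_lt_trans (ler_norm K)); rewrite -addrA ltrDl ltr_wpDr.
Qed.

End boxes.

(** * Growth in the frequency and the contradiction *)

Section zakharov_not_C2.
Context (R : realType) (d : nat) (j : 'I_d).
Local Notation E := 'rV[R]_d.
Local Notation mu := (lebesgue_rV R d).
Local Notation bx r c x := ((boxb r c x)%:R : R).
Local Notation far := (@far R d j).
Local Notation L0 := (Cbox R d).
Variables (k l T : R).
Hypothesis T0 : 0 < T.

(** The first bound keeps the test times within [[0, T]], and the second makes every phase at most
    1/2 for frequencies up to [Cbox * N]. *)
Definition tau : R := Num.min T (1 / (2 * L0 ^+ 2)).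

Lemma tau_gt0 : 0 < tau.
Proof.
have C1 : 0 < L0 := lt_le_trans ltr01 (Cbox_ge1 R d).
by rewrite lt_min T0 divr_gt0// mulr_gt0// exprn_gt0.
Qed.

Section frequency.
Variable N : R.
Hypothesis N4 : 4 <= N.

Let N1 : 1 <= N. Proof. by move: N4; lra. Qed.
Let N0 : 0 < N. Proof. by move: N4; lra. Qed.

(* At times of order [N^-2] none of the phases has moved away from 0, so that the
   quadratic term is a sum of terms of the same sign. *)
Definition small_time : R := tau / N ^+ 2.

Lemma small_timeP : 0 <= small_time <= T /\ small_time * (L0 * N) ^+ 2 <= 2^-1.
Proof.
have t0 := tau_gt0; have N2 : 1 <= N ^+ 2 by rewrite exprn_ege1.
have N20 : 0 < N ^+ 2 by rewrite exprn_gt0.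
have C1 : 0 < L0 := lt_le_trans ltr01 (Cbox_ge1 R d).
split.
  rewrite divr_ge0 ?(ltW t0) ?(ltW N20)//= /small_time ler_pdivrMr//.
  apply: (@le_trans _ _ T); first by rewrite ge_min lexx.
  by rewrite ler_peMr// ltW.
have -> : small_time * (L0 * N) ^+ 2 = tau * L0 ^+ 2.
  by rewrite /small_time; field; rewrite gt_eqF.
apply: (@le_trans _ _ (1 / (2 * L0 ^+ 2) * L0 ^+ 2)).
  by rewrite ler_wpM2r ?sqr_ge0// ge_min lexx orbT.
by rewrite le_eqVlt; apply/orP; left; apply/eqP; field; rewrite gt_eqF.
Qed.

Let LN1 : 1 <= L0 * N.
Proof. by rewrite mulr_ege1// Cbox_ge1. Qed.

Let enorm_le (x : E) : n1 x <= L0 * N -> enorm x <= L0 * N.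
Proof. exact: le_trans (enorm_le_n1 x). Qed.

Let farL (x : E) : boxb 1 (far N) x -> enorm x <= L0 * N.
Proof.
move=> hb; apply: enorm_le; apply: (near_n1 (r := 1) (c := far N)) => //.
  by rewrite ler1n.
by rewrite n1_far// ltW.
Qed.

(** For [x] near [far N] and [y] in the unit box around [x], the frequency [x - y] meets the low
    bump of [u] and [y] the high bump of [n]. All other contributions have the same sign and are
    dropped. *)
Lemma schrodinger_lower (A : R) (x : E) :
  wbound A (T + 3) (fun x : E => (low x)%:C) -> wbound A (T + 3) (fun x : E => (high2 j l N x)%:C) ->
  boxb 1 (far N) x ->
  complex.Im (duh (@kU R d) (linu (fun x : E => (low x)%:C))
    (linn (fun x : E => (high2 j l N x)%:C)) small_time x) <=
  - (small_time * (cF R d / 4 * N `^ (- l) * 2 ^+ d)).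
Proof.
move=> hphi hpsi hx; have [tT tL] := small_timeP.
have TW : T <= T + 3 by lra.
have T0' := ltW T0.
pose b (y : E) := cF R d / 4 * N `^ (- l) * bx 1 x y.
have c0 : 0 <= cF R d / 4 by rewrite divr_ge0// ltW// cF_gt0.
have ib : intble mu b by apply: intbleZ; exact: intble_boxb.
have <- : \int[mu]_y b y = cF R d / 4 * N `^ (- l) * 2 ^+ d.
  by rewrite Rintegral_scale ?Rintegral_boxb ?mulr1//; exact: intble_boxb.
apply: (duh_part_le (T := T) (W := T + 3) _ _ _ _ _ TW (@kbound_kU R d)
  (xbound_linu T0' hphi) (xbound_linn T0' hpsi)) => //.
- by move=> F [].
- by move=> F [].
move=> s y st.
apply: (le_trans (schrodinger_phase (L := L0 * N) y (@low_ge0 R d) (@high2_ge0 R d j l N) _ _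
  (farL hx) LN1 st tL)).
- by move=> z hz; apply: enorm_le; exact: low_supp.
- by move=> z hz; apply: enorm_le; exact: (high2_supp (j := j) (s := l)).
rewrite lerN2 /b -mulrA; apply: ler_wpM2l => //.
case: (boolP (boxb 1 x y)) => hy; last first.
  by rewrite mulr0 mulr_ge0 ?low_ge0 ?high2_ge0.
rewrite mulr1 /low /high2 /high.
have -> : boxb 1 0 (x - y).
  apply/forallP => i; rewrite !mxE subr0 distrC.
  by move/forallP : hy => /(_ i).
(* The high bump has radius 2 so that it contains the sum of the test box and of the low bump, both
   of radius 1. *)
have -> : boxb 2 (far N) y.
  apply/forallP => i; rewrite (_ : _ - _ = (y ord0 i - x ord0 i) + (x ord0 i - far N ord0 i)); last by ring.
  apply: le_trans (ler_normD _ _) _; rewrite (_ : 2 = 1 + 1 :> R)//.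
  by apply: lerD; [move/forallP : hy => /(_ i)|move/forallP : hx => /(_ i)].
by rewrite mul1r mulr1 lerDl mulr_ge0 ?powR_ge0.
Qed.

(** Only the interaction with [x - y] in the high bump and [y] in the low one is kept, the other
    terms having the same sign. The Laplacian contributes at least [(N / 2) ^+ 2]. *)
Lemma wave_lower (A : R) (x : E) :
  wbound A (T + 3) (fun x : E => (lowhigh j k N x)%:C) -> boxb 1 (far N) x ->
  complex.Re (duh (@kN R d) (linu (fun x : E => (lowhigh j k N x)%:C))
    (sharpt (linu (fun x : E => (lowhigh j k N x)%:C))) small_time x) <=
  - (small_time * (cF R d / 4 * (N / 2) ^+ 2 * N `^ (- k) * 2 ^+ d)).
Proof.
move=> hphi hx; have [tT tL] := small_timeP.
have TW : T <= T + 3 by lra.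
have T0' := ltW T0.
have hL := xbound_linu T0' hphi.
pose b (y : E) := cF R d / 4 * (N / 2) ^+ 2 * N `^ (- k) * bx 1 0 y.
have c0 : 0 <= cF R d / 4 by rewrite divr_ge0// ltW// cF_gt0.
have ib : intble mu b by apply: intbleZ; exact: intble_boxb.
have <- : \int[mu]_y b y = cF R d / 4 * (N / 2) ^+ 2 * N `^ (- k) * 2 ^+ d.
  by rewrite Rintegral_scale ?Rintegral_boxb ?mulr1//; exact: intble_boxb.
apply: (duh_part_le (T := T) (W := T + 3) _ _ _ _ _ TW (@kbound_kN R d)
  hL (xbound_sharpt hL)) => //.
- by move=> F [].
- by move=> F [].
move=> s y st.
apply: (le_trans (wave_phase (L := L0 * N) y (@lowhigh_ge0 R d j k N) _ (farL hx) LN1 st tL)).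
  by move=> z hz; apply: enorm_le; exact: (lowhigh_supp (j := j) (s := k)).
rewrite lerN2 /b -[leLHS]mulrA.
have p0 := lowhigh_ge0 j k N.
apply: ler_pM.
- by rewrite mulr_ge0 ?sqr_ge0.
- by rewrite mulr_ge0 ?powR_ge0.
- apply: ler_wpM2l => //; apply: lerXn2r; rewrite ?nnegrE ?enorm_ge0 ?divr_ge0 ?(ltW N0)//.
  by apply: (far_lower N4 _ hx); rewrite ler1n.
case: (boolP (boxb 1 0 y)) => hy; last by rewrite mulr0 mulr_ge0.
rewrite mulr1 -[leLHS]mulr1; apply: ler_pM => //; first exact: powR_ge0.
  rewrite /lowhigh /high.
  have -> : boxb 2 (far N) (x - y).
    by have := boxb_shift hx hy; rewrite subr0 (_ : 1 + 1 = 2 :> R).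
  by rewrite mulr1 lerDr low_ge0.
rewrite /lowhigh /low boxbN oppr0 hy lerDl; exact: high_ge0.
Qed.

Lemma sqrt_boxweight s :
  Num.sqrt (boxweight (far N) s) <= Num.sqrt (2 ^+ d * Cbr d (- s)) * N `^ (- s).
Proof.
have p0 : 0 <= 2 ^+ d * Cbr d (- s) :> R by rewrite mulr_ge0 ?exprn_ge0 ?Cbr_ge0.
apply: (le_trans (ler_wsqrtr (boxweight_far j s N4))).
rewrite (mulrC 2 (- s)) powRrM powR_mulrn ?powR_ge0// sqrtrM// sqrtr_sqr.
by rewrite ger0_norm ?powR_ge0.
Qed.

Lemma wbound_low : exists A : R, wbound A (T + 3) (fun x : E => (low x)%:C).
Proof.
apply: (@wbound_compact R d (@low R d) 1 (L0 * N) (T + 3)).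
- by move: T0; lra.
- by apply: le_trans LN1.
- exact: measurable_low.
- exact: low_ge0.
- exact: low_le1.
- by move=> x; exact: low_supp.
Qed.

Lemma wbound_high2 s : exists A : R, wbound A (T + 3) (fun x : E => (high2 j s N x)%:C).
Proof.
apply: (@wbound_compact R d (high2 j s N) (N `^ (- s) + N `^ (- s)) (L0 * N)) => //.
- by move: T0; lra.
- by apply: le_trans LN1.
- exact: measurable_high2.
- exact: high2_ge0.
- by move=> x; apply: lerD; exact: high_le.
- by move=> x; exact: high2_supp.
Qed.

Lemma wbound_lowhigh s : exists A : R, wbound A (T + 3) (fun x : E => (lowhigh j s N x)%:C).
Proof.
apply: (@wbound_compact R d (lowhigh j s N) (1 + N `^ (- s)) (L0 * N)) => //.
- by move: T0; lra.
- by apply: le_trans LN1.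
- exact: measurable_lowhigh.
- exact: lowhigh_ge0.
- by move=> x; apply: lerD; [exact: low_le1|exact: high_le].
- by move=> x; exact: lowhigh_supp.
Qed.

Lemma Hkl_norm_sq (u v : dist R d) : Hkl_norm k l ((u, v, 0) : triple R d) ^+ 2 =
  sobolev_norm k u ^+ 2 + sobolev_norm l v ^+ 2.
Proof.
rewrite sqr_sqrtr; last by rewrite !addr_ge0 ?sqr_ge0.
have := sqr_sobolev_normZ 0 (@sobolev0 R d (l - 1)).
by rewrite scale0r expr0n /= mul0r => ->; rewrite addr0.
Qed.

Let W1 : 1 <= T + 3. Proof. by move: T0; lra. Qed.

Lemma product_bound (M H C G c c' : R) : c' <= G -> 0 <= G -> H ^+ 2 <= C ->
  c <= c' * (M * H * H) -> 0 <= c' -> c <= G * (`|M| * C).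
Proof.
move=> cG G0 HC h c0; apply: (le_trans h).
apply: (@le_trans _ _ (c' * (`|M| * C))).
  apply: ler_wpM2l => //; rewrite -mulrA -expr2.
  apply: (@le_trans _ _ (`|M| * H ^+ 2)); last exact: ler_wpM2l.
  by rewrite ler_wpM2r ?sqr_ge0// ler_norm.
by rewrite ler_wpM2r// mulr_ge0// (le_trans (sqr_ge0 H)).
Qed.

(** The exponent of [N] collects [- l] from the normalised wave datum, [- 2] from the time and [k]
    from the dual norm of the box, while the norm of the data stays bounded. *)
Lemma schrodinger_estimate (M : R) :
  (forall A phih psih (c : E) t,
    wbound A (T + 3) phih -> wbound A (T + 3) psih -> herm psih -> 0 <= t <= T ->
    let H := Hkl_norm k l ((dist_ifourier phih, dist_ifourier psih, 0) : triple R d) in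
    `|2 * boxint (@complex.Im R) c (duh (@kU R d) (linu phih) (linn psih) t)| <=
      Num.sqrt (boxweight c k) * (M * H * H)) ->
  2 * (tau * (cF R d / 4) * 2 ^+ d * 2 ^+ d) * N `^ (k - 2 - l) <=
  Num.sqrt (2 ^+ d * Cbr d (- k)) * (`|M| * (Clow d k + 4 * Chigh d l)).
Proof.
move=> hM; have [A1 h1] := wbound_low; have [A2 h2] := wbound_high2 l.
have A10 := wbound_ge0 h1; have A20 := wbound_ge0 h2.
have A1le : A1 <= A1 + A2 by rewrite lerDl.
have A2le : A2 <= A1 + A2 by rewrite lerDr.
have hphi := wbound_leA A1le h1; have hpsi := wbound_leA A2le h2.
(* The wave datum has to be real; for this reason its bump is accompanied by the reflected one. *)
have hherm : herm (fun x : E => (high2 j l N x)%:C).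
  by apply: herm_even => x; rewrite /high2 opprK addrC.
have [tT tL] := small_timeP; have T0' := ltW T0.
have := hM _ _ _ (far N) _ hphi hpsi hherm tT.
set H := Hkl_norm _ _ _ => /= hb.
have HC : H ^+ 2 <= Clow d k + 4 * Chigh d l.
  rewrite Hkl_norm_sq; apply: lerD.
    exact: sobolev_low (wbound_weaken W1 h1).
  exact: (sobolev_high2 N4 (wbound_weaken W1 h2)).
have TW2 : T + 2 <= T + 3 by lra.
have wd := duh_wbound T0' TW2 (@Cker_ge0 R d) (fun x => J_ge1 x) (@kbound_kU R d)
  (xbound_linu T0' hphi) (xbound_linn T0' hpsi) tT.
set kap := small_time * (cF R d / 4 * N `^ (- l) * 2 ^+ d).
have kap0 : 0 <= kap.
  rewrite mulr_ge0//; first by case/andP: tT.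
  by rewrite mulr_ge0 ?exprn_ge0// mulr_ge0 ?powR_ge0// divr_ge0// ltW// cF_gt0.
have hlow := boxint_le (@realpart_Im R d) (wbound_weighted 0 wd)
   (fun x hx => schrodinger_lower hphi hpsi hx) kap0.
have hb2 : 2 * (kap * 2 ^+ d) <= Num.sqrt (boxweight (far N) k) * (M * H * H).
  by apply: le_trans hb; rewrite normrM ger0_norm// ler_wpM2l.
have G0 : 0 <= Num.sqrt (2 ^+ d * Cbr d (- k)) * N `^ (- k).
  by rewrite mulr_ge0 ?sqrtr_ge0 ?powR_ge0.
have hfin := product_bound (sqrt_boxweight k) G0 HC hb2 (sqrtr_ge0 _).
have Nk : N `^ (- k) * N `^ k = 1.
  by rewrite -powRD ?(gt_eqF N0) ?implybT// addNr powRr0.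
have Na : N `^ (k - 2 - l) * N ^+ 2 = N `^ k * N `^ (- l).
  rewrite -powR_mulrn ?(ltW N0)// -!powRD ?(gt_eqF N0) ?implybT//.
  by congr (_ `^ _); ring.
have Nk0 : 0 < N `^ k by rewrite powR_gt0.
have := ler_wpM2r (ltW Nk0) hfin.
rewrite [X in _ <= X](_ : _ = Num.sqrt (2 ^+ d * Cbr d (- k)) *
   (`|M| * (Clow d k + 4 * Chigh d l)) * (N `^ (- k) * N `^ k)); last by ring.
rewrite Nk mulr1; apply: le_trans.
rewrite /kap /small_time le_eqVlt; apply/orP; left; apply/eqP.
have e : N `^ (k - 2 - l) = N `^ k * N `^ (- l) / N ^+ 2.
  by rewrite -Na mulfK// expf_neq0// gt_eqF.
by rewrite e; ring.
Qed.

(** Here the exponent collects [- k] from the high bump of [u], [2] from the Laplacian, [- 2] from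
    the time and [l - 1] from the dual norm; the wave datum is 0. *)
Lemma wave_estimate (M : R) :
  (forall A phih psih (c : E) t,
    wbound A (T + 3) phih -> wbound A (T + 3) psih -> herm psih -> 0 <= t <= T ->
    let H := Hkl_norm k l ((dist_ifourier phih, dist_ifourier psih, 0) : triple R d) in
    `|2 * boxint (@complex.Re R) c (duh (@kN R d) (linu phih) (sharpt (linu phih)) t)| <=
      Num.sqrt (boxweight c (l - 1)) * (M * H * H)) ->
  2 * (tau * (cF R d / 16) * 2 ^+ d * 2 ^+ d) * N `^ (l - 1 - k) <=
  Num.sqrt (2 ^+ d * Cbr d (- (l - 1))) * (`|M| * (2 * Clow d k + 2 * Chigh d k)).
Proof.
move=> hM; have [A hphi] := wbound_lowhigh k; have A0 := wbound_ge0 hphi.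
have hpsi := wbound_leA A0 (@wbound0 R d (T + 3)).
have hherm : herm (fun _ : E => 0 : R[i]).
  by move=> x; apply: complex_ext => //=; rewrite oppr0.
have [tT tL] := small_timeP; have T0' := ltW T0.
have := hM _ _ _ (far N) _ hphi hpsi hherm tT.
set H := Hkl_norm _ _ _ => /= hb.
have HC : H ^+ 2 <= 2 * Clow d k + 2 * Chigh d k.
  rewrite Hkl_norm_sq dist_ifourier0.
  have := sqr_sobolev_normZ 0 (@sobolev0 R d l).
  rewrite scale0r expr0n /= mul0r => ->; rewrite addr0.
  exact: (sobolev_lowhigh N4 (wbound_weaken W1 hphi)).
have TW2 : T + 2 <= T + 3 by lra.
have hL := xbound_linu T0' hphi.
have wd := duh_wbound T0' TW2 (@Cker_ge0 R d) (fun x => lexx _) (@kbound_kN R d)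
  hL (xbound_sharpt hL) tT.
set kap := small_time * (cF R d / 4 * (N / 2) ^+ 2 * N `^ (- k) * 2 ^+ d).
have kap0 : 0 <= kap.
  rewrite mulr_ge0//; first by case/andP: tT.
  rewrite mulr_ge0 ?exprn_ge0// mulr_ge0 ?powR_ge0// mulr_ge0 ?sqr_ge0//.
  by rewrite divr_ge0// ltW// cF_gt0.
have hlow := boxint_le (@realpart_Re R d) (wbound_weighted 0 wd)
   (fun x hx => wave_lower hphi hx) kap0.
have hb2 : 2 * (kap * 2 ^+ d) <= Num.sqrt (boxweight (far N) (l - 1)) * (M * H * H).
  by apply: le_trans hb; rewrite normrM ger0_norm// ler_wpM2l.
have G0 : 0 <= Num.sqrt (2 ^+ d * Cbr d (- (l - 1))) * N `^ (- (l - 1)).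
  by rewrite mulr_ge0 ?sqrtr_ge0 ?powR_ge0.
have hfin := product_bound (sqrt_boxweight (l - 1)) G0 HC hb2 (sqrtr_ge0 _).
have Nk : N `^ (- (l - 1)) * N `^ (l - 1) = 1.
  by rewrite -powRD ?(gt_eqF N0) ?implybT// addNr powRr0.
have Na : N `^ (l - 1 - k) = N `^ (l - 1) * N `^ (- k).
  by rewrite -powRD ?(gt_eqF N0) ?implybT.
have Nk0 : 0 < N `^ (l - 1) by rewrite powR_gt0.
have := ler_wpM2r (ltW Nk0) hfin.
rewrite [X in _ <= X](_ : _ = Num.sqrt (2 ^+ d * Cbr d (- (l - 1))) *
   (`|M| * (2 * Clow d k + 2 * Chigh d k)) * (N `^ (- (l - 1)) * N `^ (l - 1))); last by ring.
rewrite Nk mulr1; apply: le_trans.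
rewrite /kap /small_time Na le_eqVlt; apply/orP; left; apply/eqP.
by field; rewrite gt_eqF.
Qed.

End frequency.

Lemma unbounded_contra (c G a : R) : 0 < c -> 0 < a ->
  (forall N, 4 <= N -> c * N `^ a <= G) -> False.
Proof.
move=> c0 a0 h; have [N N4 hN] := powR_unbounded (G / c) a0.
have := h N N4; rewrite leNgt => /negP; apply.
by move: hN; rewrite ltr_pdivrMr// mulrC.
Qed.

End zakharov_not_C2.

Theorem theorem1p3 (R : realType) (d : nat) (hd : (1 <= d)%N) (k l T : R)
    (hT : 0 < T) (r : R) (S : triple R d -> R -> triple R d)
    (hS : well_posed k l T r S) (hkl : l < k - 2 \/ l > k + 1) :
  ~ twice_frechet_differentiable_at0 k l T S.
Proof.
move=> hdiff; have [M hM] := second_derivative_bound (ltW hT) hS hdiff.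
(* A positive dimension provides the direction in which the high frequencies go to infinity. *)
pose j : 'I_d := Ordinal hd.
have t0 := @tau_gt0 R d T hT; have cF0 := cF_gt0 R d.
have p2 : 0 < 2 ^+ d :> R by rewrite exprn_gt0.
case: hkl => hkl.
  apply: (@unbounded_contra R (2 * (tau d T * (cF R d / 4) * 2 ^+ d * 2 ^+ d))
    (Num.sqrt (2 ^+ d * Cbr d (- k)) * (`|M| * (Clow d k + 4 * Chigh d l))) (k - 2 - l)).
  - by rewrite !mulr_gt0// divr_gt0.
  - by rewrite subr_gt0.
  move=> N N4; apply: (schrodinger_estimate j hT N4).
  by move=> A phih psih c t h1 h2 h3 h4; exact: proj1 (hM A phih psih c t h1 h2 h3 h4).
apply: (@unbounded_contra R (2 * (tau d T * (cF R d / 16) * 2 ^+ d * 2 ^+ d))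
  (Num.sqrt (2 ^+ d * Cbr d (- (l - 1))) * (`|M| * (2 * Clow d k + 2 * Chigh d k))) (l - 1 - k)).
- by rewrite !mulr_gt0// divr_gt0.
- by move: hkl; lra.
move=> N N4; apply: (wave_estimate j hT N4).
by move=> A phih psih c t h1 h2 h3 h4; exact: proj2 (hM A phih psih c t h1 h2 h3 h4).
Qed.
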